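(* Let $\psi_f,\psi_g\in C_c^\infty(I;\mathbb{R})$ be fixed, nonzero functions. Let $(\rho_1,\mathbf f_1,\mathbf g_1)$ and $(\rho_2,\mathbf f_2,\mathbf g_2)$ be two admissible triples such that, for $j=1,2$, $$\rho_j\mathbf f_j=\mathbf F_j^{\flat}(x')\psi_f(x_3),\qquad \rho_j\mathbf g_j=\mathbf G_j^{\flat}(x')\psi_g(x_3),$$ for some $\mathbf F_j^{\flat},\mathbf G_j^{\flat}\in L^2_c(D;\mathbb{R}^3)$. If $\mathscr M_{\rho_1,\mathbf f_1,\mathbf g_1}=\mathscr M_{\rho_2,\mathbf f_2,\mathbf g_2}$, then $$\rho_1\mathbf f_1=\rho_2\mathbf f_2,\qquad \rho_1\mathbf g_1=\rho_2\mathbf g_2\qquad\text{a.e. in }\mathbb{R}^3.$$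
   Context: Fixed real constants $\lambda,\mu$ with $\mu>0$ and $\lambda+2\mu>0$; $\mathcal L_{\lambda,\mu}\mathbf v=\mu\Delta\mathbf v+(\lambda+\mu)\nabla(\nabla\cdot\mathbf v)$. $\Omega\subset\mathbb{R}^3$ is a bounded Lipschitz domain. $Q=D\times I$ with $D\subset\mathbb{R}^2$ bounded and open, $I=(t_-,t_+)$ a bounded open interval, and $\overline Q\subset\Omega$. Write $x=(x',x_3)$, $x'\in\mathbb{R}^2$. Fix constants $0<\rho_-<\rho_0<\rho_+$. For an open set $O\subset\mathbb{R}^d$, $X_c(O)$ denotes the elements of $X(\mathbb{R}^d)$ whose essential support is compactly contained in $O$. An admissible triple $(\rho,\mathbf f,\mathbf g)$ satisfies $\rho\in L^\infty(\mathbb{R}^3;\mathbb{R})$, $\rho_-\le\rho\le\rho_+$ a.e., $\rho=\rho_0$ in $\mathbb{R}^3\setminus Q$, $\mathbf f\in H^1_c(Q;\mathbb{R}^3)$, $\mathbf g\in L^2_c(Q;\mathbb{R}^3)$. For such a triple let $\mathbf u\in C([0,\infty);H^1(\mathbb{R}^3)^3)\cap C^1([0,\infty);L^2(\mathbb{R}^3)^3)$ be the unique (weak, energy) solution of $\rho\,\partial_t^2\mathbf u-\mathcal L_{\lambda,\mu}\mathbf u=0$ in $\mathbb{R}^3\times(0,\infty)$, $\mathbf u(\cdot,0)=\mathbf f$, $\partial_t\mathbf u(\cdot,0)=\mathbf g$. The passive data are the trace $\mathscr M_{\rho,\mathbf f,\mathbf g}:=\mathbf u|_{\partial\Omega\times(0,\infty)}$,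 an element of $C([0,\infty);H^{1/2}(\partial\Omega)^3)$. *)

(* Defs.v *)
From HB Require Import structures.
From mathcomp Require Import all_boot all_order all_algebra.
From mathcomp Require Import all_classical all_reals all_analysis.

Set Implicit Arguments.
Unset Strict Implicit.
Unset Printing Implicit Defensive.

Import Order.TTheory GRing.Theory Num.Theory.
Import numFieldNormedType.Exports.

Local Open Scope classical_set_scope.
Local Open Scope ring_scope.

(* A point x = (x', x_3) of space is a pair (x.1, x.2) with x.1 : R^2.  The   *)
(* library norm of a product type is the maximum norm; it is only used for    *)
(* notions that do not depend on the choice of an equivalent norm.            *)
Notation R2 R := (R * R)%type (only parsing).
Notation R3 R := (R * R * R)%type (only parsing).

Definition lebesgue2 (R : realType) :
    {measure set (measurableTypeR R * measurableTypeR R)%type -> \bar R} :=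
  (@lebesgue_measure R \x @lebesgue_measure R)%E.

Definition lebesgue3 (R : realType) :
    {measure set (measurableTypeR R * measurableTypeR R * measurableTypeR R)%type
     -> \bar R} :=
  (@lebesgue2 R \x @lebesgue_measure R)%E.

Definition basis3 (R : realType) (j : 'I_3) : R3 R :=
  ((j == 0)%:R, (j == 1)%:R, (j == 2)%:R).

Definition row3 (R : realType) (x : R3 R) : 'rV[R]_3 :=
  \row_j [:: x.1.1; x.1.2; x.2]`_j.

(* All iterated directional derivatives exist and are differentiable.         *)
Definition smooth (R : realType) (V : normedModType R) (f : V -> R) : Prop :=
  forall (s : seq V) (x : V), differentiable (foldr (fun v g => 'D_v g) f s) x.

(* C_c^oo(O) *)
Definition test_function (R : realType) (V : normedModType R) (O : set V)
    (f : V -> R) : Prop :=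
  [/\ smooth f, compact (closure [set x | f x != 0])
    & closure [set x | f x != 0] `<=` O].

(* [ae] is meant to be the filter [almost_everywhere] of a measure on T.      *)
Definition ess_support (T : topologicalType) (V : zmodType)
    (ae : set_system T) (f : T -> V) : set T :=
  [set x | forall U, nbhs x U -> ~ ae [set y | U y -> f y = 0]].

Definition ess_compactly_in (T : topologicalType) (V : zmodType)
    (ae : set_system T) (O : set T) (f : T -> V) : Prop :=
  compact (ess_support ae f) /\ ess_support ae f `<=` O.

Definition vL2 d (T : measurableType d) (R : realType)
    (m : {measure set T -> \bar R}) (w : T -> 'rV[R]_3) : Prop :=
  forall i, (fun x => w x 0 i) \in Lfun m 2%:E.

Definition L2norm (R : realType) (f : R3 R -> R) : \bar R :=
  'N[lebesgue3 R]_2%:E[EFin \o f]%E.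

(* L^2_c(D; R^3) *)
Definition vL2c2 (R : realType) (D : set (R2 R)) (w : R2 R -> 'rV[R]_3) : Prop :=
  vL2 (lebesgue2 R) w /\
  ess_compactly_in (almost_everywhere (lebesgue2 R)) D w.

(* L^2_c(Q; R^3) *)
Definition vL2c3 (R : realType) (Q : set (R3 R)) (w : R3 R -> 'rV[R]_3) : Prop :=
  vL2 (lebesgue3 R) w /\
  ess_compactly_in (almost_everywhere (lebesgue3 R)) Q w.

(* g is the j-th weak partial derivative of f on R^3. *)
Definition weak_partial (R : realType) (j : 'I_3) (f g : R3 R -> R) : Prop :=
  forall phi : R3 R -> R, test_function setT phi ->
    \int[lebesgue3 R]_x (f x * 'D_(basis3 R j) phi x) =
    - \int[lebesgue3 R]_x (g x * phi x).

(* H^1(R^3; R^3) *)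
Definition vH1 (R : realType) (w : R3 R -> 'rV[R]_3) : Prop :=
  vL2 (lebesgue3 R) w /\
  forall i j, exists2 g : R3 R -> R,
    g \in Lfun (lebesgue3 R) 2%:E & weak_partial j (fun x => w x 0 i) g.

(* H^1_c(Q; R^3) *)
Definition vH1c (R : realType) (Q : set (R3 R)) (w : R3 R -> 'rV[R]_3) : Prop :=
  vH1 w /\ ess_compactly_in (almost_everywhere (lebesgue3 R)) Q w.

(* Locally, in rotated orthonormal coordinates y = x A, Omega is the region   *)
(* lying above the graph of a Lipschitz function.                             *)
Definition lipschitz_boundary (R : realType) (Omega : set (R3 R)) : Prop :=
  forall p, (closure Omega `\` Omega) p ->
    exists (A : 'M[R]_3) (gamma : R2 R -> R) (U : set (R3 R)),
      [/\ A *m A^T = 1%:M, lipschitz gamma, nbhs p U &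
        forall x, U x ->
          let y := row3 x *m A in
          Omega x <-> gamma (y 0 0, y 0 1) < y 0 2].

Definition bounded_lipschitz_domain (R : realType) (Omega : set (R3 R)) : Prop :=
  [/\ open Omega, connected Omega, bounded_set Omega
    & lipschitz_boundary Omega].

(* Two-dimensional Hausdorff measure on R^3 for the Euclidean distance,       *)
(* normalised by the factor pi/4 so that it is the surface area.              *)
Section hausdorff2.
Context (R : realType).
Local Notation T := (measurableTypeR R * measurableTypeR R * measurableTypeR R)%type.
Local Open Scope ereal_scope.

Definition edist3 (x y : R3 R) : R :=
  Num.sqrt ((x.1.1 - y.1.1) ^+ 2 + (x.1.2 - y.1.2) ^+ 2 + (x.2 - y.2) ^+ 2)%R.

(* 0 is adjoined so that the empty set has diameter 0. *)
Definition diameter3 (A : set T) : \bar R :=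
  ereal_sup ([set 0] `|` [set (edist3 x y)%:E | x in A & y in A]).

Definition hausdorff2_gauge (delta : R) (A : set T) : \bar R :=
  if diameter3 A <= delta%:E then (pi / 4)%:E * (diameter3 A * diameter3 A)
  else +oo.

(* [mu_ext] takes the infimum over countable covers by Borel sets; arbitrary  *)
(* covers give the same value, since a set and its closure have the same      *)
(* diameter.                                                                  *)
Definition hausdorff2 (A : set T) : \bar R :=
  ereal_sup [set mu_ext (hausdorff2_gauge delta) A | delta in [set e | (0 < e)%R]].

Lemma diameter3_ge0 A : 0 <= diameter3 A.
Proof. by apply: ereal_sup_ubound; left. Qed.

Lemma diameter3_set0 : diameter3 set0 = 0.
Proof.
rewrite /diameter3 (_ : _ `|` _ = [set 0]) ?ereal_sup1//.
by apply/seteqP; split=> [x [//|[y []]]|x ->]; left.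
Qed.

Lemma hausdorff2_gauge_ge0 delta A : 0 <= hausdorff2_gauge delta A.
Proof.
rewrite /hausdorff2_gauge; case: ifP => // _.
by rewrite !mule_ge0 ?diameter3_ge0 ?lee_fin ?divr_ge0 ?pi_ge0.
Qed.

Lemma hausdorff2_gauge_set0 delta : (0 < delta)%R ->
  hausdorff2_gauge delta set0 = 0.
Proof.
by move=> d0; rewrite /hausdorff2_gauge diameter3_set0 lee_fin ltW// !mule0.
Qed.

Let hausdorff2_set0 : hausdorff2 set0 = 0.
Proof.
apply/eqP; rewrite eq_le; apply/andP; split.
  apply: ge_ereal_sup => _ [e /= e0 <-].
  by rewrite mu_ext0//; [exact: hausdorff2_gauge_set0|
    exact: hausdorff2_gauge_ge0].
apply: ereal_sup_ubound; exists 1%R => //=.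
by rewrite mu_ext0//; [exact: hausdorff2_gauge_set0|
  exact: hausdorff2_gauge_ge0].
Qed.

Let hausdorff2_ge0 A : 0 <= hausdorff2 A.
Proof.
apply: (@le_trans _ _ (mu_ext (hausdorff2_gauge 1) A)).
  exact/mu_ext_ge0/hausdorff2_gauge_ge0.
by apply: ereal_sup_ubound; exists 1%R => //=.
Qed.

Let le_hausdorff2 : {homo hausdorff2 : A B / A `<=` B >-> A <= B}.
Proof.
move=> A B AB; apply: ge_ereal_sup => _ [e /= e0 <-].
apply: (@le_trans _ _ (mu_ext (hausdorff2_gauge e) B)); first exact: le_mu_ext.
by apply: ereal_sup_ubound; exists e.
Qed.

Let hausdorff2_sigma_subadditive : sigma_subadditive hausdorff2.
Proof.
move=> F; apply: ge_ereal_sup => _ [e /= e0 <-].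
apply: le_trans (mu_ext_sigma_subadditive (hausdorff2_gauge_ge0 e) F) _.
apply: lee_nneseries => [n _ _|n _].
  exact/mu_ext_ge0/hausdorff2_gauge_ge0.
by apply: ereal_sup_ubound; exists e.
Qed.

HB.instance Definition _ := isOuterMeasure.Build R T hausdorff2
  hausdorff2_set0 hausdorff2_ge0 le_hausdorff2 hausdorff2_sigma_subadditive.

Definition hausdorff2_outer : {outer_measure set T -> \bar R} := hausdorff2.

Definition surface_measure :
    {measure set (caratheodory_type hausdorff2) -> \bar R} :=
  hausdorff2_outer : set (caratheodory_type hausdorff2_outer) -> \bar R.

End hausdorff2.

(* The trace on the boundary of Omega of a function w in H^1(R^3): the        *)
(* extension by density of the restriction of test functions, continuous from *)
(* H^1 to L^2 of the boundary.  The space H^(1/2) of the boundary is the      *)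
(* space of these traces.                                                     *)
Definition is_trace (R : realType) (Omega : set (R3 R)) (w tau : R3 R -> R) :
    Prop :=
  let bd : set (R3 R) := closure Omega `\` Omega in
  measurable_fun (bd : set (caratheodory_type (@hausdorff2 R))) tau /\
  exists (phi : nat -> R3 R -> R) (g : 'I_3 -> R3 R -> R),
    [/\ forall n, test_function setT (phi n),
        forall j, g j \in Lfun (lebesgue3 R) 2%:E /\ weak_partial j w (g j),
        L2norm (fun x => phi n x - w x)
          @[n --> \oo] --> 0%E,
        forall j,
          L2norm (fun x => 'D_(basis3 R j) (phi n) x - g j x)
          @[n --> \oo] --> 0%E
      & (\int[surface_measure R]_(x in bd) ((phi n x - tau x) ^+ 2)%:E)%E
          @[n --> \oo] --> 0%E].

(* w belongs to C([0,oo); L^2(R^3)^3). *)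
Definition continuous_L2 (R : realType) (w : R -> R3 R -> 'rV[R]_3) : Prop :=
  forall t, 0 <= t -> vL2 (lebesgue3 R) (w t) /\
    forall i, L2norm (fun x => w s x 0 i - w t x 0 i)
      @[s --> within [set s | 0 <= s] (nbhs t)] --> 0%E.

(* v is the derivative of w : [0,oo) -> L^2(R^3)^3 (one-sided at 0). *)
Definition derivative_L2 (R : realType) (w v : R -> R3 R -> 'rV[R]_3) : Prop :=
  forall t, 0 <= t -> forall i,
    L2norm (fun x =>
        (s - t)^-1 * (w s x 0 i - w t x 0 i) - v t x 0 i)
      @[s --> within [set s | 0 <= s] t^'] --> 0%E.

(* Weak form of rho u_tt - mu Delta u - (lam + mu) grad div u = 0 on          *)
(* R^3 x (0,oo), where v = u_t and G t x i j = (d u_i / d x_j)(x, t).         *)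
Definition weak_elastic_equation (R : realType) (lam mu : R) (rho : R3 R -> R)
    (v : R -> R3 R -> 'rV[R]_3) (G : R -> R3 R -> 'M[R]_3) : Prop :=
  forall Phi : 'I_3 -> (R3 R * R)%type -> R,
    (forall i, test_function [set z : R3 R * R | 0 < z.2] (Phi i)) ->
    let dt i x t : R := 'D_((0, 1) : R3 R * R) (Phi i) (x, t) in
    let dx j i x t : R := 'D_((basis3 R j, 0) : R3 R * R) (Phi i) (x, t) in
    \int[@lebesgue_measure R]_(t in `]0, +oo[)
      (- (\int[lebesgue3 R]_x (rho x * \sum_i v t x 0 i * dt i x t))
       + mu * (\int[lebesgue3 R]_x (\sum_i \sum_j G t x i j * dx j i x t))
       + (lam + mu) *
           (\int[lebesgue3 R]_x (\tr (G t x) * \sum_j dx j j x t))) = 0.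

(* u is the energy solution, in C([0,oo); H^1) and C^1([0,oo); L^2), with     *)
(* initial data (f, g); only its values at times t >= 0 matter.               *)
Definition energy_solution (R : realType) (lam mu : R) (rho : R3 R -> R)
    (f g : R3 R -> 'rV[R]_3) (u : R -> R3 R -> 'rV[R]_3) : Prop :=
  exists (v : R -> R3 R -> 'rV[R]_3) (G : R -> R3 R -> 'M[R]_3),
    [/\ [/\ continuous_L2 u,
            forall t, 0 <= t -> forall i j,
              weak_partial j (fun x => u t x 0 i) (fun x => G t x i j)
          & forall i, continuous_L2 (fun t x => row i (G t x))],
        continuous_L2 v /\ derivative_L2 u v,
        weak_elastic_equation lam mu rho v G,
        u 0 = f %[ae lebesgue3 R]
      & v 0 = g %[ae lebesgue3 R]].

Record admissible (R : realType) (Q : set (R3 R)) (rhom rho0 rhop : R)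
    (rho : R3 R -> R) (f g : R3 R -> 'rV[R]_3) : Prop := Admissible {
  admissible_Loo : rho \in Lfun (lebesgue3 R) +oo%E ;
  admissible_bounds : {ae lebesgue3 R, forall x, rhom <= rho x <= rhop} ;
  admissible_background : rho = cst rho0 %[ae lebesgue3 R in ~` Q] ;
  admissible_f : vH1c Q f ;
  admissible_g : vL2c3 Q g }.

(* M represents the trace of the solution on the boundary of Omega, at all    *)
(* positive times.                                                            *)
Definition passive_data (R : realType) (lam mu : R) (Omega : set (R3 R))
    (rho : R3 R -> R) (f g : R3 R -> 'rV[R]_3) (M : R -> R3 R -> 'rV[R]_3) :
    Prop :=
  exists2 u : R -> R3 R -> 'rV[R]_3, energy_solution lam mu rho f g u &
    forall t, 0 < t -> forall i,
      is_trace Omega (fun x => u t x 0 i) (fun x => M t x 0 i).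

(* Main.v *)
(* Proof idea.  The difference of the two solutions, set to zero in Omega, has
   a weak gradient because the traces agree; outside Q both densities equal
   rho0, so it solves a homogeneous exterior problem with zero data and vanishes
   by energy conservation.  Hence, for every static field Phi cut off far from
   Omega, y(t) = sum_i <rho1 u1_i - rho2 u2_i, Phi_i> satisfies y'' = 0.  The
   energy of the time integral of a solution, together with Hardy's inequality,
   bounds the time integral of y uniformly, so y = 0: the differences of the
   rho f and of the rho g are orthogonal to all static fields.  Testing with the
   divergence-free fields built from e^(a x1 + b x2) cos(r x3) and
   e^(a x1 + b x2) sin(r x3), r^2 = a^2 + b^2, separates the factor psi(x3) and
   leaves vanishing exponential moments of a compactly supported function of
   x', which is therefore zero.
   Time integrals are replaced by Riemann sums throughout. *)

Require Import Defs.
From HB Require Import structures.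
From mathcomp Require Import all_boot all_order all_algebra.
From mathcomp Require Import all_classical all_reals all_analysis.
From mathcomp Require Import measurable_realfun ess_sup_inf.
From mathcomp Require Import ring lra.
Set Implicit Arguments.
Unset Strict Implicit.
Unset Printing Implicit Defensive.
Import Order.TTheory GRing.Theory Num.Theory.
Import numFieldNormedType.Exports.
Local Open Scope classical_set_scope.
Local Open Scope ring_scope.

(** No divergence theorem on [Omega] is used. The exterior is shifted by [h] along an axis, the
    volume swept is bounded by [h] times the Hausdorff measure of the boundary, and dyadic level
    sets turn an L2 bound on the boundary into a bound on the boundary term. The elastic operator is
    written as the divergence of mu (G - G^T) + (lam + 2 mu) tr(G) I. It has the same weak equation
    as the usual stress, but its form is mu |curl|^2 + (lam + 2 mu) |div|^2, coercive on gradients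
    exactly under the given signs. The energy is always that of the time integral w of a solution,
    which satisfies rho w_tt - L w = rho v(0). It contains no gradient of u itself, and Hardy's
    inequality absorbs its linear term, so that w is bounded locally, uniformly in time, whereas its
    pairing with a static field would be T y(0) + T^2 y'(0) / 2. The profiles psi enter through
    their cosine and sine integrals at frequency r: being nonzero, they have one that does not
    vanish on an open interval of r, so that a and b range over an open set. *)

Lemma ae_eq_integrable d (T : measurableType d) (R : realType)
    (m : {measure set T -> \bar R}) (f g : T -> R) :
  measurable_fun setT f -> {ae m, forall x, g x = f x} ->
  m.-integrable setT (EFin \o g) -> m.-integrable setT (EFin \o f).
Proof.
move=> mf gf /integrableP[mg gi]; apply/integrableP; split; first exact/measurable_EFinP.
apply: le_lt_trans gi; rewrite (ae_eq_integral (fun x => `|(EFin \o g) x|%E))//.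
- by do 2 apply: measurableT_comp => //.
- exact: measurableT_comp.
- by apply: filterS gf => x fg _ /=; rewrite fg.
Qed.

(** * Square-integrable functions *)

Section L2_space.
Context d (T : measurableType d) (R : realType).
Variable m : {measure set T -> \bar R}.
Implicit Types f g h : T -> R.

Definition L2 f : Prop := f \in Lfun m 2%:E.
Definition dot f g : R := \int[m]_x (f x * g x).
Definition nrm f : R := Num.sqrt (dot f f).

Lemma L2_measurable f : L2 f -> measurable_fun setT f.
Proof. by rewrite /L2 inE => /andP[+ _]; rewrite inE. Qed.

Lemma L2_sqr f : L2 f -> m.-integrable setT (EFin \o (fun x => f x ^+ 2)).
Proof. by move=> f2; exact: Lfun2_integrable_sqr. Qed.

Lemma dot_integrable f g : L2 f -> L2 g ->
  m.-integrable setT (EFin \o (fun x => f x * g x)).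
Proof. by move=> f2 g2; apply/Lfun1_integrable; exact: Lfun2_mul_Lfun1. Qed.

Lemma Lnorm2E f : measurable_fun setT f ->
  ('N[m]_2%:E[EFin \o f] = (\int[m]_x (f x ^+ 2)%:E) `^ 2^-1)%E.
Proof.
move=> mf; rewrite unlock; congr poweR; apply: eq_integral => x _ /=.
by rewrite powR_mulrn// -normrX ger0_norm// sqr_ge0.
Qed.

Lemma L2P f : measurable_fun setT f ->
  m.-integrable setT (EFin \o (fun x => f x ^+ 2)) -> L2 f.
Proof.
move=> mf /integrableP[_ fi]; rewrite /L2 inE; apply/andP; rewrite !inE; split=> //.
rewrite /= /finite_norm Lnorm2E// poweR_lty//.
by under eq_integral do rewrite -[X in X%:E]ger0_norm ?sqr_ge0//.
Qed.

Lemma nrm_ge0 f : 0 <= nrm f. Proof. exact: sqrtr_ge0. Qed.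

Lemma dot_ge0 f : 0 <= dot f f.
Proof. by apply: Rintegral_ge0 => x _; rewrite -expr2 sqr_ge0. Qed.

Lemma nrm_sqr f : nrm f ^+ 2 = dot f f.
Proof. by rewrite sqr_sqrtr// dot_ge0. Qed.

Lemma Lnorm2_nrm f : L2 f -> ('N[m]_2%:E[EFin \o f] = (nrm f)%:E)%E.
Proof.
move=> f2; rewrite Lnorm2E; last exact: L2_measurable.
rewrite /nrm -powR12_sqrt ?dot_ge0// -poweR_EFin.
congr poweR; rewrite /dot /Rintegral fineK.
  by apply: eq_integral => x _; rewrite expr2.
exact/integrable_fin_num/dot_integrable.
Qed.

Let p1 : (1 <= 2%:E :> \bar R)%E. Proof. by rewrite lee_fin ler1n. Qed.

Lemma L2_0 : L2 (fun=> 0).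
Proof. by have [+ _] := Lfun_addr_closed m p1. Qed.

Lemma L2D f g : L2 f -> L2 g -> L2 (fun x => f x + g x).
Proof. by move=> f2 g2; have [_] := Lfun_addr_closed m p1; apply. Qed.

Lemma L2Z a f : L2 f -> L2 (fun x => a * f x).
Proof.
move=> f2; have [_ /(_ a f _ f2 L2_0)] := Lfun_submod_closed m p1.
rewrite /L2 (_ : a *: f + _ = fun x => a * f x)//.
by apply/funext => x; rewrite !fctE addr0.
Qed.

Lemma L2N f : L2 f -> L2 (fun x => - f x).
Proof.
by move=> /(L2Z (-1)); rewrite (_ : (fun x => -1 * f x) = (fun x => - f x))//;
  apply/funext => x; rewrite mulN1r.
Qed.

Lemma L2B f g : L2 f -> L2 g -> L2 (fun x => f x - g x).
Proof. by move=> f2 g2; apply: L2D => //; exact: L2N. Qed.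

Lemma L2_sum (I : Type) (r : seq I) (F : I -> T -> R) :
  (forall i, L2 (F i)) -> L2 (fun x => \sum_(i <- r) F i x).
Proof.
move=> F2; elim: r => [|i r IH].
  rewrite (_ : (fun x => _) = fun=> 0); first exact: L2_0.
  by apply/funext => x; rewrite big_nil.
under [X in L2 X]eq_fun do rewrite big_cons.
exact: L2D.
Qed.

Lemma L2M (M : R) f g : measurable_fun setT g -> {ae m, forall x, `|g x| <= M} ->
  L2 f -> L2 (fun x => g x * f x).
Proof.
move=> mg gM f2; have mf := L2_measurable f2.
apply: L2P; first exact: measurable_funM.
have := L2_sqr f2 => /(integrableZl measurableT (M ^+ 2)) i2.
(* The bound on [g] holds only almost everywhere, while [le_integrable] asks for domination at every
   point. The minimum with the dominating function is dominated everywhere and changes the integrand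
   on a null set only. *)
apply: (@ae_eq_integrable _ _ _ m _
  (fun x => Num.min ((g x * f x) ^+ 2) (M ^+ 2 * f x ^+ 2))).
- by apply: measurable_funX; exact: measurable_funM.
- move: gM; apply: filterS => x gM /=.
  apply/min_idPl; rewrite exprMn ler_wpM2r ?sqr_ge0//.
  by rewrite -[leLHS]real_normK ?num_real// lerXn2r ?nnegrE// (le_trans _ gM).
- apply: (le_integrable measurableT _ _ i2) => //=.
    apply/measurable_EFinP; apply: measurable_minr.
      by apply: measurable_funX; exact: measurable_funM.
    by apply: measurable_funM => //; exact: measurable_funX.
  move=> x _; have h : 0 <= M ^+ 2 * f x ^+ 2 by apply: mulr_ge0; exact: sqr_ge0.
  rewrite lee_fin (ger0_norm h) ger0_norm ?le_min ?sqr_ge0//.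
  by rewrite ge_min lexx orbT.
Qed.

Lemma dotC f g : dot f g = dot g f.
Proof. by apply: eq_Rintegral => x _; rewrite mulrC. Qed.

Lemma dotDl f g h : L2 f -> L2 g -> L2 h ->
  dot (fun x => f x + g x) h = dot f h + dot g h.
Proof.
move=> f2 g2 h2; rewrite -RintegralD//; [|exact: dot_integrable..].
by apply: eq_Rintegral => x _; rewrite mulrDl.
Qed.

Lemma dotZl a f h : L2 f -> L2 h -> dot (fun x => a * f x) h = a * dot f h.
Proof.
move=> f2 h2; rewrite -RintegralZl//; last exact: dot_integrable.
by apply: eq_Rintegral => x _; rewrite mulrA.
Qed.

Lemma dotNl f h : L2 f -> L2 h -> dot (fun x => - f x) h = - dot f h.
Proof.
move=> f2 h2; rewrite -[RHS]mulN1r -dotZl//.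
by apply: eq_Rintegral => x _; rewrite mulN1r.
Qed.

Lemma dotBl f g h : L2 f -> L2 g -> L2 h ->
  dot (fun x => f x - g x) h = dot f h - dot g h.
Proof. by move=> f2 g2 h2; rewrite dotDl ?dotNl//; exact: L2N. Qed.

Lemma dotDr f g h : L2 f -> L2 g -> L2 h ->
  dot h (fun x => f x + g x) = dot h f + dot h g.
Proof. by move=> f2 g2 h2; rewrite dotC dotDl// ![dot _ h]dotC. Qed.

Lemma dotZr a f h : L2 f -> L2 h -> dot h (fun x => a * f x) = a * dot h f.
Proof. by move=> f2 h2; rewrite dotC dotZl// dotC. Qed.

Lemma dotBr f g h : L2 f -> L2 g -> L2 h ->
  dot h (fun x => f x - g x) = dot h f - dot h g.
Proof. by move=> f2 g2 h2; rewrite dotC dotBl// ![dot _ h]dotC. Qed.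

Lemma dot0l f : dot (fun=> 0) f = 0.
Proof.
rewrite /dot (_ : (fun x => _) = fun=> 0); first by rewrite Rintegral_cst// mul0r.
by apply/funext => x; rewrite mul0r.
Qed.

Lemma dot0r f : dot f (fun=> 0) = 0. Proof. by rewrite dotC dot0l. Qed.

Lemma dot_suml (I : Type) (r : seq I) (F : I -> T -> R) h :
  (forall i, L2 (F i)) -> L2 h ->
  dot (fun x => \sum_(i <- r) F i x) h = \sum_(i <- r) dot (F i) h.
Proof.
move=> F2 h2; elim: r => [|i r IH].
  by rewrite big_nil -[RHS](dot0l h); apply: eq_Rintegral => x _; rewrite big_nil.
rewrite big_cons -IH -dotDl//; last exact: L2_sum.
by apply: eq_Rintegral => x _; rewrite big_cons.
Qed.

Lemma dot_sumr (I : Type) (r : seq I) (F : I -> T -> R) h :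
  (forall i, L2 (F i)) -> L2 h ->
  dot h (fun x => \sum_(i <- r) F i x) = \sum_(i <- r) dot h (F i).
Proof.
by move=> F2 h2; rewrite dotC dot_suml//; apply: eq_bigr => i _; rewrite dotC.
Qed.

Lemma ae_dot f f' g g' : L2 f -> L2 g -> L2 f' -> L2 g' ->
  {ae m, forall x, f x = f' x} -> {ae m, forall x, g x = g' x} ->
  dot f g = dot f' g'.
Proof.
move=> f2 g2 f2' g2' ff gg; congr fine; apply: ae_eq_integral => //.
- exact/measurable_int/dot_integrable.
- exact/measurable_int/dot_integrable.
- by apply: filterS2 ff gg => x -> ->.
Qed.

Lemma dot_sqr_le f g : L2 f -> L2 g -> dot f g ^+ 2 <= dot f f * dot g g.
Proof.
move=> f2 g2.
have H a b : 0 <= a ^+ 2 * dot f f + 2 * a * b * dot f g + b ^+ 2 * dot g g.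
  have fa := L2Z a f2; have gb := L2Z b g2.
  have := dot_ge0 (fun x => a * f x + b * g x).
  rewrite dotDl ?dotDr// ?dotZl ?dotZr ?(dotC g f)//; last exact: L2D.
  by move=> h; lra.
have [g0|gn0] := eqVneq (dot g g) 0.
  have H' b : 0 <= dot f f + 2 * b * dot f g.
    by have := H 1 b; rewrite g0 mulr0 addr0 expr1n mul1r mulr1.
  have [->|fg0] := eqVneq (dot f g) 0; first by rewrite expr0n mulr_ge0// dot_ge0.
  (* At this value the affine expression equals -1. *)
  have := H' (- (dot f f + 1) / (2 * dot f g)).
  rewrite (_ : 2 * _ * dot f g = - (dot f f + 1)); last by field.
  by move=> h; exfalso; lra.
have gp : 0 < dot g g by rewrite lt0r gn0 dot_ge0.
(* With these coefficients the form is [dot g g] times the Cauchy-Schwarz defect. *)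
have := H (dot g g) (- dot f g).
rewrite (_ : _ + _ = dot g g * (dot f f * dot g g - dot f g ^+ 2)); last by ring.
by rewrite pmulr_rge0// subr_ge0.
Qed.

Lemma nrmD_sqr f g : L2 f -> L2 g ->
  nrm (fun x => f x + g x) ^+ 2 = dot f f + 2 * dot f g + dot g g.
Proof.
move=> f2 g2; have fg2 := L2D f2 g2.
by rewrite nrm_sqr dotDl// !dotDr// (dotC g f); ring.
Qed.

Lemma nrmB_sqr f g : L2 f -> L2 g ->
  nrm (fun x => f x - g x) ^+ 2 = dot f f - 2 * dot f g + dot g g.
Proof.
move=> f2 g2; have fg2 := L2B f2 g2.
by rewrite nrm_sqr dotBl// !dotBr// (dotC g f); ring.
Qed.

Lemma cauchy_schwarz f g : L2 f -> L2 g -> `|dot f g| <= nrm f * nrm g.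
Proof.
move=> f2 g2; rewrite -(ler_pXn2r (ltn0Sn 1)) ?nnegrE// ?mulr_ge0 ?nrm_ge0//.
by rewrite exprMn !nrm_sqr real_normK ?num_real// dot_sqr_le.
Qed.

Lemma nrmD f g : L2 f -> L2 g -> nrm (fun x => f x + g x) <= nrm f + nrm g.
Proof.
move=> f2 g2; rewrite -(ler_pXn2r (ltn0Sn 1)) ?nnegrE ?addr_ge0 ?nrm_ge0//.
rewrite nrmD_sqr//; have := cauchy_schwarz f2 g2; rewrite ler_norml => /andP[_ h].
rewrite sqrrD !nrm_sqr; lra.
Qed.

Lemma nrmZ a f : L2 f -> nrm (fun x => a * f x) = `|a| * nrm f.
Proof.
move=> f2; rewrite /nrm dotZl ?dotZr//; last exact: L2Z.
by rewrite mulrA -expr2 sqrtrM ?sqr_ge0// sqrtr_sqr.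
Qed.

Lemma nrmN f : L2 f -> nrm (fun x => - f x) = nrm f.
Proof.
move=> f2; rewrite -[RHS]mul1r -[X in X * _](normrN1 R) -nrmZ//.
by congr nrm; apply/funext => x; rewrite mulN1r.
Qed.

Lemma nrmB f g : L2 f -> L2 g -> nrm (fun x => f x - g x) <= nrm f + nrm g.
Proof. by move=> f2 g2; rewrite -(nrmN g2); apply: nrmD => //; exact: L2N. Qed.

Lemma nrmBC f g : nrm (fun x => f x - g x) = nrm (fun x => g x - f x).
Proof.
congr Num.sqrt; apply: eq_Rintegral => x _.
by rewrite -expr2 -sqrrN opprB expr2.
Qed.

Lemma nrm_triangle f g h : L2 f -> L2 g -> L2 h ->
  nrm (fun x => f x - h x) <= nrm (fun x => f x - g x) + nrm (fun x => g x - h x).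
Proof.
move=> f2 g2 h2; rewrite [X in nrm X](_ : _ = fun x => (f x - g x) + (g x - h x)).
  by apply: nrmD; exact: L2B.
by apply/funext => x; rewrite addrA subrK.
Qed.

Lemma le_nrm f g : L2 f -> L2 g -> (forall x, `|f x| <= `|g x|) -> nrm f <= nrm g.
Proof.
move=> f2 g2 fg; rewrite ler_wsqrtr//; apply: le_Rintegral => //; [exact: dot_integrable..|].
by move=> x _; rewrite -!expr2 -[leLHS]real_normK ?num_real// -[leRHS]real_normK ?num_real// lerXn2r ?nnegrE.
Qed.

Lemma ae_le_nrm f g : L2 f -> L2 g -> {ae m, forall x, `|f x| <= `|g x|} ->
  nrm f <= nrm g.
Proof.
move=> f2 g2 fg; rewrite ler_wsqrtr//.
have [if2 ig2] := (dot_integrable f2 f2, dot_integrable g2 g2).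
apply: fine_le; [exact: integrable_fin_num if2|exact: integrable_fin_num ig2|].
apply: ae_ge0_le_integral => //.
- by move=> x _; rewrite lee_fin -expr2 sqr_ge0.
- exact: measurable_int if2.
- by move=> x _; rewrite lee_fin -expr2 sqr_ge0.
- exact: measurable_int ig2.
- apply: filterS fg => x fg _; rewrite lee_fin -!expr2.
  by rewrite -[leLHS]real_normK ?num_real// -[leRHS]real_normK ?num_real// lerXn2r ?nnegrE.
Qed.

Lemma nrm_eq0 f : L2 f -> nrm f = 0 -> {ae m, forall x, f x = 0}.
Proof.
move=> f2 /eqP; rewrite sqrtr_eq0 => f0.
have i2 := L2_sqr f2.
have /ae_eq_integral_abs : measurable_fun setT (EFin \o (fun x => f x ^+ 2)).
  exact: measurable_int i2.
move=> /(_ m measurableT) [+ _].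
have -> : (\int[m]_x `|(EFin \o (fun x => f x ^+ 2)%R) x| = 0)%E.
  under eq_integral do rewrite /= ger0_norm ?sqr_ge0//.
  rewrite -[LHS]fineK; last exact: integrable_fin_num i2.
  congr EFin; apply/le_anti/andP; split.
    by rewrite (_ : dot f f = \int[m]_x (f x ^+ 2)) in f0 => //; apply: eq_Rintegral => x _; rewrite expr2.
  by rewrite fine_ge0// integral_ge0// => x _; rewrite lee_fin sqr_ge0.
move=> /(_ erefl); apply: filterS => x /(_ I) /= [] /eqP.
by rewrite sqrf_eq0 => /eqP.
Qed.

Definition cvgL2 (u : nat -> T -> R) f : Prop :=
  [/\ forall n, L2 (u n), L2 f & nrm (fun x => u n x - f x) @[n --> \oo] --> 0].

Lemma cvgL2_dot u f g : cvgL2 u f -> L2 g -> dot (u n) g @[n --> \oo] --> dot f g.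
Proof.
move=> [u2 f2 uf] g2; apply/cvgrPdist_le => e e0.
have h : nrm (fun x => u n x - f x) * nrm g @[n --> \oo] --> (0 : R).
  by rewrite -(mul0r (nrm g)); apply: cvgMl.
move/cvgrPdist_le : h => /(_ _ e0); apply: filterS => n.
rewrite sub0r normrN => h; rewrite distrC -dotBl//; apply: le_trans h.
rewrite [X in _ <= X]ger0_norm ?mulr_ge0 ?nrm_ge0//; apply: cauchy_schwarz => //.
exact: L2B.
Qed.

Lemma cvgL2_nrm u f : cvgL2 u f -> nrm (u n) @[n --> \oo] --> nrm f.
Proof.
move=> [u2 f2 uf]; apply/cvgrPdist_le => e e0.
move/cvgrPdist_le : uf => /(_ _ e0); apply: filterS => n.
rewrite sub0r normrN ger0_norm ?nrm_ge0// => h; apply: le_trans h.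
have : nrm f <= nrm (u n) + nrm (fun x => u n x - f x).
  rewrite [leLHS](_ : _ = nrm (fun x => u n x - (u n x - f x))).
    by apply: nrmB => //; exact: L2B.
  by congr nrm; apply/funext => x; rewrite subKr.
have : nrm (u n) <= nrm f + nrm (fun x => u n x - f x).
  rewrite [leLHS](_ : _ = nrm (fun x => f x + (u n x - f x))).
    by apply: nrmD => //; exact: L2B.
  by congr nrm; apply/funext => x; rewrite addrC subrK.
by rewrite ler_norml => ? ?; lra.
Qed.

Lemma cvgL2D u v f g : cvgL2 u f -> cvgL2 v g ->
  cvgL2 (fun n x => u n x + v n x) (fun x => f x + g x).
Proof.
move=> [u2 f2 uf] [v2 g2 vg]; split=> [n||]; [exact: L2D|exact: L2D|].
have h : nrm (fun x => u n x - f x) + nrm (fun x => v n x - g x) @[n --> \oo] --> (0:R).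
  by rewrite -(addr0 0); apply: cvgD.
apply: (squeeze_cvgr _ (cvg_cst 0) h); apply: nearW => n.
rewrite nrm_ge0/= [leLHS](_ : _ = nrm (fun x => (u n x - f x) + (v n x - g x))).
  by apply: nrmD; exact: L2B.
by congr nrm; apply/funext => x; rewrite opprD addrACA.
Qed.

Lemma cvgL2Z a u f : cvgL2 u f -> cvgL2 (fun n x => a * u n x) (fun x => a * f x).
Proof.
move=> [u2 f2 uf]; split=> [n||]; [exact: L2Z|exact: L2Z|].
rewrite [X in X @ _](_ : _ = fun n => `|a| * nrm (fun x => u n x - f x)).
  by rewrite -(mulr0 `|a|); apply: cvgMr.
apply/funext => n; rewrite -nrmZ; last exact: L2B.
by congr nrm; apply/funext => x; rewrite mulrBr.
Qed.

Lemma cvgL2B u v f g : cvgL2 u f -> cvgL2 v g ->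
  cvgL2 (fun n x => u n x - v n x) (fun x => f x - g x).
Proof.
move=> uf vg; have := cvgL2D uf (cvgL2Z (-1) vg).
by under [X in cvgL2 X]eq_fun => n do under eq_fun => x do rewrite mulN1r;
  under [X in cvgL2 _ X]eq_fun => x do rewrite mulN1r.
Qed.

Lemma cvgL2_cst f : L2 f -> cvgL2 (fun=> f) f.
Proof.
move=> f2; split=> //; rewrite (_ : (fun=> _) = cst 0); first exact: cvg_cst.
apply/funext => n; rewrite /nrm (_ : (fun x => _) = fun=> 0) ?dot0l ?sqrtr0//.
by apply/funext => x; rewrite subrr.
Qed.

(** Polarisation writes the pairing through squared norms of a sum and a difference, whose
    convergence is [cvgL2_nrm]. *)
Lemma cvgL2_dot2 u v f g : cvgL2 u f -> cvgL2 v g ->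
  dot (u n) (v n) @[n --> \oo] --> dot f g.
Proof.
move=> uf vg; have [u2 f2 _] := uf; have [v2 g2 _] := vg.
rewrite (_ : dot f g = ((nrm (fun x => f x + g x)) ^+ 2
     - (nrm (fun x => f x - g x)) ^+ 2) / 4); last first.
  by rewrite nrmD_sqr// nrmB_sqr//; field.
rewrite (_ : (fun n => _) = fun n => ((nrm (fun x => u n x + v n x)) ^+ 2
     - (nrm (fun x => u n x - v n x)) ^+ 2) / 4); last first.
  by apply/funext => n; rewrite nrmD_sqr// nrmB_sqr//; field.
have sqr (a : nat -> R) (l : R) : a n @[n --> \oo] --> l ->
    a n ^+ 2 @[n --> \oo] --> l ^+ 2.
  by move=> al; rewrite expr2; under eq_fun do rewrite expr2; exact: cvgM.
by apply: cvgMl; apply: cvgB; apply: sqr; apply: cvgL2_nrm;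
  [exact: cvgL2D|exact: cvgL2B].
Qed.

End L2_space.

(** * Smooth functions *)

Section smooth_functions.
Context (R : realType).

Section coinduction.
Context (V : normedModType R).
Implicit Types f g : V -> R.

Lemma smoothP f : smooth f <->
  (forall x, differentiable f x) /\ (forall v, smooth ('D_v f)).
Proof.
split=> [sf|[df sf] s].
  by split=> [x|v s x]; [exact: (sf [::])|rewrite -foldr_rcons; exact: sf].
by elim/last_ind: s => [//|s v _]; rewrite foldr_rcons; exact: sf.
Qed.

(** Smoothness is proved throughout by exhibiting a family closed under derivation. The induction
    peels the list from its right end because [foldr] differentiates along the last direction before
    the others. *)
Lemma smooth_coind (P : (V -> R) -> Prop) :
  (forall f, P f -> (forall x, differentiable f x) /\ (forall v, P ('D_v f))) ->
  forall f, P f -> smooth f.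
Proof.
move=> PS f Pf s; elim/last_ind: s f Pf => [f /PS[]//|s v IH f Pf].
by rewrite foldr_rcons; apply: IH; have [_] := PS _ Pf; apply.
Qed.

Lemma smooth_differentiable f x : smooth f -> differentiable f x.
Proof. by move=> /smoothP[]. Qed.

Lemma smooth_derivable f x v : smooth f -> derivable f x v.
Proof. by move=> sf; apply/diff_derivable/smooth_differentiable. Qed.

Lemma smooth_derive f v : smooth f -> smooth ('D_v f).
Proof. by move=> /smoothP[]. Qed.

Lemma smooth_continuous f : smooth f -> continuous f.
Proof. by move=> sf x; apply: differentiable_continuous; exact: smooth_differentiable. Qed.

End coinduction.

(* Stable under derivation, hence all its members are smooth. *)
Inductive smooth_alg (V : normedModType R) : (V -> R) -> Prop :=
| smooth_alg_smooth f : smooth f -> smooth_alg f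
| smooth_algD f g : smooth_alg f -> smooth_alg g -> smooth_alg (fun x => f x + g x)
| smooth_algM f g : smooth_alg f -> smooth_alg g -> smooth_alg (fun x => f x * g x)
| smooth_algV f : smooth_alg f -> (forall x, f x != 0) -> smooth_alg (fun x => (f x)^-1)
| smooth_alg_comp (W : normedModType R) (f : W -> R) (h : V -> W) (c : V -> W) :
    smooth f -> (forall x, is_diff x h c) -> smooth_alg (fun x => f (h x)).

Lemma smooth_cst (V : normedModType R) (a : R) : smooth (fun=> a : R^o) (V := V).
Proof.
apply: (@smooth_coind _ (fun f => exists b, f = fun=> b)); last by exists a.
move=> f [b ->]; split=> [x|v]; first exact: differentiable_cst.
by exists 0; apply/funext => x; rewrite derive_cst.
Qed.

Lemma smooth_algE (V : normedModType R) (f : V -> R) : smooth_alg f -> smooth f.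
Proof.
apply: smooth_coind => {}f; elim=> {f}
  [f sf|f g _ [df Df] _ [dg Dg]|f g af [df Df] ag [dg Dg]|f af [df Df] f0|W f h c sf hc].
- by split=> [x|v]; [exact: smooth_differentiable|apply/smooth_alg_smooth/smooth_derive].
- split=> [x|v]; first by apply: (@differentiableD _ _ _ f g).
  rewrite (_ : 'D_v _ = fun x => 'D_v f x + 'D_v g x); first exact: smooth_algD.
  by apply/funext => x; rewrite -deriveD//; exact: diff_derivable.
- split=> [x|v]; first by apply: (@differentiableM _ _ f g).
  rewrite (_ : 'D_v _ = fun x => f x * 'D_v g x + g x * 'D_v f x).
    by apply: smooth_algD; apply: smooth_algM.
  by apply/funext => x; rewrite -[LHS]/('D_v (f * g) x) deriveM//; exact: diff_derivable.
- split=> [x|v]; first exact: differentiableV.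
  rewrite (_ : 'D_v _ = fun x => -1 * ((f x)^-1 * ((f x)^-1 * 'D_v f x))).
    apply: smooth_algM; first exact/smooth_alg_smooth/smooth_cst.
    by apply: smooth_algM; [|apply: smooth_algM]; try exact: smooth_algV.
  apply/funext => x; rewrite deriveV//; last exact: diff_derivable.
  by rewrite /GRing.scale/= mulrA -invfM -expr2 mulN1r mulNr.
- split=> [x|v].
    apply: (@differentiable_comp _ _ _ _ h f); first by have [] := hc x.
    exact: smooth_differentiable.
  rewrite (_ : 'D_v _ = fun x => 'D_(c v) f (h x)).
    exact: smooth_alg_comp (smooth_derive (c v) sf) hc.
  apply/funext => x; have [dh dhE] := hc x.
  have dfh := smooth_differentiable (h x) sf.
  rewrite -[LHS]/('D_v (f \o h) x) deriveE; last exact: differentiable_comp.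
  by rewrite diff_comp//= dhE deriveE.
Qed.

Section algebra.
Context (V : normedModType R).
Implicit Types f g : V -> R.

Lemma smoothD f g : smooth f -> smooth g -> smooth (fun x => f x + g x).
Proof. by move=> sf sg; apply/smooth_algE/smooth_algD; apply: smooth_alg_smooth. Qed.

Lemma smoothM f g : smooth f -> smooth g -> smooth (fun x => f x * g x).
Proof. by move=> sf sg; apply/smooth_algE/smooth_algM; apply: smooth_alg_smooth. Qed.

Lemma smoothV f : smooth f -> (forall x, f x != 0) -> smooth (fun x => (f x)^-1).
Proof. by move=> sf f0; apply/smooth_algE/smooth_algV => //; apply: smooth_alg_smooth. Qed.

Lemma smoothZ a f : smooth f -> smooth (fun x => a * f x).
Proof. by move=> sf; apply: smoothM => //; exact: smooth_cst. Qed.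

Lemma smoothN f : smooth f -> smooth (fun x => - f x).
Proof.
move=> /(smoothZ (-1)); rewrite (_ : (fun x => _) = (fun x => - f x))//.
by apply/funext => x; rewrite mulN1r.
Qed.

Lemma smoothB f g : smooth f -> smooth g -> smooth (fun x => f x - g x).
Proof. by move=> sf sg; apply: smoothD => //; exact: smoothN. Qed.

Lemma smooth_sum (I : Type) (r : seq I) (F : I -> V -> R) :
  (forall i, smooth (F i)) -> smooth (fun x => \sum_(i <- r) F i x).
Proof.
move=> sF; elim: r => [|i r IH].
  by under eq_fun do rewrite big_nil; exact: smooth_cst.
by under eq_fun do rewrite big_cons; exact: smoothD.
Qed.

(** The differential [c] of [h] does not depend on the point, so [h] is affine and the chain rule
    only changes the direction of derivation. *)
Lemma smooth_comp (W : normedModType R) (f : W -> R) (h c : V -> W) :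
  smooth f -> (forall x, is_diff x h c) -> smooth (fun x => f (h x)).
Proof. by move=> sf hc; apply: smooth_algE; exact: smooth_alg_comp hc. Qed.

Lemma derive_smooth_comp (W : normedModType R) (f : W -> R) (h c : V -> W) x v :
  smooth f -> (forall x, is_diff x h c) ->
  'D_v (fun x => f (h x)) x = 'D_(c v) f (h x).
Proof.
move=> sf hc; have [dh dhE] := hc x; have dfh := smooth_differentiable (h x) sf.
rewrite -[LHS]/('D_v (f \o h) x) deriveE; last exact: differentiable_comp.
by rewrite diff_comp//= dhE deriveE.
Qed.

Lemma derive_smoothD f g x v : smooth f -> smooth g ->
  'D_v (fun x => f x + g x) x = 'D_v f x + 'D_v g x.
Proof. by move=> sf sg; apply: deriveD; exact: smooth_derivable. Qed.

Lemma derive_smoothM f g x v : smooth f -> smooth g ->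
  'D_v (fun x => f x * g x) x = f x * 'D_v g x + g x * 'D_v f x.
Proof.
by move=> sf sg; rewrite -[LHS]/('D_v (f * g) x) deriveM//; exact: smooth_derivable.
Qed.

Lemma derive_smoothZ a f x v : smooth f -> 'D_v (fun x => a * f x) x = a * 'D_v f x.
Proof.
by move=> sf; rewrite -[LHS]/('D_v (a \*: f) x) deriveZ//; exact: smooth_derivable.
Qed.

Lemma derive_smoothB f g x v : smooth f -> smooth g ->
  'D_v (fun x => f x - g x) x = 'D_v f x - 'D_v g x.
Proof. by move=> sf sg; apply: deriveB; exact: smooth_derivable. Qed.

Lemma derive_smooth_sum (I : Type) (r : seq I) (F : I -> V -> R) x v :
  (forall i, smooth (F i)) ->
  'D_v (fun x => \sum_(i <- r) F i x) x = \sum_(i <- r) 'D_v (F i) x.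
Proof.
move=> sF; elim: r => [|i r IH].
  by under eq_fun do rewrite big_nil; rewrite big_nil derive_cst.
under eq_fun do rewrite big_cons.
by rewrite big_cons -IH derive_smoothD//; exact: smooth_sum.
Qed.

Lemma derive_smoothDv f x a b u v : smooth f ->
  'D_(a *: u + b *: v) f x = a * 'D_u f x + b * 'D_v f x.
Proof.
move=> /smooth_differentiable sf; rewrite !deriveE//.
by rewrite linearD !linearZ.
Qed.

End algebra.

Section mean_value.
Context (V : normedModType R).
Implicit Types f g : V -> R.

Lemma smooth_MVT f x v : smooth f ->
  exists2 t, 0 <= t <= 1 & f (x + v) - f x = 'D_v f (x + t *: v).
Proof.
move=> sf; pose F (t : R) := f (x + t *: v).
have hc (t : R) : is_diff t (fun t : R => x + t *: v) ( *:%R ^~ v).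
  rewrite (_ : ( *:%R ^~ v) = 0 + ( *:%R ^~ v)); last by rewrite add0r.
  exact: is_diffD.
have dF (t : R) : is_derive t (1 : R) F ('D_v f (x + t *: v)).
  have sF : smooth F := smooth_comp sf hc.
  apply: DeriveDef; first exact: smooth_derivable.
  by rewrite (derive_smooth_comp _ _ sf hc) scale1r.
have [] := @MVT_segment R F (fun t => 'D_v f (x + t *: v)) 0 1 ler01.
- apply: continuous_subspaceT => t; apply/differentiable_continuous/derivable1_diffP.
  exact: ex_derive.
- move=> t; rewrite in_itv/= => t01; rewrite /F scale1r scale0r addr0 subr0 mulr1.
  by exists t.
Qed.

Lemma derive_smooth_le (M : R) f x v : smooth f ->
  (forall y, `|'D_v f y| <= M) -> `|f (x + v) - f x| <= M.
Proof. by move=> sf fM; have [t _ ->] := smooth_MVT x v sf. Qed.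

Lemma smooth_taylor2 (M : R) f x v : smooth f ->
  (forall y, `|'D_v ('D_v f) y| <= M) -> `|f (x + v) - f x - 'D_v f x| <= M.
Proof.
move=> sf fM; have M0 : 0 <= M by apply: le_trans (fM x).
have [t /andP[t0 t1] ->] := smooth_MVT x v sf.
have [s _ ->] := smooth_MVT x (t *: v) (smooth_derive v sf).
have sD := smooth_differentiable (x + s *: (t *: v)) (smooth_derive v sf).
rewrite deriveE// linearZ -deriveE// normrM ger0_norm//.
by rewrite -[leRHS]mul1r ler_pM.
Qed.

End mean_value.

Lemma derive_smooth1 (f : R -> R) (x v : R) : smooth f -> 'D_v f x = v * 'D_1 f x.
Proof.
move=> /smooth_differentiable sf; rewrite !deriveE//.
by rewrite -[X in 'd f x X](mulr1 v) -[LHS]/('d f x (v *: 1)) linearZ.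
Qed.

Lemma smooth_id : smooth (id : R -> R).
Proof.
apply/smoothP; split=> [x|v]; first by have [] := is_diff_id x.
rewrite (_ : 'D_v id = fun=> v); first exact: smooth_cst.
by apply/funext => x; rewrite derive_id.
Qed.

Section flat.

Lemma is_diff_affine (c k t : R) :
  is_diff t (fun t : R => k * (t - c)) (fun t => k * (t - 0)).
Proof.
by apply: (@is_diffZ _ _ _ (fun t : R => t - c)); apply: (@is_diffB _ _ _ id (cst c)).
Qed.

(** Write exp(y) as the k-th power of exp(y/k), which is at least y/k. *)
Lemma expRN_pow (k : nat) (y : R) : 0 <= y -> y ^+ k * expR (- y) <= k%:R ^+ k.
Proof.
move=> y0; rewrite expRN ler_pdivrMr ?expR_gt0//.
case: k => [|k]; first by rewrite !expr0 mul1r -[leLHS]expR0 ler_expR.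
have -> : y = k.+1%:R * (y / k.+1%:R) by field; rewrite ?pnatr_eq0.
rewrite expRM_natl exprMn ler_wpM2l ?exprn_ge0// lerXn2r ?nnegrE ?divr_ge0 ?expR_ge0//.
by apply: le_trans (expR_ge1Dx _); rewrite lerDr.
Qed.

(** The classical functions q(1/t) exp(-1/t), extended by 0. The polynomial is a parameter because
    derivation maps q to X^2 (q - q'), so that the family is closed under it. *)
Definition flat (q : {poly R}) (t : R) : R :=
  if 0 < t then q.[t^-1] * expR (- t^-1) else 0.

(** The order t^2 is what the derivative at 0 needs: the difference quotient there is O(t). *)
Lemma flat_bound q : exists C, forall t, `|flat q t| <= C * t ^+ 2.
Proof.
exists (\sum_(i < size q) `|q`_i| * (i + 2)%:R ^+ (i + 2)) => t.
have C0 : 0 <= \sum_(i < size q) `|q`_i| * (i + 2)%:R ^+ (i + 2).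
  by apply: sumr_ge0 => i _; rewrite mulr_ge0 ?exprn_ge0.
rewrite /flat; case: ifPn => [t0|_]; last by rewrite normr0 mulr_ge0 ?sqr_ge0.
rewrite -ler_pdivrMr ?exprn_gt0// horner_coef normrM (ger0_norm (expR_ge0 _)).
rewrite -mulrA; apply: le_trans (_ : (\sum_(i < size q) `|q`_i| * t^-1 ^+ i) * (expR (- t^-1) / t ^+ 2) <= _).
  rewrite ler_wpM2r ?divr_ge0 ?expR_ge0 ?sqr_ge0//.
  apply: le_trans (ler_norm_sum _ _ _) _; apply: ler_sum => i _.
  by rewrite normrM (ger0_norm (exprn_ge0 _ _))// invr_ge0 ltW.
rewrite mulr_suml; apply: ler_sum => i _; rewrite -mulrA ler_wpM2l//.
apply: le_trans (expRN_pow (i + 2) (_ : 0 <= t^-1)); last by rewrite invr_ge0 ltW.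
by rewrite exprD -exprVn mulrA mulrAC.
Qed.

Lemma is_derive_flat q (t : R) :
  is_derive t (1 : R) (flat q) (flat ('X^2 * (q - q^`())) t).
Proof.
have [t0|t0|->] := ltrgtP t 0.
- have -> : flat ('X^2 * (q - q^`())) t = 0 by rewrite /flat ltNge ltW.
  apply: (@near_eq_is_derive _ _ _ (cst (0 : R^o))).
  by near=> s; rewrite /flat ltNge ltW//; near: s; exact: lt_nbhsl.
- apply: (@near_eq_is_derive _ _ _ (fun t : R => (q.[t^-1] * expR (- t^-1) : R^o))).
    by near=> s; rewrite /flat ifT//; near: s; exact: lt_nbhsr.
  have dV : is_derive t (1 : R) (fun t : R => t^-1) (- t ^- 2).
    apply: is_derive_eq (is_deriveV _ _) _; first by rewrite gt_eqF.
    by rewrite /GRing.scale/= mulr1.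
  have dq : is_derive t (1 : R) (fun t => q.[t^-1]) (q^`().[t^-1] * - t ^- 2).
    exact: (@is_derive1_comp _ (horner q) (fun t : R => t^-1)).
  have dN : is_derive t (1 : R) (fun t : R => - t^-1) (t ^- 2).
    by apply: is_derive_eq (is_deriveN _) _; rewrite opprK.
  have de : is_derive t (1 : R) (fun t => expR (- t^-1)) (expR (- t^-1) * t ^- 2).
    exact: (@is_derive1_comp _ expR (fun t : R => - t^-1)).
  apply: is_derive_eq (is_deriveM _ _) _.
  rewrite /flat t0 /GRing.scale/= hornerM hornerXn hornerD hornerN exprVn.
  by move: (q.[_]) (q^`().[_]) (expR _) (t ^- 2) => a b c d; ring.
- have -> : flat ('X^2 * (q - q^`())) 0 = 0 by rewrite /flat ltxx.
  have [C hC] := flat_bound q.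
  have cv : h^-1 *: (flat q (h *: 1 + 0) - flat q 0) @[h --> 0^'] --> (0 : R).
    apply/cvgrPdist_le => e e0; near=> h.
    have h0 : h != 0 by near: h; exact: nbhs_dnbhs_neq.
    rewrite sub0r normrN addr0 {2}/flat ltxx subr0 /GRing.scale/= mulr1 normrM normfV.
    rewrite mulrC ler_pdivrMr ?normr_gt0//; apply: le_trans (hC h) _.
    rewrite -(real_normK (num_real h)) expr2 mulrA ler_wpM2r//.
    have C0 : 0 <= `|C| + 1 by rewrite addr_ge0.
    apply: (@le_trans _ _ ((`|C| + 1) * `|h|)); first by rewrite ler_wpM2r// (le_trans (ler_norm _))// lerDl.
    rewrite mulrC -ler_pdivlMr ?ltr_wpDl//.
    near: h; apply: dnbhs0_le; rewrite divr_gt0// ltr_wpDl//.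
  apply: DeriveDef; last by apply/cvg_lim; [exact: Rhausdorff|exact: cv].
  by apply/cvg_ex; exists 0; exact: cv.
Unshelve. all: by end_near.
Qed.

Lemma smooth_flat q : smooth (flat q).
Proof.
apply: (@smooth_coind R^o (fun f => exists p, f = flat p)); last by exists q.
move=> f [p ->].
have df x : differentiable (flat p) x.
  by apply/derivable1_diffP; have [] := is_derive_flat p x.
split=> // v; exists (v *: ('X^2 * (p - p^`()))); apply/funext => x.
have -> : 'D_v (flat p) x = v * 'D_1 (flat p) x.
  by rewrite !deriveE// -[X in 'd _ x X](mulr1 v) -[LHS]/('d (flat p) x (v *: 1)) linearZ.
have [_ ->] := is_derive_flat p x.
by rewrite /flat; case: ifP => _; rewrite ?mulr0// hornerZ mulrA.
Qed.

Definition step (t : R) : R := flat 1 t / (flat 1 t + flat 1 (1 - t)).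

Lemma flat1_ge0 t : 0 <= flat 1 t.
Proof. by rewrite /flat; case: ifP => // _; rewrite hornerC mul1r expR_ge0. Qed.

Lemma flat1_gt0 t : 0 < t -> 0 < flat 1 t.
Proof. by rewrite /flat => ->; rewrite hornerC mul1r expR_gt0. Qed.

Lemma flat_le0 q t : t <= 0 -> flat q t = 0.
Proof. by move=> t0; rewrite /flat ltNge t0. Qed.

Lemma step_denom t : 0 < flat 1 t + flat 1 (1 - t).
Proof.
have [t0|t0] := ltP 0 t; first by rewrite ltr_wpDr ?flat1_ge0// flat1_gt0.
by rewrite ltr_wpDl ?flat1_ge0// flat1_gt0//; lra.
Qed.

Lemma smooth_step : smooth step.
Proof.
have s1 : smooth (fun t : R => flat 1 (1 - t)).
  rewrite (_ : (fun t => _) = fun t => flat 1 (-1 * (t - 1))).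
    exact: (smooth_comp (smooth_flat 1) (is_diff_affine 1 (-1))).
  by apply/funext => t; congr flat; ring.
apply: smoothM; first exact: smooth_flat.
apply: smoothV; first by apply: smoothD => //; exact: smooth_flat.
by move=> t; rewrite gt_eqF// step_denom.
Qed.

Lemma step_le0 t : t <= 0 -> step t = 0.
Proof. by move=> t0; rewrite /step flat_le0// mul0r. Qed.

Lemma step_ge1 t : 1 <= t -> step t = 1.
Proof.
move=> t1; rewrite /step [flat 1 (1 - t)]flat_le0 ?addr0 ?divff//; last by lra.
by rewrite gt_eqF// flat1_gt0//; lra.
Qed.

Lemma step_ge0 t : 0 <= step t.
Proof. by rewrite divr_ge0 ?flat1_ge0// ltW// step_denom. Qed.

Lemma step_le1 t : step t <= 1.
Proof. by rewrite ler_pdivrMr ?step_denom// mul1r lerDl flat1_ge0. Qed.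

Lemma step_gt0 t : 0 < t -> 0 < step t.
Proof. by move=> t0; rewrite divr_gt0 ?flat1_gt0// step_denom. Qed.

Definition plateau (a b e t : R) : R := step ((t - a) / e) * step ((b - t) / e).

Lemma smooth_plateau a b e : smooth (plateau a b e).
Proof.
apply: smoothM.
  rewrite (_ : (fun t => step _) = fun t => step (e^-1 * (t - a))).
    exact: (smooth_comp smooth_step (is_diff_affine a e^-1)).
  by apply/funext => t; rewrite mulrC.
rewrite (_ : (fun t => step _) = fun t => step (- e^-1 * (t - b))).
  exact: (smooth_comp smooth_step (is_diff_affine b (- e^-1))).
by apply/funext => t; congr step; ring.
Qed.

Lemma plateau_ge0 a b e t : 0 <= plateau a b e t.
Proof. by rewrite mulr_ge0 ?step_ge0. Qed.

Lemma plateau_le1 a b e t : plateau a b e t <= 1.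
Proof. by rewrite -[leRHS]mulr1 ler_pM ?step_ge0 ?step_le1. Qed.

Lemma plateau_out a b e t : 0 < e -> ~~ (a < t < b) -> plateau a b e t = 0.
Proof.
move=> e0; rewrite negb_and -!leNgt => /orP[ta|bt]; rewrite /plateau.
  by rewrite step_le0 ?mul0r// pmulr_lle0 ?invr_gt0//; lra.
by rewrite [X in _ * X]step_le0 ?mulr0// pmulr_lle0 ?invr_gt0//; lra.
Qed.

Lemma plateau_in a b e t : 0 < e -> a + e <= t <= b - e -> plateau a b e t = 1.
Proof.
by move=> e0 /andP[ta tb]; rewrite /plateau !step_ge1 ?mulr1// ler_pdivlMr//; lra.
Qed.

Lemma plateau_gt0 a b e t : 0 < e -> a < t < b -> 0 < plateau a b e t.
Proof. by move=> e0 /andP[ta tb]; rewrite mulr_gt0// step_gt0// divr_gt0// subr_gt0. Qed.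

End flat.
End smooth_functions.

(** * Invariance of Lebesgue measure *)

Section measure_preserving.
Local Open Scope ereal_scope.

Definition preserving d (T : measurableType d) (R : realType)
    (m : {measure set T -> \bar R}) (p : T -> T) : Prop :=
  measurable_fun setT p /\ forall A, measurable A -> m (p @^-1` A) = m A.

Lemma preserving_prod d1 d2 (T1 : measurableType d1) (T2 : measurableType d2)
    (R : realType) (m1 : {sigma_finite_measure set T1 -> \bar R})
    (m2 : {sigma_finite_measure set T2 -> \bar R}) p1 p2 :
  preserving m1 p1 -> preserving m2 p2 ->
  preserving (m1 \x m2) (fun x => (p1 x.1, p2 x.2)).
Proof.
move=> [mp1 p1E] [mp2 p2E].
have mp : measurable_fun setT (fun x : T1 * T2 => (p1 x.1, p2 x.2)).
  by apply/measurable_fun_pair => /=; apply: measurableT_comp.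
split=> // A mA; rewrite -[LHS]/(pushforward (m1 \x m2) (fun x => (p1 x.1, p2 x.2)) A).
have mf : @isMeasurableFun _ _ _ _ (fun x : T1 * T2 => (p1 x.1, p2 x.2)) by split.
pose P : {mfun (T1 * T2)%type >-> (T1 * T2)%type} :=
  HB.pack (fun x : (T1 * T2)%type => (p1 x.1, p2 x.2)) mf.
rewrite -[LHS]/(pushforward (m1 \x m2) P A).
apply/esym; apply: product_measure_unique => // B C mB mC.
rewrite -[LHS]/((m1 \x m2) ((p1 @^-1` B) `*` (p2 @^-1` C))).
rewrite product_measure1E ?p1E ?p2E//.
- by rewrite -[X in measurable X]setTI; exact: mp1.
- by rewrite -[X in measurable X]setTI; exact: mp2.
Qed.

Lemma integral_preserving d (T : measurableType d) (R : realType)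
    (m : {measure set T -> \bar R}) (p : T -> T) (f : T -> R) :
  preserving m p -> measurable_fun setT f ->
  (\int[m]_x f (p x) = \int[m]_x f x)%R.
Proof.
move=> [mp pE] mf; congr fine.
have mfp : @isMeasurableFun _ _ _ _ p by split.
pose P : {mfun T >-> T} := HB.pack p mfp.
have H (g : T -> \bar R) : measurable_fun setT g -> (forall x, 0 <= g x) ->
    \int[m]_x g (p x) = \int[m]_x g x.
  move=> mg g0; rewrite -[LHS]/(\int[m]_(x in P @^-1` setT) (g \o P) x).
  rewrite -ge0_integral_pushforward//.
  apply: eq_measure_integral => A mA _; exact: pE.
have mF : measurable_fun setT (EFin \o f) by exact/measurable_EFinP.
rewrite integralE [RHS]integralE.
have e1 := H _ (measurable_funepos mF) (funepos_ge0 _).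
have e2 := H _ (measurable_funeneg mF) (funeneg_ge0 _).
rewrite -e1 -e2.
by congr (adde _ (oppe _)); apply: eq_integral => x _; rewrite ?funeposE ?funenegE.
Qed.

Lemma integrable_preserving d (T : measurableType d) (R : realType)
    (m : {measure set T -> \bar R}) (p : T -> T) (f : T -> R) :
  preserving m p -> measurable_fun setT f ->
  m.-integrable setT (EFin \o f) -> m.-integrable setT (EFin \o (f \o p)).
Proof.
move=> [mp pE] mf /integrableP[_ fi].
have mfp : @isMeasurableFun _ _ _ _ p by split.
pose P : {mfun T >-> T} := HB.pack p mfp.
apply/integrableP; split; first exact/measurable_EFinP/measurableT_comp.
apply: le_lt_trans fi; rewrite -[leLHS]/(\int[m]_(x in P @^-1` setT) ((fun x => `|(f x)%:E|) \o P) x).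
rewrite -ge0_integral_pushforward//; last first.
  by apply: measurableT_comp => //; exact/measurable_EFinP.
rewrite le_eqVlt; apply/orP; left; apply/eqP.
by apply: eq_measure_integral => A mA _; exact: pE.
Qed.

End measure_preserving.

Section prod_sigma_finite.
Local Open Scope ereal_scope.
Context d1 d2 (T1 : measurableType d1) (T2 : measurableType d2) (R : realType).
Variables (m1 : {sigma_finite_measure set T1 -> \bar R})
  (m2 : {sigma_finite_measure set T2 -> \bar R}).

(** A copy of the product measure that carries a sigma-finite structure. It is convertible with the
    product, so [leb2] and [leb3] stand for [lebesgue2] and [lebesgue3] wherever iterated products
    or Tonelli's theorem are applied. *)
Definition prod_sigma_finite : set (T1 * T2) -> \bar R := (m1 \x m2).

HB.instance Definition _ := Measure.on prod_sigma_finite.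

Let prod_sigma_finite_setT : sigma_finite setT prod_sigma_finite.
Proof.
have /sigma_finiteP[F [TF ndF Foo]] := sigma_finiteT m1.
have /sigma_finiteP[G [TG ndG Goo]] := sigma_finiteT m2.
exists (fun n => F n `*` G n).
  rewrite -setXTT TF TG predeqE => -[x y]; split.
    move=> [/= [n _ Fnx] [k _ Gky]]; exists (maxn n k) => //; split.
    - by move: x Fnx; exact/subsetPset/ndF/leq_maxl.
    - by move: y Gky; exact/subsetPset/ndG/leq_maxr.
  by move=> [n _ []/= ? ?]; split; exists n.
move=> k; have [? ?] := Foo k; have [? ?] := Goo k.
split; first exact: measurableX.
by rewrite /prod_sigma_finite product_measure1E// lte_mul_pinfty// ge0_fin_numE.
Qed.

HB.instance Definition _ := Measure_isSigmaFinite.Build _ _ _ prod_sigma_finite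
  prod_sigma_finite_setT.

End prod_sigma_finite.

Section lebesgue_invariance.
Context (R : realType).
Local Notation mR := (measurableTypeR R).
Local Notation lam := (@lebesgue_measure R).

Lemma measurable_shift (a : R) : measurable_fun setT (fun x : mR => x + a : mR).
Proof. exact: (@measurable_funD _ _ _ _ id (cst a)). Qed.

Lemma preserving_shift (a : R) : preserving lam (fun x : mR => x + a : mR).
Proof.
have mp := measurable_shift a; split=> // A mA.
have mfp : @isMeasurableFun _ _ mR mR (fun x : mR => x + a) by split.
pose P : {mfun mR >-> mR} := HB.pack (fun x : mR => x + a : mR) mfp.
rewrite -[LHS]/(pushforward lam P A).
apply/esym; apply: lebesgue_measure_unique => // X [[b c] /= bc <-].
rewrite /pushforward/= (_ : _ @^-1` _ = `]b - a, c - a]%classic); last first.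
  by apply/seteqP; split=> x /=; rewrite !in_itv/= => /andP[? ?]; apply/andP; split; lra.
rewrite !lebesgue_measure_itv/= !lte_fin ltrD2r; case: ifP => // _.
by rewrite -!EFinB; congr EFin; ring.
Qed.

Lemma preserving_opp : preserving lam (fun x : mR => - x : mR).
Proof.
have mp : measurable_fun setT (fun x : mR => - x : mR).
  exact: (@measurable_funN _ _ _ _ id).
have mfp : @isMeasurableFun _ _ mR mR (fun x : mR => - x) by split.
pose P : {mfun mR >-> mR} := HB.pack (fun x : mR => - x : mR) mfp.
split=> // A mA; rewrite -[LHS]/(pushforward lam P A).
apply/esym; apply: lebesgue_measure_unique => // X [[b c] /= bc <-].
rewrite /pushforward/= (_ : _ @^-1` _ = `[- c, - b[%classic); last first.
  by apply/seteqP; split=> x /=; rewrite !in_itv/= => /andP[? ?]; apply/andP; split; lra.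
rewrite !lebesgue_measure_itv/= !lte_fin ltrN2; case: ifP => // _.
by rewrite -!EFinB; congr EFin; ring.
Qed.

Lemma preserving_comp d (T : measurableType d) (m : {measure set T -> \bar R}) p q :
  preserving m p -> preserving m q -> preserving m (p \o q).
Proof.
move=> [mp pE] [mq qE]; split; first exact: measurableT_comp.
move=> A mA; rewrite comp_preimage qE ?pE//.
by rewrite -[X in measurable X]setTI; exact: mp.
Qed.

Lemma preserving_refl (a : R) : preserving lam (fun x : mR => a - x : mR).
Proof.
have := preserving_comp (preserving_shift a) preserving_opp.
by rewrite (_ : _ \o _ = fun x => a - x)//; apply/funext => x /=; rewrite addrC.
Qed.

Local Notation T2 := (mR * mR)%type.
Local Notation T3 := (mR * mR * mR)%type.

Definition leb2 : {sigma_finite_measure set T2 -> \bar R} := prod_sigma_finite lam lam.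
Definition leb3 : {sigma_finite_measure set T3 -> \bar R} := prod_sigma_finite leb2 lam.

Lemma preserving_shift3 (a : R3 R) : preserving (lebesgue3 R) (fun x : T3 => x + a : T3).
Proof.
have := preserving_prod (m1 := leb2) (preserving_prod (preserving_shift a.1.1) (preserving_shift a.1.2)) (preserving_shift a.2).
exact.
Qed.

Lemma preserving_refl3 (a : R3 R) : preserving (lebesgue3 R) (fun x : T3 => a - x : T3).
Proof.
have := preserving_prod (m1 := leb2) (preserving_prod (preserving_refl a.1.1) (preserving_refl a.1.2)) (preserving_refl a.2).
exact.
Qed.

Definition box (a b : R3 R) : set T3 :=
  (`[a.1.1, b.1.1]%classic `*` `[a.1.2, b.1.2]%classic) `*` `[a.2, b.2]%classic.

Definition obox (a b : R3 R) : set T3 :=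
  (`]a.1.1, b.1.1[%classic `*` `]a.1.2, b.1.2[%classic) `*` `]a.2, b.2[%classic.

Lemma measurable_box a b : measurable (box a b).
Proof. by apply: measurableX => //; apply: measurableX. Qed.

Lemma measurable_obox a b : measurable (obox a b).
Proof. by apply: measurableX => //; apply: measurableX. Qed.

Lemma lebesgue3_box a b : a.1.1 <= b.1.1 -> a.1.2 <= b.1.2 -> a.2 <= b.2 ->
  lebesgue3 R (box a b) =
  ((b.1.1 - a.1.1) * (b.1.2 - a.1.2) * (b.2 - a.2))%:E.
Proof.
have L (u v : R) : u <= v -> lam `[u, v]%classic = (v - u)%:E.
  rewrite le_eqVlt lebesgue_measure_itv/= lte_fin => /predU1P[->|->]//.
  by rewrite ltxx subrr.
move=> h1 h2 h3.
set X := `[a.1.1, b.1.1]%classic `*` `[a.1.2, b.1.2]%classic.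
have mX : measurable (X : set T2) by exact: measurableX.
have E2 : (lam \x lam)%E X = ((b.1.1 - a.1.1) * (b.1.2 - a.1.2))%:E.
  have E1 : (lam \x lam)%E X = (lam `[a.1.1, b.1.1]%classic * lam `[a.1.2, b.1.2]%classic)%E.
    exact: (@product_measure1E _ _ _ _ _ lam lam).
  by rewrite E1 !L.
have E3 : (leb2 \x lam)%E (X `*` `[a.2, b.2]%classic) =
    ((lam \x lam)%E X * lam `[a.2, b.2]%classic)%E.
  exact: (@product_measure1E _ _ _ _ _ leb2 lam).
by rewrite -[LHS]/((leb2 \x lam)%E (X `*` `[a.2, b.2]%classic)) E3 E2 L.
Qed.

(** The open cube with rational centre [k.1] and rational half-side [k.2]. These cubes are a
    countable base of the topology; besides measurability they serve to approximate indicators of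
    closed sets, to cover the boundary and to handle essential supports. *)
Definition rbox (k : rat * rat * rat * rat) : set T3 :=
  let r : R := ratr k.2 in let q : R3 R := (ratr k.1.1.1, ratr k.1.1.2, ratr k.1.2) in
  obox (q.1.1 - r, q.1.2 - r, q.2 - r) (q.1.1 + r, q.1.2 + r, q.2 + r).

Lemma rbox_nbhs (x : R3 R) (U : set (R3 R)) : nbhs x U ->
  exists2 k, rbox k x & rbox k `<=` U.
Proof.
move=> /nbhs_ballP[e /= e0 xU].
have e20 : 0 < e / 2 by rewrite divr_gt0.
have [r] := rat_in_itvoo e20; rewrite in_itv/= => /andP[r0 re].
have Q (y : R) : exists q : rat, `|ratr q - y| < ratr r.
  have [|q] := @rat_in_itvoo _ (y - ratr r) (y + ratr r).
    by rewrite ltrBlDr -addrA ltrDl addr_gt0.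
  by rewrite in_itv/= => /andP[? ?]; exists q; rewrite ltr_norml; apply/andP; split; lra.
have [q1 h1] := Q x.1.1; have [q2 h2] := Q x.1.2; have [q3 h3] := Q x.2.
move: h1 h2 h3; rewrite !ltr_norml => /andP[? ?] /andP[? ?] /andP[? ?].
exists (q1, q2, q3, r).
  by rewrite /rbox /obox /=; split; [split|] => /=; rewrite in_itv/=; apply/andP; split; lra.
move=> y; rewrite /rbox /obox /= => -[[/= + +] +]; rewrite !in_itv/=.
move=> /andP[? ?] /andP[? ?] /andP[? ?]; apply: xU.
split; [split|]; rewrite /ball /= ltr_norml; apply/andP; split; lra.
Qed.

Lemma open_rbox (U : set (R3 R)) : open U ->
  U = \bigcup_(k in [set k | rbox k `<=` U]) rbox k.
Proof.
move=> oU; apply/seteqP; split=> x; last by move=> [k /= + xk]; apply.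
by move=> Ux; have [k kx kU] := rbox_nbhs (open_nbhs_nbhs (conj oU Ux)); exists k.
Qed.

Lemma measurable_open3 (U : set T3) : open (U : set (R3 R)) -> measurable U.
Proof.
move=> /open_rbox ->; rewrite bigcup_mkcond.
apply: countable_bigcupT_measurable => [|k]; [exact: countableP|case: ifP] => _ //.
exact: measurable_obox.
Qed.

Lemma measurable_closed3 (U : set T3) : closed (U : set (R3 R)) -> measurable U.
Proof.
by move=> cU; rewrite -(setCK U); apply: measurableC; apply: measurable_open3; exact: closed_openC.
Qed.

Lemma continuous_measurable3 (f : R3 R -> R) : continuous f ->
  measurable_fun setT (f : T3 -> R).
Proof.
move=> cf; apply: (measurability _ (RGenOpens.measurableE R)).
move=> _ [_ [a [b ->] <-]]; rewrite setTI; apply: measurable_open3.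
exact: (open_comp (fun x _ => cf x) (interval_open _ _)).
Qed.

End lebesgue_invariance.

(** * Test functions *)

Section test_functions.
Context (R : realType) (V : normedModType R).
Implicit Types (f g : V -> R) (O : set V).

Lemma test_smooth O f : test_function O f -> smooth f.
Proof. by case. Qed.

Lemma test_subset O O' f : O `<=` O' -> test_function O f -> test_function O' f.
Proof. by move=> OO' [sf cf fO]; split=> //; exact: subset_trans OO'. Qed.

Lemma test_compact (K : set V) f : smooth f -> compact K ->
  (forall x, ~ K x -> f x = 0) -> test_function K f.
Proof.
move=> sf cK f0; have KK : closure [set x | f x != 0] `<=` K.
  rewrite [X in _ `<=` X](iffLR (closure_id K)).
    by apply: closureS => x /= /eqP fx; apply: contrapT => /f0.
  by apply: compact_closed => //; exact: norm_hausdorff.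
by split=> //; apply: subclosed_compact cK KK; exact: closed_closure.
Qed.

Lemma test_support O f : test_function O f -> exists K : set V,
  [/\ compact K, K `<=` O & forall x, ~ K x -> f x = 0].
Proof.
move=> [sf cf fO]; exists (closure [set x | f x != 0]); split=> // x nx.
by apply/eqP; apply: contra_notT nx => fx; exact: subset_closure.
Qed.

Lemma testMl O f g : smooth f -> test_function O g ->
  test_function O (fun x => f x * g x).
Proof.
move=> sf tg; have [K [cK KO g0]] := test_support tg; apply: test_subset KO _.
apply: test_compact => //; first by apply: smoothM => //; exact: test_smooth tg.
by move=> x /g0 ->; rewrite mulr0.
Qed.

Lemma testMr O f g : smooth g -> test_function O f ->
  test_function O (fun x => f x * g x).
Proof. by move=> sg tf; under eq_fun do rewrite mulrC; exact: testMl. Qed.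

Lemma testZ O a f : test_function O f -> test_function O (fun x => a * f x).
Proof. by move=> tf; apply: testMl => //; exact: smooth_cst. Qed.

Lemma testD O f g : test_function O f -> test_function O g ->
  test_function O (fun x => f x + g x).
Proof.
move=> tf tg; have [K [cK KO f0]] := test_support tf.
have [K' [cK' KO' g0]] := test_support tg.
apply: (@test_subset (K `|` K')); first by rewrite subUset.
apply: test_compact; first by apply: smoothD; [exact: test_smooth tf|exact: test_smooth tg].
  exact: compactU.
by move=> x nx; rewrite f0 ?g0 ?addr0// => ?; apply: nx; [right|left].
Qed.

Lemma testB O f g : test_function O f -> test_function O g ->
  test_function O (fun x => f x - g x).
Proof.
move=> tf /(testZ (-1)) tg; under eq_fun do rewrite -mulN1r; exact: testD.
Qed.

Lemma test0 O : test_function O (fun=> 0 : R).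
Proof.
apply: (@test_subset set0) => //; apply: test_compact => //; first exact: smooth_cst.
exact: compact0.
Qed.

Lemma test_sum O (I : Type) (r : seq I) (F : I -> V -> R) :
  (forall i, test_function O (F i)) -> test_function O (fun x => \sum_(i <- r) F i x).
Proof.
move=> tF; elim: r => [|i r IH]; first by under eq_fun do rewrite big_nil; exact: test0.
by under eq_fun do rewrite big_cons; exact: testD.
Qed.

Lemma test_derive O f v : test_function O f -> test_function O ('D_v f).
Proof.
move=> tf; have sf := test_smooth tf; have [K [cK KO f0]] := test_support tf.
apply: test_subset KO _; apply: test_compact => //; first exact: smooth_derive.
move=> x nKx; rewrite (@near_eq_derive _ _ _ _ (cst (0 : R^o))) ?derive_cst//.
have oK : open (~` K).
  by apply: closed_openC; apply: compact_closed => //; exact: norm_hausdorff.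
have : nbhs x (~` K) by exact: open_nbhs_nbhs.
by apply: filterS => y /f0.
Qed.

Lemma test_bounded O f : test_function O f ->
  exists2 M, 0 < M & forall x, `|f x| <= M.
Proof.
move=> tf; have sf := test_smooth tf; have [K [cK KO f0]] := test_support tf.
have cfK : compact (f @` K).
  by apply: continuous_compact => //; apply: continuous_subspaceT; exact: smooth_continuous.
have [M [_ Mb]] := compact_bounded cfK; exists (`|M| + 1); first by rewrite ltr_wpDl.
move=> x; have [Kx|/f0 ->] := pselect (K x); last by rewrite normr0 addr_ge0.
by apply: Mb; [rewrite (le_lt_trans (ler_norm _))// ltrDl|exists x].
Qed.

Lemma test_bounded_support O f : test_function O f ->
  exists2 N, 0 < N & forall x, N < `|x| -> f x = 0.
Proof.
move=> tf; have [K [cK KO f0]] := test_support tf.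
have [M [_ Mb]] := compact_bounded cK; exists (`|M| + 1); first by rewrite ltr_wpDl.
move=> x Mx; apply: f0 => Kx; move: Mx; apply/negP; rewrite -leNgt.
by apply: Mb => //; rewrite (le_lt_trans (ler_norm _))// ltrDl.
Qed.

Lemma deriveZv f a v x : smooth f -> 'D_(a *: v) f x = a * 'D_v f x.
Proof. by move=> /smooth_differentiable sf; rewrite !deriveE// linearZ. Qed.

Lemma test_lipschitz_along O f v : test_function O f ->
  exists2 M, 0 < M & forall x h, `|f (x + h *: v) - f x| <= M * `|h|.
Proof.
move=> tf; have sf := test_smooth tf.
have [M M0 Mb] := test_bounded (test_derive v tf); exists M => // x h.
by apply: derive_smooth_le => // y; rewrite deriveZv// normrM mulrC ler_wpM2r.
Qed.

Lemma test_taylor2 O f v : test_function O f ->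
  exists2 M, 0 < M & forall x h, `|f (x + h *: v) - f x - h * 'D_v f x| <= M * h ^+ 2.
Proof.
move=> tf; have sf := test_smooth tf.
have [M M0 Mb] := test_bounded (test_derive v (test_derive v tf)); exists M => // x h.
rewrite -deriveZv//; apply: smooth_taylor2 => // y.
rewrite (_ : 'D_(h *: v) f = fun x => h * 'D_v f x); last first.
  by apply/funext => z; rewrite deriveZv.
rewrite deriveZv; last exact/smoothZ/smooth_derive.
rewrite derive_smoothZ; last exact: smooth_derive.
rewrite mulrA normrM -expr2 normrX real_normK ?num_real// mulrC ler_wpM2r ?sqr_ge0//.
Qed.

End test_functions.

Lemma normr_shift_le (R : realType) (V : normedModType R) (x w : V) :
  `|x| <= `|x + w| + `|w|.
Proof. by apply: le_trans (ler_normB _ _); rewrite addrK. Qed.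

Lemma scale_shiftK (R : realType) (V : lmodType R) (h : R) (x v : V) :
  (x + h *: v) + (- h) *: v = x.
Proof. by rewrite scaleNr addrK. Qed.

Lemma dot_taylor d (T : measurableType d) (R : realType)
    (m : {measure set T -> \bar R}) (k : R) (f a b c : T -> R) :
  L2 m f -> L2 m a -> L2 m b -> L2 m c ->
  dot m f (fun x => a x - b x - k * c x) = dot m f a - dot m f b - k * dot m f c.
Proof.
move=> f2 a2 b2 c2; rewrite dotBr//; last exact: L2Z; last exact: L2B.
by rewrite dotBr// dotZr.
Qed.

(** In [dot_derive_sym], [A] pairs ['D_u phi] with a translate of [psi] and [B] pairs [phi] with
    ['D_u psi]; the signs are those left by moving the derivative along [u] to the other factor. *)
Lemma mixed_difference_le (R : realDomainType) (A B D1 D2 h m1 m2 : R) :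
  `|A - - B - h * D1| <= m1 -> `|- A - B - - h * D2| <= m2 ->
  `|h * (D1 - D2)| <= m1 + m2.
Proof.
move=> /(lerD) /[apply]; apply: le_trans; apply: le_trans (ler_normD _ _).
by rewrite -normrN le_eqVlt; apply/orP; left; apply/eqP; congr `|_|; ring.
Qed.

Lemma mixed_error_collect (R : comRingType) (K1 K2 M1 M2 n1 n2 h : R) :
  K1 * (M1 * h ^+ 2) * n1 + K2 * (M2 * (- h) ^+ 2) * n2 =
  (K1 * M1 * n1 + K2 * M2 * n2) * h ^+ 2.
Proof. by ring. Qed.

Section test3.
Context (R : realType).
Local Notation mR := (measurableTypeR R).
Local Notation T3 := (mR * mR * mR)%type.
Local Notation mu := (@lebesgue3 R).
Local Notation test := (@test_function R (R3 R) setT).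
Implicit Types f g phi psi : R3 R -> R.

Lemma test_measurable O f : test_function O f -> measurable_fun setT (f : T3 -> R).
Proof.
by move=> tf; apply: continuous_measurable3; apply: smooth_continuous; exact: test_smooth tf.
Qed.

Lemma norm3_box (N : R) (x : R3 R) : `|x| <= N <->
  box (- N, - N, - N) (N, N, N) x.
Proof.
rewrite !prod_normE !ge_max /box/=; split.
  by move=> /andP[/andP[+ +] +]; rewrite !ler_norml => ? ? ?; do ![split => /=]; rewrite in_itv.
by move=> [[/=]]; rewrite !in_itv/= => ? ? ?; rewrite !ler_norml; apply/andP; split=> //; apply/andP; split.
Qed.

Lemma bounded_support_integrable f (M N : R) : 0 <= N ->
  measurable_fun setT (f : T3 -> R) -> (forall x, `|f x| <= M) ->
  (forall x, N < `|x| -> f x = 0) ->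
  mu.-integrable setT (EFin \o f) /\ `|\int[mu]_x f x| <= M * (2 * N) ^+ 3.
Proof.
move=> N0 mf fM f0; set B := box (- N, - N, - N) (N, N, N).
have mB : measurable B by exact: measurable_box.
have muB : mu B = ((2 * N) ^+ 3)%:E.
  rewrite lebesgue3_box/=; [|lra..]; congr EFin; ring.
have fB : f = f \_ B.
  apply/funext => x; rewrite patchE; case: ifPn => // /negP nB; apply: f0.
  by rewrite ltNge; apply/negP => /norm3_box h; apply: nB; rewrite inE.
have iB : mu.-integrable B (EFin \o f).
  apply: measurable_bounded_integrable => //; first by rewrite muB ltry.
    exact: measurable_funS mf.
  exists M; split; first exact: num_real.
  by move=> z Mz x _ /=; apply: le_trans (fM x) _; exact: ltW.
have iT : mu.-integrable setT (EFin \o f).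
  rewrite fB -restrict_EFin; exact/(integrable_mkcond _ _).1.
split=> //; rewrite fB -Rintegral_mkcond; apply: le_trans (le_normr_Rintegral _ _) _ => //.
apply: le_trans (_ : \int[mu]_(x in B) M <= _).
  apply: le_Rintegral => //.
    exact: integrable_norm iB.
  apply: measurable_bounded_integrable => //; first by rewrite muB ltry.
  exists `|M|; split; first exact: num_real.
  by move=> z Mz x _ /=; exact: ltW.
by rewrite Rintegral_cst// muB.
Qed.

Lemma test_mul_integrable f phi : measurable_fun setT (f : T3 -> R) ->
  (exists M, forall x, `|f x| <= M) -> test phi ->
  mu.-integrable setT (EFin \o (fun x => f x * phi x)).
Proof.
move=> mf [M fM] tphi; have [N N0 s0] := test_bounded_support tphi.
have [M' M'0 b0] := test_bounded tphi.
apply: (@bounded_support_integrable _ (M * M') N _ _ _ _).1; first exact: ltW.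
- by apply: measurable_funM => //; exact: test_measurable tphi.
- by move=> x; rewrite normrM ler_pM.
- by move=> x /s0 ->; rewrite mulr0.
Qed.

Lemma test_integrable phi : test phi -> mu.-integrable setT (EFin \o phi).
Proof.
move=> tphi; rewrite (_ : phi = fun x => 1 * phi x); last first.
  by apply/funext => x; rewrite mul1r.
by apply: (test_mul_integrable (f := fun=> 1)) => //; exists 1 => x; rewrite normr1.
Qed.

Lemma test_L2 phi : test phi -> L2 mu phi.
Proof.
move=> tphi; apply: L2P; first exact: test_measurable tphi.
apply: (test_mul_integrable (f := phi)) => //; first exact: test_measurable tphi.
by have [M _ ?] := test_bounded tphi; exists M.
Qed.

Lemma normr_indic_le1 (E : set T3) x : `|\1_E x| <= 1 :> R.
Proof. by rewrite indicE; case: (_ \in _); rewrite ?normr1// normr0. Qed.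

(** The second-order Taylor bound is integrated over a cube that contains all the supports for |h|
    <= 1. With [E] the whole space this gives integration by parts, with [E] the complement of
    [Omega] the boundary term. *)
Lemma difference_quotient_le (E : set T3) v phi : measurable E -> test phi ->
  exists2 M, 0 < M & forall h : R, `|h| <= 1 ->
    `|\int[mu]_x (\1_E x * (phi (x + h *: v) - phi x))
      - h * \int[mu]_x (\1_E x * 'D_v phi x)| <= M * h ^+ 2.
Proof.
move=> mE tphi; have [M M0 Mb] := test_taylor2 v tphi.
have [N N0 s0] := test_bounded_support tphi.
have cphi := smooth_continuous (test_smooth tphi).
have [K K0 b0] := test_bounded tphi.
have [S S0 sS] := test_bounded_support (test_derive v tphi).
set N' := N + `|v| + S; have N'0 : 0 < N' by rewrite ltr_wpDl// addr_ge0// ltW.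
exists (M * (2 * N') ^+ 3); first by rewrite mulr_gt0// exprn_gt0// mulr_gt0.
move=> h h1.
have mshift : measurable_fun setT ((fun x => phi (x + h *: v)) : T3 -> R).
  by apply: (measurableT_comp (test_measurable tphi)); have [] := preserving_shift3 (h *: v).
have mind : measurable_fun setT (\1_E : T3 -> R) by exact: measurable_indic.
have mphi := test_measurable tphi; have mD := test_measurable (test_derive v tphi).
have far x : N' < `|x| -> phi (x + h *: v) = 0.
  move=> xN; apply: s0; have h2 : `|h *: v| <= `|v| by rewrite normrZ ler_piMl.
  by have := normr_shift_le x (h *: v); move: xN; rewrite /N'; lra.
have far' x : N' < `|x| -> phi x = 0.
  by move=> xN; apply: s0; apply: le_lt_trans xN; rewrite /N' -addrA lerDl addr_ge0// ltW.
have i1 : mu.-integrable setT (EFin \o (fun x => \1_E x * (phi (x + h *: v) - phi x))).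
  apply: (@bounded_support_integrable _ (1 * (K + K)) N' _ _ _ _).1; first exact: ltW.
  - by apply: measurable_funM => //; exact: measurable_funB.
  - move=> x; rewrite normrM ler_pM ?normr_indic_le1//.
    by apply: le_trans (ler_normB _ _) _; rewrite lerD.
  - by move=> x xN; rewrite far// far'// subrr mulr0.
have i2 : mu.-integrable setT (EFin \o (fun x => \1_E x * 'D_v phi x)).
  apply: test_mul_integrable => //; last exact: test_derive.
  by exists 1; exact: normr_indic_le1.
rewrite -RintegralZl// -RintegralB//; last exact: (integrableZl measurableT h i2).
apply: le_trans (@bounded_support_integrable _ (M * h ^+ 2) N' _ _ _ _).2 _.
- exact: ltW.
- apply: measurable_funB; first by apply: measurable_funM => //; exact: measurable_funB.
  by apply: measurable_funM => //; exact: measurable_funM.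
- move=> x; rewrite (_ : _ - _ = \1_E x * (phi (x + h *: v) - phi x - h * 'D_v phi x)); last by ring.
  rewrite normrM -[leRHS]mul1r ler_pM ?normr_indic_le1//.
- move=> x xN; rewrite far// far'// sS ?subrr ?mulr0 ?subr0//.
  by apply: le_lt_trans xN; rewrite lerDr addr_ge0// ltW.
- by rewrite mulrAC.
Qed.

Lemma int_shift (f : R3 R -> R) v : measurable_fun setT (f : T3 -> R) ->
  \int[mu]_x f (x + v) = \int[mu]_x f x.
Proof. by move=> mf; exact: integral_preserving (preserving_shift3 v) mf. Qed.

(** A linear function dominated by a quadratic one near 0 has slope 0. This is how identities
    between derivatives are extracted from difference quotients with explicit errors. *)
Lemma small_quadratic (a M : R) : 0 < M ->
  (forall h : R, 0 < h -> h <= 1 -> h * `|a| <= M * h ^+ 2) -> a = 0.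
Proof.
move=> M0 H; apply/eqP; rewrite -normr_le0 leNgt; apply/negP => a0.
set h := Num.min 1 (`|a| / (2 * M)).
have h0 : 0 < h by rewrite lt_min ltr01 divr_gt0// mulr_gt0.
have h1 : h <= 1 by rewrite ge_min lexx.
have ha : h <= `|a| / (2 * M) by rewrite ge_min lexx orbT.
have := H h h0 h1; rewrite expr2 mulrA [M * h]mulrC -mulrA ler_pM2l//.
move: ha; rewrite ler_pdivlMr ?mulr_gt0// => ha ha'; nra.
Qed.

(** By translation invariance the integral of [phi (x + h *: v) - phi x] is 0, and it differs from
    [h] times the integral of the derivative by O(h^2). *)
Lemma int_derive0 v phi : test phi -> \int[mu]_x 'D_v phi x = 0.
Proof.
move=> tphi; have [M M0 Mb] := difference_quotient_le v measurableT tphi.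
have E (g : R3 R -> R) : \int[mu]_x (\1_(setT : set T3) x * g x) = \int[mu]_x g x.
  by apply: eq_Rintegral => x _; rewrite indicT mul1r.
apply: (small_quadratic M0) => h h0 h1.
have h1' : `|h| <= 1 by rewrite ger0_norm// ltW.
have := Mb h h1'; rewrite !E.
rewrite RintegralB//; [|exact: integrable_preserving (preserving_shift3 _) (test_measurable tphi) (test_integrable tphi)|exact: test_integrable].
by rewrite int_shift ?subrr ?sub0r ?normrN ?normrM ?(ger0_norm (ltW h0))//; exact: test_measurable tphi.
Qed.

Lemma dot_derive v phi psi : test phi -> smooth psi ->
  dot mu ('D_v phi) psi = - dot mu phi ('D_v psi).
Proof.
move=> tphi spsi; have sphi := test_smooth tphi.
have := int_derive0 v (testMr spsi tphi).
under eq_Rintegral do rewrite derive_smoothM//.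
have t1 := testMr (smooth_derive v spsi) tphi.
have t2 := testMl spsi (test_derive v tphi).
rewrite RintegralD//; [|exact: test_integrable..].
move=> /eqP; rewrite addrC addr_eq0 => /eqP <-.
by rewrite dotC.
Qed.

Lemma dot_derive_shift v h phi psi : test phi -> test psi ->
  dot mu (fun x => phi (x + h *: v)) psi = dot mu phi (fun x => psi (x + (- h) *: v)).
Proof.
move=> tphi tpsi; rewrite /dot -[RHS](int_shift (h *: v)).
  by apply: eq_Rintegral => x _; rewrite scale_shiftK.
apply: measurable_funM; first exact: test_measurable tphi.
by apply: (measurableT_comp (test_measurable tpsi)); have [] := preserving_shift3 ((- h) *: v).
Qed.

Lemma derive_shift f (v w x : R3 R) : smooth f ->
  'D_v (fun x => f (x + w)) x = 'D_v f (x + w).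
Proof.
move=> sf; apply: (@derive_smooth_comp _ _ _ f (fun x => x + w) id) => // {}x.
rewrite -[X in is_diff _ _ X]addr0.
exact: (@is_diffD _ _ _ id (cst w)).
Qed.

Lemma smooth_shift f w : smooth f -> smooth (fun x => f (x + w)).
Proof.
move=> sf; apply: (@smooth_comp _ _ _ f (fun x => x + w) id) => // x.
rewrite -[X in is_diff _ _ X]addr0.
exact: (@is_diffD _ _ _ id (cst w)).
Qed.

Lemma test_shift phi w : test phi -> test (fun x => phi (x + w)).
Proof.
move=> tphi; have [K [cK _ K0]] := test_support tphi.
apply: (@test_subset _ _ ((fun x => x - w) @` K)) => //.
apply: test_compact.
- exact/smooth_shift/test_smooth/tphi.
- apply: continuous_compact => //; apply: continuous_subspaceT => x.
  by apply: cvgB => //; exact: cvg_cst.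
- by move=> x nx; apply: K0 => Kx; apply: nx; exists (x + w) => //; rewrite addrK.
Qed.

Lemma dot_bounded_le f g (K M N : R) : L2 mu f -> L2 mu g -> 0 <= N ->
  (forall x, `|f x| <= K) -> (forall x, N < `|x| -> f x = 0) ->
  (forall x, `|g x| <= M) -> `|dot mu f g| <= K * M * (2 * N) ^+ 3.
Proof.
move=> /L2_measurable mf /L2_measurable mg N0 fK f0 gM.
apply: (@bounded_support_integrable (fun x => f x * g x) (K * M) N _ _ _ _).2 => //.
- exact: measurable_funM.
- by move=> x; rewrite normrM ler_pM.
- by move=> x /f0 ->; rewrite mul0r.
Qed.

(* Both sides are limits of difference quotients, which avoids the symmetry   *)
(* of second derivatives.                                                     *)
Lemma dot_derive_sym u v phi psi : test phi -> test psi ->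
  dot mu ('D_u phi) ('D_v psi) = dot mu ('D_v phi) ('D_u psi).
Proof.
move=> tphi tpsi.
have spsi := test_smooth tpsi.
have L1 := test_L2 (test_derive u tphi); have L2' := test_L2 (test_derive v tpsi).
have L3 := test_L2 (test_derive v tphi); have L4 := test_L2 (test_derive u tpsi).
have [M1 M10 h1] := test_taylor2 v tpsi; have [M2 M20 h2] := test_taylor2 v tphi.
have [K1 K10 k1] := test_bounded (test_derive u tphi).
have [K2 K20 k2] := test_bounded (test_derive u tpsi).
have [N1 N10 n1] := test_bounded_support (test_derive u tphi).
have [N2 N20 n2] := test_bounded_support (test_derive u tpsi).
pose a := dot mu ('D_u phi) ('D_v psi) - dot mu ('D_v phi) ('D_u psi).
have Lphi := test_L2 tphi; have Lpsi := test_L2 tpsi.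
suff : a = 0 by move=> /eqP; rewrite subr_eq0 => /eqP.
pose M := K1 * M1 * (2 * N1) ^+ 3 + K2 * M2 * (2 * N2) ^+ 3.
have M0 : 0 < M by rewrite addr_gt0// !mulr_gt0// exprn_gt0// mulr_gt0.
apply: (small_quadratic M0) => h h0 _.
have LP := test_L2 (test_shift (h *: v) tpsi).
have LQ := test_L2 (test_shift ((- h) *: v) tphi).
have E1 := dot_bounded_le L1 (L2B (L2B LP Lpsi) (L2Z h L2')) (ltW N10) k1 n1 (fun x => h1 x h).
have E2 := dot_bounded_le L4 (L2B (L2B LQ Lphi) (L2Z (- h) L3)) (ltW N20) k2 n2 (fun x => h2 x (- h)).
rewrite (dot_taylor h L1 LP Lpsi L2') in E1.
rewrite (dot_taylor (- h) L4 LQ Lphi L3) in E2.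
have E3 : dot mu ('D_u psi) (fun x => phi (x + (- h) *: v)) =
    - dot mu ('D_u phi) (fun x => psi (x + h *: v)).
  rewrite (dot_derive u tpsi (test_smooth (test_shift ((- h) *: v) tphi))); congr (- _).
  rewrite (_ : 'D_u (fun x => phi (x + (- h) *: v)) = fun x => 'D_u phi (x + (- h) *: v)).
    by rewrite dotC (dot_derive_shift v (- h) (test_derive u tphi) tpsi) opprK.
  by apply/funext => x; rewrite derive_shift//; exact: test_smooth tphi.
have E4 := dot_derive u tphi spsi.
have E5 : dot mu ('D_u psi) phi = dot mu phi ('D_u psi) by exact: dotC.
have E6 : dot mu ('D_u psi) ('D_v phi) = dot mu ('D_v phi) ('D_u psi) by exact: dotC.
rewrite E3 E5 E6 in E2; rewrite E4 in E1.
have := mixed_difference_le E1 E2; rewrite -/a normrM (ger0_norm (ltW h0)) => E7.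
apply: le_trans E7 _; rewrite le_eqVlt; apply/orP; left; apply/eqP.
exact: mixed_error_collect.
Qed.

End test3.

Lemma Rintegral_dominated d (T : measurableType d) (R : realType)
    (m : {measure set T -> \bar R}) (u : nat -> T -> R) (f g : T -> R) :
  (forall n, measurable_fun setT (u n)) ->
  (forall x, u n x @[n --> \oo] --> f x) -> m.-integrable setT (EFin \o g) ->
  (forall n x, `|u n x| <= g x) ->
  \int[m]_x u n x @[n --> \oo] --> \int[m]_x f x.
Proof.
move=> mu uf gi ug.
have mf : measurable_fun setT f by apply: (measurable_fun_cvg mu) => x _; exact: uf.
have [] := @dominated_convergence _ _ _ m setT measurableT
  (fun n => EFin \o u n) (EFin \o f) (EFin \o g).
- by move=> n; exact/measurable_EFinP.
- exact/measurable_EFinP.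
- by apply: aeW => x _; apply: cvg_EFin; [exact: nearW|exact: uf].
- exact: gi.
- by apply: aeW => x n _; rewrite /= lee_fin.
move=> fi _ cv; apply: fine_cvg; rewrite /Rintegral fineK; first exact: cv.
exact: integrable_fin_num fi.
Qed.

Lemma is_diff_fst (R : realType) (V W : normedModType R) (x : V * W) : is_diff x fst fst.
Proof.
have c : continuous (fst : V * W -> V) by move=> y; exact: cvg_fst.
by apply: DiffDef; [exact: (@linear_differentiable _ _ _ fst)|exact: (@diff_lin _ _ _ fst)].
Qed.

Lemma is_diff_snd (R : realType) (V W : normedModType R) (x : V * W) : is_diff x snd snd.
Proof.
have c : continuous (snd : V * W -> W) by move=> y; exact: cvg_snd.
by apply: DiffDef; [exact: (@linear_differentiable _ _ _ snd)|exact: (@diff_lin _ _ _ snd)].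
Qed.

Lemma indic_setX (R : pzRingType) (T1 T2 : Type) (A : set T1) (B : set T2) x :
  \1_(A `*` B) x = \1_A x.1 * \1_B x.2 :> R.
Proof.
by rewrite !indicE in_setX; case: (_ \in A); case: (_ \in B); rewrite ?mul1r ?mul0r ?mulr1 ?mulr0.
Qed.

(** * Determining classes of sets *)

Section density.
Local Open Scope ereal_scope.
Context d (T : measurableType d) (R : realType) (m : {measure set T -> \bar R}).
Variables (f : T -> \bar R) (mf : measurable_fun setT f) (f0 : forall x, 0 <= f x).

(** The proofs of measurability and positivity are arguments, so that the measure structure can be
    attached to the term itself. *)
Definition density & measurable_fun setT f & (forall x, 0 <= f x) : set T -> \bar R :=
  fun A => \int[m]_(x in A) f x.

Let density0 : density mf f0 set0 = 0. Proof. exact: integral_set0. Qed.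

Let density_ge0 A : 0 <= density mf f0 A. Proof. exact: integral_ge0. Qed.

Let density_sigma_additive : semi_sigma_additive (density mf f0).
Proof. exact: semi_sigma_additive_nng_induced. Qed.

HB.instance Definition _ := isMeasure.Build d T R (density mf f0) density0 density_ge0
  density_sigma_additive.

End density.

Section determining.
Local Open Scope ereal_scope.

Definition determining (R : realType) d (T : measurableType d) (C : set (set T)) :=
  (forall A, C A -> measurable A) /\
  forall m1 m2 : {measure set T -> \bar R}, m1 setT < +oo -> m2 setT < +oo ->
    (forall A, C A -> m1 A = m2 A) -> forall A, measurable A -> m1 A = m2 A.

(** The positive and negative parts of [h] are densities of two finite measures that agree on [C],
    hence on all measurable sets, in particular on the set where [h] is positive. *)
Lemma determining_ae0 (R : realType) d (T : measurableType d) (C : set (set T))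
    (m : {measure set T -> \bar R}) (h : T -> R) :
  determining R C -> m.-integrable setT (EFin \o h) ->
  (forall A, C A -> (\int[m]_(x in A) h x = 0)%R) ->
  {ae m, forall x, h x = 0%R}.
Proof.
move=> [CM Cdet] hi h0; have mh := measurable_int _ hi.
have mp := measurable_funepos mh; have mn := measurable_funeneg mh.
have ip := integrable_funepos measurableT hi.
have iN := integrable_funeneg measurableT hi.
have p0 := funepos_ge0 (EFin \o h); have n0 := funeneg_ge0 (EFin \o h).
have fin (g : T -> \bar R) : (forall x, 0 <= g x) -> m.-integrable setT g ->
    \int[m]_x g x < +oo.
  move=> g0 /integrableP[_]; by under eq_integral do rewrite gee0_abs//.
have E A : measurable A -> \int[m]_(x in A) (EFin \o h)^\+ x = \int[m]_(x in A) (EFin \o h)^\- x.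
  move=> mA; rewrite -[LHS]/(density m mp p0 A) -[RHS]/(density m mn n0 A).
  apply: Cdet => //; [exact: fin|exact: fin|move=> B CB].
  have mB := CM _ CB; have := h0 B CB; rewrite /Rintegral.
  have iB : m.-integrable B (EFin \o h) by apply: integrableS hi.
  move=> hB; have : \int[m]_(x in B) (EFin \o h) x = 0.
    by rewrite -[LHS]fineK; [exact: (congr1 EFin hB)|exact: integrable_fin_num iB].
  rewrite integralE => /eqP; rewrite sube_eq ?add0e; first by move=> /eqP.
    exact: integrable_pos_fin_num iB.
  by rewrite fin_num_adde_defl// integrable_neg_fin_num.
have mA : measurable [set x | (0 < h x)%R].
  rewrite (_ : [set x | _] = h @^-1` `]0%R, +oo[%classic); last first.
    by apply/seteqP; split=> x /=; rewrite in_itv/= andbT.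
  have mhR : measurable_fun setT h by apply/measurable_EFinP.
  by rewrite -[X in measurable X]setTI; apply: mhR => //; exact: measurable_itv.
(* Where [h] is positive its negative part vanishes; equality of the two measures on this set makes
   the whole positive part null. *)
have n0' : \int[m]_(x in [set x | (0 < h x)%R]) (EFin \o h)^\- x = 0.
  apply: integral0_eq => x /= hx; rewrite funenegE; apply/max_idPr.
  by rewrite leeNl oppe0 lee_fin ltW.
have pT : \int[m]_x (EFin \o h)^\+ x = 0.
  rewrite -n0' -E// [RHS]integral_mkcond; apply: eq_integral => x _.
  rewrite patchE; case: ifPn => // /negP nx; rewrite funeposE; apply/max_idPr.
  by rewrite lee_fin leNgt; apply/negP => hx; apply: nx; rewrite inE.
have nT : \int[m]_x (EFin \o h)^\- x = 0 by rewrite -E.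
have /(ae_eq_integral_abs m measurableT) [+ _] := mp.
have /(ae_eq_integral_abs m measurableT) [+ _] := mn.
under eq_integral do rewrite gee0_abs//; move=> /(_ nT) nae.
under eq_integral do rewrite gee0_abs//; move=> /(_ pT) pae.
apply: filterS2 nae pae => x /(_ I) /= nx /(_ I) /= px.
have := congr1 (fun g => g x) (funeposneg (EFin \o h)).
by rewrite /= nx px sube0 => -[].
Qed.

(** Freeze one side of a rectangle: the restricted measures, projected on the other factor, are
    finite measures that agree on its class. Doing this in each factor gives equality on all
    measurable rectangles, a pi-system generating the product. *)
Lemma determining_prod (R : realType) d1 d2 (T1 : measurableType d1)
    (T2 : measurableType d2) (C1 : set (set T1)) (C2 : set (set T2)) :
  C1 setT -> C2 setT -> determining R C1 -> determining R C2 ->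
  determining R [set A `*` B | A in C1 & B in C2].
Proof.
move=> C1T C2T [C1M det1] [C2M det2]; split.
  by move=> _ [A CA [B CB <-]]; apply: measurableX; [exact: C1M|exact: C2M].
move=> m1 m2 m1y m2y m12.
have mfst : @isMeasurableFun _ _ (T1 * T2)%type T1 fst by split; exact: measurable_fst.
have msnd : @isMeasurableFun _ _ (T1 * T2)%type T2 snd by split; exact: measurable_snd.
pose p1 : {mfun (T1 * T2)%type >-> T1} := HB.pack (fst : T1 * T2 -> T1)%type mfst.
pose p2 : {mfun (T1 * T2)%type >-> T2} := HB.pack (snd : T1 * T2 -> T2)%type msnd.
have le (m : {measure set (T1 * T2)%type -> \bar R}) X : m setT < +oo -> measurable X -> m X < +oo.
  by move=> my mX; apply: le_lt_trans my; apply: le_measure; rewrite ?inE.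
have S1 A B : measurable A -> C2 B -> m1 (A `*` B) = m2 (A `*` B).
  move=> mA CB; have mB := C2M _ CB.
  have mTB : measurable (setT `*` B : set (T1 * T2)) by exact: measurableX.
  have E (m : {measure set (T1 * T2)%type -> \bar R}) A' :
      m (A' `*` B) = pushforward (mrestr m mTB) p1 A'.
    by rewrite /pushforward /mrestr; congr (m _); apply/seteqP; split=> -[x y] /= []// ? [].
  rewrite !E; apply: det1 => //.
  - exact: (le m1 _ m1y (measurableI _ _ measurableT mTB)).
  - exact: (le m2 _ m2y (measurableI _ _ measurableT mTB)).
  - move=> A' CA'; have : m1 (A' `*` B) = m2 (A' `*` B).
      by apply: m12; exists A' => //; exists B.
    by rewrite !E.
have S2 A B : measurable A -> measurable B -> m1 (A `*` B) = m2 (A `*` B).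
  move=> mA mB.
  have mAT : measurable (A `*` setT : set (T1 * T2)) by exact: measurableX.
  have E (m : {measure set (T1 * T2)%type -> \bar R}) B' :
      m (A `*` B') = pushforward (mrestr m mAT) p2 B'.
    by rewrite /pushforward /mrestr; congr (m _); apply/seteqP; split=> -[x y] /= [] => [?|? []] ?.
  rewrite !E; apply: det2 => //.
  - exact: (le m1 _ m1y (measurableI _ _ measurableT mAT)).
  - exact: (le m2 _ m2y (measurableI _ _ measurableT mAT)).
  - by move=> B' CB'; have := S1 A B' mA CB'; rewrite !E.
apply: (measure_unique [set A `*` B | A in measurable & B in measurable] (fun=> setT)).
- exact: measurable_prod_measurableType.
- move=> _ _ [A mA [B mB <-]] [A' mA' [B' mB' <-]]; rewrite -setXI.
  by exists (A `&` A'); [exact: measurableI|exists (B `&` B') => //; exact: measurableI].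
- by move=> _; exists setT => //; exists setT => //; rewrite setXTT.
- by rewrite bigcup_const//; exists 0%N.
- by move=> _ [A mA [B mB <-]]; exact: S2.
- by [].
Qed.

(** Indicators of half-lines are limits both of smooth steps and of polynomials on bounded sets. The
    whole line is adjoined so that products of rays contain the whole space. *)
Definition rays (R : realType) : set (set (measurableTypeR R)) :=
  [set A | A = setT \/ exists a, A = `]-oo, a[%classic].

Lemma determining_rays (R : realType) : determining R (@rays R).
Proof.
split; first by move=> A [->//|[a ->]]; exact: measurable_itv.
move=> m1 m2 m1y m2y m12.
apply: (measure_unique (@rays R) (fun=> setT)) => //.
- rewrite RGenInftyO.measurableE; apply/seteqP; split.
    apply: sub_sigma_algebra2 => _ [a ->]; right; by exists a.
  apply: smallest_sub; first exact: smallest_sigma_algebra.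
  move=> _ [->|[a ->]].
    have : sigma_algebra setT <<s @RGenInftyO.G R >> by exact: smallest_sigma_algebra.
    by move=> [s0 sC _]; have := sC _ s0; rewrite setD0.
  by apply: sub_sigma_algebra; exists a.
- move=> A B [->|[a ->]] [->|[b ->]]; rewrite ?setTI ?setIT.
  + by left.
  + by right; exists b.
  + by right; exists a.
  + right; exists (Num.min a b); apply/seteqP; split=> x /=; rewrite !in_itv/=.
      by move=> [? ?]; rewrite lt_min; apply/andP.
    by rewrite lt_min => /andP[].
- by move=> _; left.
- by rewrite bigcup_const//; exists 0%N.
Qed.

End determining.

(** * The fundamental lemma of the calculus of variations *)

Section fundamental_lemma.
Context (R : realType).
Local Notation mR := (measurableTypeR R).
Local Notation T3 := (mR * mR * mR)%type.
Local Notation mu := (@lebesgue3 R).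
Local Notation test := (@test_function R (R3 R) setT).

Definition rays3 : set (set T3) :=
  [set A `*` B | A in [set A `*` B | A in @rays R & B in @rays R] & B in @rays R].

Lemma determining_rays3 : determining R rays3.
Proof.
apply: determining_prod; [|by left| |exact: determining_rays].
  by exists setT; [left|exists setT; [left|rewrite setXTT]].
by apply: determining_prod; [left|left|exact: determining_rays|exact: determining_rays].
Qed.

Definition box_bump (a b : R3 R) (e : R) (x : R3 R) : R :=
  plateau a.1.1 b.1.1 e x.1.1 * plateau a.1.2 b.1.2 e x.1.2 * plateau a.2 b.2 e x.2.

Lemma is_diff_coord1 (x : R3 R) : is_diff x (fun y : R3 R => y.1.1) (fun y => y.1.1).
Proof. exact: (@is_diff_comp _ _ _ _ fst fst fst fst _ (is_diff_fst _) (is_diff_fst _)). Qed.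

Lemma is_diff_coord2 (x : R3 R) : is_diff x (fun y : R3 R => y.1.2) (fun y => y.1.2).
Proof. exact: (@is_diff_comp _ _ _ _ fst fst snd snd _ (is_diff_fst _) (is_diff_snd _)). Qed.

Lemma is_diff_coord3 (x : R3 R) : is_diff x (fun y : R3 R => y.2) (fun y => y.2).
Proof. exact: is_diff_snd. Qed.

Lemma smooth_coord (a b c : R -> R) : smooth a -> smooth b -> smooth c ->
  smooth (fun x : R3 R => a x.1.1 * b x.1.2 * c x.2).
Proof.
move=> sa sb sc; apply: smoothM; last exact: (smooth_comp sc is_diff_coord3).
apply: smoothM; first exact: (smooth_comp sa is_diff_coord1).
exact: (smooth_comp sb is_diff_coord2).
Qed.

Lemma test_box_bump (a b : R3 R) e : 0 < e -> test (box_bump a b e).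
Proof.
move=> e0; pose K : set (R3 R) := (`[a.1.1, b.1.1]%classic `*` `[a.1.2, b.1.2]%classic) `*` `[a.2, b.2]%classic.
apply: (@test_subset _ _ K) => //; apply: test_compact.
- by apply: smooth_coord; exact: smooth_plateau.
- by apply: compact_setX; [apply: compact_setX|]; exact: segment_compact.
- move=> x nK; rewrite /box_bump.
  have out (u v t : R) : ~ (t \in `[u, v]) -> plateau u v e t = 0.
    move=> /negP h; apply: plateau_out => //; apply: contra h => /andP[? ?].
    by rewrite in_itv/= !ltW.
  have [k1|/out ->] := pselect (x.1.1 \in `[a.1.1, b.1.1]); last by rewrite !mul0r.
  have [k2|/out ->] := pselect (x.1.2 \in `[a.1.2, b.1.2]); last by rewrite mulr0 mul0r.
  have [k3|/out ->] := pselect (x.2 \in `[a.2, b.2]); last by rewrite mulr0.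
  by exfalso; apply: nK.
Qed.

Lemma box_bump_ge0 a b e x : 0 <= box_bump a b e x.
Proof. by apply: mulr_ge0; [apply: mulr_ge0|]; exact: plateau_ge0. Qed.

Lemma box_bump_le1 a b e x : box_bump a b e x <= 1.
Proof.
rewrite -[leRHS]mulr1 ler_pM ?plateau_ge0 ?plateau_le1//; first by rewrite mulr_ge0// plateau_ge0.
by rewrite -[leRHS]mulr1 ler_pM ?plateau_ge0 ?plateau_le1.
Qed.

Definition cutoff (N : R) : R3 R -> R :=
  box_bump (- (N + 1), - (N + 1), - (N + 1)) (N + 1, N + 1, N + 1) 1.

Lemma cutoff_in N (x : R3 R) : `|x| <= N -> cutoff N x = 1.
Proof.
move=> /norm3_box [[/=]]; rewrite !in_itv/= => /andP[? ?] /andP[? ?] /andP[? ?].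
by rewrite /cutoff /box_bump !plateau_in ?mulr1//=; apply/andP; split; lra.
Qed.

Lemma test_cutoff N : test (cutoff N). Proof. exact: test_box_bump. Qed.

Lemma rays_approx (A : set mR) : rays A -> exists b : nat -> R -> R,
  [/\ forall n, smooth (b n), forall n t, 0 <= b n t <= 1 &
      forall t, b n t @[n --> \oo] --> (\1_A t : R)].
Proof.
move=> [->|[a ->]].
  exists (fun _ _ => 1); split=> [n|n t|t]; first exact: smooth_cst.
    by rewrite ler01 lexx.
  by rewrite indicT; exact: cvg_cst.
exists (fun n t => step (- n%:R * (t - a))); split=> [n|n t|t].
- exact: (smooth_comp (@smooth_step R) (is_diff_affine a (- n%:R))).
- by rewrite step_ge0 step_le1.
- rewrite indicE; have [ta|ta] := ltP t a.
    rewrite mem_set/=; last by rewrite in_itv.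
    apply: cvg_near_cst; near=> n.
    rewrite step_ge1// mulNr -mulrN opprB -ler_pdivrMr ?subr_gt0// mul1r.
    by near: n; exact: nbhs_infty_ger.
  rewrite memNset/=; last by rewrite in_itv/= ltNge ta.
  apply: cvg_near_cst; apply: nearW => n.
  by rewrite step_le0// mulNr oppr_le0 mulr_ge0// subr_ge0.
Unshelve. all: by end_near.
Qed.

(** Multiplied by a cutoff, [f] becomes integrable, and its integral over a product of rays is the
    limit of its pairings with test functions that approximate the indicator. Products of rays are
    determining. *)
Lemma test_orthogonal_ae0 (f : R3 R -> R) : L2 mu f ->
  (forall phi, test phi -> dot mu f phi = 0) -> {ae mu, forall x, f x = 0}.
Proof.
move=> f2 fphi.
have H (n : nat) : {ae mu, forall x, f x * cutoff n%:R x = 0}.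
  have tc := test_cutoff n%:R.
  have ih := dot_integrable f2 (test_L2 tc).
  apply: (determining_ae0 determining_rays3 ih).
  move=> _ [_ [A rA [B rB <-]] [C rC <-]].
  have [a [sa a01 ca]] := rays_approx rA.
  have [b [sb b01 cb]] := rays_approx rB.
  have [c [sc c01 cc]] := rays_approx rC.
  pose k n0 (x : R3 R) := a n0 x.1.1 * b n0 x.1.2 * c n0 x.2.
  have sk n0 : smooth (k n0) by exact: smooth_coord.
  have k1 n0 x : `|k n0 x| <= 1.
    have /andP[? ?] := a01 n0 x.1.1; have /andP[? ?] := b01 n0 x.1.2.
    have /andP[? ?] := c01 n0 x.2.
    rewrite ger0_norm ?mulr_ge0// -[leRHS]mulr1 ler_pM ?mulr_ge0//.
    by rewrite -[leRHS]mulr1 ler_pM.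
  have cv : \int[mu]_x (f x * cutoff n%:R x * k n0 x) @[n0 --> \oo] -->
      \int[mu]_x (f x * cutoff n%:R x * \1_((A `*` B) `*` C) x).
    apply: (@Rintegral_dominated _ _ _ mu _ _ (fun x => `|f x * cutoff n%:R x|)).
    - move=> n0; apply: measurable_funM.
        by apply: measurable_funM; [exact: L2_measurable f2|exact: test_measurable tc].
      by apply: continuous_measurable3; apply: smooth_continuous; exact: sk.
    - move=> x; apply: cvgM; first exact: cvg_cst.
      rewrite (_ : \1_((A `*` B) `*` C) x = \1_A x.1.1 * \1_B x.1.2 * \1_C x.2 :> R).
        by apply: cvgM; [apply: cvgM|]; [exact: ca|exact: cb|exact: cc].
      by rewrite !indic_setX.
    - exact: integrable_norm ih.
    - by move=> n0 x; rewrite normrM ler_piMr.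
  rewrite Rintegral_mkcond.
  rewrite (_ : (fun x => _) \_ _ = fun x => f x * cutoff n%:R x * \1_((A `*` B) `*` C) x).
    apply/esym; apply: (cvg_unique _ _ cv); first exact: Rhausdorff.
    rewrite (_ : (fun n0 => _) = cst 0); first exact: cvg_cst.
    apply/funext => n0; rewrite -(fphi _ (testMr (sk n0) tc)).
    by apply: eq_Rintegral => x _; rewrite mulrA.
  by apply/funext => x; rewrite patchE indicE; case: ifP; rewrite ?mulr1 ?mulr0.
have /ae_foralln := H; apply: filterS => x Hx.
have [n xn] : exists n : nat, `|x| <= n%:R.
  by exists (Num.truncn `|x|).+1; rewrite ltW// truncnS_gt.
by have := Hx n; rewrite cutoff_in// mulr1.
Qed.

End fundamental_lemma.

(** * Weak derivatives in time *)

Section weak_derivative.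
Context (R : realType).
Local Notation lam := (@lebesgue_measure R).

Lemma derive_step_bound : exists2 M : R, 0 < M & forall t, `|'D_1 (@step R) t| <= M.
Proof.
have sD : smooth ('D_1 (@step R)) by exact/smooth_derive/smooth_step.
have cK : compact (('D_1 (@step R)) @` `[0, 1]%classic).
  apply: continuous_compact; last exact: segment_compact.
  by apply: continuous_subspaceT; exact: smooth_continuous.
have [M [_ Mb]] := compact_bounded cK; exists (`|M| + 1); first by rewrite ltr_wpDl.
move=> t; have [t0|t0] := ltP t 0.
  rewrite (@near_eq_derive _ _ _ _ (cst (0 : R^o))) ?derive_cst ?normr0 ?addr_ge0//.
  by near=> s; rewrite step_le0// ltW//; near: s; exact: lt_nbhsl.
have [t1|t1] := ltP 1 t.
  rewrite (@near_eq_derive _ _ _ _ (cst (1 : R^o))) ?derive_cst ?normr0 ?addr_ge0//.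
  by near=> s; rewrite step_ge1// ltW//; near: s; exact: lt_nbhsr.
apply: Mb; first by rewrite (le_lt_trans (ler_norm _))// ltrDl.
by exists t => //=; rewrite in_itv/= t0 t1.
Unshelve. all: by end_near.
Qed.

Lemma derive_plateau_bound : exists2 M : R, 0 < M & forall a b e t : R, 0 < e ->
  `|'D_1 (plateau a b e) t| <= M / e.
Proof.
have [M M0 Mb] := derive_step_bound; exists (2 * M); first by rewrite mulr_gt0.
move=> a b e t e0.
have E1 : (fun t => step ((t - a) / e)) = fun t => step (e^-1 * (t - a)).
  by apply/funext => s; rewrite mulrC.
have E2 : (fun t => step ((b - t) / e)) = fun t => step (- e^-1 * (t - b)).
  by apply/funext => s; congr step; ring.
have s1 : smooth (fun t => step ((t - a) / e)).
  by rewrite E1; exact: (smooth_comp (@smooth_step R) (is_diff_affine a e^-1)).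
have s2 : smooth (fun t => step ((b - t) / e)).
  by rewrite E2; exact: (smooth_comp (@smooth_step R) (is_diff_affine b (- e^-1))).
have D1 : `|'D_1 (fun t => step ((t - a) / e)) t| <= M / e.
  rewrite E1 (derive_smooth_comp t 1 (@smooth_step R) (is_diff_affine a e^-1)) subr0 mulr1.
  rewrite derive_smooth1; last exact: smooth_step.
  by rewrite normrM normfV (ger0_norm (ltW e0)) mulrC ler_wpM2r// invr_ge0 ltW.
have D2 : `|'D_1 (fun t => step ((b - t) / e)) t| <= M / e.
  rewrite E2 (derive_smooth_comp t 1 (@smooth_step R) (is_diff_affine b (- e^-1))) subr0 mulr1.
  rewrite derive_smooth1; last exact: smooth_step.
  by rewrite normrM normrN normfV (ger0_norm (ltW e0)) mulrC ler_wpM2r// invr_ge0 ltW.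
rewrite (_ : plateau a b e = fun t => step ((t - a) / e) * step ((b - t) / e))//.
rewrite derive_smoothM//; apply: le_trans (ler_normD _ _) _.
have H (u w : R) : 0 <= u <= 1 -> `|w| <= M / e -> `|u * w| <= M / e.
  by move=> /andP[u0 u1] wM; rewrite normrM -[leRHS]mul1r ler_pM// ger0_norm.
have -> : 2 * M / e = M / e + M / e by ring.
by apply: lerD; apply: H => //; rewrite step_ge0 step_le1.
Qed.

Lemma test_plateau (a b e : R) : 0 < e -> test_function `[a, b]%classic (plateau a b e).
Proof.
move=> e0; apply: test_compact; [exact: smooth_plateau|exact: segment_compact|].
move=> t nt; apply: plateau_out => //; apply/negP => /andP[? ?]; apply: nt.
by rewrite /= in_itv/= !ltW.
Qed.

Lemma derive_plateau_out (a b e t : R) : 0 < e ->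
  ~ (a <= t <= a + e) -> ~ (b - e <= t <= b) -> 'D_1 (plateau a b e) t = 0.
Proof.
move=> e0 /negP + /negP; rewrite !negb_and -!ltNge => t1 t2.
have c0 : (\near t, plateau a b e t = cst 0 t) -> 'D_1 (plateau a b e) t = 0.
  by move=> h; rewrite (@near_eq_derive _ _ _ _ (cst (0 : R^o))) ?derive_cst.
have c1 : (\near t, plateau a b e t = cst 1 t) -> 'D_1 (plateau a b e) t = 0.
  by move=> h; rewrite (@near_eq_derive _ _ _ _ (cst (1 : R^o))) ?derive_cst.
have [ta|at_] := ltP t a.
  apply: c0; near=> s; apply: plateau_out => //.
  by rewrite negb_and -!leNgt ltW//; near: s; exact: lt_nbhsl.
have [bt|tb] := ltP b t.
  apply: c0; near=> s; apply: plateau_out => //.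
  by rewrite negb_and -!leNgt [b <= s]ltW ?orbT//; near: s; exact: lt_nbhsr.
move: t1 t2; rewrite !ltNge at_ tb/= orbF -!ltNge => t1 t2.
apply: c1; near=> s; apply: plateau_in => //; apply/andP; split; apply: ltW.
  by near: s; exact: lt_nbhsr.
by near: s; exact: lt_nbhsl.
Unshelve. all: by end_near.
Qed.

Lemma continuous_itv_integrable (f : R -> R) (a b : R) : continuous f ->
  lam.-integrable `[a, b] (EFin \o f).
Proof.
move=> cf; apply: continuous_compact_integrable; first exact: segment_compact.
exact: continuous_subspaceT.
Qed.

Lemma int_derive_itv (f : R -> R) (a b : R) : a < b -> smooth f ->
  \int[lam]_(t in `[a, b]) 'D_1 f t = f b - f a.
Proof.
move=> ab sf.
have cD : {within `[a, b], continuous ('D_1 f)}.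
  by apply: continuous_subspaceT; exact/smooth_continuous/smooth_derive.
have cf := smooth_continuous sf.
have df : derivable_oo_LRcontinuous f a b.
  split=> [x _||]; first exact: smooth_derivable.
    exact/cvg_at_right_filter/cf.
  exact/cvg_at_left_filter/cf.
have := continuous_FTC2 ab cD df; rewrite /Rintegral => -> //.
by move=> x _; rewrite derive1E.
Qed.

(** The hypothesis [weak] says a' = - b in the weak sense. Remove from [a] its affine interpolant on
    [t1, t2]: the remainder [w] vanishes at both ends, so its pairing with the derivative of a
    plateau, which lives near the ends, is small. *)
Lemma weak_derivative_increment (a b : R -> R) (t1 t2 eps : R) :
  continuous a -> continuous b -> 0 < t1 -> t1 < t2 ->
  (forall theta, test_function `[t1, t2]%classic theta ->
    \int[lam]_(t in `]0, +oo[) (b t * theta t - a t * 'D_1 theta t) = 0) ->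
  (forall s, t1 <= s <= t2 -> `|b s - b t1| <= eps) ->
  `|a t2 - a t1 + (t2 - t1) * b t1| <= (t2 - t1) * eps.
Proof.
move=> ca cb t10 t12 weak beps.
pose s := (a t2 - a t1) / (t2 - t1).
have t120 : 0 < t2 - t1 by rewrite subr_gt0.
suff H : `|s + b t1| <= eps.
  have -> : a t2 - a t1 + (t2 - t1) * b t1 = (t2 - t1) * (s + b t1).
    by rewrite /s; field; rewrite gt_eqF.
  by rewrite normrM gtr0_norm// ler_wpM2l// ltW.
have [M M0 Mb] := derive_plateau_bound.
apply/ler_addgt0Pr => k k0.
(* The derivative of the plateau is at most M / e on a set of measure 2 e, so this bound on [w] near
   the ends gives k (t2 - t1) / 2 for the integral. *)
pose k' := k * (t2 - t1) / (4 * M).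
have k'0 : 0 < k' by rewrite divr_gt0// mulr_gt0.
pose w t := a t - (a t1 + s * (t - t1)).
have cw : continuous w.
  move=> t; apply: cvgB; first exact: ca.
  apply: cvgD; first exact: cvg_cst.
  by apply: cvgMr; apply: cvgB; [exact: cvg_id|exact: cvg_cst].
have w1 : w t1 = 0 by rewrite /w subrr mulr0 addr0 subrr.
have w2 : w t2 = 0 by rewrite /w /s; field; rewrite gt_eqF.
have [d d0 wd] : exists2 d, 0 < d & forall t, `|t - t1| <= d \/ `|t - t2| <= d -> `|w t| <= k'.
  have /cvgrPdist_le /(_ _ k'0) /nbhs_ballP[d1 /= d10 H1] := cw t1.
  have /cvgrPdist_le /(_ _ k'0) /nbhs_ballP[d2 /= d20 H2] := cw t2.
  exists (Num.min d1 d2 / 2); first by rewrite divr_gt0// lt_min d10.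
  have md : Num.min d1 d2 / 2 < Num.min d1 d2.
    by rewrite ltr_pdivrMr// ltr_pMr ?ltr1n// lt_min d10.
  move=> t [] td.
    have := H1 t; rewrite w1 sub0r normrN; apply; rewrite /ball/= distrC.
    by apply: le_lt_trans td (lt_le_trans md _); rewrite ge_min lexx.
  have := H2 t; rewrite w2 sub0r normrN; apply; rewrite /ball/= distrC.
  by apply: le_lt_trans td (lt_le_trans md _); rewrite ge_min lexx orbT.
(* The fraction 1/4 leaves the plateau equal to 1 on at least half of the interval. *)
pose e := Num.min d ((t2 - t1) / 4).
have e0 : 0 < e by rewrite lt_min d0 divr_gt0.
have ed : e <= d by rewrite ge_min lexx.
have e4 : e <= (t2 - t1) / 4 by rewrite ge_min lexx orbT.
pose th := plateau t1 t2 e.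
have sth : smooth th by exact: smooth_plateau.
have cth := smooth_continuous sth.
have cD : continuous ('D_1 th) by exact/smooth_continuous/smooth_derive.
pose D := `[t1, t2]%classic : set (measurableTypeR R).
have mD : measurable D by exact: measurable_itv.
have intc f : continuous f -> lam.-integrable D (EFin \o f) by exact: continuous_itv_integrable.
have cM (f g : R -> R) : continuous f -> continuous g -> continuous (fun t => f t * g t).
  by move=> cf cg t; apply: cvgM; [exact: cf|exact: cg].
have intB (f g : R -> R) : continuous f -> continuous g ->
    \int[lam]_(t in D) (f t - g t) = \int[lam]_(t in D) f t - \int[lam]_(t in D) g t.
  by move=> cf cg; rewrite RintegralB//; exact: intc.
have intD (f g : R -> R) : continuous f -> continuous g ->
    \int[lam]_(t in D) (f t + g t) = \int[lam]_(t in D) f t + \int[lam]_(t in D) g t.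
  by move=> cf cg; rewrite RintegralD//; exact: intc.
have cB (f g : R -> R) : continuous f -> continuous g -> continuous (fun t => f t - g t).
  by move=> cf cg t; apply: cvgB; [exact: cf|exact: cg].
have cA (f g : R -> R) : continuous f -> continuous g -> continuous (fun t => f t + g t).
  by move=> cf cg t; apply: cvgD; [exact: cf|exact: cg].
have cC (c : R) : continuous (fun _ : R => c) by move=> t; exact: cvg_cst.
have caff : continuous (fun t => a t1 + s * (t - t1)).
  by apply: cA => //; apply: cM => //; apply: cB => // t; exact: cvg_id.
have saff : smooth (fun t => a t1 + s * (t - t1)).
  apply: smoothD; first exact: smooth_cst.
  by apply: smoothZ; apply: smoothB; [exact: smooth_id|exact: smooth_cst].
have Daff t : 'D_1 (fun t => a t1 + s * (t - t1)) t = s.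
  have s1 : smooth (fun t : R => t - t1) by apply: smoothB; [exact: smooth_id|exact: smooth_cst].
  rewrite derive_smoothD; [|exact: smooth_cst|exact: smoothZ].
  rewrite derive_cst add0r derive_smoothZ// derive_smoothB; [|exact: smooth_id|exact: smooth_cst].
  by rewrite derive_cst derive_id subr0 mulr1.
have weak' : \int[lam]_(t in D) (b t * th t - a t * 'D_1 th t) = 0.
  rewrite -[RHS](weak th (test_plateau t1 t2 e0)) Rintegral_mkcond [RHS]Rintegral_mkcond.
  apply: eq_Rintegral => t _; rewrite !patchE.
  case: ifPn => [|/negP]; rewrite inE /D /= in_itv/= => tD.
    by rewrite mem_set//= in_itv/= andbT; case/andP: tD => + _; exact: lt_le_trans.
  case: ifPn => // _; rewrite /th plateau_out//.
    rewrite derive_plateau_out// ?mulr0 ?subr0// => /andP[? ?]; apply: tD; apply/andP; split; lra.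
  by apply/negP => /andP[? ?]; apply: tD; apply/andP; split; exact: ltW.
have thE1 : th t1 = 0 by rewrite /th plateau_out// ltxx.
have thE2 : th t2 = 0 by rewrite /th plateau_out// ltxx andbF.
have parts : \int[lam]_(t in D) (th t * s + (a t1 + s * (t - t1)) * 'D_1 th t) = 0.
  have := int_derive_itv t12 (smoothM sth saff); rewrite thE1 thE2 !mul0r subrr => <-.
  apply: eq_Rintegral => t _; rewrite -[X in _ * X + _](Daff t).
  by apply/esym; exact: derive_smoothM.
have csb : continuous (fun t => (s + b t) * th t) by apply: cM => //; exact: cA.
have cwth : continuous (fun t => w t * 'D_1 th t) by exact: cM.
have Eth : \int[lam]_(t in D) ((s + b t) * th t) = \int[lam]_(t in D) (w t * 'D_1 th t).
  apply/eqP; rewrite -subr_eq0 -intB//; apply/eqP.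
  transitivity (\int[lam]_(t in D) ((b t * th t - a t * 'D_1 th t) +
      (th t * s + (a t1 + s * (t - t1)) * 'D_1 th t))).
    by apply: eq_Rintegral => t _; rewrite /w; ring.
  rewrite intD ?weak' ?parts ?addr0//; first by apply: cB; exact: cM.
  by apply: cA; exact: cM.
have Dfin : (lam D < +oo)%E by rewrite /D lebesgue_measure_itv/= lte_fin t12 -EFinB ltry.
have ind (u v : R) : t1 <= u -> v <= t2 -> u <= v ->
    lam.-integrable D (EFin \o (\1_(`[u, v]%classic : set (measurableTypeR R)) : R -> R)) /\
    \int[lam]_(t in D) \1_(`[u, v]%classic) t = v - u.
  move=> tu vt uv; split.
    apply: measurable_bounded_integrable => //.
    exists 1; split=> // z z1 x _ /=; apply: le_trans (ltW z1).
    by rewrite indicE; case: (_ \in _); rewrite ?normr1// normr0.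
  rewrite /Rintegral integral_indic//= (_ : _ `&` _ = `[u, v]%classic).
    rewrite lebesgue_measure_itv/= lte_fin; move: uv; rewrite le_eqVlt => /predU1P[->|->]//=.
    by rewrite ltxx subrr.
  apply/seteqP; split=> x /=; first by case.
  by rewrite /D/= !in_itv/= => /andP[? ?]; split=> //; apply/andP; split; lra.
have [i1 I1] := ind t1 (t1 + e) (lexx _) ltac:(lra) ltac:(lra).
have [i2 I2] := ind (t2 - e) t2 ltac:(lra) (lexx _) ltac:(lra).
have [i3 I3] := ind (t1 + e) (t2 - e) ltac:(lra) ltac:(lra) ltac:(lra).
have bw : `|\int[lam]_(t in D) (w t * 'D_1 th t)| <= k * (t2 - t1) / 2.
  apply: le_trans (le_normr_Rintegral mD (intc _ cwth)) _.
  have i12 : lam.-integrable D (EFin \o (fun t => k' * (M / e) * (\1_(`[t1, t1 + e]%classic) t + \1_(`[t2 - e, t2]%classic) t))).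
    exact: (integrableZl mD (k' * (M / e)) (integrableD mD i1 i2)).
  apply: le_trans (le_Rintegral mD (integrable_norm (intc _ cwth)) i12 _) _.
    move=> t _ /=; rewrite normrM.
    have [t1e|nt1e] := pselect (t1 <= t <= t1 + e).
      have t1I : t \in `[t1, t1 + e]%classic by rewrite inE/= in_itv.
      have wk : `|w t| <= k'.
        by apply: wd; left; rewrite ger0_norm; case/andP: t1e => ? ?; lra.
      rewrite -[leLHS]mulr1 ler_pM ?ler_pM//.
        exact: Mb.
      by rewrite !indicE t1I lerDl; case: (_ \in _).
    have [t2e|nt2e] := pselect (t2 - e <= t <= t2).
      have t2I : t \in `[t2 - e, t2]%classic by rewrite inE/= in_itv.
      have wk : `|w t| <= k'.
        by apply: wd; right; rewrite ler0_norm; case/andP: t2e => ? ?; lra.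
      rewrite -[leLHS]mulr1 ler_pM ?ler_pM//.
        exact: Mb.
      by rewrite !indicE t2I lerDr; case: (_ \in _).
    rewrite derive_plateau_out// normr0 mulr0 mulr_ge0//.
    by apply: mulr_ge0; [exact: ltW|apply: divr_ge0; exact: ltW].
  rewrite RintegralZl//; last exact: (integrableD mD i1 i2).
  rewrite RintegralD// I1 I2 /k' le_eqVlt; apply/orP; left; apply/eqP.
  by field; rewrite !gt_eqF.
have bth : (t2 - t1) / 2 <= \int[lam]_(t in D) th t.
  apply: le_trans (_ : \int[lam]_(t in D) \1_(`[t1 + e, t2 - e]%classic) t <= _).
    by rewrite I3; lra.
  apply: le_Rintegral => //; first exact: intc.
  move=> t _; rewrite indicE; case: (boolP (_ \in _)) => [|_]; last exact: plateau_ge0.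
  by rewrite inE/= in_itv/= => ?; rewrite /th plateau_in.
have cbb : continuous (fun t => (b t - b t1) * th t) by apply: cM => //; exact: cB.
have bb : `|\int[lam]_(t in D) ((b t - b t1) * th t)| <= eps * \int[lam]_(t in D) th t.
  apply: le_trans (le_normr_Rintegral mD (intc _ cbb)) _.
  rewrite -RintegralZl//; last exact: intc.
  apply: le_Rintegral => //.
  - exact: integrable_norm (intc _ cbb).
  - by apply: intc; exact: cM.
  - move=> t; rewrite /D/= in_itv/= => tD.
    by rewrite normrM (ger0_norm (plateau_ge0 _ _ _ _)) ler_wpM2r ?plateau_ge0// beps.
have split_ : \int[lam]_(t in D) ((s + b t) * th t) =
    (s + b t1) * \int[lam]_(t in D) th t + \int[lam]_(t in D) ((b t - b t1) * th t).
  rewrite -RintegralZl//; last exact: intc.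
  by rewrite -intD//; [apply: eq_Rintegral => t _; ring|exact: cM].
have th0 : 0 < \int[lam]_(t in D) th t by apply: lt_le_trans bth; rewrite divr_gt0.
rewrite -(ler_pM2r th0).
have -> : `|s + b t1| * \int[lam]_(t in D) th t =
    `|\int[lam]_(t in D) (w t * 'D_1 th t) - \int[lam]_(t in D) ((b t - b t1) * th t)|.
  by rewrite -Eth split_ addrK normrM (gtr0_norm th0).
apply: le_trans (ler_normB _ _) _; rewrite addrC mulrDl lerD//.
apply: le_trans bw _; rewrite -mulrA ler_wpM2l// ltW//.
Qed.

End weak_derivative.

Lemma near_dist_lt (R : realType) (t del : R) : 0 < del ->
  \forall s \near t, `|s - t| < del.
Proof.
by move=> del0; apply: filterS (nbhsx_ballx t del del0) => s; rewrite /ball/= distrC.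
Qed.

(** * Continuous paths in L2 and strong gradients *)

Section L2_paths.
Context d (T : measurableType d) (R : realType) (m : {measure set T -> \bar R}).
Implicit Types w : R -> T -> R.

Definition pathL2 w : Prop := (forall t, L2 m (w t)) /\
  forall t e, 0 < e -> exists2 del, 0 < del &
    forall s, `|s - t| < del -> nrm m (fun x => w s x - w t x) <= e.

Lemma pathL2_dot w f : pathL2 w -> L2 m f -> continuous (fun t => dot m (w t) f).
Proof.
move=> [w2 cw] f2 t; apply/cvgrPdist_le => e e0.
have n0 : 0 < nrm m f + 1 by rewrite ltr_wpDl// nrm_ge0.
have [del del0 H] := cw t _ (divr_gt0 e0 n0).
apply: filterS (near_dist_lt t del0) => s st.
rewrite distrC -dotBl//; apply: le_trans (cauchy_schwarz (L2B _ _) f2) _ => //.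
apply: le_trans (_ : e / (nrm m f + 1) * nrm m f <= _).
  by rewrite ler_wpM2r ?nrm_ge0// H.
by rewrite mulrAC ler_pdivrMr// ler_wpM2l ?(ltW e0)// lerDl.
Qed.

(** The near-covering form of compactness is applied with radii tending to 0; continuity at the
    centre of a neighbourhood is used with e / 2, once for each endpoint. *)
Lemma pathL2_uniform w (a b e : R) : pathL2 w -> 0 < e -> exists2 del, 0 < del &
  forall s t, a <= t <= b -> `|s - t| < del -> nrm m (fun x => w s x - w t x) <= e.
Proof.
move=> [w2 cw] e0.
have e20 : 0 < e / 2 by rewrite divr_gt0.
have := @segment_compact _ a b; rewrite compact_near_coveringP.
move=> /(_ R (0^'+) (fun del t => forall s, `|s - t| < del -> nrm m (fun x => w s x - w t x) <= e) _).
case.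
  move=> t _; have [del del0 H] := cw t _ e20.
  exists ([set t' | `|t' - t| < del / 2], [set x | x < del / 2]) => /=.
    split; first by apply: near_dist_lt; rewrite divr_gt0.
    by apply: nbhs_right_lt; rewrite divr_gt0.
  move=> [t' d'] [/= tt' dd] s st.
  apply: le_trans (nrm_triangle (w2 s) (w2 t) (w2 t')) _.
  rewrite [leRHS]splitr lerD//.
    apply: H; rewrite (_ : s - t = (s - t') + (t' - t)); last by ring.
    by apply: le_lt_trans (ler_normD _ _) _; rewrite [ltRHS]splitr ltrD// (lt_trans st).
  by rewrite nrmBC; apply: H; apply: lt_trans tt' _; rewrite ltr_pdivrMr// ltr_pMr ?ltr1n.
move=> d0 /= d00 H; exists (d0 / 2); first by rewrite divr_gt0.
move=> s t abt st; apply: (H (d0 / 2)) => //=.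
- by rewrite /ball/= sub0r normrN gtr0_norm ?divr_gt0// ltr_pdivrMr// ltr_pMr ?ltr1n.
- by rewrite divr_gt0.
Qed.

Lemma pathL2D w w' : pathL2 w -> pathL2 w' -> pathL2 (fun t x => w t x + w' t x).
Proof.
move=> [w2 cw] [w2' cw']; split=> [t|t e e0]; first exact: L2D.
have e20 : 0 < e / 2 by rewrite divr_gt0.
have [d1 d10 H1] := cw t _ e20; have [d2 d20 H2] := cw' t _ e20.
exists (Num.min d1 d2); first by rewrite lt_min d10.
move=> s; rewrite lt_min => /andP[s1 s2].
rewrite (_ : (fun x => _) = fun x => (w s x - w t x) + (w' s x - w' t x)).
  apply: le_trans (nrmD (L2B _ _) (L2B _ _)) _ => //.
  by rewrite [leRHS]splitr lerD ?H1 ?H2.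
by apply/funext => x; ring.
Qed.

Lemma pathL2M w (g : T -> R) (M : R) : measurable_fun setT g ->
  {ae m, forall x, `|g x| <= M} -> pathL2 w -> pathL2 (fun t x => g x * w t x).
Proof.
move=> mg gM [w2 cw]; split=> [t|t e e0]; first exact: L2M mg gM (w2 t).
have M0 : 0 < `|M| + 1 by rewrite ltr_wpDl.
have [d1 d10 H1] := cw t _ (divr_gt0 e0 M0).
exists d1 => // s s1; have := H1 s s1; rewrite ler_pdivlMr// => h; apply: le_trans h.
have fg : L2 m (fun x => w s x - w t x) by exact: L2B.
have fg' : L2 m (fun x => g x * (w s x - w t x)) by exact: L2M mg gM fg.
rewrite (_ : (fun x => _ - _) = fun x => g x * (w s x - w t x)); last first.
  by apply/funext => x; rewrite mulrBr.
rewrite mulrC -[X in X * _](ger0_norm (ltW M0)) -nrmZ//.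
apply: ae_le_nrm => //; first exact: L2Z.
apply: filterS gM => x gx; rewrite !normrM ler_wpM2r// (ger0_norm (ltW M0)).
by apply: le_trans gx _; apply: le_trans (ler_norm _) _; rewrite lerDl.
Qed.

Lemma pathL2Z w (a : R) : pathL2 w -> pathL2 (fun t x => a * w t x).
Proof.
move=> pw; apply: (@pathL2M _ (fun=> a) `|a|) => //.
by apply: aeW => x.
Qed.

Lemma pathL2B w w' : pathL2 w -> pathL2 w' -> pathL2 (fun t x => w t x - w' t x).
Proof.
move=> pw pw'; have := pathL2D pw (pathL2Z (-1) pw').
by rewrite (_ : (fun t x => _) = (fun t x => w t x - w' t x))//;
  apply/funext => t; apply/funext => x; rewrite mulN1r.
Qed.

Lemma pathL2_sum (I : Type) (r : seq I) (F : I -> R -> T -> R) :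
  (forall i, pathL2 (F i)) -> pathL2 (fun t x => \sum_(i <- r) F i t x).
Proof.
move=> pF; elim: r => [|i r IH].
  rewrite (_ : (fun t x => _) = fun t x => 0 * 0); last first.
    by apply/funext => t; apply/funext => x; rewrite big_nil mul0r.
  split=> [t|t e e0]; first by rewrite mul0r; exact: L2_0.
  exists 1 => // s _; rewrite /nrm (_ : (fun x => _) = fun=> 0) ?dot0l ?sqrtr0 ?ltW//.
  by apply/funext => x; rewrite subrr.
rewrite (_ : (fun t x => _) = fun t x => F i t x + \sum_(i <- r) F i t x); first exact: pathL2D.
by apply/funext => t; apply/funext => x; rewrite big_cons.
Qed.

End L2_paths.

Section strong_gradient.
Context (R : realType).
Local Notation mu := (@lebesgue3 R).
Local Notation test := (@test_function R (R3 R) setT).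

(** H^1 as a closure of test functions, [g] being the gradient. The definition of the trace supplies
    such a sequence at every positive time, and identities between gradients pass to the limit along
    it. *)
Definition strongH1 (w : R3 R -> R) (g : 'I_3 -> R3 R -> R) : Prop :=
  exists phi : nat -> R3 R -> R, [/\ forall n, test (phi n),
    cvgL2 mu phi w & forall j, cvgL2 mu (fun n => 'D_(basis3 R j) (phi n)) (g j)].

Lemma strongH1_test phi : test phi -> strongH1 phi (fun j => 'D_(basis3 R j) phi).
Proof.
move=> tphi; exists (fun=> phi); split=> //; first exact/cvgL2_cst/test_L2.
by move=> j; apply/cvgL2_cst/test_L2; exact: test_derive.
Qed.

Lemma strongH1_L2 w g : strongH1 w g -> L2 mu w /\ forall j, L2 mu (g j).
Proof. by move=> [phi [_ [_ ? _] h]]; split=> // j; have [] := h j. Qed.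

Lemma strongH1_sym w g i j phi : strongH1 w g -> test phi ->
  dot mu (g i) ('D_(basis3 R j) phi) = dot mu (g j) ('D_(basis3 R i) phi).
Proof.
move=> [u [tu _ cu]] tphi.
have c1 := cvgL2_dot (cu i) (test_L2 (test_derive (basis3 R j) tphi)).
have c2 := cvgL2_dot (cu j) (test_L2 (test_derive (basis3 R i) tphi)).
have E n := dot_derive_sym (basis3 R i) (basis3 R j) (tu n) tphi.
by move: c1; rewrite (funext E) => c1; apply: (cvg_unique _ c1 c2); exact: Rhausdorff.
Qed.

Lemma strongH1D w g w' g' : strongH1 w g -> strongH1 w' g' ->
  strongH1 (fun x => w x + w' x) (fun j x => g j x + g' j x).
Proof.
move=> [u [tu cu du]] [u' [tu' cu' du']].
exists (fun n x => u n x + u' n x); split=> [n||j]; [exact: testD|exact: cvgL2D|].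
rewrite (_ : (fun n => _) = fun n x => 'D_(basis3 R j) (u n) x + 'D_(basis3 R j) (u' n) x).
  exact: cvgL2D.
apply/funext => n; apply/funext => x.
by rewrite derive_smoothD//; [exact: test_smooth (tu n)|exact: test_smooth (tu' n)].
Qed.

Lemma strongH1Z a w g : strongH1 w g -> strongH1 (fun x => a * w x) (fun j x => a * g j x).
Proof.
move=> [u [tu cu du]].
exists (fun n x => a * u n x); split=> [n||j]; [exact: testZ|exact: cvgL2Z|].
rewrite (_ : (fun n => _) = fun n x => a * 'D_(basis3 R j) (u n) x).
  exact: cvgL2Z.
by apply/funext => n; apply/funext => x; rewrite derive_smoothZ//; exact: test_smooth (tu n).
Qed.

Lemma strongH1_0 : strongH1 (fun=> 0) (fun _ _ => 0).
Proof.
have := strongH1Z 0 (strongH1_test (test0 _)).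
rewrite (_ : (fun x => _) = fun=> 0); last by apply/funext => x; rewrite mul0r.
have -> // : (fun (j : 'I_3) (x : R3 R) => 0 * 'D_(basis3 R j) (fun=> 0 : R) x) = fun _ _ => 0.
by apply/funext => j; apply/funext => x; rewrite mul0r.
Qed.

(** Closedness of the graph of the gradient: a diagonal choice at precision 1 / (n + 1), half of it
    spent on each approximation. *)
Lemma strongH1_close w g : L2 mu w -> (forall j, L2 mu (g j)) ->
  (forall e, 0 < e -> exists w' g', [/\ strongH1 w' g', nrm mu (fun x => w' x - w x) <= e
     & forall j, nrm mu (fun x => g' j x - g j x) <= e]) -> strongH1 w g.
Proof.
move=> w2 g2 H.
have e1 n : 0 < (n.+1%:R^-1 / 2 : R) by rewrite divr_gt0.
have K n : exists phi, [/\ test phi, nrm mu (fun x => phi x - w x) <= n.+1%:R^-1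
    & forall j, nrm mu (fun x => 'D_(basis3 R j) phi x - g j x) <= n.+1%:R^-1].
  have [w' [g' [[u [tu [u2 w2' uw] cg]] ww gg]]] := H _ (e1 n).
  move/cvgrPdist_le : uw => /(_ _ (e1 n)) uw.
  have ug : \forall k \near \oo, forall j : 'I_3,
      `|0 - nrm mu (fun x => 'D_(basis3 R j) (u k) x - g' j x)| <= n.+1%:R^-1 / 2.
    apply: filter_forall => j; have [_ _ cj] := cg j.
    by move/cvgrPdist_le : cj => /(_ _ (e1 n)).
  have [k [k1 k2]] := filter_ex (filterI uw ug).
  exists (u k); split=> [//||j].
    apply: le_trans (nrm_triangle (u2 k) w2' w2) _; rewrite [leRHS]splitr lerD//.
    by move: k1; rewrite sub0r normrN ger0_norm ?nrm_ge0.
  have [ud2 g2' _] := cg j.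
  apply: le_trans (nrm_triangle (ud2 k) g2' (g2 j)) _; rewrite [leRHS]splitr lerD//.
  by have := k2 j; rewrite sub0r normrN ger0_norm ?nrm_ge0.
have [phi Hphi] := choice K.
have cv (f : nat -> R) : (forall n, 0 <= f n) -> (forall n, f n <= n.+1%:R^-1) -> f n @[n --> \oo] --> (0 : R).
  move=> f0 f1; apply: (squeeze_cvgr _ (cvg_cst 0) (@cvg_harmonic R)).
  by apply: nearW => n; rewrite f0/= f1.
exists phi; split=> [n||j]; first by have [] := Hphi n.
  split=> [n||]; [by have [/test_L2] := Hphi n|by []|].
  by apply: cv => n; [exact: nrm_ge0|have [] := Hphi n].
split=> [n||]; [by have [/(test_derive (basis3 R j))/test_L2] := Hphi n|exact: g2|].
by apply: cv => n; [exact: nrm_ge0|have [_ _ ->] := Hphi n].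
Qed.

End strong_gradient.

(** * The elastic equation tested against functions of space *)

Section generic_dot.
Context d (T : measurableType d) (R : realType) (m : {measure set T -> \bar R}).

Lemma dot_stress (f g h k : T -> R) (a b c : R) :
  L2 m f -> L2 m g -> L2 m h -> L2 m k ->
  dot m (fun x => a * (f x - g x) + b * (c * h x)) k =
  a * dot m f k - a * dot m g k + b * (c * dot m h k).
Proof.
move=> f2 g2 h2 k2.
have fg := L2B f2 g2; have ch := L2Z c h2.
rewrite (dotDl (L2Z a fg) (L2Z b ch) k2) (dotZl a fg k2) (dotBl f2 g2 k2).
by rewrite (dotZl b ch k2) (dotZl c h2 k2) mulrBr.
Qed.

Lemma sum_dot_integrable (I : Type) (r : seq I) (f g : I -> T -> R) :
  (forall i, L2 m (f i)) -> (forall i, L2 m (g i)) ->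
  m.-integrable setT (EFin \o (fun x => \sum_(i <- r) f i x * g i x)).
Proof.
move=> f2 g2; rewrite (_ : _ \o _ = fun x => (\sum_(i <- r) (f i x * g i x)%:E)%E); last first.
  by apply/funext => x/=; rewrite sumEFin.
by apply: integrable_sum => // i _; exact: dot_integrable.
Qed.

Lemma sum_dotE (I : Type) (r : seq I) (f g : I -> T -> R) :
  (forall i, L2 m (f i)) -> (forall i, L2 m (g i)) ->
  \int[m]_x (\sum_(i <- r) f i x * g i x) = \sum_(i <- r) dot m (f i) (g i).
Proof.
move=> f2 g2; elim: r => [|i r IH].
  rewrite big_nil -[RHS](dot0l m (fun=> 0)); apply: eq_Rintegral => x _.
  by rewrite big_nil mul0r.
rewrite big_cons -IH.
rewrite (_ : (fun x => _) = (fun x => f i x * g i x + \sum_(i <- r) f i x * g i x)).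
  by rewrite RintegralD//; [exact: dot_integrable|exact: sum_dot_integrable].
by apply/funext => x; rewrite big_cons.
Qed.

End generic_dot.

Section stress.
Context d (T : measurableType d) (R : realType) (m : {measure set T -> \bar R}).
Variables lamb mu0 : R.

(** [G i j] is the derivative along e_j of the i-th component. The usual stress is this one plus 2
    mu (G^T - tr(G) I), whose divergence is zero by the symmetry of second derivatives. The form of
    this one is mu |curl|^2 + (lam + 2 mu) |div|^2. *)
Definition stress (G : 'I_3 -> 'I_3 -> T -> R) (i j : 'I_3) (x : T) : R :=
  mu0 * (G i j x - G j i x) + (i == j)%:R * ((lamb + 2 * mu0) * \sum_k G k k x).

Lemma stress_path (G : 'I_3 -> 'I_3 -> R -> T -> R) :
  (forall i j, pathL2 m (G i j)) ->
  forall i j, pathL2 m (fun t => stress (fun i j => G i j t) i j).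
Proof.
move=> pG i j; apply: pathL2D; first by apply: pathL2Z; exact: pathL2B.
by apply: pathL2Z; apply: pathL2Z; apply: pathL2_sum.
Qed.

(** The last hypothesis is the symmetry of second derivatives in weak form. It turns the transposed
    term into a trace term, so the coefficient lam + 2 mu drops to lam + mu. *)
Lemma stress_dot (G : 'I_3 -> 'I_3 -> T -> R) (D : 'I_3 -> T -> R) i :
  (forall i j, L2 m (G i j)) -> (forall i, L2 m (D i)) ->
  (forall j, dot m (G j i) (D j) = dot m (G j j) (D i)) ->
  \sum_j dot m (stress G i j) (D j) =
  mu0 * (\sum_j dot m (G i j) (D j)) +
  (lamb + mu0) * dot m (fun x => \sum_k G k k x) (D i).
Proof.
move=> G2 D2 sym.
have tr2 : L2 m (fun x => \sum_k G k k x) by exact: L2_sum.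
have E j : dot m (stress G i j) (D j) =
    mu0 * dot m (G i j) (D j) - mu0 * dot m (G j j) (D i)
    + (i == j)%:R * ((lamb + 2 * mu0) * dot m (fun x => \sum_k G k k x) (D i)).
  rewrite -sym.
  have e1 := dot_stress mu0 (i == j)%:R (lamb + 2 * mu0) (G2 i j) (G2 j i) tr2 (D2 j).
  apply: etrans e1 _; congr (_ + _).
  by have [->|ij] := eqVneq i j; rewrite ?mul0r.
have F2 k : L2 m (G k k) by [].
have dS := dot_suml (index_enum 'I_3) F2 (D2 i).
rewrite (eq_bigr _ (fun j _ => E j)); move: (dot m (fun x => \sum_k G k k x) _) dS {E} => c dS.
rewrite !big_split/= -!mulr_sumr.
have -> : \sum_(j < 3) (i == j)%:R * ((lamb + 2 * mu0) * c) = (lamb + 2 * mu0) * c.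
  rewrite (bigD1 i)//= eqxx mul1r big1 ?addr0// => j ji.
  by rewrite eq_sym (negbTE ji) mul0r.
by rewrite sumrN -mulr_sumr -dS; ring.
Qed.

End stress.

Section elastic.
Context (R : realType) (lamb mu0 : R).
Local Notation mu := (@lebesgue3 R).
Local Notation test := (@test_function R (R3 R) setT).
Local Notation e_ j := (basis3 R j).

Lemma sum_stress_dot (G : 'I_3 -> 'I_3 -> R3 R -> R) (w : 'I_3 -> R3 R -> R) i phi :
  (forall k, strongH1 (w k) (G k)) -> test phi ->
  \sum_j dot mu (stress lamb mu0 G i j) ('D_(e_ j) phi) =
  mu0 * (\sum_j dot mu (G i j) ('D_(e_ j) phi)) +
  (lamb + mu0) * dot mu (fun x => \sum_k G k k x) ('D_(e_ i) phi).
Proof.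
move=> wG tphi.
have G2 k j : L2 mu (G k j) by have [_] := strongH1_L2 (wG k).
have D2 j : L2 mu ('D_(e_ j) phi) by exact/test_L2/test_derive.
exact: (stress_dot lamb mu0 G2 D2 (fun j => strongH1_sym i j (wG j) tphi)).
Qed.

Lemma derive_tensor (phi : R3 R -> R) (th : R -> R) (z v : R3 R * R) :
  smooth phi -> smooth th ->
  'D_v (fun z : R3 R * R => phi z.1 * th z.2) z =
    phi z.1 * (v.2 * 'D_1 th z.2) + th z.2 * 'D_(v.1) phi z.1.
Proof.
move=> sphi sth.
have s1 : smooth (fun z : R3 R * R => phi z.1).
  exact: (smooth_comp sphi (@is_diff_fst _ (R3 R) R)).
have s2 : smooth (fun z : R3 R * R => th z.2).
  exact: (smooth_comp sth (@is_diff_snd _ (R3 R) R)).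
rewrite derive_smoothM// (derive_smooth_comp z v sphi (@is_diff_fst _ (R3 R) R)).
by rewrite (derive_smooth_comp z v sth (@is_diff_snd _ (R3 R) R)) derive_smooth1.
Qed.

Lemma test_tensor (phi : R3 R -> R) (th : R -> R) (a b : R) :
  0 < a -> test phi -> test_function `[a, b]%classic th ->
  test_function [set z : R3 R * R | 0 < z.2] (fun z => phi z.1 * th z.2).
Proof.
move=> a0 tphi tth; have [K [cK _ K0]] := test_support tphi.
apply: (@test_subset _ _ (K `*` `[a, b]%classic)).
  by move=> z [_ /=]; rewrite in_itv/= => /andP[? _]; exact: lt_le_trans a0 _.
have [K' [_ K'ab K'0]] := test_support tth.
apply: test_compact.
- apply: smoothM; first exact: (smooth_comp (test_smooth tphi) (@is_diff_fst _ (R3 R) R)).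
  exact: (smooth_comp (test_smooth tth) (@is_diff_snd _ (R3 R) R)).
- by apply: compact_setX => //; exact: segment_compact.
- move=> [x t] /= nK; have [Kx|/K0 ->] := pselect (K x); last by rewrite mul0r.
  by rewrite K'0 ?mulr0// => /K'ab ?; apply: nK.
Qed.

Variables (rho : R3 R -> R) (v : R -> R3 R -> 'rV[R]_3) (G : R -> R3 R -> 'M[R]_3).
Variables (V P : 'I_3 -> R -> R3 R -> R) (H : 'I_3 -> 'I_3 -> R -> R3 R -> R).
Hypothesis PE : forall i t, 0 < t -> P i t = fun x => rho x * v t x 0 i.
Hypothesis HE : forall i j t, 0 < t -> H i j t = fun x => G t x i j.
Hypothesis Ppath : forall i, pathL2 mu (P i).
Hypothesis Hpath : forall i j, pathL2 mu (H i j).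
Hypothesis Hstrong : forall t, 0 < t -> exists w : 'I_3 -> R3 R -> R,
  forall i, strongH1 (w i) (fun j => H i j t).

Let S i j t := stress lamb mu0 (fun i j => H i j t) i j.

(** Testing the equation with the field whose i-th component is phi(x) theta(t), and whose other
    components are 0, reduces it to a scalar weak derivative in time, for which
    [weak_derivative_increment] applies. *)
Lemma weak_elastic_test i phi (t1 t2 eps : R) : weak_elastic_equation lamb mu0 rho v G ->
  test phi -> 0 < t1 -> t1 < t2 ->
  (forall s j, t1 <= s <= t2 -> nrm mu (fun x => S i j s x - S i j t1 x) <= eps) ->
  `|dot mu (P i t2) phi - dot mu (P i t1) phi
    + (t2 - t1) * \sum_j dot mu (S i j t1) ('D_(e_ j) phi)|
  <= (t2 - t1) * (eps * \sum_j nrm mu ('D_(e_ j) phi)).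
Proof.
move=> weak tphi t10 t12 Seps.
have phi2 := test_L2 tphi.
have D2 j : L2 mu ('D_(e_ j) phi) by exact/test_L2/test_derive.
have Spath := stress_path lamb mu0 Hpath.
have S2 j t : L2 mu (S i j t) by exact: (proj1 (Spath i j) t).
have sphi := test_smooth tphi.
apply: (@weak_derivative_increment _ (fun t => dot mu (P i t) phi)
  (fun t => \sum_j dot mu (S i j t) ('D_(e_ j) phi))) => //.
- exact: pathL2_dot.
- move=> t; apply: cvg_big => [|j _]; first exact: add_continuous.
  exact: (pathL2_dot (Spath i j) (D2 j)).
- move=> th tth; have sth := test_smooth tth.
  have tPhi k : test_function [set z : R3 R * R | 0 < z.2]
      (fun z => (k == i)%:R * (phi z.1 * th z.2)).
    by apply: testZ; exact: test_tensor tth.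
  rewrite -[RHS](weak _ tPhi); apply: eq_Rintegral => t; rewrite inE/= in_itv/= andbT => t0.
  have sPhi : smooth (fun z : R3 R * R => phi z.1 * th z.2).
    by have := test_tensor t10 tphi tth => /test_smooth.
  have [w wH] := Hstrong t0.
  have H2 k j : L2 mu (H k j t) by have [] := Hpath k j.
  have tr2 : L2 mu (fun x => \sum_k H k k t x) by exact: L2_sum.
  have E0 v' x : 'D_v' (fun z : R3 R * R => (0 : R) * (phi z.1 * th z.2)) x = 0.
    by rewrite derive_smoothZ// mul0r.
  have Edt k x : 'D_((0, 1) : R3 R * R) (fun z => (k == i)%:R * (phi z.1 * th z.2)) (x, t) =
      (k == i)%:R * (phi x * 'D_1 th t).
    by rewrite derive_smoothZ// derive_tensor//= mul1r derive0 mulr0 addr0.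
  have Edx k j x : 'D_((e_ j, 0) : R3 R * R) (fun z => (k == i)%:R * (phi z.1 * th z.2)) (x, t) =
      (k == i)%:R * (th t * 'D_(e_ j) phi x).
    by rewrite derive_smoothZ// derive_tensor//= mul0r mulr0 add0r.
  have col (F : 'I_3 -> R) : \sum_k F k * (k == i)%:R = F i.
    rewrite (bigD1 i)//= eqxx mulr1 big1 ?addr0// => k /negbTE ->; exact: mulr0.
  have I1 : \int[mu]_x (rho x * \sum_k v t x 0 k *
      'D_((0, 1) : R3 R * R) (fun z => (k == i)%:R * (phi z.1 * th z.2)) (x, t)) =
      'D_1 th t * dot mu (P i t) phi.
    rewrite -dotZl//; last by have [] := Ppath i.
    apply: eq_Rintegral => x _; under eq_bigr do rewrite Edt mulrCA mulrC.
    by rewrite col PE//; ring.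
  have I2 : \int[mu]_x (\sum_k \sum_j G t x k j *
      'D_((e_ j, 0) : R3 R * R) (fun z => (k == i)%:R * (phi z.1 * th z.2)) (x, t)) =
      th t * \sum_j dot mu (H i j t) ('D_(e_ j) phi).
    transitivity (th t * \int[mu]_x (\sum_j H i j t x * 'D_(e_ j) phi x)).
      rewrite -RintegralZl//; last exact: sum_dot_integrable.
      apply: eq_Rintegral => x _.
      under eq_bigr => k _ do under eq_bigr => j _ do rewrite Edx mulrCA.
      under eq_bigr => k _ do rewrite -mulr_sumr mulrC.
      by rewrite col mulr_sumr; apply: eq_bigr => j _; rewrite HE//; ring.
    congr (_ * _); exact: sum_dotE.
  have I3 : \int[mu]_x (\tr (G t x) * \sum_j
      'D_((e_ j, 0) : R3 R * R) (fun z => (j == i)%:R * (phi z.1 * th z.2)) (x, t)) =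
      th t * dot mu (fun x => \sum_k H k k t x) ('D_(e_ i) phi).
    rewrite -dotZr//; apply: eq_Rintegral => x _.
    under eq_bigr do rewrite Edx mulrC.
    rewrite col /mxtrace; congr (_ * _); apply: eq_bigr => k _; by rewrite HE.
  rewrite I1 I2 I3 (sum_stress_dot i wH tphi); ring.
- move=> s s12; rewrite -sumrB mulr_sumr; apply: le_trans (ler_norm_sum _ _ _) _.
  apply: ler_sum => j _; rewrite -dotBl//; apply: le_trans (cauchy_schwarz (L2B _ _) (D2 j)) _ => //.
  by rewrite ler_wpM2r ?nrm_ge0// Seps.
Qed.

End elastic.

(** Test functions of the equation are supported in positive times; this extends the resulting
    inequalities to the initial time. *)
Lemma continuous_le_left (R : realType) (F G : R -> R) (a b : R) : a < b ->
  continuous F -> continuous G -> (forall s, a < s < b -> F s <= G s) -> F a <= G a.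
Proof.
move=> ab cF cG FG; rewrite -subr_le0.
have c : (F s - G s) @[s --> a^'+] --> F a - G a.
  by apply: cvgB; apply: cvg_at_right_filter; [exact: cF|exact: cG].
apply: (cvgr_to_le c); near=> s.
rewrite subr_le0; apply: FG; apply/andP; split; near: s.
  exact: nbhs_right_gt.
exact: nbhs_right_lt.
Unshelve. all: by end_near. Qed.

(** * Solutions as continuous paths in L2 *)

Section elastic_path.
Context d (T : measurableType d) (R : realType) (m : {measure set T -> \bar R}).
Variables (lamb mu0 : R) (H1 : (T -> R) -> ('I_3 -> T -> R) -> Prop).

(** The equation integrated between two times, the stress being frozen at [t1] at the cost of its
    oscillation [eps]. [H1] is the class of test functions with their gradients: all of strong H^1
    for the given solutions, only functions carried by the exterior for their restricted
    difference. *)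
Definition momentum_balance (P : 'I_3 -> R -> T -> R) (H : 'I_3 -> 'I_3 -> R -> T -> R) : Prop :=
  forall phi D, H1 phi D -> forall i t1 t2 eps, 0 <= t1 -> t1 < t2 ->
  (forall s s' j, t1 <= s <= t2 -> t1 <= s' <= t2 ->
    nrm m (fun x => stress lamb mu0 (fun i j => H i j s) i j x -
      stress lamb mu0 (fun i j => H i j s') i j x) <= eps) ->
  `|dot m (P i t2) phi - dot m (P i t1) phi
    + (t2 - t1) * \sum_j dot m (stress lamb mu0 (fun i j => H i j t1) i j) (D j)|
  <= (t2 - t1) * (eps * \sum_j nrm m (D j)).

(** Differentiability of [w] with derivative [v], uniform on bounded intervals of nonnegative times
    and stated for forward increments, which is what telescoping sums consume. *)
Definition velocity (w v : R -> T -> R) : Prop :=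
  forall b eps, 0 < eps -> exists2 del, 0 < del &
  forall s t, 0 <= s -> s <= t -> t <= b -> t < s + del ->
    nrm m (fun x => w t x - w s x - (t - s) * v s x) <= (t - s) * eps.

Record elastic_path (rho : T -> R) (U V : 'I_3 -> R -> T -> R)
    (H : 'I_3 -> 'I_3 -> R -> T -> R) : Prop := ElasticPath {
  elastic_U : forall i, pathL2 m (U i) ;
  elastic_V : forall i, pathL2 m (V i) ;
  elastic_H : forall i j, pathL2 m (H i j) ;
  elastic_H1 : forall i t, H1 (U i t) (fun j => H i j t) ;
  elastic_velocity : forall i, velocity (U i) (V i) ;
  elastic_balance : momentum_balance (fun i t x => rho x * V i t x) H }.

(** Every term is continuous for L2 convergence of the test function and of its gradient, so the
    balance passes from test functions to their closure. *)
Lemma balance_closed (p q : T -> R) (S : 'I_3 -> T -> R) (c e : R)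
    (u : nat -> T -> R) f (du : 'I_3 -> nat -> T -> R) (df : 'I_3 -> T -> R) :
  L2 m p -> L2 m q -> (forall j, L2 m (S j)) ->
  cvgL2 m u f -> (forall j, cvgL2 m (du j) (df j)) ->
  (forall n, `|dot m p (u n) - dot m q (u n) + c * \sum_j dot m (S j) (du j n)|
    <= c * (e * \sum_j nrm m (du j n))) ->
  `|dot m p f - dot m q f + c * \sum_j dot m (S j) (df j)|
    <= c * (e * \sum_j nrm m (df j)).
Proof.
move=> p2 q2 S2 cu cdu H; rewrite -subr_le0.
have cl : `|dot m p (u n) - dot m q (u n) + c * \sum_j dot m (S j) (du j n)| -
    c * (e * \sum_j nrm m (du j n)) @[n --> \oo] -->
    `|dot m p f - dot m q f + c * \sum_j dot m (S j) (df j)| -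
    c * (e * \sum_j nrm m (df j)).
  apply: cvgB.
    apply: cvg_norm; apply: cvgD.
      by apply: cvgB; under eq_cvg do rewrite dotC; rewrite dotC; exact: cvgL2_dot.
    apply: cvgMr; apply: cvg_big => [|j _]; first exact: add_continuous.
    by under eq_cvg do rewrite dotC; rewrite dotC; exact: cvgL2_dot.
  apply: cvgMr; apply: cvgMr; apply: cvg_big => [|j _]; first exact: add_continuous.
  exact: cvgL2_nrm.
by apply: (cvgr_to_le cl); apply: nearW => n; rewrite subr_le0.
Qed.

Lemma L2norm_cvg (I : Type) (F : set_system I) (FF : Filter F) (f : I -> T -> R) :
  (\forall s \near F, L2 m (f s)) ->
  ('N[m]_2%:E[EFin \o f s]%E @[s --> F] --> 0%E) ->
  forall e, 0 < e -> \forall s \near F, nrm m (f s) <= e.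
Proof.
move=> f2 h e e0.
have H : nbhs (0 : \bar R)%E [set y | (y < e%:E)%E].
  by apply: open_nbhs_nbhs; split; [exact: open_ereal_lt_ereal|rewrite /= lte_fin].
have := h _ H; apply: filterS2 f2 => s s2 /=.
by rewrite (Lnorm2_nrm s2) lte_fin => /ltW.
Qed.

(** Solutions live on nonnegative times; composition with this map makes them constant before time 0
    and keeps the paths continuous on the whole line. *)
Definition clamp (t : R) : R := Num.max 0 t.

Lemma clamp_ge0 t : 0 <= clamp t. Proof. by rewrite le_max lexx. Qed.

Lemma clampE t : 0 <= t -> clamp t = t. Proof. by move=> ?; rewrite /clamp max_r. Qed.

Lemma clamp_lipschitz s t : `|clamp s - clamp t| <= `|s - t|.
Proof.
rewrite /clamp; case: (ltP 0 s); case: (ltP 0 t) => t0 s0 //.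
- by rewrite subr0 !ger0_norm ?subr_ge0 ?lerBrDr ?lerDl ?(ltW s0) ?(le_trans t0 (ltW s0))//; lra.
- by rewrite sub0r normrN (ger0_norm (ltW t0)) ler0_norm; lra.
- by rewrite subrr normr0.
Qed.

Lemma pathL2_clamp (w : R -> T -> R) : (forall t, 0 <= t -> L2 m (w t) /\
    ('N[m]_2%:E[EFin \o (fun x => w s x - w t x)%R]%E
      @[s --> within [set s | 0 <= s] (nbhs t)] --> 0%E)) ->
  pathL2 m (fun t => w (clamp t)).
Proof.
move=> H; split=> [t|t e e0]; first by have [] := H _ (clamp_ge0 t).
have [w2 cw] := H _ (clamp_ge0 t).
have f2 : \forall s \near within [set s | 0 <= s] (nbhs (clamp t)), L2 m (fun x => w s x - w (clamp t) x).
  by rewrite near_withinE; apply: nearW => s /= s0; apply: L2B => //; have [] := H _ s0.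
have FW : Filter (within [set s : R | 0 <= s] (nbhs (clamp t))) by exact: within_filter.
have := L2norm_cvg FW f2 cw e0.
rewrite /within/= -nbhs_ballE => -[del /= del0 K].
exists del => // s st; apply: K; last exact: clamp_ge0.
by rewrite /ball/= distrC; apply: le_lt_trans st; exact: clamp_lipschitz.
Qed.

Lemma dot_quotient (a b v r : T -> R) (k : R) : L2 m a -> L2 m b -> L2 m v -> L2 m r ->
  dot m v r - k * (dot m a r - dot m b r) = - dot m (fun x => k * (a x - b x) - v x) r.
Proof.
move=> a2 b2 v2 r2; have ab := L2B a2 b2.
by rewrite (dotBl (L2Z k ab) v2 r2) (dotZl k ab r2) (dotBl a2 b2 r2) opprB.
Qed.

(** The remainder [r] of the first-order expansion is paired with itself: the mean value theorem for
    the scalar function x |-> <W x, r> gives |r|^2 = (t - s) <V c - V s, r>, and uniform continuity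
    of [V] bounds the right side. *)
Lemma velocity_derivative (w v W V : R -> T -> R) : pathL2 m W -> pathL2 m V ->
  (forall t, 0 <= t -> W t = w t) -> (forall t, 0 <= t -> V t = v t) ->
  (forall t, 0 <= t -> 'N[m]_2%:E[EFin \o
      (fun x => (s - t)^-1 * (w s x - w t x) - v t x)%R]%E
      @[s --> within [set s | 0 <= s] t^'] --> 0%E) ->
  velocity W V.
Proof.
move=> pW pV WE VE H b eps eps0.
have W2 t : L2 m (W t) by exact: (proj1 pW t).
have V2 t : L2 m (V t) by exact: (proj1 pV t).
have [del del0 Vdel] := pathL2_uniform 0 b pV eps0.
exists del => // s t s0; rewrite le_eqVlt => /predU1P[<- _ _|st tb tdel].
  rewrite subrr mul0r (_ : (fun x => _) = fun=> 0); first by rewrite /nrm dot0l sqrtr0.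
  by apply/funext => x; rewrite subrr mul0r subrr.
set r := fun x => _.
have r2 : L2 m r by apply: L2B; [exact: L2B|exact: L2Z].
have cF : continuous (fun x => dot m (W x) r) by exact: pathL2_dot.
have dF x : x \in `]s, t[ -> is_derive x 1 (fun x => dot m (W x) r) (dot m (V x) r).
  rewrite in_itv/= => /andP[sx xt]; have x0 : 0 < x by exact: le_lt_trans sx.
  have D : (fun h => h^-1 *: (dot m (W (h *: 1 + x)) r - dot m (W x) r)) @ 0^' --> dot m (V x) r.
    apply/cvgrPdist_le => e e0.
    have n0 : 0 < nrm m r + 1 by rewrite ltr_wpDl// nrm_ge0.
    have f2 : \forall s \near within [set s | 0 <= s] x^',
        L2 m (fun y => (s - x)^-1 * (w s y - w x y) - v x y).
      rewrite near_withinE; apply: nearW => u u0; rewrite -(WE u u0) -(WE x (ltW x0)) -(VE x (ltW x0)).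
      by apply: L2B => //; apply: L2Z; exact: L2B.
    have FW : Filter (within [set s : R | 0 <= s] x^') by exact: within_filter.
    have := L2norm_cvg FW f2 (H x (ltW x0)) (divr_gt0 e0 n0).
    rewrite /dnbhs !near_withinE => /nbhs_ballP[k /= k0 K].
    have m0 : 0 < Num.min k x by rewrite lt_min k0.
    exists (Num.min k x) => //= h; rewrite /ball/= sub0r normrN lt_min => /andP[hk hx] h0.
    have hx0 : 0 <= h *: 1 + x.
      by rewrite /GRing.scale/= mulr1; move: hx; rewrite ltr_norml => /andP[? _]; lra.
    have hE : h *: 1 + x - x = h by rewrite addrK /GRing.scale/= mulr1.
    have := K (h *: 1 + x); rewrite /ball/= -(WE _ hx0) -(WE x (ltW x0)) -(VE x (ltW x0)) distrC hE.
    have hx1 : h *: 1 + x != x by rewrite -subr_eq0 hE.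
    move=> /(_ hk hx1 hx0) K1.
    rewrite /GRing.scale/= (dot_quotient _ (W2 _) (W2 x) (V2 x) r2) normrN.
    have q2 : L2 m (fun y => h^-1 * (W (h *: 1 + x) y - W x y) - V x y).
      by apply: L2B => //; apply: L2Z; exact: L2B.
    apply: le_trans (cauchy_schwarz q2 r2) _.
    apply: le_trans (ler_wpM2r (nrm_ge0 _ _) K1) _.
    by rewrite mulrAC ler_pdivrMr// ler_wpM2l ?(ltW e0)// lerDl.
  apply: DeriveDef; first by apply/cvg_ex; exists (dot m (V x) r).
  by rewrite /derive; exact: cvg_lim D.
have [|c cst Fc] := MVT st dF; first exact: continuous_subspaceT.
move: cst; rewrite in_itv/= => /andP[sc ct].
have E : nrm m r ^+ 2 = (t - s) * dot m (fun x => V c x - V s x) r.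
  rewrite nrm_sqr {1}/r (dotBl (L2B (W2 t) (W2 s)) (L2Z _ (V2 s)) r2) (dotBl (W2 t) (W2 s) r2).
  by rewrite Fc (dotZl _ (V2 s) r2) (dotBl (V2 c) (V2 s) r2); ring.
have vb : nrm m (fun x => V c x - V s x) <= eps.
  apply: Vdel; first by rewrite s0 (le_trans (ltW st)).
  by rewrite gtr0_norm ?subr_gt0// ltrBlDl; exact: lt_trans ct tdel.
have ts0 : 0 <= t - s by rewrite subr_ge0 ltW.
have E1 : nrm m r ^+ 2 <= (t - s) * eps * nrm m r.
  rewrite E -mulrA ler_wpM2l//; apply: le_trans (ler_norm _) _.
  apply: le_trans (cauchy_schwarz (L2B (V2 c) (V2 s)) r2) _.
  by rewrite ler_wpM2r ?nrm_ge0.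
move: (nrm_ge0 m r) E1; rewrite expr2; case: (ltrgtP 0 (nrm m r)) => // [n0 _|<- _ _].
  by rewrite ler_pM2r.
by rewrite mulr_ge0 ?(ltW eps0).
Qed.

End elastic_path.

Lemma ae_imp d (T : measurableType d) (R : realType) (m : {measure set T -> \bar R})
  (P Q : T -> Prop) : (forall x, P x -> Q x) -> {ae m, forall x, P x} -> {ae m, forall x, Q x}.
Proof. by move=> PQ; apply: filterS => x; exact: PQ. Qed.

Lemma ae_imp2 d (T : measurableType d) (R : realType) (m : {measure set T -> \bar R})
  (P P' Q : T -> Prop) : (forall x, P x -> P' x -> Q x) ->
  {ae m, forall x, P x} -> {ae m, forall x, P' x} -> {ae m, forall x, Q x}.
Proof. by move=> PQ; apply: filterS2 => x; exact: PQ. Qed.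

Lemma nrm_ae d (T : measurableType d) (R : realType) (m : {measure set T -> \bar R})
  (f g : T -> R) : L2 m f -> L2 m g -> {ae m, forall x, f x = g x} ->
  nrm m f = nrm m g.
Proof.
move=> f2 g2 fg; apply/eqP; rewrite eq_le; apply/andP; split; apply: ae_le_nrm => //;
  by apply: filterS fg => x ->.
Qed.

Section elastic3.
Context (R : realType).
Local Notation mR := (measurableTypeR R).
Local Notation T3 := (mR * mR * mR)%type.
Local Notation mu := (@lebesgue3 R).
Local Notation test := (@test_function R (R3 R) setT).
Local Notation e_ j := (basis3 R j).

Lemma weak_partial_unique j (w g h : R3 R -> R) : L2 mu g -> L2 mu h ->
  weak_partial j w g -> weak_partial j w h -> {ae mu, forall x, g x = h x}.
Proof.
move=> g2 h2 wg wh.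
have E phi : test phi -> dot mu (fun x => g x - h x) phi = 0.
  move=> tphi; have p2 := test_L2 tphi; apply: etrans (dotBl g2 h2 p2) _.
  have : - dot mu g phi = - dot mu h phi by apply: etrans (wh phi tphi); apply: esym; exact: wg.
  by move=> /oppr_inj ->; rewrite subrr.
apply: ae_imp (test_orthogonal_ae0 (L2B g2 h2) E) => x; exact: subr0_eq.
Qed.

Lemma cvgL2_ae (u : nat -> R3 R -> R) f g : L2 mu g -> {ae mu, forall x, f x = g x} ->
  cvgL2 mu u f -> cvgL2 mu u g.
Proof.
move=> g2 fg [u2 f2 c]; split => //.
have E n : nrm mu (fun x => u n x - f x) = nrm mu (fun x => u n x - g x).
  apply: nrm_ae; [exact: L2B|exact: L2B|].
  by apply: ae_imp fg => x ->.
by rewrite (_ : (fun n => nrm _ _) = (fun n => nrm mu (fun x => u n x - f x)))//; apply/funext.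
Qed.

Lemma L2norm_cvgL2 (u : nat -> R3 R -> R) f : (forall n, L2 mu (u n)) -> L2 mu f ->
  L2norm (fun x => u n x - f x) @[n --> \oo] --> 0%E -> cvgL2 mu u f.
Proof.
move=> u2 f2 c; split=> //; apply/cvgrPdist_le => e e0.
have d2 : \forall n \near \oo, L2 mu (fun x => u n x - f x) by apply: nearW => n; exact: L2B.
have := L2norm_cvg eventually_filter d2 c e0.
apply: filterS => n; rewrite sub0r normrN ger0_norm ?nrm_ge0; exact: id.
Qed.

Section equation.
Variables (lamb mu0 : R).
Variables (rho : R3 R -> R) (v : R -> R3 R -> 'rV[R]_3) (G : R -> R3 R -> 'M[R]_3).
Variables (P : 'I_3 -> R -> R3 R -> R) (H : 'I_3 -> 'I_3 -> R -> R3 R -> R).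
Hypothesis PE : forall i t, 0 < t -> P i t = fun x => rho x * v t x 0 i.
Hypothesis HE : forall i j t, 0 < t -> H i j t = fun x => G t x i j.
Hypothesis Ppath : forall i, pathL2 mu (P i).
Hypothesis Hpath : forall i j, pathL2 mu (H i j).
Hypothesis Hstrong : forall t, 0 < t -> exists w : 'I_3 -> R3 R -> R,
  forall i, strongH1 (w i) (fun j => H i j t).

Lemma weak_elastic_balance : weak_elastic_equation lamb mu0 rho v G ->
  momentum_balance mu lamb mu0 (@strongH1 R) P H.
Proof.
move=> weak phi D [u [tu cu cdu]] i t1 t2 eps t10 t12 Seps.
set S := fun j t => stress lamb mu0 (fun i j => H i j t) i j.
have Spath j : pathL2 mu (S j) by exact: (stress_path lamb mu0 Hpath i j).
have S2 j t : L2 mu (S j t) by exact: (proj1 (Spath j) t).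
have P2 t : L2 mu (P i t) by exact: (proj1 (Ppath i) t).
have phi2 : L2 mu phi by have [] := cu.
have D2 j : L2 mu (D j) by have [] := cdu j.
have K s : t1 < s < t2 ->
    `|dot mu (P i t2) phi - dot mu (P i s) phi + (t2 - s) * \sum_j dot mu (S j s) (D j)|
    <= (t2 - s) * (eps * \sum_j nrm mu (D j)).
  move=> /andP[ts st].
  apply: (balance_closed (P2 t2) (P2 s) (fun j => S2 j s) cu cdu) => n.
  apply: (weak_elastic_test PE HE Ppath Hpath Hstrong weak (tu n)) => //.
  - exact: le_lt_trans ts.
  - move=> s' j /andP[ss' s't]; apply: Seps.
      by rewrite (le_trans (ltW ts) ss').
    by rewrite (ltW ts) ltW.
apply: (continuous_le_left t12 _ _ K).
  move=> s; apply: cvg_norm; apply: cvgD.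
    by apply: cvgB; [exact: cvg_cst|exact: (pathL2_dot (Ppath i) phi2)].
  apply: cvgM; first by apply: cvgB; [exact: cvg_cst|exact: cvg_id].
  apply: cvg_big => [|j _]; first exact: add_continuous.
  exact: (pathL2_dot (Spath j) (D2 j)).
move=> s; apply: cvgM; last exact: cvg_cst.
by apply: cvgB; [exact: cvg_cst|exact: cvg_id].
Qed.

End equation.

(** The weak gradient that comes with a trace coincides with the one of the energy solution, by
    uniqueness of weak derivatives. Hence the sequence that approximates the trace also shows that
    the displacement is in strong H^1 at positive times. *)
Lemma passive_elastic lamb mu0 (Omega : set (R3 R)) (rho : R3 R -> R) f g M (C : R) :
  measurable_fun setT (rho : T3 -> R) -> {ae mu, forall x, `|rho x| <= C} ->
  passive_data lamb mu0 Omega rho f g M ->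
  exists U V H, [/\ elastic_path mu lamb mu0 (@strongH1 R) rho U V H,
    forall i, {ae mu, forall x, U i 0 x = f x 0 i},
    forall i, {ae mu, forall x, V i 0 x = g x 0 i}
  & forall t, 0 < t -> forall i,
      measurable_fun (closure Omega `\` Omega : set (caratheodory_type (@hausdorff2 R)))
        (fun x => M t x 0 i) /\
      exists phi : nat -> R3 R -> R, [/\ forall n, test (phi n), cvgL2 mu phi (U i t),
        forall j, cvgL2 mu (fun n => 'D_(e_ j) (phi n)) (H i j t)
      & (\int[surface_measure R]_(x in closure Omega `\` Omega)
          ((phi n x - M t x 0 i) ^+ 2)%:E)%E @[n --> \oo] --> 0%E]].
Proof.
move=> mrho rhoC [u [v [G [[cu dG cG] [cv duv] weak uf vg]]] tr].
pose U i t (x : T3) : R := u (clamp t) x 0 i; pose V i t (x : T3) : R := v (clamp t) x 0 i.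
pose H i j t (x : T3) : R := G (clamp t) x i j.
have pU i : pathL2 mu (U i).
  apply: (pathL2_clamp (w := fun t (x : T3) => u t x 0 i : R)) => t t0.
  by have [a b] := cu t t0; split; [exact: a|exact: b].
have pV i : pathL2 mu (V i).
  apply: (pathL2_clamp (w := fun t (x : T3) => v t x 0 i : R)) => t t0.
  by have [a b] := cv t t0; split; [exact: a|exact: b].
have pH i j : pathL2 mu (H i j).
  apply: (pathL2_clamp (w := fun t (x : T3) => G t x i j : R)) => t t0.
  have [a b] := cG i t t0; have rE s x : row i (G s x) 0 j = G s x i j by rewrite mxE.
  split; first by have := a j; rewrite (_ : (fun x => _) = fun x => G t x i j)//; apply/funext.
  have := b j; rewrite (_ : (fun s => L2norm _) = (fun s => L2norm (fun x => G s x i j - G t x i j)))//.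
  by apply/funext => s; congr L2norm; apply/funext => x; rewrite !rE.
have U2 i t : L2 mu (U i t) by exact: (proj1 (pU i) t).
have H2 i j t : L2 mu (H i j t) by exact: (proj1 (pH i j) t).
have trE t : 0 < t -> forall i, measurable_fun
        (closure Omega `\` Omega : set (caratheodory_type (@hausdorff2 R)))
        (fun x => M t x 0 i) /\
      exists phi : nat -> R3 R -> R, [/\ forall n, test (phi n), cvgL2 mu phi (U i t),
        forall j, cvgL2 mu (fun n => 'D_(e_ j) (phi n)) (H i j t)
      & (\int[surface_measure R]_(x in closure Omega `\` Omega)
          ((phi n x - M t x 0 i) ^+ 2)%:E)%E @[n --> \oo] --> 0%E].
  move=> t0 i; have [mM [phi [gg [tphi g2 cphi cg cM]]]] := tr t t0 i.
  split=> //; exists phi; split=> //.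
    apply: L2norm_cvgL2 => [n|//|]; first exact: test_L2.
    by rewrite /U clampE// ltW.
  move=> j; have [gj2 wj] := g2 j.
  have ae : {ae mu, forall x, gg j x = H i j t x}.
    have HE : H i j t = fun x => G t x i j.
      by rewrite /H; have -> : clamp t = t by apply: clampE; exact: ltW.
    have wH : weak_partial j (fun x => u t x 0 i) (H i j t).
      by rewrite HE; exact: (dG t (ltW t0) i j).
    exact: (weak_partial_unique gj2 (H2 i j t) wj wH).
  apply: (cvgL2_ae (H2 i j t) ae); apply: L2norm_cvgL2 => [n|//|]; last exact: cg.
  exact/test_L2/test_derive.
have str i t : 0 < t -> strongH1 (U i t) (fun j => H i j t).
  by move=> t0; have [_ [phi [? ? ? _]]] := trE t t0 i; exists phi; split.
have str0 i t : strongH1 (U i t) (fun j => H i j t).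
  have [t0|t0] := ltP 0 t; first exact: str.
  (* For nonpositive [t] the path equals its value at 0, which is a limit of values at positive
     times. *)
  have c0 : clamp t = clamp 0 by rewrite /clamp max_l// max_l.
  apply: (strongH1_close (U2 i t) (fun j => H2 i j t)) => e e0.
  have [d1 d10 K1] := proj2 (pU i) 0 e e0.
  have [d2 d20 K2] : exists2 del, 0 < del & forall j s, `|s - 0| < del ->
      nrm mu (fun x => H i j s x - H i j 0 x) <= e.
    have [dd Hdd] := choice (fun j => let: ex_intro2 a b c := proj2 (pH i j) 0 e e0 in
      ex_intro (fun a => 0 < a /\ _) a (conj b c)).
    exists (\big[Num.min/1]_j dd j).
      by apply/bigmin_gtP; split=> // j _; have [] := Hdd j.
    move=> j s sd; have [_] := Hdd j; apply; apply: lt_le_trans sd _.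
    exact: bigmin_le_cond.
  pose s := Num.min d1 d2 / 2.
  have m0 : 0 < Num.min d1 d2 by rewrite lt_min d10.
  have s0 : 0 < s by rewrite divr_gt0.
  have sm : `|s - 0| < Num.min d1 d2 by rewrite subr0 gtr0_norm// ltr_pdivrMr// ltr_pMr ?ltr1n.
  move: sm; rewrite lt_min => /andP[s1 s2].
  exists (U i s), (fun j => H i j s); split; first exact: str.
    by rewrite /U c0; exact: K1.
  by move=> j; rewrite /H c0; exact: K2.
exists U, V, H; split=> //.
- split=> //.
    move=> i; apply: (velocity_derivative (w := fun t (x : T3) => u t x 0 i : R) (v := fun t (x : T3) => v t x 0 i : R)) => //.
    + by move=> t t0; rewrite /U clampE.
    + by move=> t t0; rewrite /V clampE.
    + by move=> t t0; exact: duv.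
  apply: (weak_elastic_balance (rho := rho) (v := v) (G := G)) => //.
  + by move=> i t t0; rewrite /V clampE// ltW.
  + by move=> i j t t0; rewrite /H clampE// ltW.
  + by move=> i; exact: pathL2M mrho rhoC (pV i).
  + by move=> t t0; exists (fun i => U i t) => i; exact: str.
- by move=> i; rewrite /U clampE//; apply: ae_imp uf => x ->.
- by move=> i; rewrite /V clampE//; apply: ae_imp vg => x ->.
Qed.

End elastic3.

Lemma fin_del (R : realType) (n : nat) (P : 'I_n -> R -> Prop) :
  (forall i del del', del' <= del -> P i del -> P i del') ->
  (forall i, exists2 del, 0 < del & P i del) -> exists2 del, 0 < del & forall i, P i del.
Proof.
move=> mono H; have H' i : exists del, 0 < del /\ P i del by have [del d0 Pd] := H i; exists del.
have [f Hf] := choice H'.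
exists (\big[Num.min/1]_i f i).
  by apply/bigmin_gtP; split=> // i _; have [] := Hf i.
move=> i; have [_] := Hf i; apply: mono.
exact: bigmin_le_cond.
Qed.

(** Since tau <= e <= 1, each tau^2 is at most tau * e: the error of one step is [tau] times
    something small, and survives the summation over b / tau steps. *)
Lemma energy_const (R : realType) (C M b e tau : R) : 0 <= C -> 0 <= M -> 0 < e -> e <= 1 -> 0 < tau -> tau <= e ->
  C * (2 * M * (tau * e) + (tau * M + tau * e) ^+ 2) *+ 3
     + 2 * tau * (b * (e * (M *+ 9))) + tau ^+ 2 * (M ^+ 2 *+ 9) <=
  tau * (e * (C * (2 * M + (M + 1) ^+ 2) *+ 3 + 2 * (b * (M *+ 9)) + M ^+ 2 *+ 9)).
Proof.
move=> C0 M0 e0 e1 tau0 te.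
have -> : tau * (e * (C * (2 * M + (M + 1) ^+ 2) *+ 3 + 2 * (b * (M *+ 9)) + M ^+ 2 *+ 9)) =
  C * (2 * M * (tau * e) + tau * (e * (M + 1) ^+ 2)) *+ 3
     + 2 * tau * (b * (e * (M *+ 9))) + tau * (e * (M ^+ 2 *+ 9)).
  move: (M *+ 9) (M ^+ 2 *+ 9) ((M + 1) ^+ 2) => x y z.
  have r3 (t : R) : t *+ 3 = t + t + t by rewrite !mulrS mulr0n addr0 addrA.
  have r2 (t : R) : 2 * t = t + t by rewrite mulr_natl.
  rewrite !r3 -[2 * tau * _]mulrA !r2; ring.
rewrite lerD//.
  rewrite lerD// lerMn2r/= ler_wpM2l// lerD2l -mulrDr exprMn expr2 -mulrA ler_wpM2l ?(ltW tau0)//.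
  rewrite ler_pM ?sqr_ge0 ?(ltW tau0)// ler_sqr ?nnegrE ?addr_ge0 ?(ltW e0)//.
  by rewrite lerD2l.
by rewrite expr2 -mulrA ler_wpM2l ?(ltW tau0)// ler_wpM2r// mulrn_wge0// sqr_ge0.
Qed.

(** * The energy identity without time integrals *)

Section path_bounds.
Context d (T : measurableType d) (R : realType) (m : {measure set T -> \bar R}).

Lemma pathL2_bounded (w : R -> T -> R) (b : R) : pathL2 m w ->
  exists2 M, 0 <= M & forall t, 0 <= t <= b -> nrm m (w t) <= M.
Proof.
move=> pw; have w2 t : L2 m (w t) by exact: (proj1 pw t).
have [b0|b0] := leP 0 b; last first.
  by exists 0 => // t /andP[t0 tb]; have := le_lt_trans (le_trans t0 tb) b0; rewrite ltxx.
have cn : continuous (fun t => nrm m (w t)).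
  move=> t; apply/cvgrPdist_le => e e0; have [del del0 H] := proj2 pw t e e0.
  apply: filterS (near_dist_lt t del0) => s /H st.
  have tr f g : L2 m f -> L2 m g -> nrm m f <= nrm m g + nrm m (fun x => f x - g x).
    move=> f2 g2; have := nrmD g2 (L2B f2 g2); rewrite (_ : (fun x => _) = f)//.
    by apply/funext => x; rewrite addrC subrK.
  have st' : nrm m (fun x => w t x - w s x) <= e by rewrite nrmBC.
  rewrite ler_distlC lerBlDr; apply/andP; split.
    exact: le_trans (tr _ _ (w2 t) (w2 s)) (lerD (lexx _) st').
  exact: le_trans (tr _ _ (w2 s) (w2 t)) (lerD (lexx _) st).
have [|c _ Hc] := @EVT_max _ (fun t => nrm m (w t)) 0 b b0; first exact: continuous_subspaceT.
exists (nrm m (w c)); first exact: nrm_ge0.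
by move=> t t0b; apply: Hc; rewrite in_itv.
Qed.

Lemma pathL2_bounded_fin (n : nat) (w : 'I_n -> R -> T -> R) (b : R) : (forall i, pathL2 m (w i)) ->
  exists2 M, 0 <= M & forall i t, 0 <= t <= b -> nrm m (w i t) <= M.
Proof.
move=> pw; have H i : exists M, 0 <= M /\ forall t, 0 <= t <= b -> nrm m (w i t) <= M.
  by have [M M0 HM] := pathL2_bounded b (pw i); exists M.
have [M HM] := choice H.
exists (\sum_i M i); first by apply: sumr_ge0 => i _; have [] := HM i.
move=> i t tb; have [_ h] := HM i; apply: le_trans (h t tb) _.
rewrite (bigD1 i)//= lerDl; apply: sumr_ge0 => k _; by have [] := HM k.
Qed.

End path_bounds.

Section kinetic.
Context d (T : measurableType d) (R : realType) (m : {measure set T -> \bar R}).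
Variables (rho : T -> R) (C : R).
Hypotheses (mrho : measurable_fun setT rho) (rhoC : {ae m, forall x, `|rho x| <= C}) (C0 : 0 <= C).

Lemma L2_rho f : L2 m f -> L2 m (fun x => rho x * f x).
Proof. exact: L2M mrho rhoC. Qed.

Lemma nrm_rho f : L2 m f -> nrm m (fun x => rho x * f x) <= C * nrm m f.
Proof.
move=> f2; rewrite -[C in leRHS]ger0_norm// -nrmZ//; apply: ae_le_nrm; [exact: L2_rho|exact: L2Z|].
by apply: filterS rhoC => x hx; rewrite !normrM (ger0_norm C0) ler_wpM2r.
Qed.

Lemma dot_rhoC f g : dot m (fun x => rho x * f x) g = dot m (fun x => rho x * g x) f.
Proof. by apply: eq_Rintegral => x _; rewrite mulrAC. Qed.

(** With r = u' - u - k v, the quantity estimated equals 2 <rho u, r> + <rho (u' - u), u' - u>. *)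
Lemma kinetic_step (u u' v : T -> R) (k : R) : L2 m u -> L2 m u' -> L2 m v -> 0 <= k ->
  `|dot m (fun x => rho x * u' x) u' - dot m (fun x => rho x * u x) u
    - 2 * k * dot m (fun x => rho x * v x) u| <=
  C * (2 * nrm m u * nrm m (fun x => u' x - u x - k * v x)
       + (k * nrm m v + nrm m (fun x => u' x - u x - k * v x)) ^+ 2).
Proof.
move=> u2 u2' v2 k0; set r := fun x => u' x - u x - k * v x.
have d2 := L2B u2' u2; have kv2 := L2Z k v2; have r2 : L2 m r := L2B d2 kv2.
have ru := L2_rho u2; have ru' := L2_rho u2'; have rd := L2_rho d2.
have e1 : dot m (fun x => rho x * u x) r = dot m (fun x => rho x * u x) u' -
    dot m (fun x => rho x * u x) u - k * dot m (fun x => rho x * v x) u.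
  by rewrite (dot_rhoC v u); exact: dot_taylor.
have e2 : dot m (fun x => rho x * (u' x - u x)) (fun x => u' x - u x) =
    dot m (fun x => rho x * u' x) u' - 2 * dot m (fun x => rho x * u x) u' + dot m (fun x => rho x * u x) u.
  rewrite (_ : (fun x => rho x * (u' x - u x)) = fun x => rho x * u' x - rho x * u x); last first.
    by apply/funext => x; rewrite mulrBr.
  rewrite (dotBl ru' ru d2) (dotBr u2' u2 ru') (dotBr u2' u2 ru) (dot_rhoC u' u); ring.
have b1 := le_trans (cauchy_schwarz ru r2) (ler_wpM2r (nrm_ge0 m r) (nrm_rho u2)).
have b2 := le_trans (cauchy_schwarz rd d2) (ler_wpM2r (nrm_ge0 m _) (nrm_rho d2)).
have b3 : nrm m (fun x => u' x - u x) <= k * nrm m v + nrm m r.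
  rewrite -(ger0_norm k0) -nrmZ//; apply: le_trans (nrmD kv2 r2).
  rewrite (_ : (fun x => _ + _) = (fun x => u' x - u x))//.
  by apply/funext => x; rewrite /r; ring.
move: e1 e2 b1 b2 b3 (nrm_ge0 m (fun x => u' x - u x)).
move: (dot m _ r) (dot m (fun x => rho x * (u' x - u x)) _) (dot m (fun x => rho x * u x) u').
move: (dot m _ u') (dot m _ u) (dot m _ u) => a b c x y z e1 e2 b1 b2 b3 n0.
have -> : a - c - 2 * k * b = 2 * x + y by rewrite e1 e2; ring.
apply: le_trans (ler_normD _ _) _; rewrite mulrDr lerD//.
  rewrite normrM ger0_norm//; have := ler_wpM2l (ler0n R 2) b1; congr (_ <= _); ring.
apply: le_trans b2 _; rewrite -mulrA ler_wpM2l// -expr2 ler_sqr ?nnegrE//.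
exact: le_trans n0 b3.
Qed.

End kinetic.

Section elastic_form.
Context d (T : measurableType d) (R : realType) (m : {measure set T -> \bar R}).
Variables lamb mu0 : R.
Implicit Types A D : 'I_3 -> 'I_3 -> T -> R.

Definition elastic_form A D : R := \sum_i \sum_j dot m (stress lamb mu0 A i j) (D i j).
Local Notation B := elastic_form.

Lemma elastic_formE A D : (forall i j, L2 m (A i j)) -> (forall i j, L2 m (D i j)) ->
  B A D = mu0 * (\sum_i \sum_j dot m (A i j) (D i j)) - mu0 * (\sum_i \sum_j dot m (A j i) (D i j))
    + (lamb + 2 * mu0) * (\sum_i \sum_k dot m (A k k) (D i i)).
Proof.
move=> A2 D2; rewrite !mulr_sumr -sumrB -big_split/=; apply: eq_bigr => i _.
have tr2 : L2 m (fun x => \sum_k A k k x) by exact: L2_sum.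
rewrite (eq_bigr _ (fun j _ => dot_stress mu0 (i == j)%:R (lamb + 2 * mu0) (A2 i j) (A2 j i) tr2 (D2 i j))).
rewrite big_split/= sumrB -!mulr_sumr; congr (_ + _).
rewrite (bigD1 i)//= eqxx mul1r big1 ?addr0; last first.
  by move=> j ji; rewrite eq_sym (negbTE ji) mul0r.
by rewrite dot_suml.
Qed.

Lemma elastic_formC A D : (forall i j, L2 m (A i j)) -> (forall i j, L2 m (D i j)) -> B A D = B D A.
Proof.
move=> A2 D2; rewrite !elastic_formE//; congr (_ * _ - _ * _ + _ * _).
- by apply: eq_bigr => i _; apply: eq_bigr => j _; exact: dotC.
- by rewrite exchange_big; apply: eq_bigr => i _; apply: eq_bigr => j _; exact: dotC.
- by rewrite exchange_big; apply: eq_bigr => i _; apply: eq_bigr => j _; exact: dotC.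
Qed.

Lemma elastic_formDZ (k : R) A A' D : (forall i j, L2 m (A i j)) -> (forall i j, L2 m (A' i j)) ->
  (forall i j, L2 m (D i j)) ->
  B (fun i j x => A i j x + k * A' i j x) D = B A D + k * B A' D.
Proof.
move=> A2 A2' D2.
have AA i j : L2 m (fun x => A i j x + k * A' i j x) by apply: L2D => //; exact: L2Z.
have E i j p q : dot m (fun x => A i j x + k * A' i j x) (D p q) = dot m (A i j) (D p q) + k * dot m (A' i j) (D p q).
  by rewrite (dotDl (A2 i j) (L2Z k (A2' i j)) (D2 p q)) (dotZl k (A2' i j) (D2 p q)).
have S (F F' : 'I_3 -> 'I_3 -> R) : \sum_i \sum_j (F i j + k * F' i j) =
    \sum_i \sum_j F i j + k * \sum_i \sum_j F' i j.
  rewrite mulr_sumr -big_split/=; apply: eq_bigr => i _.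
  by rewrite mulr_sumr -big_split.
rewrite !elastic_formE//.
rewrite (eq_bigr _ (fun i _ => eq_bigr _ (fun j _ => E i j i j))) S.
rewrite (eq_bigr _ (fun i _ => eq_bigr _ (fun j _ => E j i i j))) S.
rewrite (eq_bigr _ (fun i _ => eq_bigr _ (fun j _ => E j j i i))) S.
ring.
Qed.

End elastic_form.

Section energy.
Context d (T : measurableType d) (R : realType) (m : {measure set T -> \bar R}).
Variables (lamb mu0 : R) (H1 : (T -> R) -> ('I_3 -> T -> R) -> Prop).
Variables (rho : T -> R) (C : R).
Hypotheses (mrho : measurable_fun setT rho) (rhoC : {ae m, forall x, `|rho x| <= C}) (C0 : 0 <= C).
Variables (U V : 'I_3 -> R -> T -> R) (H : 'I_3 -> 'I_3 -> R -> T -> R).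
Hypothesis EP : elastic_path m lamb mu0 H1 rho U V H.

Fixpoint riemann (tau : R) (w : R -> T -> R) (n : nat) : T -> R :=
  if n is k.+1 then fun x => riemann tau w k x + tau * w (k%:R * tau) x else fun=> 0.

Lemma riemann_L2 tau w n : (forall t, L2 m (w t)) -> L2 m (riemann tau w n).
Proof. by move=> w2; elim: n => [|n IH] /=; [exact: L2_0|apply: L2D => //; exact: L2Z]. Qed.

Local Notation S i j t := (stress lamb mu0 (fun i j => H i j t) i j).
Local Notation B := (elastic_form m lamb mu0).
Let U2 i t : L2 m (U i t). Proof. exact: (proj1 (elastic_U EP i) t). Qed.
Let V2 i t : L2 m (V i t). Proof. exact: (proj1 (elastic_V EP i) t). Qed.
Let H2 i j t : L2 m (H i j t). Proof. exact: (proj1 (elastic_H EP i j) t). Qed.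

Definition kinetic t : R := \sum_i dot m (fun x => rho x * U i t x) (U i t).
(** Twice the energy of the time integral w of the displacement, with [riemann] in the role of w. As
    rho w_tt - L w = rho V(0) and w(0) = 0, the exact quantity is conserved and equals [kinetic 0];
    its kinetic part involves w_t = U, which is why [kinetic] is formed with displacements. *)
Definition energy tau n : R := kinetic (n%:R * tau)
  + B (fun i j => riemann tau (H i j) n) (fun i j => riemann tau (H i j) n)
  - 2 * \sum_i dot m (fun x => rho x * V i 0 x) (riemann tau (U i) n).

(* Telescoping the momentum balance: the sum of the stresses over the steps is
   the stress of the Riemann sum, so no integral of L2-valued paths is needed. *)
Lemma momentum_sum tau n eps (Y : 'I_3 -> T -> R) (DY : 'I_3 -> 'I_3 -> T -> R) : 0 < tau ->
  (forall k, (k < n)%N -> forall i j s s', k%:R * tau <= s <= k.+1%:R * tau ->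
     k%:R * tau <= s' <= k.+1%:R * tau ->
     nrm m (fun x => S i j s x - S i j s' x) <= eps) ->
  (forall i, H1 (Y i) (DY i)) -> (forall i j, L2 m (DY i j)) ->
  `|\sum_i dot m (fun x => rho x * V i (n%:R * tau) x) (Y i) -
    \sum_i dot m (fun x => rho x * V i 0 x) (Y i) + B (fun i j => riemann tau (H i j) n) DY|
  <= n%:R * (tau * (eps * \sum_i \sum_j nrm m (DY i j))).
Proof.
move=> tau0 osc HY DY2; elim: n osc => [|n IH] osc.
  rewrite !mul0r subrr add0r /elastic_form big1 ?normr0// => i _; rewrite big1// => j _.
  rewrite (_ : stress _ _ _ _ _ = fun=> 0) ?dot0l//.
  by apply/funext => x; rewrite /stress/= subrr !mulr0 big1// !mulr0 addr0.
have {IH} := IH (fun k kn => osc k (leqW kn)).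
rewrite (elastic_formDZ lamb mu0 tau (fun i j => riemann_L2 tau n (H2 i j)) (fun i j => H2 i j (n%:R * tau)) DY2).
have tE : n.+1%:R * tau - n%:R * tau = tau by rewrite -mulrBl -natrB// subSnn mul1r.
have st i := elastic_balance EP (HY i) (i := i) (mulr_ge0 (ler0n R n) (ltW tau0)) _
   (fun s s' j h h' => osc n (ltnSn n) i j s s' h h').
have lt : n%:R * tau < n.+1%:R * tau by rewrite ltr_pM2r// ltr_nat.
have {}st := st lt; rewrite tE in st.
have : `|\sum_i dot m (fun x => rho x * V i (n.+1%:R * tau) x) (Y i) -
    \sum_i dot m (fun x => rho x * V i (n%:R * tau) x) (Y i) +
    tau * B (fun i j => H i j (n%:R * tau)) DY| <= tau * (eps * \sum_i \sum_j nrm m (DY i j)).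
  rewrite /elastic_form !mulr_sumr -sumrB -big_split/=; apply: le_trans (ler_norm_sum _ _ _) _.
  by apply: ler_sum => i _; exact: st.
move: (B _ _) (B _ _) (\sum_i dot m _ _) (\sum_i dot m _ _) (\sum_i dot m _ _) => a b c d' e h1 h2.
rewrite -natr1 mulrDl mul1r.
by apply: le_trans (lerD h2 h1); apply: le_trans (ler_normD _ _); rewrite le_eqVlt; apply/orP; left;
  apply/eqP; congr (`|_|); ring.
Qed.

Lemma energy_increment_le (k0 k1 a b b1 p0 p1 x tau : R) (u v w : R) :
  `|k1 - k0 - 2 * tau * a| <= u -> `|a - p1 + b| <= v -> `|b1| <= w -> 0 <= tau ->
  `|(k1 + (x + tau * b + tau * (b + tau * b1)) - 2 * (p0 + tau * p1)) - (k0 + x - 2 * p0)|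
   <= u + 2 * tau * v + tau ^+ 2 * w.
Proof.
move=> h1 h2 h3 t0.
have -> : (k1 + (x + tau * b + tau * (b + tau * b1)) - 2 * (p0 + tau * p1)) - (k0 + x - 2 * p0)
  = (k1 - k0 - 2 * tau * a) + 2 * tau * (a - p1 + b) + tau ^+ 2 * b1 by ring.
have t2 : 0 <= 2 * tau by rewrite mulr_ge0.
apply: le_trans (ler_normD _ _) _; apply: lerD; last first.
  by rewrite normrM ger0_norm ?sqr_ge0// ler_wpM2l// sqr_ge0.
apply: le_trans (ler_normD _ _) _; apply: lerD => //.
by rewrite normrM (ger0_norm t2) ler_wpM2l.
Qed.

(** One step contributes three errors: that of [kinetic_step], that of [momentum_sum] tested with
    the current displacement, and the quadratic term tau^2 B(H, H). The factors 3 and 9 count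
    components and entries of the gradient. *)
Lemma energy_discrete tau n b eps M : 0 < tau -> 0 < eps -> n%:R * tau <= b -> 0 <= M ->
  (forall i t, 0 <= t <= b -> nrm m (U i t) <= M) ->
  (forall i t, 0 <= t <= b -> nrm m (V i t) <= M) ->
  (forall i j t, 0 <= t <= b -> nrm m (H i j t) <= M) ->
  (forall i j t, 0 <= t <= b -> nrm m (S i j t) <= M) ->
  (forall k, (k < n)%N -> forall i j s s', k%:R * tau <= s <= k.+1%:R * tau ->
     k%:R * tau <= s' <= k.+1%:R * tau ->
     nrm m (fun x => S i j s x - S i j s' x) <= eps) ->
  (forall k, (k < n)%N -> forall i, nrm m (fun x =>
     U i (k.+1%:R * tau) x - U i (k%:R * tau) x - tau * V i (k%:R * tau) x) <= tau * eps) ->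
  `|energy tau n - kinetic 0| <= n%:R * (C * (2 * M * (tau * eps) + (tau * M + tau * eps) ^+ 2) *+ 3
     + 2 * tau * (b * (eps * (M *+ 9))) + tau ^+ 2 * (M ^+ 2 *+ 9)).
Proof.
move=> tau0 eps0 nb M0 UM VM HM SM; elim: n nb => [|n IH] nb osc vel.
  rewrite mul0r /energy mul0r big1 ?mulr0 ?subr0 => [|i _]; last exact: dot0r.
  rewrite /elastic_form big1 ?addr0 ?subrr ?normr0// => i _.
  by rewrite big1// => j _; exact: dot0r.
have ntb : n%:R * tau <= b by apply: le_trans nb; rewrite ler_wpM2r ?(ltW tau0)// ler_nat.
have {IH} := IH ntb (fun k kn => osc k (leqW kn)) (fun k kn => vel k (leqW kn)).
set t := n%:R * tau; have tb : 0 <= t <= b by rewrite mulr_ge0 ?(ltW tau0).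
have R2 i j : L2 m (riemann tau (H i j) n) by exact: riemann_L2.
have RS2 i j : L2 m (riemann tau (H i j) n.+1) by exact: riemann_L2.
have RU i : L2 m (riemann tau (U i) n) by exact: riemann_L2.
set K := (X in n%:R * X) => h.
suff : `|energy tau n.+1 - energy tau n| <= K.
  move=> h'; rewrite -natr1 mulrDl mul1r.
  rewrite (_ : _ - _ = (energy tau n - kinetic 0) + (energy tau n.+1 - energy tau n)); last by ring.
  by apply: le_trans (ler_normD _ _) _; rewrite lerD.
have B1 : B (fun i j => riemann tau (H i j) n.+1) (fun i j => riemann tau (H i j) n.+1) =
    B (fun i j => riemann tau (H i j) n) (fun i j => riemann tau (H i j) n)
    + tau * B (fun i j => riemann tau (H i j) n) (fun i j => H i j t)
    + tau * (B (fun i j => riemann tau (H i j) n) (fun i j => H i j t) + tau *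
      B (fun i j => H i j t) (fun i j => H i j t)).
  have H2t i j : L2 m (H i j t) by [].
  rewrite (elastic_formDZ lamb mu0 tau R2 H2t RS2).
  rewrite (elastic_formC lamb mu0 R2 RS2) (elastic_formC lamb mu0 H2t RS2).
  rewrite (elastic_formDZ lamb mu0 tau R2 H2t R2) (elastic_formDZ lamb mu0 tau R2 H2t H2t).
  by rewrite (elastic_formC lamb mu0 H2t R2).
have P1 : \sum_i dot m (fun x => rho x * V i 0 x) (riemann tau (U i) n.+1) =
    \sum_i dot m (fun x => rho x * V i 0 x) (riemann tau (U i) n) +
    tau * \sum_i dot m (fun x => rho x * V i 0 x) (U i t).
  rewrite mulr_sumr -big_split; apply: eq_bigr => i _.
  have r2 := L2_rho mrho rhoC (V2 i 0).
  by rewrite /= (dotDr (RU i) (L2Z tau (U2 i t)) r2) (dotZr tau (U2 i t) r2).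
rewrite /energy B1 P1 /K.
apply: (energy_increment_le (a := \sum_i dot m (fun x => rho x * V i t x) (U i t))); last exact: ltW.
- rewrite /kinetic mulr_sumr -!sumrB; apply: le_trans (ler_norm_sum _ _ _) _.
  apply: (@le_trans _ _ (\sum_(i < 3) C * (2 * M * (tau * eps) + (tau * M + tau * eps) ^+ 2))); last first.
    by rewrite sumr_const card_ord.
  apply: ler_sum => i _.
  apply: le_trans (kinetic_step mrho rhoC C0 (U2 i t) (U2 i _) (V2 i t) (ltW tau0)) _.
  have v := vel n (ltnSn n) i; have um := UM i t tb; have vm := VM i t tb.
  rewrite ler_wpM2l// lerD//.
    by rewrite ler_pM ?mulr_ge0 ?nrm_ge0// ler_wpM2l.
  rewrite ler_sqr ?nnegrE ?addr_ge0 ?mulr_ge0 ?nrm_ge0 ?(ltW tau0) ?(ltW eps0)// lerD// ler_wpM2l//.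
  exact: ltW.
- have h3 := momentum_sum tau0 (fun k kn => osc k (leqW kn)) (fun i => elastic_H1 EP i t) (fun i j => H2 i j t).
  apply: le_trans h3 _; rewrite mulrA ler_pM ?mulr_ge0 ?(ltW tau0) ?(ltW eps0)//.
    by apply: sumr_ge0 => i _; apply: sumr_ge0 => j _; exact: nrm_ge0.
  rewrite ler_wpM2l ?(ltW eps0)//.
  apply: (@le_trans _ _ (\sum_(i < 3) \sum_(j < 3) M)); last by rewrite !sumr_const !card_ord -mulrnA.
  by apply: ler_sum => i _; apply: ler_sum => j _; exact: HM.
- apply: le_trans (ler_norm_sum _ _ _) _.
  apply: (@le_trans _ _ (\sum_(i < 3) \sum_(j < 3) M ^+ 2)); last by rewrite !sumr_const !card_ord -mulrnA.
  apply: ler_sum => i _; apply: le_trans (ler_norm_sum _ _ _) _; apply: ler_sum => j _.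
  have S2 : L2 m (S i j t) by exact: (proj1 (stress_path lamb mu0 (elastic_H EP) i j) t).
  apply: le_trans (cauchy_schwarz S2 (H2 i j t)) _.
  by rewrite expr2 ler_pM ?nrm_ge0 ?SM ?HM.
Qed.

(** On [0, b] the paths are bounded and uniformly continuous, so the error of a step of length b / n
    is o(1 / n), and the n steps together contribute o(1). *)
Lemma energy_identity b eps : 0 < b -> 0 < eps ->
  \forall n \near \oo, `|energy (b / n%:R) n - kinetic 0| <= eps.
Proof.
move=> b0 eps0.
have [M1 M10 UM] := pathL2_bounded_fin b (elastic_U EP).
have [M2 M20 VM] := pathL2_bounded_fin b (elastic_V EP).
pose HH (k : 'I_3 * 'I_3) := H k.1 k.2.
have [M3 M30 HM] : exists2 M, 0 <= M & forall i j t, 0 <= t <= b -> nrm m (H i j t) <= M.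
  have K i : exists M, 0 <= M /\ forall j t, 0 <= t <= b -> nrm m (H i j t) <= M.
    by have [M ? ?] := pathL2_bounded_fin b (elastic_H EP i); exists M.
  have [f Hf] := choice K; exists (\sum_i f i); first by apply: sumr_ge0 => i _; have [] := Hf i.
  move=> i j t tb; have [_ h] := Hf i; apply: le_trans (h j t tb) _.
  by rewrite (bigD1 i)//= lerDl; apply: sumr_ge0 => k _; have [] := Hf k.
have Spath := stress_path lamb mu0 (elastic_H EP).
have [M4 M40 SM] : exists2 M, 0 <= M & forall i j t, 0 <= t <= b -> nrm m (S i j t) <= M.
  have K i : exists M, 0 <= M /\ forall j t, 0 <= t <= b -> nrm m (S i j t) <= M.
    by have [M ? ?] := pathL2_bounded_fin b (Spath i); exists M.
  have [f Hf] := choice K; exists (\sum_i f i); first by apply: sumr_ge0 => i _; have [] := Hf i.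
  move=> i j t tb; have [_ h] := Hf i; apply: le_trans (h j t tb) _.
  by rewrite (bigD1 i)//= lerDl; apply: sumr_ge0 => k _; have [] := Hf k.
pose M := M1 + M2 + M3 + M4.
have M0 : 0 <= M by rewrite !addr_ge0.
pose K : R := C * (2 * M + (M + 1) ^+ 2) *+ 3 + 2 * (b * (M *+ 9)) + M ^+ 2 *+ 9.
have K0 : 0 <= K.
  apply: addr_ge0; last by apply: mulrn_wge0; exact: sqr_ge0.
  apply: addr_ge0.
    by apply: mulrn_wge0; apply: mulr_ge0 => //; apply: addr_ge0; [exact: mulr_ge0|exact: sqr_ge0].
  by apply: mulr_ge0 => //; apply: mulr_ge0; [exact: ltW|exact: mulrn_wge0].
have bK : 0 < b * K + 1 by rewrite ltr_wpDl// mulr_ge0// ltW.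
(* The total error will be at most b * e * K; this choice makes it at most [eps]. *)
pose e := Num.min 1 (eps / (b * K + 1)).
have e0 : 0 < e by rewrite lt_min ltr01 divr_gt0.
have e1 : e <= 1 by rewrite ge_min lexx.
have eK : e <= eps / (b * K + 1) by rewrite ge_min lexx orbT.
clearbody e.
have [d1 d10 vel] : exists2 del, 0 < del & forall i s t, 0 <= s -> s <= t -> t <= b -> t < s + del ->
    nrm m (fun x => U i t x - U i s x - (t - s) * V i s x) <= (t - s) * e.
  apply: (@fin_del R 3 (fun i del => forall s t, 0 <= s -> s <= t -> t <= b -> t < s + del ->
    nrm m (fun x => U i t x - U i s x - (t - s) * V i s x) <= (t - s) * e)).
    by move=> i del del' dd h s t s0 st tb tdel; apply: h => //; apply: lt_le_trans tdel _; rewrite lerD2l.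
  by move=> i; exact: elastic_velocity EP i b e e0.
have [d2 d20 osc] : exists2 del, 0 < del & forall i j s t, 0 <= t <= b -> `|s - t| < del ->
    nrm m (fun x => S i j s x - S i j t x) <= e.
  apply: (@fin_del R 3 (fun i del => forall j s t, 0 <= t <= b -> `|s - t| < del ->
    nrm m (fun x => S i j s x - S i j t x) <= e)).
    by move=> i del del' dd h j s t tb st; apply: h => //; exact: lt_le_trans st dd.
  move=> i; apply: (@fin_del R 3 (fun j del => forall s t, 0 <= t <= b -> `|s - t| < del ->
    nrm m (fun x => S i j s x - S i j t x) <= e)).
    by move=> j del del' dd h s t tb st; apply: h => //; exact: lt_le_trans st dd.
  by move=> j; exact: pathL2_uniform.
(* Besides the two moduli of continuity, steps are kept shorter than [e], as [energy_const]
   requires. *)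
pose del := Num.min e (Num.min d1 d2).
have del0 : 0 < del by rewrite !lt_min e0 d10.
have bdel : \forall n \near \oo, (0 < n)%N /\ b / n%:R < del.
  near=> n; have n0 : (0 < n)%N by near: n; exists 1%N.
  split=> //; rewrite ltr_pdivrMr ?ltr0n// -ltr_pdivrMl//; near: n.
  exact: nbhs_infty_gtr.
apply: filterS bdel => n [n0]; rewrite !lt_min => /and3P[te t1 t2].
set tau := b / n%:R; have tau0 : 0 < tau by rewrite divr_gt0 ?ltr0n.
have ntb : n%:R * tau = b by rewrite mulrC divfK// pnatr_eq0 -lt0n.
have kb k : (k <= n)%N -> 0 <= k%:R * tau <= b.
  by move=> kn; rewrite mulr_ge0 ?(ltW tau0)//= -ntb ler_wpM2r ?(ltW tau0)// ler_nat.
have kS k : k.+1%:R * tau = k%:R * tau + tau by rewrite -natr1 mulrDl mul1r.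
apply: le_trans (@energy_discrete tau n b e M tau0 e0 _ M0 _ _ _ _ _ _) _.
- by rewrite ntb.
- by move=> i t tb; apply: le_trans (UM i t tb) _; rewrite /M -!addrA lerDl !addr_ge0.
- move=> i t tb; apply: le_trans (VM i t tb) _; rewrite /M; lra.
- move=> i j t tb; apply: le_trans (HM i j t tb) _; rewrite /M; lra.
- move=> i j t tb; apply: le_trans (SM i j t tb) _; rewrite /M; lra.
- move=> k kn i j s s' /andP[ks sk] /andP[ks' sk']; have /andP[k0 _] := kb k (ltnW kn).
  have /andP[_ kb'] := kb k.+1 kn.
  apply: osc; first by rewrite (le_trans k0 ks') (le_trans sk').
  apply: le_lt_trans t2; rewrite -/tau ler_distl; rewrite kS in sk sk'; apply/andP; split.
    by rewrite lerBlDr; apply: le_trans sk' _; rewrite lerD2r.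
  by apply: le_trans sk _; rewrite lerD2r.
- move=> k kn i; have /andP[k0 _] := kb k (ltnW kn); have /andP[_ kb'] := kb k.+1 kn.
  have := vel i (k%:R * tau) (k.+1%:R * tau) k0 _ kb' _.
  by rewrite kS addrAC subrr add0r lerDl ltrD2l; apply => //; exact: ltW.
have q := energy_const b C0 M0 e0 e1 tau0 (ltW te).
rewrite -/K in q.
apply: le_trans (ler_wpM2l (ler0n R n) q) _.
clearbody K; rewrite (mulrA n%:R tau) ntb (mulrCA b e).
apply: le_trans (ler_wpM2r _ eK) _; first by rewrite mulr_ge0// ltW.
by rewrite mulrAC ler_pdivrMr// ler_wpM2l ?(ltW eps0)// lerDl.
Unshelve. all: by end_near. Qed.

End energy.

(** * Hardy's inequality and time averages of solutions *)

Lemma hardy_square d (T : measurableType d) (R : realType) (m : {measure set T -> \bar R})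
  (D W : 'I_3 -> T -> R) (p : 'I_3 -> R) (c : R) :
  (forall j, L2 m (D j)) -> (forall j, L2 m (W j)) ->
  (forall j, 2 * dot m (D j) (W j) = - p j) ->
  \sum_j (p j - dot m (W j) (W j)) = c -> c <= \sum_j dot m (D j) (D j).
Proof.
move=> D2 W2 Ep <-; apply: ler_sum => j _.
have := sqr_ge0 (nrm m (fun x => D j x + W j x)); rewrite (nrmD_sqr (D2 j) (W2 j)) Ep.
by move: (dot m _ _) (dot m _ _) => a b h; lra.
Qed.

Lemma dot_fieldB d (T : measurableType d) (R : realType) (m : {measure set T -> \bar R})
  (f a b : T -> R) : L2 m f -> L2 m (fun x => a x * f x) -> L2 m (fun x => b x * f x) ->
  dot m f (fun x => a x * f x) - dot m (fun x => b x * f x) (fun x => b x * f x) =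
  dot m f (fun x => (a x - b x ^+ 2) * f x).
Proof.
move=> f2 af bf; have i1 := dot_integrable f2 af; have i2 := dot_integrable bf bf.
rewrite /dot -RintegralB//; apply: eq_Rintegral => x _; ring.
Qed.

Lemma ae_eq_Rintegral d (T : measurableType d) (R : realType) (m : {measure set T -> \bar R})
  (f g : T -> R) : m.-integrable setT (EFin \o f) -> m.-integrable setT (EFin \o g) ->
  {ae m, forall x, f x = g x} -> (\int[m]_x f x = \int[m]_x g x)%R.
Proof.
move=> f1 g1 fg; rewrite /Rintegral; congr fine; apply: ae_eq_integral => //.
- exact: measurable_int f1.
- exact: measurable_int g1.
- by apply: filterS fg => x /= ->.
Qed.

Lemma dot_weight_ge0 d (T : measurableType d) (R : realType) (m : {measure set T -> \bar R})
  (rho f : T -> R) C : measurable_fun setT rho -> {ae m, forall x, `|rho x| <= C} ->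
  {ae m, forall x, 0 <= rho x} -> L2 m f -> 0 <= dot m (fun x => rho x * f x) f.
Proof.
move=> mrho rhoC rho0 f2.
have r2 := L2M mrho rhoC f2.
have mr : measurable_fun setT (fun x => `|rho x|) by exact: measurableT_comp.
have r2' : L2 m (fun x => `|rho x| * f x).
  by apply: (L2M mr _ f2); apply: filterS rhoC => x; rewrite normr_id; exact: id.
rewrite (ae_dot r2 f2 r2' f2).
- by apply: Rintegral_ge0 => x _; rewrite -mulrA mulr_ge0// -expr2 sqr_ge0.
- by apply: filterS rho0 => x r0; rewrite ger0_norm.
- by apply: aeW.
Qed.

Section hardy.
Context (R : realType).
Local Notation mR := (measurableTypeR R).
Local Notation T3 := (mR * mR * mR)%type.
Local Notation mu := (@lebesgue3 R).
Local Notation test := (@test_function R (R3 R) setT).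
Local Notation e_ j := (basis3 R j).

Definition coord (j : 'I_3) (x : R3 R) : R := [:: x.1.1; x.1.2; x.2]`_j.

Lemma smooth_coordj j : smooth (coord j).
Proof.
case: j => [[|[|[|//]]] ?].
- exact: (smooth_comp (@smooth_id R) (@is_diff_coord1 R)).
- exact: (smooth_comp (@smooth_id R) (@is_diff_coord2 R)).
- exact: (smooth_comp (@smooth_id R) (@is_diff_coord3 R)).
Qed.

Lemma derive_coord j x v : 'D_v (coord j) x = coord j v.
Proof.
have D1 (a y : R) : 'D_a (id : R -> R) y = a.
  by rewrite derive_smooth1 ?derive_id ?mulr1//; exact: smooth_id.
case: j => [[|[|[|//]]] ?].
- exact: etrans (derive_smooth_comp x v (@smooth_id R) (@is_diff_coord1 R)) (D1 _ _).
- exact: etrans (derive_smooth_comp x v (@smooth_id R) (@is_diff_coord2 R)) (D1 _ _).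
- exact: etrans (derive_smooth_comp x v (@smooth_id R) (@is_diff_coord3 R)) (D1 _ _).
Qed.

Lemma coord_basis i j : coord i (e_ j) = (i == j)%:R.
Proof. by case: i => [[|[|[|//]]] ?]; case: j => [[|[|[|//]]] ?]. Qed.

Definition weight (x : R3 R) : R := 1 + \sum_j coord j x * coord j x.

Lemma weight_ge1 x : 1 <= weight x.
Proof. by rewrite lerDl; apply: sumr_ge0 => j _; rewrite -expr2 sqr_ge0. Qed.

Lemma weight_neq0 x : weight x != 0.
Proof. by rewrite gt_eqF// (lt_le_trans ltr01 (weight_ge1 x)). Qed.

Lemma smooth_weight : smooth weight.
Proof.
apply: smoothD; first exact: smooth_cst.
by apply: smooth_sum => j; apply: smoothM; exact: smooth_coordj.
Qed.

Lemma derive_weight j x : 'D_(e_ j) weight x = 2 * coord j x.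
Proof.
have s2 i : smooth (fun x => coord i x * coord i x) by apply: smoothM; exact: smooth_coordj.
rewrite derive_smoothD ?derive_cst ?add0r; [|exact: smooth_cst|exact: smooth_sum].
rewrite derive_smooth_sum// (bigD1 j)//= big1 ?addr0 => [|i ij].
  rewrite derive_smoothM; [|exact: smooth_coordj..].
  by rewrite derive_coord coord_basis eqxx mulr1 mulr_natl mulr2n.
rewrite derive_smoothM; [|exact: smooth_coordj..].
by rewrite derive_coord coord_basis (negbTE ij) mulr0 addr0.
Qed.

Definition radial j (x : R3 R) : R := coord j x * (weight x)^-1.

Lemma smooth_radial j : smooth (radial j).
Proof.
apply: smoothM; [exact: smooth_coordj|apply: smoothV; [exact: smooth_weight|exact: weight_neq0]].
Qed.

Lemma derive_radial j x :
  'D_(e_ j) (radial j) x = (weight x)^-1 - 2 * (coord j x) ^+ 2 * (weight x)^-1 ^+ 2.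
Proof.
have sV : smooth (fun x => (weight x)^-1).
  by apply: smoothV; [exact: smooth_weight|exact: weight_neq0].
rewrite derive_smoothM//; last exact: smooth_coordj.
rewrite derive_coord coord_basis eqxx deriveV ?weight_neq0//; last first.
  exact: smooth_derivable smooth_weight.
rewrite derive_weight /GRing.scale/= exprVn; ring.
Qed.

(** For X = x / (1 + |x|^2) and w = 1 + |x|^2, div X - |X|^2 is 3 / w - 3 |x|^2 / w^2 with |x|^2 = w
    - 1: the terms in 1 / w cancel precisely in dimension three. *)
Lemma sum_radial x :
  \sum_j ('D_(e_ j) (radial j) x - radial j x ^+ 2) = 3 * (weight x)^-1 ^+ 2.
Proof.
rewrite (eq_bigr (fun j => (weight x)^-1 - 3 * (weight x)^-1 ^+ 2 * (coord j x * coord j x))); last first.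
  by move=> j _; rewrite derive_radial /radial; ring.
rewrite sumrB sumr_const card_ord -mulr_sumr.
have -> : \sum_j coord j x * coord j x = weight x - 1 by rewrite /weight addrAC subrr add0r.
have w0 := weight_neq0 x; move: (weight x) w0 => w w0; rewrite -mulr_natl.
by field.
Qed.

(* Completing the square with the field x / (1 + |x|^2). *)
Lemma hardy_test phi : test phi ->
  3 * dot mu (fun x => (weight x)^-1 * phi x) (fun x => (weight x)^-1 * phi x) <=
  \sum_j dot mu ('D_(e_ j) phi) ('D_(e_ j) phi).
Proof.
move=> tphi; have sphi := test_smooth tphi; have p2 := test_L2 tphi.
have sV : smooth (fun x => (weight x)^-1).
  by apply: smoothV; [exact: smooth_weight|exact: weight_neq0].
have tW j : test (fun x => radial j x * phi x) by apply: testMl => //; exact: smooth_radial.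
have tD j : test (fun x => 'D_(e_ j) (radial j) x * phi x).
  by apply: testMl => //; apply: smooth_derive; exact: smooth_radial.
have tV : test (fun x => (weight x)^-1 * phi x) by exact: testMl.
have D2 j : L2 mu ('D_(e_ j) phi) by exact/test_L2/test_derive.
apply: (@hardy_square _ T3 R mu (fun j => 'D_(e_ j) phi) (fun j x => radial j x * phi x)
   (fun j => dot mu phi (fun x => 'D_(e_ j) (radial j) x * phi x)) _ D2 (fun j => test_L2 (tW j))).
- move=> j; have e1 := dot_derive (e_ j) tphi (smoothM (smooth_radial j) sphi).
  have E : 'D_(e_ j) (fun x => radial j x * phi x) =
      fun x => radial j x * 'D_(e_ j) phi x + 'D_(e_ j) (radial j) x * phi x.
    by apply/funext => x; rewrite derive_smoothM// ?(mulrC (phi x))//; exact: smooth_radial.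
  have t1 : test (fun x => radial j x * 'D_(e_ j) phi x).
    by apply: testMl; [exact: smooth_radial|exact: test_derive].
  have e2 := dotDr (test_L2 t1) (test_L2 (tD j)) p2.
  have e3 : dot mu phi (fun x => radial j x * 'D_(e_ j) phi x) =
      dot mu ('D_(e_ j) phi) (fun x => radial j x * phi x).
    by apply: eq_Rintegral => x _; ring.
  have sc (a b b' c : R) : a = - b -> b = b' + c -> b' = a -> 2 * a = - c by move=> *; lra.
  apply: (sc _ _ _ _ e1 _ e3); apply: etrans e2; by rewrite E.
- rewrite (eq_bigr (fun j => dot mu phi (fun x => ('D_(e_ j) (radial j) x - radial j x ^+ 2) * phi x))).
    have F2 j : L2 mu (fun x => ('D_(e_ j) (radial j) x - radial j x ^+ 2) * phi x).
      apply/test_L2/testMl => //; apply: smoothB; first by apply: smooth_derive; exact: smooth_radial.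
      by apply: smoothM; exact: smooth_radial.
    have e1 := dot_sumr (index_enum 'I_3) F2 p2.
    have e2 := dotZr 3 (test_L2 tV) (test_L2 tV).
    apply: etrans (esym e1) (etrans _ e2); apply: eq_Rintegral => x _.
    rewrite -mulr_suml sum_radial; ring.
  by move=> j _; exact: (dot_fieldB p2 (test_L2 (tD j)) (test_L2 (tW j))).
Qed.

Lemma coord_le j x : `|coord j x| <= `|x|.
Proof.
case: x => [[a b] c]; rewrite !prod_normE/=.
by case: j => [[|[|[|//]]] ?]; rewrite /coord/= !le_max ?lexx ?orbT.
Qed.

Lemma weight_le N x : `|x| <= N -> weight x <= 1 + N ^+ 2 *+ 3.
Proof.
move=> xN; rewrite lerD2l.
apply: (@le_trans _ _ (\sum_(j < 3) N ^+ 2)); last by rewrite sumr_const card_ord.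
apply: ler_sum => j _; rewrite -expr2 -real_normK ?num_real//.
by rewrite ler_sqr ?nnegrE// ?(le_trans _ xN)// (le_trans (coord_le j x)).
Qed.

(** Divide [w] and multiply [r] by the weight: Hardy's inequality bounds the first, and the support
    of [r] the second. Only the gradient of [w] appears on the right. The constant is the bound of
    the weight on a ball of the maximum norm. *)
Lemma hardy_dot N r w g : 0 <= N -> L2 mu r -> {ae mu, forall x : T3, N < `|x : R3 R| -> r x = 0} -> strongH1 w g ->
  `|dot mu r w| <= (1 + N ^+ 2 *+ 3) * nrm mu r * Num.sqrt (\sum_j dot mu (g j) (g j)).
Proof.
move=> N0 r2 r0 [u [tu cu cg]].
have w2 : L2 mu w by have [] := cu.
have g2 j : L2 mu (g j) by have [] := cg j.
have sV : smooth (fun x => (weight x)^-1).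
  by apply: smoothV; [exact: smooth_weight|exact: weight_neq0].
set K := 1 + _; have K0 : 0 <= K by rewrite addr_ge0 ?mulrn_wge0 ?sqr_ge0.
have S n : `|dot mu (u n) r| <= K * nrm mu r * Num.sqrt (\sum_j dot mu ('D_(e_ j) (u n)) ('D_(e_ j) (u n))).
  have tV : test (fun x => (weight x)^-1 * u n x) by exact: testMl.
  have V2 := test_L2 tV.
  (* The indicator makes the multiplier of [r] bounded everywhere; almost everywhere it does not
     change the product. *)
  have wr2 : L2 mu (fun x => (\1_[set y : T3 | `|y : R3 R| <= N] x * weight x) * r x).
    apply: (@L2M _ _ _ _ K) => //; last first.
      apply: aeW => x; rewrite indicE; have [xN|_] := boolP (x \in _); last by rewrite mul0r normr0.
      rewrite mul1r ger0_norm ?(le_trans ler01 (weight_ge1 _))//; apply: weight_le.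
      by move: xN; rewrite inE.
    apply: measurable_funM; last exact: continuous_measurable3 (smooth_continuous smooth_weight).
    apply: measurable_indic; rewrite (_ : [set _ | _] = box (- N, - N, - N) (N, N, N)).
      exact: measurable_box.
    by apply/seteqP; split=> x /norm3_box.
  have E : dot mu (u n) r = dot mu (fun x => (\1_[set y : T3 | `|y : R3 R| <= N] x * weight x) * r x)
     (fun x => (weight x)^-1 * u n x).
    have i1 := dot_integrable (test_L2 (tu n)) r2; have i2 := dot_integrable wr2 V2.
    apply: ae_eq_Rintegral => //.
    apply: ae_imp r0 => x h; have [xN|xN] := leP `|x : R3 R| N.
      rewrite indicE mem_set// mul1r; have := weight_neq0 x.
      by move: (weight x) (u n x) (r x) => w' a b' w0; field.
    by rewrite h// !mulr0 mul0r.
  rewrite E; apply: le_trans (cauchy_schwarz wr2 V2) _; apply: ler_pM; rewrite ?nrm_ge0//.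
    rewrite -(ger0_norm K0) -nrmZ//; apply: le_nrm => // [|x]; first exact: L2Z.
    rewrite !normrM ler_wpM2r// (ger0_norm K0) (ger0_norm (le_trans ler01 (weight_ge1 x))).
    rewrite indicE; have [xN|_] := boolP (x \in _); last by rewrite normr0 mul0r.
    by rewrite normr1 mul1r; apply: weight_le; move: xN; rewrite inE.
  rewrite /nrm ler_wsqrtr//; apply: le_trans (hardy_test (tu n)).
  by rewrite ler_peMl ?dot_ge0// ler1n.
have c1 : `|dot mu (u n) r| @[n --> \oo] --> `|dot mu w r| by apply: cvg_norm; exact: cvgL2_dot.
have c2 : (\sum_j dot mu ('D_(e_ j) (u n)) ('D_(e_ j) (u n))) @[n --> \oo] -->
    \sum_j dot mu (g j) (g j).
  by apply: cvg_big => [|j _]; [exact: add_continuous|exact: cvgL2_dot2].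
have c3 : K * nrm mu r * Num.sqrt (\sum_j dot mu ('D_(e_ j) (u n)) ('D_(e_ j) (u n))) @[n --> \oo] -->
    K * nrm mu r * Num.sqrt (\sum_j dot mu (g j) (g j)).
  by apply: cvgMr; apply: continuous_cvg c2; exact: sqrt_continuous.
rewrite dotC; apply: (ler_cvg_to c1 c3); exact: nearW.
Qed.

Lemma strongH1_sym2 w g w' g' i j : strongH1 w g -> strongH1 w' g' ->
  dot mu (g i) (g' j) = dot mu (g j) (g' i).
Proof.
move=> wg [u [tu cu cg]].
have g2 k : L2 mu (g k) by have [_] := strongH1_L2 wg.
have c1 := cvgL2_dot (cg j) (g2 i); have c2 := cvgL2_dot (cg i) (g2 j).
have E n : dot mu ('D_(e_ j) (u n)) (g i) = dot mu ('D_(e_ i) (u n)) (g j).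
  by rewrite dotC [RHS]dotC; exact: strongH1_sym wg (tu n).
rewrite dotC [RHS]dotC; move: c1; rewrite (funext E) => c1.
by apply: (cvg_unique _ c1 c2); exact: Rhausdorff.
Qed.

Lemma strongH1_riemann tau (w : R -> R3 R -> R) (g : 'I_3 -> R -> R3 R -> R) n :
  (forall t, strongH1 (w t) (fun j => g j t)) ->
  strongH1 (riemann tau w n) (fun j => riemann tau (g j) n).
Proof.
move=> wg; elim: n => [|n IH]; first exact: strongH1_0.
exact: strongH1D IH (strongH1Z tau (wg (n%:R * tau))).
Qed.

End hardy.

Lemma coercive_scalar (R : realDomainType) (mu0 lamb s q : R) : 0 < mu0 -> 0 < lamb + 2 * mu0 ->
  0 <= q -> q <= s -> Num.min mu0 (lamb + 2 * mu0) * s <= mu0 * s - mu0 * q + (lamb + 2 * mu0) * q.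
Proof.
move=> m0 l0 q0 qs; set l := lamb + _ in l0 *; have sq : 0 <= s - q by rewrite subr_ge0.
rewrite -subr_ge0; have [ml|ml] := leP mu0 l.
  by rewrite (_ : _ - _ = (l - mu0) * q); [rewrite mulr_ge0// subr_ge0|ring].
by rewrite (_ : _ - _ = (mu0 - l) * (s - q)); [rewrite mulr_ge0// subr_ge0 ltW|ring].
Qed.

(** Let s be the squared norm of the gradient and q that of the divergence. By the symmetry
    hypothesis the transposed products sum to q, and the sum of the squares of A_ij - A_ji, equal to
    2 s - 2 q, is nonnegative. Hence q <= s, and the form mu (s - q) + (lam + 2 mu) q is at least
    the smaller coefficient times s. *)
Lemma elastic_form_coercive d (T : measurableType d) (R : realType) (m : {measure set T -> \bar R})
  (lamb mu0 : R) (A : 'I_3 -> 'I_3 -> T -> R) : 0 < mu0 -> 0 < lamb + 2 * mu0 ->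
  (forall i j, L2 m (A i j)) -> (forall i j, dot m (A j i) (A i j) = dot m (A j j) (A i i)) ->
  Num.min mu0 (lamb + 2 * mu0) * (\sum_i \sum_j dot m (A i j) (A i j)) <=
  elastic_form m lamb mu0 A A.
Proof.
move=> m0 l0 A2 sym; rewrite elastic_formE//.
have -> : \sum_i \sum_j dot m (A j i) (A i j) = \sum_i \sum_k dot m (A k k) (A i i).
  by apply: eq_bigr => i _; apply: eq_bigr => j _; exact: sym.
have tr2 : L2 m (fun x => \sum_k A k k x) by exact: L2_sum.
have F2 i : L2 m (A i i) by [].
have q0 : 0 <= \sum_i \sum_k dot m (A k k) (A i i).
  rewrite (eq_bigr (fun i => dot m (fun x => \sum_k A k k x) (A i i))); last first.
    by move=> i _; rewrite dot_suml.
  by rewrite -dot_sumr// dot_ge0.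
apply: coercive_scalar => //.
have h : 0 <= \sum_i \sum_j nrm m (fun x => A i j x - A j i x) ^+ 2.
  by apply: sumr_ge0 => i _; apply: sumr_ge0 => j _; exact: sqr_ge0.
rewrite (eq_bigr (fun i => (\sum_j dot m (A i j) (A i j) - 2 * \sum_j dot m (A j j) (A i i))
   + \sum_j dot m (A j i) (A j i))) in h; last first.
  move=> i _; rewrite mulr_sumr -sumrB -big_split; apply: eq_bigr => j _ /=.
  by rewrite (nrmB_sqr (A2 i j) (A2 j i)) (dotC _ (A i j)) sym.
rewrite big_split sumrB -mulr_sumr in h.
have ex : \sum_i \sum_j dot m (A j i) (A j i) = \sum_i \sum_j dot m (A i j) (A i j).
  by rewrite exchange_big.
rewrite /= ex in h.
by move: (\sum_i \sum_j _) (\sum_i \sum_j _) h => s q /=; lra.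
Qed.

Section riemann_bounded.
Context (R : realType).
Local Notation mR := (measurableTypeR R).
Local Notation T3 := (mR * mR * mR)%type.
Local Notation mu := (@lebesgue3 R).

Lemma quadratic_bound (z a c : R) : 0 <= z -> 0 <= a -> 0 <= c -> z ^+ 2 <= a + c * z -> z <= 1 + a + c.
Proof.
move=> z0 a0 c0 h; have [z1|z1] := leP z 1; first by rewrite -addrA; apply: le_trans z1 _; rewrite lerDl addr_ge0.
have zp : 0 < z by exact: lt_trans z1.
rewrite -(ler_pM2r zp) -expr2; apply: le_trans h _; rewrite mulrDl lerD//.
by rewrite mulrDl mul1r; apply: (@le_trans _ _ (a * z)); [rewrite ler_peMr// ltW|rewrite lerDr].
Qed.

(** By the energy identity with precision 1, the elastic form B of the Riemann sum is at most a + c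
    sqrt(B), the linear term being controlled by Hardy's inequality. So sqrt(B) has a bound that
    does not involve the final time [b], and a second use of Hardy's inequality gives the pairing
    with [r]. *)
Lemma riemann_bounded (lamb mu0 : R) (rho : R3 R -> R) (C N : R) U V H : 0 < mu0 -> 0 < lamb + 2 * mu0 ->
  measurable_fun setT (rho : T3 -> R) -> {ae mu, forall x, 0 <= rho x <= C} -> 0 <= C -> 0 <= N ->
  elastic_path mu lamb mu0 (@strongH1 R) rho U V H ->
  (forall i, {ae mu, forall x : T3, N < `|x : R3 R| -> V i 0 x = 0}) ->
  exists2 Z, 0 <= Z & forall b, 0 < b -> \forall n \near \oo, forall i N' r, 0 <= N' -> L2 mu r ->
    {ae mu, forall x : T3, N' < `|x : R3 R| -> r x = 0} ->
    `|dot mu r (riemann (b / n%:R) (U i) n)| <= (1 + N' ^+ 2 *+ 3) * nrm mu r * Z.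
Proof.
move=> m0 l0 mrho rho0C C0 N0 EP VN.
have rhoC : {ae mu, forall x, `|rho x| <= C}.
  by apply: ae_imp rho0C => x /andP[? ?]; rewrite ger0_norm.
have V2 i t : L2 mu (V i t) by exact: (proj1 (elastic_V EP i) t).
have U2 i t : L2 mu (U i t) by exact: (proj1 (elastic_U EP i) t).
have H2 i j t : L2 mu (H i j t) by exact: (proj1 (elastic_H EP i j) t).
have P2 i : L2 mu (fun x => rho x * V i 0 x) by exact: L2M mrho rhoC (V2 i 0).
have PN i : {ae mu, forall x : T3, N < `|x : R3 R| -> rho x * V i 0 x = 0}.
  by apply: ae_imp (VN i) => x h /h ->; rewrite mulr0.
have kin0 t : 0 <= kinetic mu rho U t.
  apply: sumr_ge0 => i _; apply: (dot_weight_ge0 mrho rhoC) => //.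
  by apply: ae_imp rho0C => x /andP[].
set k := Num.min mu0 (lamb + 2 * mu0); have kp : 0 < k by rewrite lt_min m0.
set a := kinetic mu rho U 0 + 1.
set c := 2 * ((1 + N ^+ 2 *+ 3) * (\sum_i nrm mu (fun x => rho x * V i 0 x))) / Num.sqrt k.
have sk : 0 < Num.sqrt k by rewrite sqrtr_gt0.
have a0 : 0 <= a by rewrite addr_ge0.
have n0 : 0 <= 1 + N ^+ 2 *+ 3 by rewrite addr_ge0 ?mulrn_wge0 ?sqr_ge0.
have c0 : 0 <= c.
  rewrite !mulr_ge0 ?invr_ge0 ?(ltW sk)//; apply: sumr_ge0 => i _; exact: nrm_ge0.
exists ((1 + a + c) / Num.sqrt k); first by rewrite divr_ge0 ?addr_ge0 ?(ltW sk).
move=> b b0; have := energy_identity mrho rhoC C0 EP b0 (@ltr01 R).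
apply: filterS => n en.
set tau := b / n%:R in en *; set X := fun i => riemann tau (U i) n.
set D := fun i j => riemann tau (H i j) n.
have XD i : strongH1 (X i) (D i) by apply: strongH1_riemann => t; exact: elastic_H1 EP i t.
have D2 i j : L2 mu (D i j) by have [_] := strongH1_L2 (XD i).
set B := elastic_form mu lamb mu0 D D.
have coer : k * (\sum_i \sum_j dot mu (D i j) (D i j)) <= B.
  apply: elastic_form_coercive => // i j.
  exact: strongH1_sym2 (XD j) (XD i).
have dd0 i : 0 <= \sum_j dot mu (D i j) (D i j) by apply: sumr_ge0 => j _; exact: dot_ge0.
have B0 : 0 <= B.
  by apply: le_trans coer; rewrite mulr_ge0 ?(ltW kp)//; apply: sumr_ge0.
have grad i : Num.sqrt (\sum_j dot mu (D i j) (D i j)) <= Num.sqrt B / Num.sqrt k.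
  rewrite ler_pdivlMr// -sqrtrM ?dd0// ler_wsqrtr// mulrC; apply: le_trans coer.
  rewrite ler_wpM2l ?(ltW kp)// [leRHS](bigD1 i)//= lerDl; exact: sumr_ge0.
have hd i N' r : 0 <= N' -> L2 mu r -> {ae mu, forall x : T3, N' < `|x : R3 R| -> r x = 0} ->
    `|dot mu r (X i)| <= (1 + N' ^+ 2 *+ 3) * nrm mu r * (Num.sqrt B / Num.sqrt k).
  move=> N0' r2 rN; apply: le_trans (hardy_dot N0' r2 rN (XD i)) _.
  by rewrite ler_wpM2l// mulr_ge0 ?nrm_ge0// addr_ge0 ?mulrn_wge0 ?sqr_ge0.
suff zB : Num.sqrt B <= 1 + a + c.
  move=> i N' r N0' r2 rN; apply: le_trans (hd i N' r N0' r2 rN) _.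
  rewrite ler_wpM2l ?mulr_ge0 ?nrm_ge0 ?addr_ge0 ?mulrn_wge0 ?sqr_ge0//.
  by rewrite ler_wpM2r ?invr_ge0 ?(ltW sk).
apply: quadratic_bound => //; rewrite sqr_sqrtr//.
have px : `|\sum_i dot mu (fun x => rho x * V i 0 x) (X i)| <=
    (1 + N ^+ 2 *+ 3) * (\sum_i nrm mu (fun x => rho x * V i 0 x)) * (Num.sqrt B / Num.sqrt k).
  rewrite mulr_sumr mulr_suml; apply: le_trans (ler_norm_sum _ _ _) _.
  by apply: ler_sum => i _; exact: hd.
have -> : c * Num.sqrt B = 2 * ((1 + N ^+ 2 *+ 3) * (\sum_i nrm mu (fun x => rho x * V i 0 x)) * (Num.sqrt B / Num.sqrt k)).
  by rewrite /c -!mulrA; congr (_ * (_ * (_ * _))); rewrite mulrC.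
move: en px; rewrite /energy -/D -/X -/B -/tau /a.
move: (kin0 (n%:R * tau)) (kin0 0).
move: (kinetic _ _ _ _) (kinetic _ _ _ _) => k1 k2.
move: (\sum_i dot mu _ _) (_ * (Num.sqrt B / _)) => p q k10 k20.
rewrite !ler_norml => /andP[_ e1] /andP[_ e2]; lra.
Qed.

End riemann_bounded.

(** A quadratic remainder identifies the differential; the form [df] has to be a bundled linear map,
    which [lincomb] provides for convolutions. *)
Lemma differentiable_quadratic (R : realType) (V : normedModType R) (f : V -> R)
    (df : {linear V -> R}) (x : V) (C : R) : continuous df ->
  (forall h, `|h| <= 1 -> `|f (h + x) - f x - df h| <= C * `|h| ^+ 2) ->
  differentiable f x /\ forall v, 'D_v f x = df v.
Proof.
move=> cdf H.
have E : f \o shift x = cst (f x) + df +o_ 0 id.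
  apply/eqaddoP => e e0.
  have n0 : 0 < `|C| + 1 by rewrite ltr_wpDl.
  have m0 : 0 < Num.min 1 (e / (`|C| + 1)) by rewrite lt_min ltr01 divr_gt0.
  apply: filterS (nbhs0_lt m0) => h; rewrite lt_min => /andP[h1 he].
  rewrite !fctE/= opprD addrA; apply: le_trans (H h (ltW h1)) _.
  rewrite expr2 mulrA ler_wpM2r//; apply: le_trans (_ : (`|C| + 1) * `|h| <= _).
    by rewrite ler_wpM2r//; apply: le_trans (ler_norm _) _; rewrite lerDl.
  by rewrite mulrC -ler_pdivlMr// ltW.
have dE := diff_unique cdf E.
have dfx : differentiable f x.
  by apply/diff_locallyP; rewrite dE.
by split=> // v; rewrite deriveE// dE.
Qed.

Lemma L2_norm d (T : measurableType d) (R : realType) (m : {measure set T -> \bar R})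
  (f : T -> R) : L2 m f -> L2 m (fun x => `|f x|).
Proof.
move=> f2; apply: L2P; first by apply: measurableT_comp => //; exact: L2_measurable f2.
rewrite (_ : _ \o _ = EFin \o (fun x => f x ^+ 2)); first exact: L2_sqr.
by apply/funext => x /=; rewrite real_normK ?num_real.
Qed.

Lemma integrable_Rintegral d (T : measurableType d) (R : realType) (m : {measure set T -> \bar R})
  (f : T -> R) : m.-integrable setT (EFin \o f) ->
  (\int[m]_x (f x)%:E = (\int[m]_x f x)%R%:E)%E.
Proof. by move=> h; rewrite /Rintegral fineK//; exact: integrable_fin_num. Qed.

(** * Convolution and restriction of weak gradients to closed sets *)

Section schur_test.
Context d (T : measurableType d) (R : realType) (m : {sigma_finite_measure set T -> \bar R}).
Variables (K : T * T -> R) (c M : R).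
Hypotheses (mK : measurable_fun setT K) (KM : forall z, `|K z| <= M) (c0 : 0 <= c).
Hypothesis row_int : forall x, (\int[m]_y (`|K (x, y)|)%:E = c%:E)%E.
Hypothesis col_int : forall y, (\int[m]_x (`|K (x, y)|)%:E = c%:E)%E.

(** Splitting |K| into two square roots, the Cauchy-Schwarz inequality gives |g(x)|^2 <= c times the
    integral of |K(x, y)| f(y)^2 over y; Tonelli's theorem and the column integrals give the other
    factor c. Measurability of the image is a hypothesis; for convolutions it comes from
    smoothness. *)
Lemma schur_test f : L2 m f -> measurable_fun setT (fun x => dot m (fun y => K (x, y)) f) ->
  L2 m (fun x => dot m (fun y => K (x, y)) f) /\
  nrm m (fun x => dot m (fun y => K (x, y)) f) <= c * nrm m f.
Proof.
move=> f2 mg; set g := fun x => _ in mg *.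
have mf := L2_measurable f2.
have mrow x : measurable_fun setT (fun y => K (x, y)) by exact: measurableT_comp mK (measurable_pair1 x).
have maK x : measurable_fun setT (fun y => `|K (x, y)|) by exact: measurableT_comp.
have fa2 : L2 m (fun y => `|f y|) by exact: L2_norm.
have M0 : 0 <= M by apply: le_trans (KM (point, point)).
have iK x : m.-integrable setT (EFin \o (fun y => `|K (x, y)|)).
  apply/integrableP; split; first exact/measurable_EFinP.
  under eq_integral do rewrite /= normr_id.
  by rewrite row_int ltry.
have s2 x : L2 m (fun y => Num.sqrt `|K (x, y)|).
  apply: L2P; first by apply: measurableT_comp => //; exact: (continuous_measurable_fun (@sqrt_continuous R)).
  by rewrite (_ : _ \o _ = EFin \o (fun y => `|K (x, y)|))//; apply/funext => y /=; rewrite sqr_sqrtr.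
have sb x : {ae m, forall y, `|Num.sqrt `|K (x, y)| | <= Num.sqrt M}.
  by apply: aeW => y; rewrite ger0_norm ?sqrtr_ge0// ler_wsqrtr.
have sf2 x : L2 m (fun y => Num.sqrt `|K (x, y)| * `|f y|).
  exact: L2M (L2_measurable (s2 x)) (sb x) fa2.
have pw x : ((g x ^+ 2)%:E <= c%:E * \int[m]_y (`|K (x, y)| * f y ^+ 2)%:E)%E.
  have i1 := dot_integrable (s2 x) (s2 x); have i2 := dot_integrable (sf2 x) (sf2 x).
  have d1 : dot m (fun y => Num.sqrt `|K (x, y)|) (fun y => Num.sqrt `|K (x, y)|) = c.
    apply: EFin_inj; rewrite -(integrable_Rintegral i1) -(row_int x); apply: eq_integral => y _.
    by rewrite -expr2 sqr_sqrtr.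
  have d2 : (\int[m]_y (`|K (x, y)| * f y ^+ 2)%:E = (dot m (fun y => Num.sqrt `|K (x, y)| * `|f y|)
       (fun y => Num.sqrt `|K (x, y)| * `|f y|))%:E)%E.
    rewrite -(integrable_Rintegral i2); apply: eq_integral => y _.
    by rewrite -expr2 exprMn sqr_sqrtr// real_normK ?num_real.
  rewrite d2 -EFinM lee_fin -d1; apply: le_trans (dot_sqr_le (s2 x) (sf2 x)).
  rewrite -[g x ^+ 2]real_normK ?num_real//; set h := dot _ _ _.
  have gh : `|g x| <= h.
    have Kf : m.-integrable setT (EFin \o (fun y => K (x, y) * f y)).
      have kb : {ae m, forall y, `|K (x, y)| <= M} by exact: aeW.
      apply/integrableP; split; first by apply/measurable_EFinP; exact: measurable_funM.
      have := dot_integrable (s2 x) (sf2 x) => /integrableP[_]; apply: le_lt_trans.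
      rewrite le_eqVlt; apply/orP; left; apply/eqP; apply: eq_integral => y _ /=.
      by rewrite mulrA -expr2 sqr_sqrtr// !normrM !normr_id.
    apply: le_trans (le_normr_Rintegral _ Kf) _ => //.
    rewrite le_eqVlt; apply/orP; left; apply/eqP; apply: eq_Rintegral => y _.
    by rewrite mulrA -expr2 sqr_sqrtr// normrM.
  by rewrite ler_sqr ?nnegrE// (le_trans _ gh).
have mF : measurable_fun setT (fun z : T * T => (`|K z| * f z.2 ^+ 2)%:E).
  apply/measurable_EFinP; apply: measurable_funM; first exact: measurableT_comp.
  by apply: measurable_funX; exact: measurableT_comp mf measurable_snd.
have F0 z : (0 <= (`|K z| * f z.2 ^+ 2)%:E)%E by rewrite lee_fin mulr_ge0// sqr_ge0.
have ff := dot_integrable f2 f2.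
have bound : (\int[m]_x (g x ^+ 2)%:E <= (c ^+ 2 * dot m f f)%:E)%E.
  apply: (@le_trans _ _ (\int[m]_x (c%:E * \int[m]_y (`|K (x, y)| * f y ^+ 2)%:E))%E).
    apply: ge0_le_integral => //.
    - by move=> x _; rewrite lee_fin sqr_ge0.
    - by apply/measurable_EFinP; exact: measurable_funX.
    - by apply: measurable_funeM; exact: (measurable_fun_fubini_tonelli_F (fun z : T * T => (`|K z| * f z.2 ^+ 2)%:E)).
  rewrite ge0_integralZl_EFin//; last 2 first.
  - by move=> x _; apply: integral_ge0 => y _; exact: F0 (x, y).
  - exact: (measurable_fun_fubini_tonelli_F (fun z : T * T => (`|K z| * f z.2 ^+ 2)%:E)).
  rewrite (fubini_tonelli (fun z : T * T => (`|K z| * f z.2 ^+ 2)%:E))//=.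
  rewrite expr2 -mulrA [(c * (c * _))%:E]EFinM lee_wpmul2l ?lee_fin//.
  rewrite le_eqVlt; apply/orP; left; apply/eqP.
  rewrite (EFinM c) -(integrable_Rintegral ff) -ge0_integralZl_EFin//; last 2 first.
  - by move=> y _; rewrite lee_fin -expr2 sqr_ge0.
  - by apply/measurable_EFinP; exact: measurable_funM.
  apply: eq_integral => y _; under eq_integral do rewrite mulrC EFinM.
  rewrite ge0_integralZl_EFin ?sqr_ge0//.
    by rewrite col_int -expr2 muleC.
  by apply/measurable_EFinP; apply: measurableT_comp => //; exact: measurableT_comp mK (measurable_pair2 y).
have g2 : m.-integrable setT (EFin \o (fun x => g x ^+ 2)).
  apply/integrableP; split; first by apply/measurable_EFinP; exact: measurable_funX.
  under eq_integral do rewrite /= ger0_norm ?sqr_ge0//.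
  by apply: le_lt_trans bound _; rewrite ltry.
split; first exact: L2P.
rewrite -(ger0_norm c0) -sqrtr_sqr -sqrtrM ?sqr_ge0// /nrm ler_wsqrtr//.
have -> : dot m g g = \int[m]_x (g x ^+ 2) by apply: eq_Rintegral => x _; rewrite expr2.
by rewrite -lee_fin -(integrable_Rintegral g2).
Qed.

End schur_test.

Section convolution.
Context (R : realType).
Local Notation mR := (measurableTypeR R).
Local Notation T3 := (mR * mR * mR)%type.
Local Notation mu := (@lebesgue3 R).
Local Notation test := (@test_function R (R3 R) setT).
Local Notation e_ j := (basis3 R j).

Section linear_combination.
Variable c : 'I_3 -> R.
Definition lincomb (h : R3 R) : R := \sum_j coord j h * c j.
Lemma lincomb_linear : linear (lincomb : R3 R -> R^o).
Proof.
move=> a u v; rewrite /lincomb /GRing.scale/= mulr_sumr -big_split/=; apply: eq_bigr => j _.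
by rewrite mulrA -mulrDl; congr (_ * _); case: j => [[|[|[|//]]] ?].
Qed.
HB.instance Definition _ := GRing.isLinear.Build R (R3 R) R^o *:%R lincomb lincomb_linear.
End linear_combination.

Lemma continuous_lincomb c : continuous (lincomb c).
Proof.
move=> x; apply: cvg_big => [|j _]; first exact: add_continuous.
by apply: cvgMl; exact: smooth_continuous (smooth_coordj j) x.
Qed.

Lemma derive_coords (f : R3 R -> R) (h x : R3 R) : smooth f ->
  'D_h f x = \sum_j coord j h * 'D_(e_ j) f x.
Proof.
move=> sf; have hE : h = 1 *: (h.1.1 *: e_ 0 + h.1.2 *: e_ 1) + h.2 *: e_ 2.
  case: h => [[a b] c]; rewrite scale1r; congr ((_, _), _) => /=;
    by rewrite /GRing.scale/= ?mulr1 ?mulr0 ?addr0 ?add0r.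
rewrite {1}hE derive_smoothDv// mul1r derive_smoothDv// 3!big_ord_recl big_ord0 addr0.
rewrite addrA; congr (_ * 'D_(e_ _) f x + _ * 'D_(e_ _) f x + _ * 'D_(e_ _) f x); exact: val_inj.
Qed.

Lemma test_taylor (k : R3 R -> R) : test k -> exists2 C, 0 <= C &
  forall x h, `|k (x + h) - k x - 'D_h k x| <= C * `|h| ^+ 2.
Proof.
move=> tk; have sk := test_smooth tk.
have H (ij : 'I_3 * 'I_3) : exists M, 0 < M /\ forall x, `|'D_(e_ ij.1) ('D_(e_ ij.2) k) x| <= M.
  by have [M M0 HM] := test_bounded (test_derive (e_ ij.1) (test_derive (e_ ij.2) tk)); exists M.
have [M HM] := choice H.
have M0 ij : 0 <= M ij by have [/ltW] := HM ij.
exists (\sum_i \sum_j M (i, j)); first by apply: sumr_ge0 => i _; apply: sumr_ge0.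
move=> x h; apply: smooth_taylor2 => // y.
have E : 'D_h k = fun x => \sum_j coord j h * 'D_(e_ j) k x.
  by apply/funext => z; exact: derive_coords.
have sd j : smooth ('D_(e_ j) k) by exact: smooth_derive.
rewrite E derive_smooth_sum => [|j]; last exact: smoothZ.
rewrite exchange_big mulr_suml; apply: le_trans (ler_norm_sum _ _ _) _; apply: ler_sum => j _.
rewrite derive_smoothZ// derive_coords//= mulr_sumr mulr_suml.
apply: le_trans (ler_norm_sum _ _ _) _; apply: ler_sum => i _.
have [_ HD] := HM (i, j).
rewrite !normrM; apply: le_trans (ler_pM _ _ (coord_le j h) (ler_pM _ _ (coord_le i h) (HD y))) _ => //.
by rewrite mulrA -expr2 mulrC.
Qed.

Lemma nrm_bounded (f : R3 R -> R) K N : 0 <= N -> 0 <= K -> measurable_fun setT (f : T3 -> R) ->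
  (forall x, `|f x| <= K) -> (forall x, N < `|x| -> f x = 0) ->
  L2 mu f /\ nrm mu f <= K * Num.sqrt ((2 * N) ^+ 3).
Proof.
move=> N0 K0 mf fK fN.
have mf2 : measurable_fun setT ((fun x => f x ^+ 2) : T3 -> R) by exact: measurable_funX.
have [i1 i2] : mu.-integrable setT (EFin \o (fun x : T3 => f x ^+ 2)) /\
    `|\int[mu]_x f x ^+ 2| <= K ^+ 2 * (2 * N) ^+ 3.
  apply: bounded_support_integrable => // x.
    by rewrite normrX ler_sqr ?nnegrE.
  by move=> /fN ->; rewrite expr0n.
split; first exact: L2P.
rewrite -[K in leRHS]ger0_norm// -sqrtr_sqr -sqrtrM ?sqr_ge0// /nrm ler_wsqrtr//.
by apply: le_trans i2; apply: le_trans (ler_norm _).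
Qed.

Definition conv (k f : R3 R -> R) (x : R3 R) : R := dot mu (fun y => k (x - y)) f.

Lemma is_diff_flip (x z : R3 R) : is_diff z (fun y : R3 R => x - y) (fun y => 0 - y).
Proof. exact: (@is_diffB _ _ _ (cst x) id). Qed.

Lemma test_flip (k : R3 R -> R) x : test k -> test (fun y => k (x - y)).
Proof.
move=> tk; have sk := test_smooth tk; have [N N0 kN] := test_bounded_support tk.
have d := @is_diff_flip x.
have [K [cK _ K0]] := test_support tk.
apply: (@test_subset _ _ ((fun z => x - z) @` K)) => //; apply: test_compact.
- exact: (smooth_comp sk d).
- apply: continuous_compact => //; apply: continuous_subspaceT => z.
  by apply: cvgB; [exact: cvg_cst|exact: cvg_id].
- move=> y nK; apply: K0 => Ky; apply: nK; exists (x - y) => //.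
  by rewrite opprB addrCA subrr addr0.
Qed.

Lemma derive_flip (k : R3 R -> R) (x y v : R3 R) : smooth k ->
  'D_v (fun y => k (x - y)) y = - 'D_v k (x - y).
Proof.
move=> sk.
have d := @is_diff_flip x.
rewrite (derive_smooth_comp y v sk d) sub0r.
by have := deriveZv (-1) v (x - y) sk; rewrite scaleN1r mulN1r.
Qed.

Lemma test_bounded_support1 (k : R3 R -> R) : test k -> exists2 N, 0 < N &
  forall x, N < `|x| -> k x = 0 /\ forall v, 'D_v k x = 0.
Proof.
move=> tk; have sk := test_smooth tk; have [N N0 kN] := test_bounded_support tk.
have H j : exists N, 0 < N /\ forall x, N < `|x| -> 'D_(e_ j) k x = 0.
  by have [M M0 HM] := test_bounded_support (test_derive (e_ j) tk); exists M.
have [M HM] := choice H; have M0 j : 0 <= M j by have [/ltW] := HM j.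
exists (N + \sum_j M j); first by rewrite ltr_pwDl// sumr_ge0.
move=> x xN; split.
  by apply: kN; apply: le_lt_trans xN; rewrite lerDl sumr_ge0.
move=> v; rewrite derive_coords// big1// => j _.
have [_ ->] := HM j; first by rewrite mulr0.
by apply: le_lt_trans xN; rewrite (bigD1 j)//= addrCA lerDl addr_ge0 ?(ltW N0)// sumr_ge0.
Qed.

(** The Taylor remainder of the kernel is O(|h|^2) and, for |h| <= 1, supported in a fixed ball, so
    its L2 norm is O(|h|^2); the Cauchy-Schwarz inequality transfers the bound to the
    convolution. *)
Lemma conv_differentiable k f x : test k -> L2 mu f ->
  differentiable (conv k f) x /\ forall v, 'D_v (conv k f) x = conv ('D_v k) f x.
Proof.
move=> tk f2; have sk := test_smooth tk; have [C C0 HC] := test_taylor tk.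
have [N N0 kN] := test_bounded_support1 tk.
have L2k k' z : test k' -> L2 mu (fun y => k' (z - y)) by move=> tk'; exact/test_L2/test_flip.
have L2D v z : L2 mu (fun y => 'D_v k (z - y)) by exact: (L2k ('D_v k) z (test_derive v tk)).
have lin v : lincomb (fun j => conv ('D_(e_ j) k) f x) v = conv ('D_v k) f x.
  have e1 := dot_suml (index_enum 'I_3) (fun j => L2Z (coord j v) (L2D (e_ j) x)) f2.
  rewrite /lincomb (eq_bigr (fun j => dot mu (fun y => coord j v * 'D_(e_ j) k (x - y)) f)).
    apply: etrans (esym e1) _; apply: eq_Rintegral => y _; congr (_ * _).
    by rewrite derive_coords.
  by move=> j _; exact: esym (dotZl (coord j v) (L2D (e_ j) x) f2).
(* The radius |x| + N + 1 is that of a ball outside which both k(x - y) and k(x - y + h) vanish when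
   |h| <= 1. *)
pose K := C * Num.sqrt ((2 * (`|x| + N + 1)) ^+ 3) * nrm mu f.
have cl := @continuous_lincomb (fun j => conv ('D_(e_ j) k) f x).
have [|d D] := @differentiable_quadratic R _ (conv k f) (lincomb (fun j => conv ('D_(e_ j) k) f x)) x K cl.
  move=> h h1.
  apply: (@le_trans _ _ `|conv k f (h + x) - conv k f x - conv ('D_h k) f x|).
    by rewrite -(lin h); exact: lexx.
  have tF : test (fun z => k (z + h) - k z - 'D_h k z).
    by apply: testB; [apply: testB => //; exact: test_shift|exact: test_derive].
  have F2 := L2k _ x tF.
  have E : conv k f (h + x) - conv k f x - conv ('D_h k) f x =
      dot mu (fun y => k (x - y + h) - k (x - y) - 'D_h k (x - y)) f.
    have e1 := dotBl (L2B (L2k _ (h + x) tk) (L2k _ x tk)) (L2D h x) f2.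
    have e2 := dotBl (L2k _ (h + x) tk) (L2k _ x tk) f2.
    rewrite /conv -e2; apply: etrans (esym e1) _; apply: eq_Rintegral => y _.
    by rewrite [h + x - y]addrAC [h - y + x]addrC addrA addrAC; congr ((k _ - _ - _) * _); rewrite -addrA addrC -addrA [_ + x]addrC addrA.
  rewrite E; apply: le_trans (cauchy_schwarz F2 f2) _.
  rewrite /K mulrAC ler_wpM2r ?nrm_ge0//.
  have [] := @nrm_bounded (fun y => k (x - y + h) - k (x - y) - 'D_h k (x - y)) (C * `|h| ^+ 2) (`|x| + N + 1).
  - by rewrite !addr_ge0// ltW.
  - by rewrite mulr_ge0// sqr_ge0.
  - exact: test_measurable (test_flip x tF).
  - by move=> y; exact: HC.
  - move=> y yN.
    have a1 : N < `|x - y|.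
      have := ler_normB x (x - y); rewrite opprB addrCA subrr addr0; lra.
    have a2 : N < `|x - y + h|.
      have := ler_normB (x - y + h) h; rewrite addrK; have := ler_normB x (x - y).
      rewrite opprB addrCA subrr addr0; lra.
    by have [-> ->] := kN _ a1; have [-> _] := kN _ a2; rewrite !subr0.
  move=> _ h2; apply: le_trans h2 _; lra.
by split=> // v; exact: etrans (D v) (lin v).
Qed.

Lemma smooth_conv k f : test k -> L2 mu f -> smooth (conv k f).
Proof.
move=> tk f2; apply: (smooth_coind (P := fun g => exists2 k, test k & g = conv k f)).
  move=> _ [k' tk' ->]; split=> [x|v]; first by have [] := conv_differentiable x tk' f2.
  exists ('D_v k'); first exact: test_derive.
  by apply/funext => x; have [_] := conv_differentiable x tk' f2; apply.
by exists k.
Qed.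

Lemma derive_conv k f v : test k -> L2 mu f -> 'D_v (conv k f) = conv ('D_v k) f.
Proof. by move=> tk f2; apply/funext => x; have [_] := conv_differentiable x tk f2; apply. Qed.

Lemma test_conv k f N : test k -> L2 mu f -> (forall x, N < `|x| -> f x = 0) -> test (conv k f).
Proof.
move=> tk f2 fN; have [M M0 kM] := test_bounded_support tk.
apply: (@test_subset _ _ (box (- (M + N), - (M + N), - (M + N)) (M + N, M + N, M + N) : set (R3 R))) => //.
apply: test_compact; first exact: smooth_conv.
  by apply: compact_setX; [apply: compact_setX|]; exact: segment_compact.
move=> x nx; rewrite /conv -[RHS](dot0l mu (fun=> 0 : R)); apply: eq_Rintegral => y _.
rewrite mulr0; have [yN|/fN ->] := leP `|y| N; last by rewrite mulr0.
rewrite kM ?mul0r// ltNge; apply/negP => xyM; apply: nx; apply/norm3_box.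
by have := ler_normD (x - y) y; rewrite subrK; lra.
Qed.

Lemma convB k f g x : test k -> L2 mu f -> L2 mu g ->
  conv k (fun x => f x - g x) x = conv k f x - conv k g x.
Proof.
by move=> tk f2 g2; exact: (dotBr f2 g2 (test_L2 (test_flip x tk))).
Qed.

Lemma sub3_measurable : measurable_fun setT (fun z : T3 * T3 => (z.1 : R3 R) - z.2 : T3).
Proof.
have B (p q : T3 * T3 -> mR) : measurable_fun setT p -> measurable_fun setT q ->
    measurable_fun setT (fun z => p z - q z : mR) by exact: measurable_funB.
have c1 (p : T3 * T3 -> T3) : measurable_fun setT p -> measurable_fun setT (fun z => (p z).1.1).
  by move=> mp; do 2 apply: (measurableT_comp measurable_fst).
have c2 (p : T3 * T3 -> T3) : measurable_fun setT p -> measurable_fun setT (fun z => (p z).1.2).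
  by move=> mp; apply: (measurableT_comp measurable_snd); apply: (measurableT_comp measurable_fst).
have c3 (p : T3 * T3 -> T3) : measurable_fun setT p -> measurable_fun setT (fun z => (p z).2).
  by move=> mp; apply: (measurableT_comp measurable_snd).
have m1 := @measurable_fst _ _ T3 T3; have m2 := @measurable_snd _ _ T3 T3.
apply/measurable_fun_pairP; split.
  apply/measurable_fun_pairP; split; first exact: B (c1 _ m1) (c1 _ m2).
  exact: B (c2 _ m1) (c2 _ m2).
exact: B (c3 _ m1) (c3 _ m2).
Qed.

Lemma young k f : test k -> L2 mu f -> L2 mu (conv k f) /\
  nrm mu (conv k f) <= (\int[mu]_x `|k x|) * nrm mu f.
Proof.
move=> tk f2; have mk := test_measurable tk.
have ik : mu.-integrable setT (EFin \o (fun x : T3 => `|k x|)).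
  by have /integrable_abse := test_integrable tk.
have mak : measurable_fun setT (fun x : T3 => `|k x|) by exact: measurableT_comp.
have [M M0 kM] := test_bounded tk.
pose K (z : T3 * T3) : R := k ((z.1 : R3 R) - z.2).
have mK : measurable_fun setT K by exact: (measurableT_comp mk sub3_measurable).
have c0 : 0 <= \int[mu]_x `|k x| by apply: Rintegral_ge0.
have row x : (\int[leb3 R]_y (`|K (x, y)|)%:E = (\int[mu]_x `|k x|)%:E)%E.
  have p := preserving_refl3 x; have e := integral_preserving p mak.
  by rewrite -e; apply: integrable_Rintegral; exact: integrable_preserving p mak ik.
have col y : (\int[leb3 R]_x (`|K (x, y)|)%:E = (\int[mu]_x `|k x|)%:E)%E.
  have p := preserving_shift3 (- y); have e := integral_preserving p mak.
  by rewrite -e; apply: integrable_Rintegral; exact: integrable_preserving p mak ik.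
have mc : measurable_fun setT (conv k f : T3 -> R).
  by apply: continuous_measurable3; apply: smooth_continuous; exact: smooth_conv.
exact: (@schur_test _ T3 R (leb3 R) K _ M mK (fun z => kM _) c0 row col f f2 mc).
Qed.

Lemma cvgL2_conv k (u : nat -> R3 R -> R) f : test k -> cvgL2 mu u f ->
  cvgL2 mu (fun n => conv k (u n)) (conv k f).
Proof.
move=> tk [u2 f2 c]; have [kf2 _] := young tk f2.
split=> // [n|]; first by have [] := young tk (u2 n).
have c' : (\int[mu]_x `|k x|) * nrm mu (fun x => u n x - f x) @[n --> \oo] --> (0 : R).
  by rewrite -[X in _ --> X](mulr0 (\int[mu]_x `|k x|)); exact: cvgMr.
apply: (squeeze_cvgr _ (cvg_cst 0) c'); apply: nearW => n; rewrite nrm_ge0/=.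
have [_ h] := young tk (L2B (u2 n) f2); apply: le_trans h.
rewrite le_eqVlt; apply/orP; left; apply/eqP; congr (nrm mu _).
by apply/funext => x; rewrite convB.
Qed.

Lemma mollifier e : 0 < e -> exists k, [/\ test k, forall x, 0 <= k x,
  \int[mu]_x k x = 1 & forall x, e < `|x| -> k x = 0].
Proof.
move=> e0; pose a : R3 R := (- e, - e, - e); pose b : R3 R := (e, e, e).
have h0 : 0 < e / 2 by rewrite divr_gt0.
have tb : test (box_bump a b (e / 2)) by exact: test_box_bump.
have b0 := box_bump_ge0 a b (e / 2).
have out x : e < `|x| -> box_bump a b (e / 2) x = 0.
  move=> xe; apply: contra_notP (negP (_ : ~~ (`|x| <= e))) => [/eqP nz|]; last by rewrite -ltNge.
  have pz (u v t : R) : plateau u v (e / 2) t != 0 -> u <= t <= v.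
    by move=> h; apply: contraNT h => h; apply/eqP/plateau_out => //; apply: contra h => /andP[/ltW -> /ltW ->].
  move: nz; rewrite /box_bump mulf_eq0 negb_or => /andP[n12 n3].
  move: n12; rewrite mulf_eq0 negb_or => /andP[n1 n2].
  have p1 := pz _ _ _ n1; have p2 := pz _ _ _ n2; have p3 := pz _ _ _ n3.
  by apply/norm3_box; split; [split|]; rewrite /= in_itv.
have inb (x : T3) : box (- (e / 2), - (e / 2), - (e / 2)) (e / 2, e / 2, e / 2) x -> box_bump a b (e / 2) x = 1.
  have E1 : - e + e / 2 = - (e / 2) by rewrite [e in - e]splitr; ring.
  have E2 : e - e / 2 = e / 2 by rewrite {1}[e]splitr; ring.
  move=> [[/= h1 h2] h3]; rewrite in_itv/= in h1; rewrite in_itv/= in h2; rewrite in_itv/= in h3.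
  by rewrite /box_bump !plateau_in ?mul1r//= ?E1 ?E2.
have I0 : 0 < \int[mu]_x box_bump a b (e / 2) x.
  pose B : set T3 := box (- (e / 2), - (e / 2), - (e / 2)) (e / 2, e / 2, e / 2).
  have mB : measurable B by exact: measurable_box.
  have hh : - (e / 2) <= e / 2 by lra.
  have vB : mu B = ((e * e * e)%:E)%E.
    by rewrite lebesgue3_box//=; congr (_%:E); field.
  have iB : mu.-integrable setT (EFin \o (\1_B : T3 -> R)).
    apply/integrableP; split; first by apply/measurable_EFinP; exact: measurable_indic.
    under eq_integral do rewrite /= ger0_norm//.
    by rewrite integral_indic// setIT [X in (X < _)%E]vB ltry.
  apply: (@lt_le_trans _ _ (\int[mu]_x (\1_B x : R))).
    by rewrite /Rintegral integral_indic// setIT [X in fine X]vB/= !mulr_gt0.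
  apply: le_Rintegral => //; first exact: test_integrable.
  move=> x _; rewrite indicE; have [xB|_] := boolP (x \in B); last exact: b0.
  by rewrite inb//; move: xB; rewrite inE.
exists (fun x => (\int[mu]_x box_bump a b (e / 2) x)^-1 * box_bump a b (e / 2) x); split.
- exact: testZ.
- by move=> x; rewrite mulr_ge0 ?invr_ge0 ?(ltW I0).
- by rewrite RintegralZl ?mulVf ?gt_eqF//; exact: test_integrable.
- by move=> x /out ->; rewrite mulr0.
Qed.

Lemma test_lipschitz phi : test phi -> exists2 L, 0 <= L &
  forall x h, `|phi (x + h) - phi x| <= L * `|h|.
Proof.
move=> tphi; have sphi := test_smooth tphi.
have H j : exists M, 0 < M /\ forall x, `|'D_(e_ j) phi x| <= M.
  by have [M M0 HM] := test_bounded (test_derive (e_ j) tphi); exists M.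
have [M HM] := choice H; have M0 j : 0 <= M j by have [/ltW] := HM j.
exists (\sum_j M j); first exact: sumr_ge0.
move=> x h; apply: derive_smooth_le => // y.
rewrite derive_coords// mulr_suml; apply: le_trans (ler_norm_sum _ _ _) _; apply: ler_sum => j _.
by rewrite normrM mulrC ler_pM ?coord_le//; have [_] := HM j; apply.
Qed.

(** A Lipschitz function moves by at most L * del under averaging at scale [del], and for del <= 1
    the difference is supported in a ball of radius N + 1. *)
Lemma conv_close phi e : test phi -> 0 < e -> exists2 del, 0 < del & forall k del', del' <= del ->
  test k -> (forall x, 0 <= k x) -> \int[mu]_x k x = 1 -> (forall x, del' < `|x| -> k x = 0) ->
  nrm mu (fun x => conv k phi x - phi x) <= e.
Proof.
move=> tphi e0; have [L L0 HL] := test_lipschitz tphi.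
have [N N0 phiN] := test_bounded_support tphi.
pose S := Num.sqrt ((2 * (N + 1)) ^+ 3); have S0 : 0 <= S by exact: sqrtr_ge0.
have LS : 0 < L * S + 1 by rewrite ltr_wpDl// mulr_ge0.
exists (Num.min 1 (e / (L * S + 1))); first by rewrite lt_min ltr01 divr_gt0.
move=> k d dd tk k0 k1 kd; move: dd; rewrite le_min => /andP[d1 de].
have mk := test_measurable tk.
have flip1 x : \int[mu]_y k (x - y) = 1.
  by rewrite -k1; exact: integral_preserving (preserving_refl3 x) mk.
have tf x := test_flip x tk; have p2 := test_L2 tphi.
have b x : `|conv k phi x - phi x| <= L * (e / (L * S + 1)).
  have i1 := dot_integrable (test_L2 (tf x)) p2; have i2 := test_integrable (tf x).
  have i3 : mu.-integrable setT (EFin \o (fun y : T3 => k (x - y) * phi x)).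
    by rewrite (_ : _ \o _ = EFin \o (fun y : T3 => phi x * k (x - y)));
      [apply: test_integrable; exact: testZ|apply/funext => y /=; rewrite mulrC].
  have -> : conv k phi x - phi x = \int[mu]_y (k (x - y) * phi y - k (x - y) * phi x).
    rewrite RintegralB//; congr (_ - _); under eq_Rintegral do rewrite mulrC.
    by rewrite RintegralZl// flip1 mulr1.
  have i4 : mu.-integrable setT (EFin \o (fun y : T3 => k (x - y) * phi y - k (x - y) * phi x)).
    exact: (integrableB _ i1 i3).
  apply: le_trans (le_normr_Rintegral _ i4) _ => //.
  set c := L * _; rewrite -[leRHS]mulr1 -(flip1 x) -RintegralZl//.
  apply: le_Rintegral => //.
  - by have /integrable_abse := i4.
  - by apply: test_integrable; exact: testZ.
  - move=> y _; rewrite -mulrBr normrM (ger0_norm (k0 _)) mulrC.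
    have [xy|/kd ->] := leP `|x - y| d; last by rewrite !mulr0.
    rewrite ler_wpM2r//; have := HL x (y - x); rewrite addrCA subrr addr0 => h.
    by apply: le_trans h _; rewrite /c ler_wpM2l// distrC (le_trans xy).
have mc : measurable_fun setT ((fun x => conv k phi x - phi x) : T3 -> R).
  apply: continuous_measurable3; apply: smooth_continuous.
  by apply: smoothB; [exact: smooth_conv|exact: test_smooth tphi].
have sup x : N + 1 < `|x| -> conv k phi x - phi x = 0.
  move=> xN; rewrite (phiN x) ?subr0; last lra.
  rewrite /conv -[RHS](dot0l mu (fun=> 0 : R)); apply: eq_Rintegral => y _; rewrite mulr0.
  have [yN|/phiN ->] := leP `|y| N; last by rewrite mulr0.
  by rewrite kd ?mul0r//; have := ler_normD (x - y) y; rewrite subrK; lra.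
have LE0 : 0 <= L * (e / (L * S + 1)) by rewrite mulr_ge0// divr_ge0// ltW.
have N10 : 0 <= N + 1 by rewrite addr_ge0// ltW.
have [_ h] := nrm_bounded N10 LE0 mc b sup; apply: le_trans h _; rewrite -/S.
have -> : L * (e / (L * S + 1)) * S = e * (L * S) / (L * S + 1) by ring.
by rewrite ler_pdivrMr// ler_wpM2l ?(ltW e0)// lerDl.
Qed.

(** The components of a strong H^1 function and of its gradient lie here by construction, and the
    class is stable under restriction to a closed set; approximation by mollifiers is established
    for it. *)
Definition test_closure (f : R3 R -> R) : Prop := L2 mu f /\ forall e, 0 < e ->
  exists2 phi, test phi & nrm mu (fun x => phi x - f x) <= e.

Lemma conv_approx f e : test_closure f -> 0 < e -> exists2 del, 0 < del & forall k del', del' <= del ->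
  test k -> (forall x, 0 <= k x) -> \int[mu]_x k x = 1 -> (forall x, del' < `|x| -> k x = 0) ->
  nrm mu (fun x => conv k f x - f x) <= e.
Proof.
move=> [f2 cf] e0; have e30 : 0 < e / 3 by rewrite divr_gt0.
have [phi tphi phif] := cf _ e30; have p2 := test_L2 tphi.
have [del del0 H] := conv_close tphi e30; exists del => // k d dd tk k0 k1 kd.
have h := H k d dd tk k0 k1 kd.
have [kf2 _] := young tk f2; have [kp2 _] := young tk p2.
have k1' : \int[mu]_x `|k x| = 1 by rewrite -k1; apply: eq_Rintegral => x _; rewrite ger0_norm.
have [_ y] := young tk (L2B f2 p2); rewrite k1' mul1r in y.
have y' : nrm mu (fun x => conv k f x - conv k phi x) <= e / 3.
  apply: le_trans (_ : nrm mu (fun x => f x - phi x) <= _); last by rewrite nrmBC.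
  apply: le_trans y; rewrite le_eqVlt; apply/orP; left; apply/eqP; congr (nrm mu _).
  by apply/funext => x; rewrite convB.
apply: le_trans (nrm_triangle kf2 kp2 f2) _.
have := nrm_triangle kp2 p2 f2; lra.
Qed.

Lemma prod01 (I : Type) (r : seq I) (P : pred I) (F : I -> R) :
  (forall i, P i -> 0 <= F i <= 1) -> 0 <= \prod_(i <- r | P i) F i <= 1.
Proof.
move=> h; apply: (big_ind (fun y => 0 <= y <= 1)) => //; first by rewrite lexx ler01.
by move=> x y /andP[x0 x1] /andP[y0 y1]; rewrite mulr_ge0//= -[leRHS]mulr1 ler_pM.
Qed.

(** * Restriction of strong gradients to a closed set *)

Section closed_indicator.
Variable E : set (R3 R).
Hypothesis cE : closed E.

(** Attached to the n-th rational cube: a bump positive exactly on the cube if the cube misses [E],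
    and 0 otherwise. The common zero set of these functions is [E]. *)
Definition hole (n : nat) : R3 R -> R :=
  if unpickle n is Some k then
    if `[< rbox k `<=` ~` E >] then
      box_bump ((ratr k.1.1.1 - ratr k.2, ratr k.1.1.2 - ratr k.2), ratr k.1.2 - ratr k.2)
        ((ratr k.1.1.1 + ratr k.2, ratr k.1.1.2 + ratr k.2), ratr k.1.2 + ratr k.2) 1
    else fun=> 0
  else fun=> 0.

Lemma smooth_hole n : smooth (hole n).
Proof.
rewrite /hole; case: (unpickle n) => [k|]; last exact: smooth_cst.
case: asboolP => _; last exact: smooth_cst.
by apply: test_smooth (test_box_bump _ _ _).
Qed.

Lemma hole01 n x : 0 <= hole n x <= 1.
Proof.
rewrite /hole; case: (unpickle n) => [k|]; last by rewrite lexx ler01.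
case: asboolP => _; last by rewrite lexx ler01.
by rewrite box_bump_ge0 box_bump_le1.
Qed.

Lemma hole_in n x : E x -> hole n x = 0.
Proof.
move=> Ex; rewrite /hole; case: (unpickle n) => [k|] //.
case: asboolP => // kE; apply: contra_notP (_ : ~ rbox k x); last by move/kE.
move=> /eqP nz.
have pz (u v t : R) : plateau u v 1 t != 0 -> u < t < v.
  by move=> h; apply: contraNT h => h; apply/eqP/plateau_out.
move: nz; rewrite /box_bump mulf_eq0 negb_or => /andP[n12 n3].
move: n12; rewrite mulf_eq0 negb_or => /andP[n1 n2].
have p1 := pz _ _ _ n1; have p2 := pz _ _ _ n2; have p3 := pz _ _ _ n3.
by split; [split|]; rewrite /= in_itv.
Qed.

Lemma hole_out x : ~ E x -> exists n, 0 < hole n x.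
Proof.
move=> nEx; have oE : open (~` E) by exact: closed_openC.
have : nbhs x (~` E) by exact: open_nbhs_nbhs.
move=> /rbox_nbhs[k kx kE]; exists (pickle k).
rewrite /hole pickleK; case: asboolP => // _.
move: kx => [[/= h1 h2] h3]; rewrite in_itv/= in h1; rewrite in_itv/= in h2; rewrite in_itv/= in h3.
by apply: mulr_gt0; [apply: mulr_gt0|]; apply: plateau_gt0.
Qed.

(** Smooth approximations of the indicator of [E]: all factors are 1 on [E], while off [E] some hole
    is positive and its factor tends to 0. The number of holes and the exponent grow together. *)
Definition sieve (n : nat) (x : R3 R) : R := \prod_(i < n) (1 - hole i x) ^+ n.

Lemma smooth_sieve n : smooth (sieve n).
Proof.
have sX (f : R3 R -> R) k : smooth f -> smooth (fun x => f x ^+ k).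
  move=> sf; elim: k => [|k IH]; first exact: smooth_cst.
  by rewrite (_ : (fun x => _) = fun x => f x * f x ^+ k); [exact: smoothM|apply/funext => x; rewrite exprS].
have sP (I : Type) (r : seq I) (F : I -> R3 R -> R) : (forall i, smooth (F i)) ->
    smooth (fun x => \prod_(i <- r) F i x).
  move=> sF; elim: r => [|i r IH].
    by rewrite (_ : (fun x => _) = fun=> 1); [exact: smooth_cst|apply/funext => x; rewrite big_nil].
  by rewrite (_ : (fun x => _) = fun x => F i x * \prod_(i <- r) F i x);
    [exact: smoothM|apply/funext => x; rewrite big_cons].
apply: sP => i; apply: sX; apply: smoothB; [exact: smooth_cst|exact: smooth_hole].
Qed.

Lemma sieve01 n x : 0 <= sieve n x <= 1.
Proof.
have h i : 0 <= (1 - hole i x) ^+ n <= 1.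
  have /andP[? ?] := hole01 i x; rewrite exprn_ge0 ?subr_ge0// exprn_ile1 ?subr_ge0//.
  by rewrite lerBlDr lerDl.
by apply: prod01 => i _; exact: h.
Qed.

Lemma sieve_cvg x : sieve n x @[n --> \oo] --> (\1_E x : R).
Proof.
rewrite indicE; have [Ex|nEx] := boolP (x \in E).
  apply: cvg_near_cst; apply: nearW => n; rewrite /sieve big1// => i _.
  by rewrite hole_in ?subr0 ?expr1n//; move: Ex; rewrite inE.
have [|i hi] := @hole_out x; first by move=> Ex; move: nEx; rewrite mem_set.
have /andP[_ h1] := hole01 i x.
have c : (1 - hole i x) ^+ n @[n --> \oo] --> (0 : R).
  by apply: cvg_expr; rewrite ger0_norm ?subr_ge0// ltrBlDr ltrDl.
apply: (squeeze_cvgr _ (cvg_cst 0) c); near=> n.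
have /andP[-> _] /= := sieve01 n x.
have ni : (i < n)%N by near: n; exists i.+1.
rewrite /sieve (bigD1 (Ordinal ni))//=.
have /andP[h0' h1'] := hole01 i x.
rewrite ler_piMr ?exprn_ge0 ?subr_ge0//.
suff /andP[] : 0 <= \prod_(j < n | j != Ordinal ni) (1 - hole j x) ^+ n <= 1 by [].
apply: prod01 => j _.
have /andP[? ?] := hole01 j x; rewrite exprn_ge0 ?subr_ge0// exprn_ile1 ?subr_ge0//.
by rewrite lerBlDr lerDl.
Unshelve. all: by end_near. Qed.

Lemma measurable_E : measurable (E : set T3).
Proof. exact: measurable_closed3. Qed.

Lemma L2_indic f : L2 mu f -> L2 mu (fun x => \1_E x * f x).
Proof.
move=> f2; apply: (@L2M _ _ _ _ 1) => //.
  by apply: measurable_indic; exact: measurable_E.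
by apply: aeW => x; exact: normr_indic_le1.
Qed.

Lemma nrm_indic f : L2 mu f -> nrm mu (fun x => \1_E x * f x) <= nrm mu f.
Proof.
move=> f2; apply: le_nrm => //; first exact: L2_indic.
by move=> x; rewrite normrM ler_piMl// normr_indic_le1.
Qed.

Lemma test_closure_indic_test phi : test phi -> test_closure (fun x => \1_E x * phi x).
Proof.
move=> tphi; have p2 := test_L2 tphi; split; first exact: L2_indic.
move=> e e0.
have c : \int[mu]_x (sieve n x * phi x - \1_E x * phi x) ^+ 2 @[n --> \oo] --> \int[mu]_x (0 : R).
  apply: (@Rintegral_dominated _ _ _ mu _ _ (fun x => phi x ^+ 2)).
  - move=> n; apply: measurable_funX; apply: measurable_funB.
      by apply: test_measurable (testMl (smooth_sieve n) tphi).
    exact: L2_measurable (L2_indic p2).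
  - move=> x; rewrite -[X in _ --> X](_ : (\1_E x * phi x - \1_E x * phi x) ^+ 2 = 0); last first.
      by rewrite subrr expr0n.
    have cc : sieve n x * phi x - \1_E x * phi x @[n --> \oo] --> \1_E x * phi x - \1_E x * phi x.
      by apply: cvgB; [apply: cvgMl; exact: sieve_cvg|exact: cvg_cst].
    exact: (cvgM cc cc).
  - exact: L2_sqr.
  - move=> n x; rewrite -mulrBl exprMn normrM ger0_norm ?sqr_ge0// (ger0_norm (sqr_ge0 _)).
    rewrite ler_piMl ?sqr_ge0// -[(_ - _) ^+ 2]real_normK ?num_real// exprn_ile1//.
    have /andP[s0 s1] := sieve01 n x; rewrite indicE.
    by case: (x \in E); rewrite ler_norml /=; apply/andP; split; lra.
have {}c : \int[mu]_x (sieve n x * phi x - \1_E x * phi x) ^+ 2 @[n --> \oo] --> (0 : R).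
  have z : \int[mu]_x (0 : R) = 0 by rewrite -[RHS](dot0l mu (fun=> 0 : R)); apply: eq_Rintegral => x _; rewrite mulr0.
  by rewrite -z.
have e20 : 0 < e ^+ 2 by rewrite exprn_gt0.
move/cvgrPdist_le : c => /(_ _ e20) /filter_ex[n]; rewrite sub0r normrN => hn.
have ts : test (fun x => sieve n x * phi x) by apply: testMl => //; exact: smooth_sieve.
exists (fun x => sieve n x * phi x) => //.
rewrite -(ger0_norm (ltW e0)) -sqrtr_sqr /nrm ler_wsqrtr//; apply: le_trans hn.
apply: le_trans (ler_norm _); rewrite le_eqVlt; apply/orP; left; apply/eqP.
by apply: eq_Rintegral => x _; rewrite expr2.
Qed.

Lemma test_closure_close f : L2 mu f -> (forall e, 0 < e -> exists2 g, test_closure g &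
  nrm mu (fun x => g x - f x) <= e) -> test_closure f.
Proof.
move=> f2 H; split=> // e e0; have e20 : 0 < e / 2 by rewrite divr_gt0.
have [g [g2 cg] gf] := H _ e20; have [phi tphi pg] := cg _ e20.
exists phi => //; apply: le_trans (nrm_triangle (test_L2 tphi) g2 f2) _.
by rewrite [leRHS]splitr lerD.
Qed.

Lemma test_closure_indic f : test_closure f -> test_closure (fun x => \1_E x * f x).
Proof.
move=> [f2 cf]; apply: test_closure_close; first exact: L2_indic.
move=> e e0; have [phi tphi h] := cf _ e0.
exists (fun x => \1_E x * phi x); first exact: test_closure_indic_test.
apply: le_trans h; have := nrm_indic (L2B (test_L2 tphi) f2).
rewrite (_ : (fun x => \1_E x * (phi x - f x)) = (fun x => \1_E x * phi x - \1_E x * f x))//.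
by apply/funext => x; rewrite mulrBr.
Qed.

Lemma cvgL2_test_closure u f : (forall n, test (u n)) -> cvgL2 mu u f -> test_closure f.
Proof.
move=> tu [u2 f2 c]; split=> // e e0.
move/cvgrPdist_le : c => /(_ _ e0) /filter_ex[n]; rewrite sub0r normrN => hn.
by exists (u n) => //; apply: le_trans hn; exact: ler_norm.
Qed.

Lemma cvgL2_indic u f : cvgL2 mu u f -> cvgL2 mu (fun n x => \1_E x * u n x) (fun x => \1_E x * f x).
Proof.
move=> [u2 f2 c]; split=> [n||]; [exact: L2_indic|exact: L2_indic|].
apply: (squeeze_cvgr _ (cvg_cst 0) c); apply: nearW => n; rewrite nrm_ge0/=.
have := nrm_indic (L2B (u2 n) f2).
rewrite (_ : (fun x => \1_E x * (u n x - f x)) = (fun x => \1_E x * u n x - \1_E x * f x))//.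
by apply/funext => x; rewrite mulrBr.
Qed.

(** The hypothesis says that the restricted functions still have the restricted gradient in the weak
    sense. Convolution makes it strong: the derivative falls on the kernel, where both restricted
    sequences converge, and the hypothesis tested with a reflected kernel identifies the limit as
    the convolution of the restricted gradient. *)
Lemma strongH1_indic w g : strongH1 w g ->
  (forall phi j, test phi -> dot mu (fun x => \1_E x * w x) ('D_(e_ j) phi) =
    - dot mu (fun x => \1_E x * g j x) phi) ->
  strongH1 (fun x => \1_E x * w x) (fun j x => \1_E x * g j x).
Proof.
move=> [u [tu cu cg]] trace.
have w2 : L2 mu w by have [] := cu.
have g2 j : L2 mu (g j) by have [] := cg j.
have Z2 := L2_indic w2; have D2 j := L2_indic (g2 j).
have cZ : test_closure (fun x => \1_E x * w x) by apply: test_closure_indic; exact: cvgL2_test_closure cu.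
have cD j : test_closure (fun x => \1_E x * g j x).
  apply: test_closure_indic; apply: cvgL2_test_closure (cg j) => n; exact: test_derive.
apply: strongH1_close => // e e0.
have [d1 d10 H1] := conv_approx cZ e0.
have [d2 d20 H2] : exists2 del, 0 < del & forall j, forall k del', del' <= del ->
    test k -> (forall x, 0 <= k x) -> \int[mu]_x k x = 1 -> (forall x, del' < `|x| -> k x = 0) ->
    nrm mu (fun x => conv k (fun x => \1_E x * g j x) x - \1_E x * g j x) <= e.
  apply: (@fin_del R 3 (fun j del => forall k del', del' <= del ->
    test k -> (forall x, 0 <= k x) -> \int[mu]_x k x = 1 -> (forall x, del' < `|x| -> k x = 0) ->
    nrm mu (fun x => conv k (fun x => \1_E x * g j x) x - \1_E x * g j x) <= e)).
    by move=> j del del' dd h k d' d'' *; apply: (h k d') => //; exact: le_trans dd.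
  by move=> j; exact: conv_approx (cD j) e0.
have m0 : 0 < Num.min d1 d2 by rewrite lt_min d10.
have [k [tk k0 k1 kd]] := mollifier m0.
exists (conv k (fun x => \1_E x * w x)), (fun j => conv k (fun x => \1_E x * g j x)); split.
- have bs n : exists N, forall x, N < `|x| -> \1_E x * u n x = 0.
    by have [N _ uN] := test_bounded_support (tu n); exists N => x /uN ->; rewrite mulr0.
  exists (fun n => conv k (fun x => \1_E x * u n x)); split.
  + move=> n; have [N uN] := bs n; apply: test_conv tk _ uN.
    by apply: L2_indic; exact: test_L2.
  + by apply: cvgL2_conv => //; exact: cvgL2_indic.
  + move=> j.
    (* The weak hypothesis is used here, with y |-> k(x - y) as test function; the reflection
       accounts for the sign. *)
    have E1 : conv k (fun x => \1_E x * g j x) = conv ('D_(e_ j) k) (fun x => \1_E x * w x).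
      apply/funext => x; have tf := test_flip x tk.
      have e1 := trace _ j tf; rewrite /conv dotC [RHS]dotC.
      apply: oppr_inj; apply: etrans (esym e1) _.
      have t2 := test_L2 (test_flip x (test_derive (e_ j) tk)).
      apply: etrans (_ : dot mu (fun x => \1_E x * w x) (fun y => - 'D_(e_ j) k (x - y)) = _).
        by apply: eq_Rintegral => y _; rewrite (derive_flip x y (e_ j) (test_smooth tk)).
      rewrite dotC (dotNl t2 Z2) dotC; by [].
    rewrite E1 (_ : (fun n => _) = fun n => conv ('D_(e_ j) k) (fun x => \1_E x * u n x)).
      by apply: cvgL2_conv; [exact: test_derive|exact: cvgL2_indic].
    by apply/funext => n; rewrite derive_conv//; apply: L2_indic; exact: test_L2.
- by apply: (H1 k (Num.min d1 d2)) => //; rewrite ge_min lexx.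
- by move=> j; apply: (H2 j k (Num.min d1 d2)) => //; rewrite ge_min lexx orbT.
Qed.

End closed_indicator.

End convolution.

(** * Two-dimensional Hausdorff measure *)

Section separating_function.
Context (R : realType) (T : pointedType) (mu : {outer_measure set T -> \bar R}) (f : T -> R).
Local Open Scope ereal_scope.
Hypothesis sep : forall (A B : set T) (a b : R), (a < b)%R -> (forall x, A x -> (f x <= a)%R) ->
  (forall x, B x -> (b <= f x)%R) -> mu A + mu B <= mu (A `|` B).

Variables (X : set T) (a : R).
Let c (n : nat) : R := (a + n.+1%:R^-1)%R.
Let Y (n : nat) : set T := X `&` [set x | (c n <= f x)%R].
Let D (n : nat) : set T := X `&` [set x | (c n.+1 <= f x < c n)%R].

Let c_lt m n : (m < n)%N -> (c n < c m)%R.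
Proof. by move=> mn; rewrite ltrD2l ltf_pV2 ?posrE ?ltr0n// ltr_nat ltnS. Qed.

Let c_gt n : (a < c n)%R. Proof. by rewrite ltrDl invr_gt0 ltr0n. Qed.

Let mu0 A : 0 <= mu A. Proof. exact: outer_measure_ge0. Qed.

(* The annuli [D j] with [j] of a fixed parity are pairwise separated. *)
Let annuli_parity (s n : nat) : \sum_(0 <= k < n) mu (D (k.*2 + s)) <= mu X.
Proof.
pose W n := \bigcup_(k in [set k | (k < n)%N]) D (k.*2 + s).
suff H : \sum_(0 <= k < n) mu (D (k.*2 + s)) <= mu (W n).
  by apply: le_trans H _; apply: le_outer_measure => x [k _ []].
elim: n => [|n IH]; first by rewrite big_geq.
rewrite big_nat_recr//=; apply: le_trans (leeD2r _ IH) _; rewrite addeC.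
case: n IH => [|n] IH.
  rewrite (_ : W 0%N = set0) ?outer_measure0 ?adde0.
    by apply: le_outer_measure => x Dx; exists 0%N.
  by apply/seteqP; split=> // x [].
apply: le_trans (_ : mu (D (n.+1.*2 + s) `|` W n.+1) <= _); last first.
  apply: le_outer_measure => x [Dx|[k /= kn Dx]]; first by exists n.+1 => //=; exact: ltnSn.
  by exists k => //=; exact: leqW.
have E : (n.+1.*2 + s = (n.*2 + s).+2)%N by rewrite doubleS !addSn.
apply: (@sep _ _ (c (n.+1.*2 + s)) (c (n.*2 + s).+1)).
- by rewrite E; exact: c_lt.
- by move=> x [_ /= /andP[_ /ltW]].
- move=> x [k /= kn [_ /= /andP[h _]]]; apply: le_trans h.
  have [->//|nk] := eqVneq k n.
  apply/ltW/c_lt; rewrite ltnS ltn_add2r ltn_double ltn_neqAle nk; exact: kn.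
Qed.

Let annuli_summable : mu X < +oo -> \sum_(0 <= k <oo) mu (D k) < +oo.
Proof.
move=> Xoo; apply: (@le_lt_trans _ _ (mu X + mu X)); last by rewrite lte_add_pinfty.
have nd : nondecreasing_seq (fun n => \sum_(0 <= k < n) mu (D k)).
  by apply: ereal_nondecreasing_series => k _.
apply: lime_le; first by apply: is_cvg_nneseries => k _ _.
apply: nearW => n; apply: le_trans (_ : \sum_(0 <= k < n.*2) mu (D k) <= _).
  by apply: nd; rewrite -addnn leq_addr.
have -> : \sum_(0 <= k < n.*2) mu (D k) =
    \sum_(0 <= k < n) mu (D (k.*2 + 0)) + \sum_(0 <= k < n) mu (D (k.*2 + 1)).
  elim: n => [|n IH]; first by rewrite !big_geq// adde0.
  rewrite doubleS !big_nat_recr//= IH addn0 addn1 -!addeA; congr (_ + _).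
  by rewrite addeCA; congr (_ + _); rewrite addeC.
by apply: leeD; exact: annuli_parity.
Qed.

(** Caratheodory's argument for metric outer measures. The sublevel set is separated from each
    [Y n], so the measures add up there. What [Y n] misses of the set f > a is covered by the annuli
    [D k] with k >= n; these have summable measure, since annuli of equal parity are separated, and
    the tail tends to 0. *)
Lemma caratheodory_sublevel_le : mu (X `&` [set x | (f x <= a)%R]) + mu (X `&` ~` [set x | (f x <= a)%R]) <= mu X.
Proof.
have [Xoo|] := ltP (mu X) +oo; last by rewrite leye_eq => /eqP ->; exact: leey.
set A := [set x | _].
have H1 n : mu (X `&` A) + mu (Y n) <= mu X.
  apply: le_trans (sep (c_gt n) _ _) _; [by move=> x [_]|by move=> x [_]|].
  by apply: le_outer_measure => x [[]|[]].
have H2 n : mu (X `&` ~` A) <= mu (Y n) + \sum_(n <= k <oo) mu (D k).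
  have cov : X `&` ~` A `<=` Y n `|` \bigcup_(k in ~` `I_n) D k.
    move=> x [Xx nAx]; have fx : (a < f x)%R by rewrite ltNge; apply/negP.
    have [h|h] := leP (c n) (f x); first by left.
    right; have d0 : (0 < f x - a)%R by rewrite subr_gt0.
    have ex : exists k, (c k <= f x)%R.
      exists (Num.bound (f x - a)^-1)%R; rewrite /c -lerBrDl -[leRHS]invrK.
      rewrite lef_pV2 ?posrE ?invr_gt0// ltW//.
      apply: lt_trans (archi_boundP _) _; first by rewrite invr_ge0 ltW.
      by rewrite ltr_nat.
    case: (ex_minnP ex) => -[|k] ck kmin.
      by have := le_lt_trans ck h; rewrite ltNge; case: n h {H1} => [|n] h; rewrite ?lexx// (ltW (c_lt _)).
    have kx : (f x < c k)%R by rewrite ltNge; apply/negP => /kmin; rewrite ltnn.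
    exists k => /=; last by split=> //=; rewrite ck.
    move=> /= kn; have := lt_le_trans h _ => /(_ (c k.+1)).
    have /= : (c n <= c k.+1)%R.
      by have [->//|nk] := eqVneq n k.+1; apply/ltW/c_lt; rewrite ltn_neqAle eq_sym nk.
    by move=> h1 /(_ h1); rewrite ltNge ck.
  apply: le_trans (le_outer_measure mu _ _ cov) _.
  apply: le_trans (outer_measureU2 _ _ _) _; rewrite leeD2l//.
  exact: outer_measure_sigma_subadditive_tail.
have H3 n : mu (X `&` A) + mu (X `&` ~` A) <= mu X + \sum_(n <= k <oo) mu (D k).
  apply: le_trans (leeD2l _ (H2 n)) _; rewrite addeA leeD2r//.
have tail : \sum_(n <= k <oo) mu (D k) @[n --> \oo] --> 0.
  by apply: (@nneseries_tail_cvg _ _ xpredT) => //; exact: annuli_summable.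
have cv : mu X + \sum_(n <= k <oo) mu (D k) @[n --> \oo] --> mu X + 0.
  apply: cvgeD => //; last exact: cvg_cst.
  by rewrite fin_num_adde_defl.
rewrite adde0 in cv.
by apply: (cvge_to_ge cv); apply: nearW.
Qed.

End separating_function.

Section hausdorff_measurability.
Context (R : realType).
Local Notation mR := (measurableTypeR R).
Local Notation T3 := (mR * mR * mR)%type.
Local Open Scope ereal_scope.
Local Notation H2 := (@hausdorff2 R).
Local Notation gauge := (@hausdorff2_gauge R).

Lemma diameter3_ge (A : set T3) x y : A x -> A y -> (edist3 x y)%:E <= diameter3 A.
Proof. by move=> Ax Ay; apply: ereal_sup_ubound; right; exists x => //; exists y. Qed.

Lemma diameter3_le (A : set T3) (r : R) : (0 <= r)%R ->
  (forall x y, A x -> A y -> (edist3 x y <= r)%R) -> diameter3 A <= r%:E.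
Proof.
by move=> r0 h; apply: ge_ereal_sup => _ [->|[x Ax [y Ay <-]]]; rewrite lee_fin//; exact: h.
Qed.

Lemma gauge_le_diameter (d : R) (A : set T3) (r : R) : (0 <= r <= d)%R ->
  (forall x y, A x -> A y -> (edist3 x y <= r)%R) -> gauge d A <= (pi / 4 * r ^+ 2)%:E.
Proof.
move=> /andP[r0 rd] h; have dr := diameter3_le r0 h.
rewrite /hausdorff2_gauge (le_trans dr) ?lee_fin// [leRHS]EFinM.
apply: lee_pmul; rewrite ?lee_fin ?divr_ge0 ?pi_ge0 ?mule_ge0 ?diameter3_ge0//.
by rewrite expr2 EFinM; apply: lee_pmul => //; exact: diameter3_ge0.
Qed.

Lemma gauge_mono (d d' : R) (A : set T3) : (d' <= d)%R -> gauge d A <= gauge d' A.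
Proof.
move=> dd; rewrite /hausdorff2_gauge; case: (leP (diameter3 A) d'%:E) => [h|_]; last exact: leey.
by rewrite (le_trans h) ?lee_fin.
Qed.

Lemma mu_ext_mono (d d' : R) (A : set T3) : (d' <= d)%R -> mu_ext (gauge d) A <= mu_ext (gauge d') A.
Proof.
move=> dd; apply: le_ereal_inf_tmp => _ [F FA <-].
have : exists2 y, [set \sum_(0 <= k <oo) gauge d (F0 k) | F0 in measurable_cover A] y &
    y <= \sum_(0 <= k <oo) gauge d' (F k).
  exists (\sum_(0 <= k <oo) gauge d (F k)); first by exists F.
  by apply: lee_nneseries => k *; [exact: hausdorff2_gauge_ge0|exact: gauge_mono].
by case=> y yS yle; apply: le_trans yle; exact: ereal_inf_lbound.
Qed.

Lemma mu_ext_le_hausdorff (d : R) (A : set T3) : (0 < d)%R -> mu_ext (gauge d) A <= H2 A.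
Proof. by move=> d0; apply: ereal_sup_ubound; exists d. Qed.

(** A covering set of finite gauge has diameter at most d < r and so cannot meet both [A] and [B]:
    the cover splits in two without cost. If some gauge is infinite there is nothing to show. *)
Lemma mu_ext_separated (d r : R) (A B : set T3) : (0 < d)%R -> (d < r)%R ->
  (forall x y, A x -> B y -> (r <= edist3 x y)%R) ->
  mu_ext (gauge d) A + mu_ext (gauge d) B <= mu_ext (gauge d) (A `|` B).
Proof.
move=> d0 dr AB; apply: le_ereal_inf_tmp => _ [F [mF FAB] <-].
have g0 k : 0 <= gauge d (F k) by exact: hausdorff2_gauge_ge0.
have [big|small] := pselect (exists k, gauge d (F k) = +oo).
  case: big => k Fk; rewrite (_ : \sum_(0 <= k <oo) _ = +oo) ?leey//.
  apply/eqP; rewrite -leye_eq -Fk.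
  apply: le_trans (nneseries_lim_ge k.+1 (fun n _ _ => g0 n)).
  rewrite big_nat_recr//= leeDr//; exact: sume_ge0.
have diam k : diameter3 (F k) <= d%:E.
  rewrite leNgt; apply/negP => h; apply: small; exists k.
  by rewrite /hausdorff2_gauge leNgt h.
pose FA k := if `[< F k `&` A !=set0 >] then F k else set0.
pose FB k := if `[< F k `&` A !=set0 >] then set0 else F k.
have gs : gauge d set0 = 0 by exact: hausdorff2_gauge_set0.
have -> : \sum_(0 <= k <oo) gauge d (F k) = \sum_(0 <= k <oo) gauge d (FA k) + \sum_(0 <= k <oo) gauge d (FB k).
  rewrite -nneseriesD; [|by move=> *; exact: hausdorff2_gauge_ge0..].
  by apply: eq_eseriesr => k _; rewrite /FA /FB; case: ifP => _; rewrite gs ?adde0 ?add0e.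
apply: leeD; apply: ereal_inf_lbound.
  exists FA => //; split=> [k|x Ax]; first by rewrite /FA; case: ifP.
  have [k _ Fkx] := FAB x (or_introl Ax); exists k => //; rewrite /FA.
  by case: asboolP => // n; exfalso; apply: n; exists x.
exists FB => //; split=> [k|x Bx]; first by rewrite /FB; case: ifP.
have [k _ Fkx] := FAB x (or_intror Bx); exists k => //; rewrite /FB.
case: asboolP => // -[y [Fky Ay]].
have := le_trans (diameter3_ge Fky Fkx) (diam k); rewrite lee_fin => h.
by have := lt_le_trans dr (le_trans (AB _ _ Ay Bx) h); rewrite ltxx.
Qed.

Lemma hausdorff2_separated (r : R) (A B : set T3) : (0 < r)%R ->
  (forall x y, A x -> B y -> (r <= edist3 x y)%R) -> H2 A + H2 B <= H2 (A `|` B).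
Proof.
move=> r0 AB.
have [ABoo|] := ltP (H2 (A `|` B)) +oo; last by rewrite leye_eq => /eqP ->; exact: leey.
have ge0 (X : set T3) : 0 <= H2 X by exact: (@outer_measure_ge0 _ _ (@hausdorff2_outer R)).
have fin (X : set T3) : X `<=` A `|` B -> H2 X \is a fin_num.
  move=> XAB; rewrite ge0_fin_numE//; apply: le_lt_trans ABoo.
  exact: (@le_outer_measure _ _ (@hausdorff2_outer R)).
have fA : H2 A \is a fin_num by apply: fin => x; left.
have fB : H2 B \is a fin_num by apply: fin => x; right.
have e0 (d : R) (X : set T3) : 0 <= mu_ext (gauge d) X.
  by apply: mu_ext_ge0 => Y; exact: hausdorff2_gauge_ge0.
rewrite -leeBrDr//; apply: ge_ereal_sup => _ [d1 /= d10 <-].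
rewrite leeBrDr// addeC.
have f1 : mu_ext (gauge d1) A \is a fin_num.
  rewrite ge0_fin_numE//; apply: le_lt_trans (mu_ext_le_hausdorff _ d10) _.
  by rewrite ltey_eq fA.
rewrite -leeBrDr//; apply: ge_ereal_sup => _ [d2 /= d20 <-].
rewrite leeBrDr// addeC.
(* Both suprema over the scale are replaced by one scale, finer than the two given ones and smaller
   than the distance of the sets. *)
pose d := Num.min (r / 2)%R (Num.min d1 d2).
have d0 : (0 < d)%R by rewrite !lt_min d10 d20 divr_gt0.
have dd1 : (d <= d1)%R by rewrite /d !ge_min lexx !orbT.
have dd2 : (d <= d2)%R by rewrite /d !ge_min lexx !orbT.
have dr : (d < r)%R.
  by apply: (@le_lt_trans _ _ (r / 2)%R); [rewrite ge_min lexx|rewrite ltr_pdivrMr// ltr_pMr ?ltr1n].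
apply: le_trans (leeD (mu_ext_mono A dd1) (mu_ext_mono B dd2)) _.
apply: le_trans (mu_ext_separated d0 dr AB) _.
exact: mu_ext_le_hausdorff.
Qed.

Lemma lipschitz_caratheodory (f : T3 -> R) (L a : R) : (0 < L)%R ->
  (forall x y, (`|f x - f y| <= L * edist3 x y)%R) ->
  (hausdorff2 (R := R)).-caratheodory [set x | (f x <= a)%R].
Proof.
move=> L0 fL; apply: (@le_caratheodory_measurable R T3 (@hausdorff2_outer R)) => X.
apply: (@caratheodory_sublevel_le R T3 (@hausdorff2_outer R) f) => A B u v uv fA fB.
apply: (@hausdorff2_separated ((v - u) / L)%R); first by rewrite divr_gt0// subr_gt0.
move=> x y /fA fx /fB fy; rewrite ler_pdivrMr// mulrC; apply: le_trans (fL x y).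
by rewrite distrC; apply: le_trans (ler_norm _); lra.
Qed.

Lemma lipschitz_surface_measurable (f : T3 -> R) (L : R) : (0 < L)%R ->
  (forall x y, (`|f x - f y| <= L * edist3 x y)%R) ->
  measurable_fun setT (f : caratheodory_type (@hausdorff2 R) -> R).
Proof.
move=> L0 fL; apply: (measurability _ (RGenOInfty.measurableE R)) => _ [_ [a ->] <-].
rewrite setTI (_ : f @^-1` _ = ~` [set x | (f x <= a)%R]).
  by apply: measurableC; exact: (lipschitz_caratheodory a L0 fL).
apply/seteqP; split=> x /=; rewrite in_itv/= andbT; first by move=> h; apply/negP; rewrite -ltNge.
by move/negP; rewrite -ltNge.
Qed.

End hausdorff_measurability.

(** * Boundary layers and traces *)

Section boundary_layer.
Context (R : realType).
Local Notation mR := (measurableTypeR R).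
Local Notation T3 := (mR * mR * mR)%type.
Local Notation mu := (@lebesgue3 R).
Local Notation test := (@test_function R (R3 R) setT).
Local Notation e_ j := (basis3 R j).
Local Notation H2 := (@hausdorff2 R).
Local Notation gauge := (@hausdorff2_gauge R).

Lemma coord_le_edist j (x y : R3 R) : `|coord j x - coord j y| <= edist3 x y.
Proof.
rewrite /edist3 -sqrtr_sqr ler_wsqrtr//.
have := sqr_ge0 (x.1.1 - y.1.1); have := sqr_ge0 (x.1.2 - y.1.2); have := sqr_ge0 (x.2 - y.2).
by case: j => [[|[|[|//]]] ?]; rewrite /coord/=; lra.
Qed.

Lemma norm_le_edist (x y : R3 R) : `|x - y| <= edist3 x y.
Proof.
rewrite !prod_normE/= !ge_max -andbA; apply/and3P; split.
- exact: (coord_le_edist 0 x y).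
- exact: (coord_le_edist 1 x y).
- exact: (coord_le_edist 2 x y).
Qed.

Definition thick (j : 'I_3) (h : R) (A : set T3) : set T3 :=
  [set x | exists2 s, 0 <= s <= h & A ((x : R3 R) - s *: e_ j)].

Lemma compact_thick j h (A : set (R3 R)) : compact A -> compact (thick j h A : set (R3 R)).
Proof.
move=> cA; have c : compact (A `*` `[0, h]%classic) by apply: compact_setX => //; exact: segment_compact.
rewrite (_ : thick j h A = (fun z : R3 R * R => z.1 + z.2 *: e_ j) @` (A `*` `[0, h]%classic)).
  apply: continuous_compact => //; apply: continuous_subspaceT => z.
  by apply: cvgD; [exact: cvg_fst|apply: cvgZr_tmp; exact: cvg_snd].
apply/seteqP; split=> [x [s sh Ax]|_ [[x s] [/= Ax sh] <-]].
  by exists (x - s *: e_ j, s) => //=; rewrite ?subrK//; split=> //=; rewrite in_itv.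
by exists s; [move: sh; rewrite in_itv|rewrite addrK].
Qed.

Lemma measurable_thick j h (A : set (R3 R)) : compact A -> measurable (thick j h A).
Proof.
move=> cA; apply: measurable_closed3; apply: compact_closed; first exact: norm_hausdorff.
exact: compact_thick.
Qed.

Definition thick_box (j : 'I_3) (h d : R) (p : R3 R) : set T3 :=
  box ((p.1.1 - d, p.1.2 - d), p.2 - d)
      ((p.1.1 + d + h * (j == 0)%:R, p.1.2 + d + h * (j == 1)%:R), p.2 + d + h * (j == 2)%:R).

Lemma thick_box_measure j h d p : 0 <= d -> 0 <= h -> d <= h ->
  (mu (thick_box j h d p) <= (12 * h * d ^+ 2)%:E)%E.
Proof.
move=> d0 h0 dh; have hj k : 0 <= h * (j == k)%:R by rewrite mulr_ge0.
rewrite /thick_box lebesgue3_box/=; [|by have := hj 0; lra|by have := hj 1; lra|by have := hj 2; lra].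
rewrite lee_fin.
have -> : (p.1.1 + d + h * (j == 0)%:R - (p.1.1 - d)) * (p.1.2 + d + h * (j == 1)%:R - (p.1.2 - d)) *
    (p.2 + d + h * (j == 2)%:R - (p.2 - d)) = 4 * d ^+ 2 * (2 * d + h).
  by case: j {hj} => [[|[|[|//]]] ?] /=; ring.
have -> : 12 * h * d ^+ 2 = 4 * d ^+ 2 * (3 * h) by ring.
by rewrite ler_wpM2l ?mulr_ge0 ?sqr_ge0//; lra.
Qed.

Lemma thick_boxP j h d p (F : set T3) : 0 <= h -> F p -> (forall x y, F x -> F y -> edist3 x y <= d) ->
  thick j h F `<=` thick_box j h d p.
Proof.
move=> h0 Fp Fd x [s /andP[s0 sh] Fx]; have dd := Fd _ _ Fx Fp.
have b (k : 'I_3) : `|coord k (x - s *: e_ j) - coord k p| <= d by exact: le_trans (coord_le_edist k _ _) dd.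
have sb (k : 'I_3) : 0 <= s * (j == k)%:R <= h * (j == k)%:R by rewrite mulr_ge0//= ler_wpM2r.
have a (c q e u : R) : `|c - e - q| <= d -> 0 <= e <= u -> q - d <= c <= q + d + u.
  by rewrite ler_norml => /andP[? ?] /andP[? ?]; apply/andP; split; lra.
have b0 := b 0; have b1 := b 1; have b2 := b 2.
rewrite /coord/= /GRing.scale/= in b0; rewrite /coord/= /GRing.scale/= in b1; rewrite /coord/= /GRing.scale/= in b2.
split; [split|]; rewrite /= in_itv/=; apply: (a _ _ (s * _)); eauto.
Qed.

(** Covers of [A] by sets of diameter d <= h suffice, since larger sets have infinite gauge. The
    thickening of such a set lies in a box of volume at most 4 d^2 (2 d + h) <= 12 h d^2, and 4 / pi
    undoes the normalisation of the gauge. *)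
Lemma thick_le j h (A : set (R3 R)) : 0 < h -> compact A ->
  (mu (thick j h A) <= (12 * h * (4 / pi))%:E * H2 A)%E.
Proof.
move=> h0 cA; set c := 12 * h * (4 / pi).
have c0 : 0 < c by rewrite mulr_gt0 ?divr_gt0 ?pi_gt0// mulr_gt0.
apply: le_trans (lee_wpmul2l _ (mu_ext_le_hausdorff A h0)); last by rewrite lee_fin ltW.
rewrite -lee_pdivrMl//; apply: le_ereal_inf_tmp => _ [F [mF FA] <-].
rewrite lee_pdivrMl//.
have K k : exists B : set T3, [/\ measurable B, thick j h (F k) `<=` B &
    (mu B <= c%:E * gauge h (F k))%E].
  have [dh|dh] := leP (diameter3 (F k)) h%:E; last first.
    have -> : gauge h (F k) = +oo%E by rewrite /hausdorff2_gauge leNgt dh.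
    by exists setT; split=> //; rewrite gt0_muley ?lte_fin//; exact: leey.
  have [Fne|Fe] := pselect (F k !=set0); last first.
    exists set0; split=> //; last by rewrite measure0 mule_ge0 ?lee_fin ?(ltW c0) ?hausdorff2_gauge_ge0.
    by move=> x [s _ Fx]; apply: Fe; eexists; exact: Fx.
  have [p Fp] := Fne.
  have dfin : diameter3 (F k) \is a fin_num.
    by rewrite ge0_fin_numE ?diameter3_ge0//; apply: le_lt_trans dh _; rewrite ltry.
  set d := fine (diameter3 (F k)).
  have dE : diameter3 (F k) = d%:E by rewrite fineK.
  have d0 : 0 <= d by rewrite fine_ge0// diameter3_ge0.
  have dh' : d <= h by rewrite -lee_fin -dE.
  exists (thick_box j h d p); split; first exact: measurable_box.
    apply: thick_boxP => //; first exact: ltW.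
    by move=> x y Fx Fy; rewrite -lee_fin -dE; exact: diameter3_ge.
  apply: le_trans (thick_box_measure j p d0 (ltW h0) dh') _.
  rewrite /hausdorff2_gauge dh dE -!EFinM lee_fin /c le_eqVlt; apply/orP; left; apply/eqP.
  have fe (u v P : R) : P != 0 -> 12 * u * v ^+ 2 = 12 * u * (4 / P) * (P / 4 * (v * v)).
    by move=> P0; field.
  by apply: fe; rewrite gt_eqF// pi_gt0.
have [B HB] := choice K.
have mB k : measurable (B k) by have [] := HB k.
have cov : thick j h A `<=` \bigcup_k B k.
  move=> x [s sh Ax]; have [k _ Fk] := FA _ Ax; exists k => //.
  by have [_ h' _] := HB k; apply: h'; exists s.
have mt : measurable (thick j h A) by exact: measurable_thick.
have h1 := measure_sigma_subadditive mu mB mt cov; apply: (le_trans h1).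
rewrite -nneseriesZl => [|k _]; last exact: hausdorff2_gauge_ge0.
by apply: lee_nneseries => k *; have [] := HB k.
Qed.

(** Otherwise the preimage of [Omega] would be open and closed in the interval, which is
    connected. *)
Lemma frontier_crossing (Omega : set (R3 R)) (p : R -> R3 R) (a b s t : R) : open Omega ->
  continuous p -> a <= s <= b -> a <= t <= b -> Omega (p s) -> ~ Omega (p t) ->
  exists2 r, a <= r <= b & (closure Omega `\` Omega) (p r).
Proof.
move=> oO cp sab tab Os nOt; apply: contrapT => no.
have I : connected (`[a, b]%classic : set R) by exact: segment_connected.
have E : `[a, b]%classic `&` (p @^-1` Omega) = `[a, b]%classic.
  apply: I.
  - by exists s; split; rewrite //= in_itv.
  - by exists (p @^-1` Omega) => //; apply: open_comp => // x _; exact: cp.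
  - exists (p @^-1` closure Omega).
      by apply: closed_comp; [move=> x _; exact: cp|exact: closed_closure].
    apply/seteqP; split=> r [rab Or]; split=> //; first exact: subset_closure.
    apply: contrapT => nO; apply: no; exists r => //.
have : (`[a, b]%classic `&` (p @^-1` Omega)) t by rewrite E /= in_itv.
by case.
Qed.

Lemma thick_frontier (Omega : set (R3 R)) j h x : open Omega -> 0 <= h ->
  \1_(~` Omega) (x - h *: e_ j) != \1_(~` Omega) x :> R -> thick j h (closure Omega `\` Omega) x.
Proof.
move=> oO h0 ne; pose p r := x - r *: e_ j.
have cp : continuous p.
  by move=> r; apply: cvgB; [exact: cvg_cst|apply: cvgZr_tmp; exact: cvg_id].
have i0 : (0 : R) <= 0 <= h by apply/andP; split.
have ih : 0 <= h <= h by apply/andP; split.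
have p0 : p 0 = x by rewrite /p scale0r subr0.
move: ne; rewrite !indicE.
have [hh|hh] := pselect (Omega (p h)); have [hz|hz] := pselect (Omega (p 0)).
- by rewrite !memNset ?eqxx//; rewrite -?p0; exact: contra_not (fun h => h) _.
- by move=> _; exact: (frontier_crossing oO cp ih i0 hh hz).
- by move=> _; exact: (frontier_crossing oO cp i0 ih hz hh).
- by rewrite !mem_set ?eqxx// -p0.
Qed.

(** A dyadic layer-cake bound. It converts a pointwise bound by |phi| on the boundary into a finite
    sum over level sets, so that only measures of compact sets have to be compared. *)
Lemma dyadic_le (y d : R) (m : nat) : 0 < d -> 0 <= y -> y <= 2 ^+ m * d ->
  y <= d + \sum_(k < m) 2 ^+ k * d * (2 ^+ k * d <= y)%R%:R.
Proof.
move=> d0; elim: m y => [|m IH] y y0 ym; first by rewrite big_ord0 addr0; rewrite expr0 mul1r in ym.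
rewrite big_ord_recr/=; have [h|h] := leP (2 ^+ m * d) y; last first.
  by rewrite mulr0 addr0; apply: IH => //; exact: ltW.
have p0 : 0 <= 2 ^+ m * d by rewrite mulr_ge0 ?exprn_ge0 ?(ltW d0).
have := IH (2 ^+ m * d) p0 (lexx _).
rewrite mulr1 addrA => IH'; apply: (@le_trans _ _ (2 ^+ m * d + 2 ^+ m * d)).
  by apply: le_trans ym _; rewrite exprS -mulrA mulr_natl mulr2n.
rewrite lerD2r; apply: le_trans IH' _; rewrite lerD2l; apply: ler_sum => k _.
rewrite ler_wpM2l ?mulr_ge0 ?exprn_ge0 ?(ltW d0)// ler_nat.
by case: (leP _ (2 ^+ m * d)) => // h'; rewrite (le_trans h' h).
Qed.

Lemma test_surface_measurable phi : test phi ->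
  measurable_fun setT (phi : caratheodory_type H2 -> R).
Proof.
move=> tphi; have [L L0 HL] := test_lipschitz tphi.
apply: (@lipschitz_surface_measurable R phi (L + 1)); first by rewrite ltr_wpDl.
move=> x y; have := HL y (x - y); rewrite addrCA subrr addr0 => h.
apply: le_trans h _; apply: ler_pM => //; first by rewrite lerDl.
exact: norm_le_edist.
Qed.

(** The complement is the countable union of the positivity sets of the holes, which are Lipschitz
    and therefore Caratheodory measurable for the Hausdorff measure. *)
Lemma closed_surface_measurable (E : set (R3 R)) : closed E ->
  measurable (E : set (caratheodory_type H2)).
Proof.
move=> cE.
have -> : E = ~` \bigcup_n [set x | 0 < hole E n x].
  apply/seteqP; split=> [x Ex [n _ /=]|x nx]; first by rewrite hole_in// ltxx.
  apply: contrapT => nE; have [n hn] := hole_out cE nE; by apply: nx; exists n.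
apply: measurableC; apply: bigcupT_measurable => n.
have [->|tH] : hole E n = (fun=> 0) \/ test (hole E n).
- rewrite /hole; case: (unpickle n) => [k|]; last by left.
  by case: asboolP => _; [right; exact: test_box_bump|left].
- by rewrite (_ : [set _ | _] = set0)//; apply/seteqP; split=> // x /=; rewrite ltxx.
have m := test_surface_measurable tH.
rewrite (_ : [set _ | _] = setT `&` (hole E n @^-1` `]0, +oo[%classic)); last first.
  by apply/seteqP; split=> x /=; rewrite in_itv/= andbT; [split|case].
exact: m.
Qed.

Section layer_estimate.
Variable Omega : set (R3 R).
Hypotheses (oO : open Omega) (bO : bounded_set Omega).
Let bd : set (R3 R) := closure Omega `\` Omega.
Hypothesis bd_fin : (H2 bd < +oo)%E.

Lemma closed_frontier : closed bd.
Proof. by apply: closedI; [exact: closed_closure|exact: open_closedC]. Qed.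

Lemma bounded_closed_compact3 (A : set (R3 R)) (N : R) : closed A -> (forall x, A x -> `|x| <= N) -> compact A.
Proof.
move=> cA AN; apply: (subclosed_compact cA (B := box (- N, - N, - N) (N, N, N) : set (R3 R))).
  by apply: compact_setX; [apply: compact_setX|]; exact: segment_compact.
by move=> x /AN /norm3_box.
Qed.

Lemma closure_bounded (N : R) : (forall x, Omega x -> `|x| <= N) -> forall x, closure Omega x -> `|x| <= N.
Proof.
move=> ON x; have cl : closed [set x : R3 R | `|x| <= N].
  apply: (@closed_comp _ _ (fun x : R3 R => `|x|) [set t : R | t <= N]); last exact: closed_le.
  by move=> y _; exact: norm_continuous.
by rewrite closureE => /(_ _ (conj cl ON)).
Qed.

Lemma compact_frontier : compact bd.
Proof.
have [N [_ ON]] := bO; apply: (@bounded_closed_compact3 _ (N + 1)); first exact: closed_frontier.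
move=> x [cx _]; apply: closure_bounded cx => y Oy; apply: ON => //; by rewrite ltrDl.
Qed.

Definition level (phi : R3 R -> R) (s : R) : set (R3 R) := bd `&` [set x | s <= `|phi x|].

Lemma compact_level phi s : test phi -> compact (level phi s).
Proof.
move=> tphi; apply: (subclosed_compact _ compact_frontier); last by move=> x [].
apply: closedI; first exact: closed_frontier.
apply: (@closed_comp _ _ (fun x : R3 R => `|phi x|) [set t : R | s <= t]); last exact: closed_ge.
move=> y _; apply: continuous_comp; last exact: norm_continuous.
exact: smooth_continuous (test_smooth tphi) y.
Qed.

Lemma level_fin phi s : (H2 (level phi s) < +oo)%E.
Proof.
apply: le_lt_trans bd_fin; apply: (@le_outer_measure _ _ (@hausdorff2_outer R)).
by move=> x [].
Qed.

Let c : R := 12 * (4 / pi).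

Lemma thick_fine j h A : 0 < h -> compact A -> (H2 A < +oo)%E ->
  mu (thick j h A) \is a fin_num /\ fine (mu (thick j h A)) <= h * c * fine (H2 A).
Proof.
move=> h0 cA Afin.
have A0 : (0 <= H2 A)%E by exact: (@outer_measure_ge0 _ _ (@hausdorff2_outer R)).
have fA : H2 A \is a fin_num by rewrite ge0_fin_numE.
have t := thick_le j h0 cA; rewrite -(fineK fA) -EFinM in t.
have ft : mu (thick j h A) \is a fin_num.
  by rewrite ge0_fin_numE//; apply: le_lt_trans t _; rewrite ltry.
split=> //; rewrite -lee_fin fineK//; apply: le_trans t _.
by rewrite lee_fin /= /c le_eqVlt; apply/orP; left; apply/eqP; ring.
Qed.

Lemma indic_integrable (A : set T3) : measurable A -> mu A \is a fin_num ->
  mu.-integrable setT (EFin \o (\1_A : T3 -> R)) /\ \int[mu]_x (\1_A x : R) = fine (mu A).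
Proof.
move=> mA fA; split.
  apply/integrableP; split; first by apply/measurable_EFinP; exact: measurable_indic.
  under eq_integral do rewrite /= ger0_norm//.
  by rewrite integral_indic// setIT ltey_eq fA.
by rewrite /Rintegral integral_indic// setIT.
Qed.

(* The points of [~` Omega] that leave it under a shift by [h e_j] lie within
   [h] of the boundary; their volume near the level sets of [|phi|] is bounded
   by [h] times the surface measure of these level sets. *)
Lemma layer_estimate j phi d m : test phi -> 0 < d -> (forall x, `|phi x| <= 2 ^+ m * d) ->
  `|\int[mu]_x (\1_(~` Omega) x * 'D_(e_ j) phi x)| <=
  c * (d * fine (H2 bd) + \sum_(k < m) 2 ^+ k * d * fine (H2 (level phi (2 ^+ k * d)))).
Proof.
move=> tphi d0 phim; set I := \int[mu]_x _; set S := c * _.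
have mE : measurable (~` Omega : set T3) by apply: measurable_closed3; exact: open_closedC.
have [M M0 HM] := difference_quotient_le (e_ j) mE tphi.
have [L L0 HL] := test_lipschitz_along (e_ j) tphi.
have c0 : 0 <= c by rewrite mulr_ge0// divr_ge0// pi_ge0.
have H20 A : 0 <= fine (H2 A) by rewrite fine_ge0//; exact: (@outer_measure_ge0 _ _ (@hausdorff2_outer R)).
pose K := M + L * c * fine (H2 bd).
(* Divide by [h] and let it tend to 0. The quadratic error collects the Taylor remainder and the
   variation of [phi] within the layer. *)
suff : forall h : R, 0 < h -> h <= 1 -> h * `|I| <= h * S + K * h ^+ 2.
  move=> H; have K0 : 0 <= K by rewrite addr_ge0 ?(ltW M0)// mulr_ge0// mulr_ge0// ltW.
  rewrite leNgt; apply/negP => SI.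
  have e0 : 0 < (`|I| - S) / (K + 1) by rewrite divr_gt0 ?subr_gt0// ltr_wpDl.
  pose h := Num.min 1 ((`|I| - S) / (K + 1) / 2).
  have h0 : 0 < h by rewrite lt_min ltr01 divr_gt0.
  have h1 : h <= 1 by rewrite ge_min lexx.
  have hh : h <= (`|I| - S) / (K + 1) / 2 by rewrite ge_min lexx orbT.
  have h2 : `|I| <= S + K * h.
    rewrite -(ler_pM2l h0) (_ : h * (S + K * h) = h * S + K * h ^+ 2); first exact: H.
    have sc (x y z : R) : x * (y + z * x) = x * y + z * x ^+ 2 by ring.
    exact: sc.
  have : K * h <= (`|I| - S) / 2.
    apply: le_trans (ler_wpM2l K0 hh) _; rewrite !mulrA ler_pM2r ?invr_gt0// ler_pdivrMr ?ltr_wpDl//.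
    by rewrite mulrC ler_wpM2l ?subr_ge0 ?(ltW SI)// lerDl.
  have : 0 < `|I| - S by rewrite subr_gt0.
  have sc2 (x y z : R) : x <= y + z -> 0 < x - y -> z <= (x - y) / 2 -> False by move=> *; lra.
  exact: sc2 h2.
move=> h h0 h1; have hM := HM h _; rewrite (ger0_norm (ltW h0)) in hM; have {hM} := hM h1.
have mi : measurable_fun setT (\1_(~` Omega) : T3 -> R) by exact: measurable_indic.
have mphi := test_measurable tphi.
have tsh := test_shift (h *: e_ j) tphi.
have ib : exists B : R, forall x : R3 R, `|\1_(~` Omega) x : R| <= B by exists 1 => x; exact: normr_indic_le1.
have i1 : mu.-integrable setT (EFin \o (fun x : T3 => \1_(~` Omega) x * phi (x + h *: e_ j))).
  exact: test_mul_integrable.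
have i2 : mu.-integrable setT (EFin \o (fun x : T3 => \1_(~` Omega) x * phi x)).
  exact: test_mul_integrable.
(* Translation invariance moves the shift from [phi] to the indicator, so that only points where the
   indicator changes contribute. *)
pose E' (x : R3 R) : R := \1_(~` Omega) (x - h *: e_ j).
have mE' : measurable_fun setT (E' : T3 -> R).
  exact: measurableT_comp mi (proj1 (preserving_shift3 (- (h *: e_ j)))).
have i3 : mu.-integrable setT (EFin \o (fun x : T3 => E' x * phi x)).
  by apply: test_mul_integrable => //; exists 1 => x; exact: normr_indic_le1.
have e1 : \int[mu]_x (\1_(~` Omega) x * (phi (x + h *: e_ j) - phi x)) = \int[mu]_x ((E' x - \1_(~` Omega) x) * phi x).
  have -> : \int[mu]_x (\1_(~` Omega) x * (phi (x + h *: e_ j) - phi x)) =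
     \int[mu]_x (\1_(~` Omega) x * phi (x + h *: e_ j)) - \int[mu]_x (\1_(~` Omega) x * phi x).
    by rewrite -RintegralB//; apply: eq_Rintegral => x _; rewrite mulrBr.
  have -> : \int[mu]_x (\1_(~` Omega) x * phi (x + h *: e_ j)) = \int[mu]_x (E' x * phi x).
    have mm : measurable_fun setT (fun x : T3 => E' x * phi x) by exact: measurable_funM.
    rewrite -(int_shift (h *: e_ j) mm); apply: eq_Rintegral => x _.
    by rewrite /E' addrK.
  by rewrite -RintegralB//; apply: eq_Rintegral => x _; rewrite mulrBl.
rewrite e1 => hI.
have [t0fin t0le] := thick_fine j h0 compact_frontier bd_fin.
have tk k := thick_fine j h0 (@compact_level phi (2 ^+ k * d) tphi) (level_fin phi (2 ^+ k * d)).
have [it0 et0] := indic_integrable (measurable_thick j h compact_frontier) t0fin.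
have itk k := indic_integrable (measurable_thick j h (@compact_level phi (2 ^+ k * d) tphi)) (proj1 (tk k)).
pose Gk (k : 'I_m) (x : T3) : R := 2 ^+ k * d * \1_(thick j h (level phi (2 ^+ k * d))) x.
pose G0 (x : T3) : R := (d + L * h) * \1_(thick j h bd) x.
have iG0 : mu.-integrable setT (EFin \o G0).
  rewrite (_ : _ \o _ = fun x => ((d + L * h)%:E * (\1_(thick j h bd) x)%:E)%E).
    exact: integrableZl.
  by apply/funext => x; rewrite /= EFinM.
have iGk k : mu.-integrable setT (EFin \o Gk k).
  rewrite (_ : _ \o _ = fun x => ((2 ^+ k * d)%:E * (\1_(thick j h (level phi (2 ^+ k * d))) x)%:E)%E).
    by apply: integrableZl => //; exact: (proj1 (itk k)).
  by apply/funext => x; rewrite /= EFinM.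
have iS : mu.-integrable setT (EFin \o (fun x => \sum_(k < m) Gk k x)).
  rewrite (_ : _ \o _ = fun x => (\sum_(k < m) (Gk k x)%:E)%E).
    by apply: integrable_sum => // k _; exact: iGk.
  by apply/funext => x; rewrite /= sumEFin.
(* Where the indicator changes, the segment of length [h] ending at x meets the boundary; there
   |phi| differs from |phi(x)| by at most L h, and its value is distributed over the dyadic
   levels. *)
have pw x : `|(E' x - \1_(~` Omega) x) * phi x| <= G0 x + \sum_(k < m) Gk k x.
  have r0 : 0 <= G0 x + \sum_(k < m) Gk k x.
    rewrite addr_ge0//; first by rewrite mulr_ge0// addr_ge0 ?mulr_ge0 ?(ltW d0) ?(ltW L0) ?(ltW h0).
    by apply: sumr_ge0 => k _; rewrite mulr_ge0// mulr_ge0 ?exprn_ge0 ?(ltW d0).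
  have [ee|ne] := eqVneq (E' x) (\1_(~` Omega) x); first by rewrite ee subrr mul0r normr0.
  have tx := thick_frontier oO (ltW h0) ne.
  have [s /andP[s0 sh] bs] := tx.
  have E1 : `|E' x - \1_(~` Omega) x| <= 1.
    rewrite /E' !indicE; do 2 case: (_ \in _); rewrite ?subrr ?subr0 ?sub0r ?normrN ?normr1 ?normr0//.
  rewrite normrM; apply: (@le_trans _ _ `|phi x|); first by rewrite ler_piMl.
  have hp : `|phi x| <= `|phi (x - s *: e_ j)| + L * h.
    have := HL (x - s *: e_ j) s; rewrite subrK (ger0_norm s0) => h2.
    have h3 : L * s <= L * h by rewrite ler_wpM2l// ltW.
    have := ler_normD (phi (x - s *: e_ j)) (phi x - phi (x - s *: e_ j)).
    rewrite addrCA subrr addr0; lra.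
  apply: le_trans hp _.
  have := dyadic_le d0 (normr_ge0 _) (phim (x - s *: e_ j)) => dy.
  apply: le_trans (lerD dy (lexx _)) _.
  rewrite /G0 indicE mem_set// mulr1 addrAC lerD2l; apply: ler_sum => k _.
  rewrite /Gk ler_wpM2l//; first by rewrite mulr_ge0 ?exprn_ge0 ?(ltW d0).
  rewrite indicE ler_nat; case: (leP (2 ^+ k * d)) => // hk.
  by rewrite mem_set//; exists s; [rewrite s0|split].
have iabs : mu.-integrable setT (EFin \o (fun x => `|(E' x - \1_(~` Omega) x) * phi x|)).
  have i4 : mu.-integrable setT (EFin \o (fun x : T3 => (E' x - \1_(~` Omega) x) * phi x)).
    rewrite (_ : _ \o _ = fun x => ((E' x * phi x)%:E - (\1_(~` Omega) x * phi x)%:E)%E).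
      exact: integrableB.
    by apply/funext => x; rewrite /= mulrBl EFinB.
  by have /integrable_abse := i4.
have iG : mu.-integrable setT (EFin \o (fun x => G0 x + \sum_(k < m) Gk k x)).
  by rewrite (_ : _ \o _ = fun x => ((G0 x)%:E + (\sum_(k < m) Gk k x)%:E)%E)//; exact: integrableD.
have X1 : `|\int[mu]_x ((E' x - \1_(~` Omega) x) * phi x)| <= \int[mu]_x (G0 x + \sum_(k < m) Gk k x).
  have i4 : mu.-integrable setT (EFin \o (fun x : T3 => (E' x - \1_(~` Omega) x) * phi x)).
    rewrite (_ : _ \o _ = fun x => ((E' x * phi x)%:E - (\1_(~` Omega) x * phi x)%:E)%E).
      exact: integrableB.
    by apply/funext => x; rewrite /= mulrBl EFinB.
  apply: le_trans (le_normr_Rintegral _ i4) _ => //.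
  by apply: le_Rintegral => // x _; exact: pw.
have X2 : \int[mu]_x (G0 x + \sum_(k < m) Gk k x) =
    (d + L * h) * fine (mu (thick j h bd)) +
    \sum_(k < m) 2 ^+ k * d * fine (mu (thick j h (level phi (2 ^+ k * d)))).
  rewrite RintegralD//; congr (_ + _); first by rewrite RintegralZl// et0.
  have iG' (r : seq 'I_m) : mu.-integrable setT (EFin \o (fun x => \sum_(k <- r) Gk k x)) /\
      \int[mu]_x (\sum_(k <- r) Gk k x) = \sum_(k <- r) \int[mu]_x Gk k x.
    elim: r => [|k r [IH1 IH2]].
      rewrite big_nil; split.
        rewrite (_ : _ \o _ = fun x => 0%:E); first exact: integrable0.
        by apply/funext => x; rewrite /= big_nil.
      by rewrite -[RHS](dot0l mu (fun=> 0 : R)); apply: eq_Rintegral => x _; rewrite big_nil mul0r.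
    have e2 : (fun x => \sum_(k <- k :: r) Gk k x) = (fun x => Gk k x + \sum_(k <- r) Gk k x).
      by apply/funext => x; rewrite big_cons.
    rewrite e2 big_cons; split.
      exact: (integrableD _ (iGk k) IH1).
    by rewrite RintegralD// IH2.
  have [_ ->] := iG' (index_enum 'I_m); apply: eq_bigr => k _.
  have [i5 e5] := itk k.
  by rewrite RintegralZl// e5.
have X3 : (d + L * h) * fine (mu (thick j h bd)) +
    \sum_(k < m) 2 ^+ k * d * fine (mu (thick j h (level phi (2 ^+ k * d)))) <=
    (d + L * h) * (h * c * fine (H2 bd)) +
    \sum_(k < m) 2 ^+ k * d * (h * c * fine (H2 (level phi (2 ^+ k * d)))).
  apply: lerD; first by rewrite ler_wpM2l// addr_ge0 ?mulr_ge0 ?(ltW d0) ?(ltW L0) ?(ltW h0).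
  apply: ler_sum => k _; rewrite ler_wpM2l//; first by rewrite mulr_ge0 ?exprn_ge0 ?(ltW d0).
  exact: (proj2 (tk k)).
have X4 : (d + L * h) * (h * c * fine (H2 bd)) +
    \sum_(k < m) 2 ^+ k * d * (h * c * fine (H2 (level phi (2 ^+ k * d)))) =
    h * S + L * c * fine (H2 bd) * h ^+ 2.
  rewrite /S (eq_bigr (fun k : 'I_m => h * c * (2 ^+ k * d * fine (H2 (level phi (2 ^+ k * d)))))); last first.
    by move=> k _; ring.
  by rewrite -mulr_sumr; ring.
have X5 := le_trans X1 (le_trans (eq_ind_r (fun z => z <= _) X3 X2) (eq_ind_r (fun z => z <= _) (lexx _) X4)).
have hI' : `|h * I| <= M * h ^+ 2 + (h * S + L * c * fine (H2 bd) * h ^+ 2).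
  move: hI X5; rewrite -/I; move: (\int[mu]_x _) => Z hI X5.
  have -> : h * I = Z - (Z - h * I) by ring.
  by apply: le_trans (ler_normB _ _) _; rewrite addrC lerD.
rewrite normrM (ger0_norm (ltW h0)) in hI'; apply: le_trans hI' _.
by rewrite /K le_eqVlt; apply/orP; left; apply/eqP; ring.
Qed.

End layer_estimate.

End boundary_layer.

Lemma markov_square d (T : measurableType d) (R : realType) (m : {measure set T -> \bar R})
    (D A : set T) (f : T -> R) (s J : R) : measurable D -> measurable A -> A `<=` D ->
  measurable_fun D (fun x => (f x ^+ 2)%:E) -> 0 < s -> (forall x, A x -> s <= `|f x|) ->
  (\int[m]_(x in D) (f x ^+ 2)%:E <= J%:E)%E -> ((s ^+ 2)%:E * m A <= J%:E)%E.
Proof.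
move=> mD mA AD mf s0 sA; apply: le_trans.
rewrite -integral_cst//; apply: (@le_trans _ _ (\int[m]_(x in A) (f x ^+ 2)%:E)%E).
  apply: ge0_le_integral => //.
  - by move=> x _; rewrite lee_fin sqr_ge0.
  - exact: measurable_funS AD mf.
  - move=> x /sA sx; rewrite lee_fin -[leRHS]real_normK ?num_real//.
    by rewrite ler_sqr ?nnegrE ?(ltW s0).
by apply: ge0_subset_integral => // x _; rewrite lee_fin sqr_ge0.
Qed.

Lemma square_diff_le (R : realDomainType) (a b c e : R) : c = e ->
  (a - b) ^+ 2 <= 2 * (a - c) ^+ 2 + 2 * (b - e) ^+ 2.
Proof.
move=> <-; rewrite -subr_ge0 (_ : _ - _ = ((a - c) + (b - c)) ^+ 2); first exact: sqr_ge0.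
ring.
Qed.

(** Where t1 = t2, (f1 - f2)^2 <= 2 (f1 - t1)^2 + 2 (f2 - t2)^2: two approximations of one trace are
    close on the boundary. *)
Lemma square_diff_integral d (T : measurableType d) (R : realType) (m : {measure set T -> \bar R})
    (D : set T) (f1 f2 t1 t2 phi : T -> R) (B r : R) : measurable D ->
  measurable_fun D f1 -> measurable_fun D f2 -> measurable_fun D t1 -> measurable_fun D t2 ->
  measurable_fun D phi -> (forall x, `|phi x| <= B) -> {ae m, forall x, D x -> t1 x = t2 x} ->
  (\int[m]_(x in D) ((f1 x - t1 x) ^+ 2)%:E <= r%:E)%E ->
  (\int[m]_(x in D) ((f2 x - t2 x) ^+ 2)%:E <= r%:E)%E ->
  (\int[m]_(x in D) (((f1 x - f2 x) * phi x) ^+ 2)%:E <= (B ^+ 2 * (4 * r))%:E)%E.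
Proof.
move=> mD m1 m2 mt1 mt2 mp HB t12 h1 h2.
have mq (f t : T -> R) : measurable_fun D f -> measurable_fun D t ->
    measurable_fun D (fun x => (2 * (f x - t x) ^+ 2)%:E).
  by move=> mf mt; apply/measurable_EFinP; apply: measurable_funM => //; apply: measurable_funX; exact: measurable_funB.
have mq1 := mq _ _ m1 mt1; have mq2 := mq _ _ m2 mt2.
have q0 (u : T -> R) x : D x -> (0 <= (2 * (u x) ^+ 2)%:E)%E.
  by move=> _; rewrite lee_fin mulr_ge0// sqr_ge0.
apply: (@le_trans _ _ ((B ^+ 2)%:E * \int[m]_(x in D) ((2 * (f1 x - t1 x) ^+ 2)%:E + (2 * (f2 x - t2 x) ^+ 2)%:E))%E).
  rewrite -ge0_integralZl_EFin ?sqr_ge0//; last 2 first.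
  - by move=> x _; rewrite adde_ge0// lee_fin mulr_ge0// sqr_ge0.
  - exact: emeasurable_funD.
  apply: ae_ge0_le_integral => //.
  - by move=> x _; rewrite lee_fin sqr_ge0.
  - by apply/measurable_EFinP; apply: measurable_funX; apply: measurable_funM => //; exact: measurable_funB.
  - move=> x _; apply: mule_ge0; first by rewrite lee_fin sqr_ge0.
    by apply: adde_ge0; rewrite lee_fin mulr_ge0// sqr_ge0.
  - by apply: measurable_funeM; exact: emeasurable_funD.
  apply: filterS t12 => x h xD; rewrite -EFinD -EFinM lee_fin exprMn mulrC.
  have B0 : 0 <= B by exact: le_trans (HB x).
  apply: ler_pM; rewrite ?sqr_ge0//; last exact: square_diff_le (h xD).
  by rewrite -[leLHS]real_normK ?num_real// ler_sqr ?nnegrE.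
rewrite [leRHS]EFinM lee_wpmul2l ?lee_fin ?sqr_ge0//.
rewrite ge0_integralD//; [|exact: (q0 (fun x => f1 x - t1 x))|exact: (q0 (fun x => f2 x - t2 x))].
have half (u : T -> R) : measurable_fun D u ->
    (\int[m]_(x in D) ((u x) ^+ 2)%:E <= r%:E)%E ->
    (\int[m]_(x in D) (2 * (u x) ^+ 2)%:E <= (2 * r)%:E)%E.
  move=> mu' h; under eq_integral do rewrite EFinM.
  rewrite ge0_integralZl_EFin//; last 2 first.
  - by move=> x _; rewrite lee_fin sqr_ge0.
  - by apply/measurable_EFinP; exact: measurable_funX.
  by rewrite [leRHS]EFinM lee_wpmul2l// lee_fin.
rewrite (_ : 4 * r = 2 * r + 2 * r); last by ring.
rewrite EFinD; apply: leeD; apply: half => //; exact: measurable_funB.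
Qed.

Section trace.
Context (R : realType).
Local Notation mu := (@lebesgue3 R).
Local Notation test := (@test_function R (R3 R) setT).
Local Notation e_ j := (basis3 R j).
Local Notation H2 := (@hausdorff2 R).
Local Notation sig := (@surface_measure R).
Local Notation C3 := (caratheodory_type (@hausdorff2 R)).

Lemma sum_half (m : nat) : \sum_(k < m) (2 ^+ k)^-1 <= 2 :> R.
Proof.
suff : \sum_(k < m) (2 ^+ k)^-1 = 2 - 2 * (2 ^+ m)^-1 :> R.
  by move=> ->; rewrite lerBlDr lerDl mulr_ge0// invr_ge0 exprn_ge0.
elim: m => [|m IH]; first by rewrite big_ord0 expr0 invr1 mulr1 subrr.
rewrite big_ord_recr/= IH exprS; have : (2 : R) ^+ m != 0 by rewrite expf_neq0.
by move: (2 ^+ m : R) => x x0; field.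
Qed.

Section domain.
Variable Omega : set (R3 R).
Hypotheses (oO : open Omega) (bO : bounded_set Omega).
Local Notation bd := (closure Omega `\` Omega).
Hypothesis bd_fin : (H2 bd < +oo)%E.

Lemma measurable_frontier : measurable (bd : set C3).
Proof. by apply: closed_surface_measurable; exact: closed_frontier. Qed.

Lemma square_surface_measurable phi : test phi ->
  measurable_fun (bd : set C3) (fun x : C3 => (phi x ^+ 2)%:E).
Proof.
move=> tphi; apply/measurable_EFinP; apply: measurable_funX.
by apply: measurable_funTS; exact: test_surface_measurable.
Qed.

Lemma level_markov phi s J : test phi -> 0 < s ->
  (\int[sig]_(x in (bd : set C3)) (phi x ^+ 2)%:E <= J%:E)%E ->
  s ^+ 2 * fine (H2 (level Omega phi s)) <= J.
Proof.
move=> tphi s0 IJ.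
have ml : measurable (level Omega phi s : set C3).
  apply: closed_surface_measurable; apply: compact_closed; first exact: norm_hausdorff.
  exact: compact_level.
have mb := measurable_frontier.
have fl : H2 (level Omega phi s) \is a fin_num.
  rewrite ge0_fin_numE; first exact: level_fin.
  exact: (@outer_measure_ge0 _ _ (@hausdorff2_outer R)).
have sl : (level Omega phi s : set C3) `<=` bd by move=> x [].
have mp := square_surface_measurable tphi.
rewrite -lee_fin EFinM fineK//.
exact: (markov_square mb ml sl mp s0 (fun x h => proj2 h) IJ).
Qed.

(** By Markov's inequality the level 2^k d has area at most J / (2^k d)^2, so the dyadic sum is at
    most 2 J / d. The point is the order of limits: a small [d] controls the area term, after which
    [J] may tend to 0. *)
Lemma layer_integral j phi d J : test phi -> 0 < d ->
  (\int[sig]_(x in (bd : set C3)) (phi x ^+ 2)%:E <= J%:E)%E ->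
  `|\int[mu]_x (\1_(~` Omega) x * 'D_(e_ j) phi x)| <=
  12 * (4 / pi) * (d * fine (H2 bd) + 2 * J / d).
Proof.
move=> tphi d0 IJ.
have [M M0 HM] := test_bounded tphi.
have [m Hm] : exists m, M <= 2 ^+ m * d.
  exists (Num.bound (M / d)); rewrite -ler_pdivrMr//.
  apply: le_trans (ltW (archi_boundP _)) _; first by rewrite divr_ge0 ?ltW.
  by rewrite -natrX ler_nat ltnW// ltn_expl.
have J0 : 0 <= J.
  by rewrite -lee_fin; apply: le_trans IJ; apply: integral_ge0 => x _; rewrite lee_fin sqr_ge0.
have H := layer_estimate oO bO bd_fin j tphi d0 (fun x => le_trans (HM x) Hm).
apply: le_trans H _; apply: ler_wpM2l; first by rewrite mulr_ge0// divr_ge0// pi_ge0.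
rewrite lerD2l; apply: (@le_trans _ _ (\sum_(k < m) J / d * (2 ^+ k)^-1)).
  apply: ler_sum => k _; have p0 : (0 : R) < 2 ^+ k by rewrite exprn_gt0.
  have s0 : 0 < 2 ^+ k * d by rewrite mulr_gt0.
  have := level_markov tphi s0 IJ; move: (fine _) => h.
  by move: (2 ^+ k : R) p0 s0 => t p0 s0 hh; rewrite ler_pdivlMr// ler_pdivlMr//; move: hh; congr (_ <= _); ring.
have -> : 2 * J / d = J / d * 2 by ring.
rewrite -mulr_sumr.
by rewrite ler_wpM2l ?sum_half// divr_ge0// ltW.
Qed.

(** By the product rule, the exterior integral of the derivative of (u1 n - u2 n) phi tends to the
    sum [L] of the two pairings. [layer_integral] bounds it by the L2 size of u1 n - u2 n on the
    boundary, which tends to 0 because the traces coincide. *)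
Lemma trace_identity (u1 u2 : nat -> R3 R -> R) w1 w2 (g1 g2 : 'I_3 -> R3 R -> R) (tau1 tau2 : R3 R -> R) :
  (forall n, test (u1 n)) -> (forall n, test (u2 n)) ->
  cvgL2 mu u1 w1 -> cvgL2 mu u2 w2 ->
  (forall j, cvgL2 mu (fun n => 'D_(e_ j) (u1 n)) (g1 j)) ->
  (forall j, cvgL2 mu (fun n => 'D_(e_ j) (u2 n)) (g2 j)) ->
  measurable_fun (bd : set C3) (tau1 : C3 -> R) -> measurable_fun (bd : set C3) (tau2 : C3 -> R) ->
  (\int[sig]_(x in (bd : set C3)) ((u1 n x - tau1 x) ^+ 2)%:E)%E @[n --> \oo] --> 0%E ->
  (\int[sig]_(x in (bd : set C3)) ((u2 n x - tau2 x) ^+ 2)%:E)%E @[n --> \oo] --> 0%E ->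
  {ae sig, forall x : C3, (bd : set C3) x -> tau1 x = tau2 x} ->
  forall phi j, test phi -> dot mu (fun x => \1_(~` Omega) x * (w1 x - w2 x)) ('D_(e_ j) phi) =
    - dot mu (fun x => \1_(~` Omega) x * (g1 j x - g2 j x)) phi.
Proof.
move=> t1 t2 cu1 cu2 cg1 cg2 mt1 mt2 c1 c2 t12 phi j tphi.
have cE : closed (~` Omega) by exact: open_closedC.
have mb := measurable_frontier.
have [B B0 HB] := test_bounded tphi.
have tpsi n : test (fun x => (u1 n x - u2 n x) * phi x).
  by apply: testMl => //; apply: test_smooth (testB (t1 n) (t2 n)).
pose L := dot mu (fun x => \1_(~` Omega) x * (w1 x - w2 x)) ('D_(e_ j) phi) +
  dot mu (fun x => \1_(~` Omega) x * (g1 j x - g2 j x)) phi.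
have cw := cvgL2_indic cE (cvgL2B cu1 cu2).
have cg := cvgL2_indic cE (cvgL2B (cg1 j) (cg2 j)).
have p2 := test_L2 tphi; have dp2 := test_L2 (test_derive (e_ j) tphi).
have cL : \int[mu]_x (\1_(~` Omega) x * 'D_(e_ j) (fun x => (u1 n x - u2 n x) * phi x) x) @[n --> \oo] --> L.
  have E n : \int[mu]_x (\1_(~` Omega) x * 'D_(e_ j) (fun x => (u1 n x - u2 n x) * phi x) x) =
      dot mu (fun x => \1_(~` Omega) x * (u1 n x - u2 n x)) ('D_(e_ j) phi) +
      dot mu (fun x => \1_(~` Omega) x * ('D_(e_ j) (u1 n) x - 'D_(e_ j) (u2 n) x)) phi.
    have [a2 _ _] := cw; have [b2 _ _] := cg.
    have i1 := dot_integrable (a2 n) dp2; have i2 := dot_integrable (b2 n) p2.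
    rewrite /dot -RintegralD//; apply: eq_Rintegral => x _.
    have s1 := test_smooth (t1 n); have s2 := test_smooth (t2 n).
    rewrite (derive_smoothM x (e_ j) (smoothB s1 s2) (test_smooth tphi)) (derive_smoothB x (e_ j) s1 s2).
    by rewrite mulrDr !mulrA [_ * phi x * _]mulrAC.
  rewrite (funext E); apply: cvgD; exact: cvgL2_dot.
have H20 : 0 <= fine (H2 bd) by rewrite fine_ge0//; exact: (@outer_measure_ge0 _ _ (@hausdorff2_outer R)).
pose c : R := 12 * (4 / pi).
have c0 : 0 <= c by rewrite mulr_ge0// divr_ge0// pi_ge0.
have main e : 0 < e -> `|L| <= e.
  move=> e0.
  have m1 : 0 < c * fine (H2 bd) + 1 by rewrite ltr_wpDl// mulr_ge0.
  (* Fixed before [n]: the area term is at most e / 3, and the tolerance [r] below compensates the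
     factor 1 / d. *)
  pose d := e / 3 / (c * fine (H2 bd) + 1).
  have d0 : 0 < d by rewrite !divr_gt0.
  have dle : c * (d * fine (H2 bd)) <= e / 3.
    rewrite /d mulrCA mulrAC -mulrA ler_piMr ?divr_ge0 ?(ltW e0)//.
    by rewrite ler_pdivrMr// mul1r mulrC lerDl.
  pose K := c * (8 * B ^+ 2 / d) + 1.
  have K0 : 0 < K by rewrite ltr_wpDl// mulr_ge0// divr_ge0 ?(ltW d0)// mulr_ge0// sqr_ge0.
  pose r := e / 3 / K; have r0 : 0 < r by rewrite !divr_gt0.
  have small (u : nat -> \bar R) : u n @[n --> \oo] --> 0%E -> \forall n \near \oo, (u n <= r%:E)%E.
    move=> cu; have HH : nbhs (0 : \bar R)%E [set y | (y < r%:E)%E].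
      by apply: open_nbhs_nbhs; split; [exact: open_ereal_lt_ereal|rewrite /= lte_fin].
    apply: (@filterS _ \oo _ [set n | (u n < r%:E)%E]); first by move=> n /ltW.
    exact: (cu _ HH).
  have e30 : 0 < e / 3 by rewrite divr_gt0.
  move/cvgrPdist_le : cL => /(_ _ e30) nL.
  have [n [[n1 n2] n3]] := filter_ex (filterI (filterI (small _ c1) (small _ c2)) nL).
  have sq1 : (\int[sig]_(x in (bd : set C3)) (((u1 n x - u2 n x) * phi x) ^+ 2)%:E <= (B ^+ 2 * (4 * r))%:E)%E.
    have ms u : test u -> measurable_fun (bd : set C3) (u : C3 -> R).
      by move=> tu; apply: measurable_funTS; exact: test_surface_measurable.
    exact: (square_diff_integral mb (ms _ (t1 n)) (ms _ (t2 n)) mt1 mt2 (ms _ tphi) HB t12 n1 n2).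
  have lay := layer_integral j (tpsi n) d0 sq1.
  rewrite -/c mulrDr in lay.
  have rle : c * (2 * (B ^+ 2 * (4 * r)) / d) <= e / 3.
    have -> : c * (2 * (B ^+ 2 * (4 * r)) / d) = (c * (8 * B ^+ 2 / d)) * r by ring.
    have sc (x q : R) : 0 <= x -> 0 <= q -> x * (q / (x + 1)) <= q.
      move=> x0 q0; rewrite mulrCA ler_piMr// ler_pdivrMr ?ltr_wpDl// mul1r lerDl; exact: ler01.
    by apply: sc; [rewrite mulr_ge0// divr_ge0 ?(ltW d0)// mulr_ge0// sqr_ge0|rewrite ltW].
  have := ler_normD (L - \int[mu]_x (\1_(~` Omega) x * 'D_(e_ j) (fun x => (u1 n x - u2 n x) * phi x) x))
    (\int[mu]_x (\1_(~` Omega) x * 'D_(e_ j) (fun x => (u1 n x - u2 n x) * phi x) x)).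
  rewrite subrK; move: n3 lay dle rle.
  move: (\int[mu]_x _) (c * (d * _)) (c * (2 * _ / d)) => z a b n3 lay dle rle nl.
  lra.
have L0 : L = 0.
  apply/eqP; rewrite -normr_eq0 eq_le normr_ge0 andbT leNgt; apply/negP => L0.
  have l2 : 0 < `|L| / 2 by rewrite divr_gt0.
  have := main _ l2; lra.
by apply/eqP; rewrite -addr_eq0; apply/eqP.
Qed.

End domain.

End trace.

(** * Lipschitz boundaries have finite area *)

Section frontier_finite.
Context (R : realType).
Local Notation mR := (measurableTypeR R).
Local Notation T3 := (mR * mR * mR)%type.
Local Notation H2 := (@hausdorff2 R).
Local Notation gauge := (@hausdorff2_gauge R).

(** The bound on N r^2 is uniform over scales, so it survives the supremum that defines the
    measure. *)
Lemma hausdorff2_finite_cover (B : set T3) (C : R) :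
  (forall d, 0 < d -> exists (N : nat) (F : nat -> set T3) (r : R), [/\ forall k, measurable (F k),
     B `<=` \bigcup_(k in `I_N) F k, 0 <= r <= d,
     forall k x y, F k x -> F k y -> edist3 x y <= r & N%:R * r ^+ 2 <= C]) ->
  (H2 B < +oo)%E.
Proof.
move=> H; apply: (@le_lt_trans _ _ (pi / 4 * C)%:E); last by rewrite ltry.
apply: ge_ereal_sup => _ [d /= d0 <-].
have [N [F [r [mF BF rd Fr NC]]]] := H d d0.
pose F' k := if (k < N)%N then F k else set0.
apply: (@le_trans _ _ (\sum_(0 <= k <oo) gauge d (F' k))%E).
  apply: ereal_inf_lbound; exists F' => //; split=> [k|x Bx].
    by rewrite /F'; case: ifP.
  by have [k /= kN Fx] := BF x Bx; exists k => //; rewrite /F' kN.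
rewrite (nneseries_split _ N); last by move=> *; exact: hausdorff2_gauge_ge0.
rewrite [X in (_ + X)%E]eseries0 ?adde0; last first.
  by move=> k Nk _; rewrite /F' ltnNge Nk/= hausdorff2_gauge_set0.
apply: (@le_trans _ _ (\sum_(0 <= k < N) (pi / 4 * r ^+ 2)%:E)%E).
  rewrite add0n big_nat [leRHS]big_nat; apply: lee_sum => k /andP[_ kN].
  by rewrite /F' kN; apply: gauge_le_diameter => // x y; exact: Fr.
rewrite sumEFin lee_fin big_const_nat subn0 iter_addr_0.
have sc (a b c : R) n : 0 <= a -> n%:R * b <= c -> (a * b) *+ n <= a * c.
  by move=> a0 h; rewrite -mulr_natr -mulrA ler_wpM2l// mulrC.
by apply: sc => //; rewrite divr_ge0// pi_ge0.
Qed.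

Section rotated.
Variables (A : 'M[R]_3) (AA : A *m A^T = 1%:M).

Definition rotated (x : R3 R) (j : 'I_3) : R := (row3 x *m A) 0 j.

Lemma rotatedE x j : rotated x j = lincomb (fun i => A i j) x.
Proof.
rewrite /rotated /lincomb mxE; apply: eq_bigr => i _; rewrite mxE /coord.
by [].
Qed.

Lemma continuous_rotated j : continuous (rotated ^~ j).
Proof.
rewrite (_ : rotated ^~ j = lincomb (fun i => A i j)); last by apply/funext => x; exact: rotatedE.
exact: continuous_lincomb.
Qed.

Lemma edist_rotated x y : edist3 x y ^+ 2 = \sum_j (rotated x j - rotated y j) ^+ 2.
Proof.
have E (d : 'rV[R]_3) : (d *m d^T) 0 0 = \sum_j d 0 j ^+ 2.
  by rewrite mxE; apply: eq_bigr => j _; rewrite mxE expr2.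
have sub : row3 x *m A - row3 y *m A = (row3 x - row3 y) *m A by rewrite mulmxBl.
have F : \sum_j (rotated x j - rotated y j) ^+ 2 = \sum_j ((row3 x - row3 y) *m A) 0 j ^+ 2.
  by apply: eq_bigr => j _; rewrite -sub [in RHS]mxE [X in _ = (_ + X) ^+ 2]mxE.
rewrite F -E trmx_mul mulmxA -(mulmxA _ A) AA mulmx1 E /edist3 sqr_sqrtr ?addr_ge0 ?sqr_ge0//.
by rewrite 3!big_ord_recl big_ord0 addr0 !mxE/= addrA.
Qed.

(** The part of space above one square of side [s] in rotated coordinates, within L s of the height
    of the graph at the corner. An L-Lipschitz graph stays in it above that square, and its diameter
    is O(s). *)
Definition cell (gamma : R2 R -> R) (L s M : R) (k l : nat) : set T3 :=
  [set x : T3 | [/\ k%:R * s - M <= rotated x 0 <= k.+1%:R * s - M,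
    l%:R * s - M <= rotated x 1 <= l.+1%:R * s - M &
    `|rotated x 2 - gamma (k%:R * s - M, l%:R * s - M)| <= L * s]].

Lemma measurable_cell gamma L s M k l : measurable (cell gamma L s M k l).
Proof.
apply: measurable_closed3.
have I j a b : closed [set x : R3 R | a <= rotated x j <= b].
  have -> : [set x : R3 R | a <= rotated x j <= b] = (rotated ^~ j) @^-1` `[a, b]%classic.
    by apply/seteqP; split=> x /=; rewrite in_itv.
  by apply: closed_comp; [move=> x _; exact: continuous_rotated|exact: itv_closed].
pose g := gamma (k%:R * s - M, l%:R * s - M).
have -> : cell gamma L s M k l = [set x : R3 R | k%:R * s - M <= rotated x 0 <= k.+1%:R * s - M] `&`
    [set x : R3 R | l%:R * s - M <= rotated x 1 <= l.+1%:R * s - M] `&`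
    [set x : R3 R | g - L * s <= rotated x 2 <= g + L * s].
  apply/seteqP; split=> x; first by move=> [h1 h2]; rewrite ler_distl => h3; split.
  by move=> [[h1 h2] h3]; split=> //; rewrite ler_distl.
by apply: closedI; [apply: closedI|]; exact: I.
Qed.

Lemma edist_cell gamma L s M k l x y : 0 <= s -> 0 <= L -> cell gamma L s M k l x -> cell gamma L s M k l y ->
  edist3 x y <= (2 + 2 * L) * s.
Proof.
move=> s0 L0 [x0 x1 x2] [y0 y1 y2].
have r0 : 0 <= (2 + 2 * L) * s by rewrite mulr_ge0// addr_ge0// mulr_ge0.
have e0 : 0 <= edist3 x y by exact: sqrtr_ge0.
rewrite -ler_sqr ?nnegrE// edist_rotated 3!big_ord_recl big_ord0 addr0.
have b (a c m : R) (n : nat) : n%:R * s - m <= a <= n.+1%:R * s - m -> n%:R * s - m <= c <= n.+1%:R * s - m ->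
    (a - c) ^+ 2 <= s ^+ 2.
  rewrite -natr1 mulrDl mul1r => /andP[h1 h2] /andP[h3 h4].
  rewrite -real_normK ?num_real// ler_sqr ?nnegrE// ler_norml; apply/andP; split; lra.
have b2 : (rotated x 2 - rotated y 2) ^+ 2 <= (2 * (L * s)) ^+ 2.
  have l0 : 0 <= 2 * (L * s) by rewrite !mulr_ge0.
  rewrite -real_normK ?num_real// ler_sqr ?nnegrE//.
  move: x2 y2; rewrite !ler_norml => /andP[h1 h2] /andP[h3 h4]; apply/andP; split; lra.
have i0 : lift ord0 ord0 = 1 :> 'I_3 by exact: val_inj.
have i1 : lift ord0 (lift ord0 ord0) = 2 :> 'I_3 by exact: val_inj.
rewrite i1 i0; apply: (@le_trans _ _ (s ^+ 2 + (s ^+ 2 + (2 * (L * s)) ^+ 2))).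
  by rewrite lerD ?lerD// ?(b _ _ _ _ x0 y0) ?(b _ _ _ _ x1 y1).
rewrite -subr_ge0 (_ : _ - _ = 2 * s ^+ 2 + 8 * (L * s ^+ 2)); last by ring.
by rewrite addr_ge0 ?mulr_ge0 ?sqr_ge0.
Qed.

Lemma hausdorff2_graph (gamma : R2 R -> R) (L M : R) (B : set T3) : 0 <= L -> 0 < M ->
  (forall p q : R2 R, `|gamma p - gamma q| <= L * `|p - q|) ->
  (forall x, B x -> [/\ `|rotated x 0| < M, `|rotated x 1| < M & rotated x 2 = gamma (rotated x 0, rotated x 1)]) ->
  (H2 B < +oo)%E.
Proof.
move=> L0 M0 lip HB.
apply: (@hausdorff2_finite_cover B (((2 + 2 * L) * (2 * M)) ^+ 2)) => d d0.
have c0 : 0 < 2 + 2 * L by rewrite ltr_wpDr// mulr_ge0.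
(* Large enough for the cell diameter (2 + 2 L) s to be at most [d]; the successor keeps it
   positive. *)
pose n := (Num.bound ((2 + 2 * L) * (2 * M) / d)).+1.
have n0 : 0 < n%:R :> R by rewrite ltr0n.
pose s := 2 * M / n%:R; have s0 : 0 < s by rewrite divr_gt0// mulr_gt0.
have ns : n%:R * s = 2 * M by rewrite /s mulrC divfK// gt_eqF.
exists (n * n)%N, (fun i => cell gamma L s M (i %/ n) (i %% n)), ((2 + 2 * L) * s); split.
- by move=> k; exact: measurable_cell.
- move=> x Bx; have [h0 h1 h2] := HB x Bx.
  have idx (a : R) : `|a| < M -> exists2 k, (k < n)%N & k%:R * s - M <= a <= k.+1%:R * s - M.
    rewrite ltr_norml => /andP[a1 a2].
    have p0 : 0 <= (a + M) / s by rewrite divr_ge0 ?(ltW s0)//; lra.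
    have /andP[t1 t2] := truncn_itv p0; exists (Num.truncn ((a + M) / s)).
      rewrite -(ltr_nat R); apply: le_lt_trans t1 _; rewrite ltr_pdivrMr// ns; lra.
    by move: t1 t2; rewrite ler_pdivlMr// ltr_pdivrMr// => t1 /ltW t2; apply/andP; split; lra.
  have [k kn hk] := idx _ h0; have [l ln hl] := idx _ h1.
  exists (k * n + l)%N => /=.
    by apply: (@leq_trans (k * n + n)%N); [rewrite ltn_add2l|rewrite -mulSnr leq_mul2r kn orbT].
  rewrite divnMDl// divn_small// addn0 modnMDl modn_small//; split=> //.
  rewrite h2; apply: le_trans (lip _ _) _; rewrite ler_wpM2l// prod_normE/= ge_max.
  move: hk hl; rewrite -!natr1 !mulrDl !mul1r => /andP[k1 k2] /andP[l1 l2].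
  by rewrite !ler_norml; apply/andP; split; apply/andP; split; lra.
- rewrite mulr_ge0 ?(ltW c0) ?(ltW s0)//= /s mulrA ler_pdivrMr//.
  rewrite -ler_pdivrMl// mulrC; apply: ltW.
  apply: lt_trans (archi_boundP _) _; first by rewrite divr_ge0 ?(ltW d0)// mulr_ge0 ?(ltW c0)// mulr_ge0 ?(ltW M0).
  by rewrite ltr_nat.
- by move=> k x y; exact: (edist_cell (ltW s0) L0).
- rewrite natrM -ns le_eqVlt; apply/orP; left; apply/eqP; ring.
Qed.

End rotated.

(** Each boundary point has a rational cube in which the boundary is part of a Lipschitz graph over
    a bounded square, hence of finite area; compactness leaves finitely many cubes. *)
Lemma hausdorff2_frontier_finite (Omega : set (R3 R)) : open Omega -> bounded_set Omega ->
  lipschitz_boundary Omega -> (H2 (closure Omega `\` Omega) < +oo)%E.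
Proof.
move=> oO bO lip; set bd := _ `\` _.
have cb : compact bd by exact: compact_frontier.
pose D := [set k : rat * rat * rat * rat | (H2 (bd `&` rbox k) < +oo)%E].
have orb k : open (rbox k : set (R3 R)).
  rewrite /rbox; set a := (_, _, _); set b := (_, _, _).
  have I j (u v : R) : open [set x : R3 R | u < coord j x < v].
    have -> : [set x : R3 R | u < coord j x < v] = (coord j) @^-1` `]u, v[%classic.
      by apply/seteqP; split=> x /=; rewrite in_itv.
    by apply: open_comp => [x _|]; [exact: smooth_continuous (smooth_coordj j) x|exact: itv_open].
  have -> : obox a b = [set x : R3 R | a.1.1 < coord 0 x < b.1.1] `&` [set x : R3 R | a.1.2 < coord 1 x < b.1.2]
     `&` [set x : R3 R | a.2 < coord 2 x < b.2].
    by apply/seteqP; split=> x; move=> [[/= h1 h2] h3]; move: h1 h2 h3; rewrite /coord/= ?in_itv/=.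
  by apply: openI; [apply: openI|]; exact: I.
have cov : bd `<=` cover D (fun k => rbox k : set (R3 R)).
  move=> p bp; have [A [gamma [U [AA lg pU HU]]]] := lip p bp.
  have [k pk kU] := rbox_nbhs pU; exists k => //; rewrite /D /=.
  have [L [L0 HL]] : exists L, 0 <= L /\ forall p q : R2 R, `|gamma p - gamma q| <= L * `|p - q|.
    move: lg; rewrite /lipschitz_on => -[L [Lr HL]].
    exists (`|L| + 1); split=> [|u v]; first by rewrite addr_ge0.
    by apply: (HL (`|L| + 1) _ (u, v)) => //; rewrite ltr_pwDr// ler_norm.
  have cg : continuous gamma.
    move=> q; apply/cvgrPdist_le => e e0.
    have l1 : 0 < L + 1 by rewrite ltr_wpDl.
    have := nbhsx_ballx (q : R2 R) _ (divr_gt0 e0 l1); rewrite -ball_normE.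
    apply: filterS => z /= /ltW hz; apply: le_trans (HL _ _) _.
    apply: le_trans (ler_wpM2l L0 hz) _; rewrite mulrCA ler_piMr ?(ltW e0)//.
    by rewrite ler_pdivrMr// mul1r lerDl ler01.
  have [N N0 bN] : exists2 N, 0 < N & forall x, bd x -> `|x| <= N.
    have [N [_ ON]] := bO; exists (`|N| + 1); first by rewrite ltr_pwDr.
    move=> x [cx _]; apply: closure_bounded cx => y Oy; apply: ON => //.
    by rewrite ltr_pwDr// ler_norm.
  apply: (@hausdorff2_graph A AA gamma L (2 * N + 1)) => //.
    by rewrite addr_gt0// mulr_gt0.
  move=> x [bx kx].
  have ry j : `|rotated A x j| < 2 * N + 1.
    have r00 i : rotated A 0 i = 0.
      rewrite rotatedE; apply: big1 => l _.
      by have -> : coord l (0 : R3 R) = 0; [case: l => [[|[|[|//]]] ?]|rewrite mul0r].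
    have h1 : rotated A x j ^+ 2 <= edist3 x 0 ^+ 2.
      rewrite (edist_rotated AA) (bigD1 j)//= r00 subr0 lerDl; apply: sumr_ge0 => i _; exact: sqr_ge0.
    have h2 : edist3 x 0 ^+ 2 <= (2 * N) ^+ 2.
      rewrite /edist3 sqr_sqrtr ?addr_ge0 ?sqr_ge0// !subr0.
      have q i : coord i x ^+ 2 <= N ^+ 2.
        rewrite -real_normK ?num_real// ler_sqr ?nnegrE ?(ltW N0)//.
        exact: le_trans (coord_le i x) (bN x bx).
      have := q 0; have := q 1; have := q 2; rewrite /coord/=.
      have := sqr_ge0 N; rewrite exprMn; lra.
    have h3 := le_trans h1 h2.
    have n20 : 0 <= 2 * N by rewrite mulr_ge0// ltW.
    rewrite -real_normK ?num_real// ler_sqr ?nnegrE// in h3.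
    by apply: le_lt_trans h3 _; rewrite ltrDl.
  split=> //; have Ux := kU x kx; have [cx nO] := bx.
  have /= HUx := HU x Ux.
  apply/eqP; rewrite eq_le; apply/andP; split.
    by rewrite leNgt; apply/negP => h; apply: nO; apply/HUx.
  rewrite leNgt; apply/negP => lt.
  (* A point strictly below the graph has a neighbourhood that misses [Omega], so it is not in the
     closure. *)
  have cF : continuous (fun z : R3 R => gamma (rotated A z 0, rotated A z 1) - rotated A z 2).
    move=> z; apply: cvgB; last exact: continuous_rotated.
    apply: (continuous_comp (f := fun z : R3 R => (rotated A z 0, rotated A z 1))); last exact: cg.
    exact: (cvg_pair (@continuous_rotated A 0 z) (@continuous_rotated A 1 z)).
  have W : \forall z \near x, 0 < gamma (rotated A z 0, rotated A z 1) - rotated A z 2.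
    by apply: (cvgr_gt _ (cF x)); rewrite subr_gt0.
  have rx : nbhs x (rbox k) by apply: open_nbhs_nbhs; split.
  have [z [Oz [Wz /kU Uz]]] := cx _ (filterI W rx).
  have /= [HUz _] := HU z Uz; have := HUz Oz.
  by move: Wz; rewrite /= subr_gt0 => Wz /(lt_trans Wz); rewrite ltxx.
have fin (s : seq (rat * rat * rat * rat)) :
    (H2 [set x | bd x /\ exists k, [/\ k \in s, D k & rbox k x]] < +oo)%E.
  elim: s => [|k s IH].
    rewrite (_ : [set _ | _] = set0); first by rewrite (@outer_measure0 _ _ (@hausdorff2_outer R)).
    by apply/seteqP; split=> // x [_ [? []]].
  have [Dk|nDk] := pselect (D k); last first.
    apply: le_lt_trans IH; apply: (@le_outer_measure _ _ (@hausdorff2_outer R)) => x [bx [k' [+ Dk' kx]]].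
    rewrite inE => /orP[/eqP kk|ks]; first by exfalso; apply: nDk; rewrite -kk.
    by split=> //; exists k'.
  apply: le_lt_trans (lte_add_pinfty Dk IH).
  apply: le_trans (@outer_measureU2 _ _ (@hausdorff2_outer R) _ _).
  apply: (@le_outer_measure _ _ (@hausdorff2_outer R)) => x [bx [k' [+ Dk' kx]]].
  rewrite inE => /orP[/eqP kk|ks]; first by left; rewrite -kk.
  by right; split=> //; exists k'.
have /compact_near_coveringP cb' := cb.
(* Compactness in near-covering form, along the enumeration of the rational cubes: an initial
   segment of it already covers the boundary. *)
have := cb' nat \oo (fun n x => exists k, [/\ k \in pmap unpickle (iota 0 n), D k & rbox k x]) _.
case.
  move=> p bp; have [k Dk kp] := cov p bp.
  exists (rbox k, [set n | (pickle k < n)%N]) => /=.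
    split; first by apply: open_nbhs_nbhs; split; [exact: orb|].
    by exists (pickle k).+1.
  move=> [x n] [/= kx kn]; exists k; split=> //.
  by rewrite mem_pmap; apply/mapP; exists (pickle k); rewrite ?pickleK// mem_iota.
move=> n _ Hn; apply: le_lt_trans (fin (pmap unpickle (iota 0 n))).
apply: (@le_outer_measure _ _ (@hausdorff2_outer R)) => x bx; split=> //.
exact: (Hn n (leqnn n)).
Qed.

End frontier_finite.

(** * Uniqueness outside the domain *)

Section increments.
Context (R : realType).
Implicit Types p q r s : R -> R.

(** [p] has derivative [s] on nonnegative times, in the form of uniform forward increments. It is
    stable under sums and allows a mean value inequality by subdivision. *)
Definition increments p s : Prop := forall b e, 0 < e -> exists2 del, 0 < del &
  forall a a', 0 <= a -> a <= a' -> a' <= b -> a' < a + del ->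
    `|p a' - p a - (a' - a) * s a| <= (a' - a) * e.

(** Subdivide [t1, t2] into equal steps shorter than the modulus and add up; the extra error per
    unit of time is arbitrary. *)
Lemma increments_mean p s (t1 t2 K eps : R) : increments p s -> 0 <= t1 -> t1 <= t2 ->
  (forall t, t1 <= t <= t2 -> `|s t - K| <= eps) ->
  `|p t2 - p t1 - (t2 - t1) * K| <= (t2 - t1) * eps.
Proof.
move=> ps t10 t12 sK; apply/ler_addgt0Pl => e0 e00.
have d0 : 0 < t2 - t1 + 1 by rewrite ltr_wpDl// subr_ge0.
pose e := e0 / (t2 - t1 + 1); have ep : 0 < e by rewrite divr_gt0.
have ee : (t2 - t1) * e <= e0.
  by rewrite /e mulrA ler_pdivrMr// mulrC ler_wpM2l ?(ltW e00)// lerDl.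
clearbody e; apply: le_trans (_ : _ <= (t2 - t1) * (eps + e)) _; last first.
  by rewrite mulrDr addrC lerD2r.
have [del del0 h] := ps t2 e ep.
have [n n0 nd] : exists2 n : nat, (0 < n)%N & (t2 - t1) / n%:R < del.
  have [n nl] : exists n : nat, (t2 - t1) / del < n%:R by have := archi_boundP (divr_ge0 (_ : 0 <= t2 - t1) (ltW del0)); rewrite subr_ge0 => /(_ t12); exists (Num.bound ((t2 - t1) / del)).
  have n0 : (0 < n)%N.
    by rewrite -(ltr0n R); apply: le_lt_trans nl; rewrite divr_ge0 ?subr_ge0 ?(ltW del0).
  by exists n => //; rewrite ltr_pdivrMr ?ltr0n// mulrC -ltr_pdivrMr.
set h0 := (t2 - t1) / n%:R; rewrite -/h0 in nd.
have nh : n%:R * h0 = t2 - t1 by rewrite mulrC divfK// pnatr_eq0 -lt0n.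
have h00 : 0 <= h0 by rewrite divr_ge0 ?subr_ge0.
clearbody h0.
suff H k : (k <= n)%N -> `|p (t1 + k%:R * h0) - p t1 - k%:R * h0 * K| <= k%:R * h0 * (eps + e).
  by have := H n (leqnn n); rewrite nh addrCA subrr addr0.
elim: k => [_|k IH kn]; first by rewrite !mul0r addr0 subrr subr0 normr0.
have {}IH := IH (ltnW kn).
have kS : t1 + k.+1%:R * h0 = t1 + k%:R * h0 + h0 by rewrite -natr1 mulrDl mul1r addrA.
have kh0 : 0 <= k%:R * h0 by rewrite mulr_ge0.
have le : t1 + k.+1%:R * h0 <= t2 by rewrite -lerBrDl -nh ler_wpM2r// ler_nat.
have st := h (t1 + k%:R * h0) (t1 + k.+1%:R * h0) _ _ le _.
have {}st := st (addr_ge0 t10 kh0).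
rewrite kS lerDl ltrD2l in st; have {}st := st h00 nd.
have b : `|s (t1 + k%:R * h0) - K| <= eps.
  by apply: sK; rewrite lerDl kh0/=; apply: le_trans le; rewrite kS lerDl.
rewrite kS -natr1.
have sc (pa pb pc x sa y : R) : `|pa - pb - (y + h0 - y) * sa| <= (y + h0 - y) * e ->
    `|pb - pc - x * h0 * K| <= x * h0 * (eps + e) -> `|sa - K| <= eps ->
    `|pa - pc - (x + 1) * h0 * K| <= (x + 1) * h0 * (eps + e).
  rewrite (_ : y + h0 - y = h0); last by ring.
  move=> a1 a2 a3.
  have -> : pa - pc - (x + 1) * h0 * K = (pa - pb - h0 * sa) + (pb - pc - x * h0 * K) + h0 * (sa - K) by ring.
  rewrite (_ : (x + 1) * h0 * (eps + e) = h0 * e + x * h0 * (eps + e) + h0 * eps); last by ring.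
  apply: le_trans (ler_normD _ _) _; apply: lerD.
    by apply: le_trans (ler_normD _ _) _; exact: lerD.
  by rewrite normrM ger0_norm// ler_wpM2l.
exact: sc st IH b.
Qed.

Lemma increments_eq p q r s : (forall t, 0 <= t -> q t = p t) -> (forall t, 0 <= t -> s t = r t) ->
  increments p r -> increments q s.
Proof.
move=> pq rs ps b e e0; have [del d0 h] := ps b e e0; exists del => // a a' a0 aa' ab ad.
by rewrite !pq ?rs//; [exact: h|exact: le_trans a0 aa'].
Qed.

Lemma incrementsB p q r s : increments p r -> increments q s ->
  increments (fun t => p t - q t) (fun t => r t - s t).
Proof.
move=> pr qs b e e0; have e2 : 0 < e / 2 by rewrite divr_gt0.
have [d1 d10 h1] := pr b _ e2; have [d2 d20 h2] := qs b _ e2.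
exists (Num.min d1 d2) => [|a a' a0 aa' ab]; first by rewrite lt_min d10.
rewrite addr_minr lt_min => /andP[/(h1 a a' a0 aa' ab) k1 /(h2 a a' a0 aa' ab) k2].
have sc (x y z w u v k f : R) : `|x - y - k * u| <= k * (f / 2) -> `|z - w - k * v| <= k * (f / 2) ->
   `|(x - z) - (y - w) - k * (u - v)| <= k * f.
  move=> a1 a2; rewrite (_ : _ - k * (u - v) = (x - y - k * u) - (z - w - k * v)); last by ring.
  by apply: le_trans (ler_normB _ _) _; apply: le_trans (lerD a1 a2) _; rewrite -mulrDr -splitr.
exact: sc.
Qed.

Lemma increments_sum (n : nat) (p s : 'I_n -> R -> R) : (forall i, increments (p i) (s i)) ->
  increments (fun t => \sum_i p i t) (fun t => \sum_i s i t).
Proof.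
elim: n p s => [|n IH] p s ps.
  move=> b e e0; exists 1 => // a a' _ aa' _ _.
  by rewrite !big_ord0 mulr0 !subr0 normr0 mulr_ge0 ?subr_ge0// ltW.
have q : increments (fun t => - \sum_i p (lift ord0 i) t) (fun t => - \sum_i s (lift ord0 i) t).
  have z : increments (fun=> 0) (fun=> 0).
    move=> b e e0; exists 1 => // a a' _ aa' _ _.
    by rewrite !mulr0 !subr0 normr0 mulr_ge0 ?subr_ge0// ltW.
  have := incrementsB z (IH _ _ (fun i => ps (lift ord0 i))).
  by apply: increments_eq => t _; rewrite sub0r.
have := incrementsB (ps ord0) q.
by apply: increments_eq => t _; rewrite big_ord_recl opprK.
Qed.

Lemma increments_cst p (c t : R) : increments p (fun=> c) -> 0 <= t -> p t = p 0 + t * c.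
Proof.
move=> ps t0.
have h := increments_mean (K := c) (eps := 0) ps (lexx 0) t0.
have c0 (u : R) : 0 <= u <= t -> `|c - c| <= 0 by rewrite subrr normr0.
have {}h := h c0.
by move: h; rewrite subr0 mulr0 normr_le0 subr_eq0 => /eqP <-; rewrite addrC subrK.
Qed.

End increments.

Section path_increments.
Context d (T : measurableType d) (R : realType) (m : {measure set T -> \bar R}).

Lemma velocity_increments (w v : R -> T -> R) f : pathL2 m w -> pathL2 m v -> velocity m w v -> L2 m f ->
  increments (fun t => dot m (w t) f) (fun t => dot m (v t) f).
Proof.
move=> [w2 _] [v2 _] wv f2 b e e0.
have n0 : 0 < nrm m f + 1 by rewrite ltr_wpDl ?nrm_ge0.
have [del d0 h] := wv b (e / (nrm m f + 1)) (divr_gt0 e0 n0).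
exists del => // a a' a0 aa' ab ad.
have {}h := h a a' a0 aa' ab ad.
rewrite -(dotBl (w2 a') (w2 a) f2) -(dotZl _ (v2 a) f2) -dotBl//; [|exact: L2B|exact: L2Z].
apply: le_trans (cauchy_schwarz _ f2) _; first by apply: L2B; [exact: L2B|exact: L2Z].
apply: le_trans (ler_wpM2r (nrm_ge0 m f) h) _.
rewrite -mulrA ler_wpM2l ?subr_ge0// mulrAC ler_pdivrMr// ler_wpM2l ?(ltW e0)// lerDl//.
Qed.

Variables (lamb mu0 : R) (H1 : (T -> R) -> ('I_3 -> T -> R) -> Prop).
Variables (P : 'I_3 -> R -> T -> R) (H : 'I_3 -> 'I_3 -> R -> T -> R).
Hypothesis Hpath : forall i j, pathL2 m (H i j).
Local Notation S i j t := (stress lamb mu0 (fun i j => H i j t) i j).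

Lemma momentum_increments phi D i : momentum_balance m lamb mu0 H1 P H -> H1 phi D ->
  increments (fun t => dot m (P i t) phi) (fun t => - \sum_j dot m (S i j t) (D j)).
Proof.
move=> bal pD b e e0.
set K := \sum_j nrm m (D j).
have K0 : 0 <= K by apply: sumr_ge0 => j _; exact: nrm_ge0.
have K1 : 0 < K + 1 by rewrite ltr_wpDl.
have eK : 0 < e / (K + 1) by rewrite divr_gt0.
have [del d0 osc] : exists2 del, 0 < del & forall j s t, 0 <= s <= b -> `|t - s| < del ->
    nrm m (fun x => S i j t x - S i j s x) <= e / (K + 1).
  apply: (@fin_del R 3 (fun j del => forall s t, 0 <= s <= b -> `|t - s| < del ->
    nrm m (fun x => S i j t x - S i j s x) <= e / (K + 1))).
    by move=> j del del' dd h s t sb st; apply: h => //; exact: lt_le_trans dd.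
  move=> j; have [del d0 h] := pathL2_uniform 0 b (stress_path lamb mu0 Hpath i j) eK.
  by exists del => // s t; exact: h.
exists del => // a a' a0; rewrite le_eqVlt => /predU1P[<- _ _|aa' ab ad].
  by rewrite !subrr !mul0r subr0 normr0.
have := bal phi D pD i a a' (e / (K + 1)) a0 aa'.
rewrite mulrN opprK; set X := `|_| => h; apply: le_trans (h _) _.
  move=> s s' j /andP[s1 s2] /andP[s1' s2']; apply: osc.
    by rewrite (le_trans a0 s1') (le_trans s2' ab).
  by move: s1 s2 s1' s2' ad => *; rewrite ltr_norml; apply/andP; split; lra.
rewrite -/K ler_wpM2l ?subr_ge0 ?(ltW aa')// mulrAC ler_pdivrMr// ler_wpM2l ?(ltW e0)// lerDl//.
Qed.

(** The converse of [momentum_increments]: the mean value inequality with the stress term frozen at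
    [t1]. The increment form is the one that can be subtracted between two solutions. *)
Lemma increments_momentum : (forall phi D, H1 phi D -> forall j, L2 m (D j)) ->
  (forall phi D i, H1 phi D ->
     increments (fun t => dot m (P i t) phi) (fun t => - \sum_j dot m (S i j t) (D j))) ->
  momentum_balance m lamb mu0 H1 P H.
Proof.
move=> D2 inc phi D pD i t1 t2 eps t10 t12 osc.
have S2 j t : L2 m (S i j t) by exact: (proj1 (stress_path lamb mu0 Hpath i j) t).
have := increments_mean (K := - \sum_j dot m (S i j t1) (D j)) (eps := eps * \sum_j nrm m (D j))
  (inc phi D i pD) t10 (ltW t12).
rewrite mulrN !opprK; apply => t tt.
rewrite -normrN opprD opprK -sumrB mulr_sumr; apply: le_trans (ler_norm_sum _ _ _) _.
apply: ler_sum => j _; have Dj := D2 _ _ pD j.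
rewrite -(dotBl (S2 j t) (S2 j t1) Dj); apply: le_trans (cauchy_schwarz (L2B (S2 j t) (S2 j t1)) Dj) _.
by rewrite ler_wpM2r ?nrm_ge0//; apply: osc => //; rewrite lexx (ltW t12).
Qed.

End path_increments.

Lemma pathL2_clamped d (T : measurableType d) (R : realType) (m : {measure set T -> \bar R})
    (w : R -> T -> R) : pathL2 m w -> pathL2 m (fun t => w (clamp t)).
Proof.
move=> [w2 h]; split=> [t|t e e0]; first exact: w2.
have [del d0 k] := h (clamp t) e e0; exists del => // s st; apply: k.
exact: le_lt_trans (clamp_lipschitz s t) st.
Qed.

Section generic_exterior.
Context d (T : measurableType d) (R : realType) (m : {measure set T -> \bar R}).

Lemma stress_indic lamb mu0 (E : set T) (A A' : 'I_3 -> 'I_3 -> T -> R) i j :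
  stress lamb mu0 (fun i j x => \1_E x * (A i j x - A' i j x)) i j =
  fun x => \1_E x * (stress lamb mu0 A i j x - stress lamb mu0 A' i j x).
Proof.
by apply/funext => x; rewrite /stress/= -mulr_sumr sumrB; ring.
Qed.

Lemma dot_indic_move (E : set T) (f phi : T -> R) : phi = (fun x => \1_E x * phi x) ->
  dot m f phi = dot m (fun x => \1_E x * f x) phi.
Proof. by move=> E1; rewrite {1}E1; congr Rintegral; apply/funext => x; ring. Qed.

Lemma dot_indicB (E : set T) (f g phi : T -> R) : phi = (fun x => \1_E x * phi x) ->
  L2 m f -> L2 m g -> L2 m phi -> 
  dot m (fun x => \1_E x * (f x - g x)) phi = dot m f phi - dot m g phi.
Proof. by move=> E1 f2 g2 p2; rewrite -dotBl// -(dot_indic_move (fun x => f x - g x) E1). Qed.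

End generic_exterior.

Section exterior.
Context (R : realType).
Local Notation mR := (measurableTypeR R).
Local Notation T3 := (mR * mR * mR)%type.
Local Notation mu := (lebesgue3 R).
Local Notation test := (@test_function R (R3 R) setT).
Local Notation e_ := (basis3 R).

Lemma strongH1_path0 (w : R -> R3 R -> R) (g : 'I_3 -> R -> R3 R -> R) :
  pathL2 mu w -> (forall j, pathL2 mu (g j)) ->
  (forall t, 0 < t -> strongH1 (w t) (fun j => g j t)) -> strongH1 (w 0) (fun j => g j 0).
Proof.
move=> [w2 wc] gp h; apply: strongH1_close => [|j|e e0]; [exact: w2|exact: (proj1 (gp j))|].
have [d1 d10 h1] := wc 0 e e0.
have [d2 d20 h2] := @fin_del R 3 (fun j del => forall s, `|s - 0| < del -> nrm mu (fun x => g j s x - g j 0 x) <= e)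
   (fun j del del' dd h s st => h s (lt_le_trans st dd)) (fun j => proj2 (gp j) 0 e e0).
pose t := Num.min d1 d2 / 2.
have t0 : 0 < t by rewrite divr_gt0// lt_min d10.
have tm : `|t - 0| < Num.min d1 d2.
  by rewrite subr0 gtr0_norm// /t ltr_pdivrMr// ltr_pMr ?lt_min ?d10// ltr1n.
move: tm; rewrite lt_min => /andP[t1 t2].
exists (w t), (fun j => g j t); split; [exact: h|exact: h1|by move=> j; exact: h2].
Qed.

Section unique.
Variables (lamb mu0 rho0 C : R) (E : set (R3 R)) (rho1 rho2 : R3 R -> R).
Variables (U1 V1 U2 V2 : 'I_3 -> R -> R3 R -> R) (H1 H2 : 'I_3 -> 'I_3 -> R -> R3 R -> R).
Hypotheses (m0 : 0 < mu0) (l0 : 0 < lamb + 2 * mu0) (r0 : 0 < rho0) (cE : closed E).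
Hypotheses (mr1 : measurable_fun setT (rho1 : T3 -> R)) (mr2 : measurable_fun setT (rho2 : T3 -> R)).
Hypotheses (rC1 : {ae mu, forall x, `|rho1 x| <= C}) (rC2 : {ae mu, forall x, `|rho2 x| <= C}).
Hypotheses (EP1 : elastic_path mu lamb mu0 (@strongH1 R) rho1 U1 V1 H1)
  (EP2 : elastic_path mu lamb mu0 (@strongH1 R) rho2 U2 V2 H2).
Hypotheses (rE1 : {ae mu, forall x, E x -> rho1 x = rho0}) (rE2 : {ae mu, forall x, E x -> rho2 x = rho0}).
Hypotheses (U0 : forall i, {ae mu, forall x, E x -> U1 i 0 x = U2 i 0 x})
  (V0 : forall i, {ae mu, forall x, E x -> V1 i 0 x = V2 i 0 x}).
Hypothesis trace : forall t, 0 < t -> forall i phi j, test phi ->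
  dot mu (fun x => \1_E x * (U1 i t x - U2 i t x)) ('D_(e_ j) phi) =
  - dot mu (fun x => \1_E x * (H1 i j t x - H2 i j t x)) phi.

Let mE : measurable (E : set T3). Proof. exact: measurable_closed3. Qed.
Let m1E : measurable_fun setT (\1_E : T3 -> R). Proof. exact: measurable_indic. Qed.
Let l1E : {ae mu, forall x, `|\1_E x| <= 1 :> R}.
Proof. by apply: nearW => x; exact: normr_indic_le1. Qed.

(** The difference of the two displacements restricted to the exterior [E], and below those of the
    velocities and gradients, with time clamped to obtain paths on the whole line. *)
Let Z i t x := \1_E x * (U1 i (clamp t) x - U2 i (clamp t) x).
Let W i t x := \1_E x * (V1 i (clamp t) x - V2 i (clamp t) x).
Let G i j t x := \1_E x * (H1 i j (clamp t) x - H2 i j (clamp t) x).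

Let path_indic (w w' : R -> R3 R -> R) : pathL2 mu w -> pathL2 mu w' ->
  pathL2 mu (fun t x => \1_E x * (w (clamp t) x - w' (clamp t) x)).
Proof. by move=> h h'; apply: (pathL2M m1E l1E); apply: pathL2B; exact: pathL2_clamped. Qed.

Let Zp i : pathL2 mu (Z i). Proof. exact: path_indic (elastic_U EP1 i) (elastic_U EP2 i). Qed.
Let Wp i : pathL2 mu (W i). Proof. exact: path_indic (elastic_V EP1 i) (elastic_V EP2 i). Qed.
Let Gp i j : pathL2 mu (G i j). Proof. exact: path_indic (elastic_H EP1 i j) (elastic_H EP2 i j). Qed.

Let indicK (f : R3 R -> R) : (fun x => \1_E x * f x) = (fun x => \1_E x * (\1_E x * f x)).
Proof. by apply/funext => x; rewrite mulrA indicE; case: (_ \in _); rewrite ?mul1r ?mul0r. Qed.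

Let Zstrong i t : strongH1 (Z i t) (fun j => G i j t).
Proof.
have pos s : 0 < s -> strongH1 (Z i s) (fun j => G i j s).
  move=> s0; rewrite /Z /G clampE ?(ltW s0)//.
  apply: (strongH1_indic cE); last by move=> phi j tp; exact: trace.
  have := strongH1D (elastic_H1 EP1 i s) (strongH1Z (-1) (elastic_H1 EP2 i s)).
  rewrite (_ : (fun x => U1 i s x + -1 * U2 i s x) = fun x => U1 i s x - U2 i s x); last first.
    by apply/funext => x; rewrite mulN1r.
  rewrite (_ : (fun j x => H1 i j s x + -1 * H2 i j s x) = fun j x => H1 i j s x - H2 i j s x)//.
  by apply/funext => j; apply/funext => x; rewrite mulN1r.
have [t0|t0] := ltP 0 t; first exact: pos.
have ct : clamp t = clamp 0 by rewrite /clamp maxxx max_l.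
rewrite /Z /G ct; exact: (strongH1_path0 (Zp i) (Gp i) pos).
Qed.

(** Test functions carried by [E], where both densities equal [rho0]. The displacement [Z] belongs
    to this class, which is what the energy identity requires. *)
Let D1 (phi : R3 R -> R) (D : 'I_3 -> R3 R -> R) : Prop :=
  [/\ strongH1 phi D, phi = (fun x => \1_E x * phi x) & forall j, D j = (fun x => \1_E x * D j x)].

(** Against functions carried by [E], multiplying a momentum or a stress by the indicator changes no
    pairing, so the two balances can be subtracted and the difference has the constant density
    [rho0]. *)
Let path3 : elastic_path mu lamb mu0 D1 (cst rho0) Z W G.
Proof.
split=> //.
- by move=> i t; split=> //; [exact: indicK|move=> j; exact: indicK].
- move=> i b e e0; have e2 : 0 < e / 2 by rewrite divr_gt0.
  have [d1 d10 h1] := elastic_velocity EP1 i b e2; have [d2 d20 h2] := elastic_velocity EP2 i b e2.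
  exists (Num.min d1 d2) => [|s t s0 st tb]; first by rewrite lt_min d10.
  rewrite addr_minr lt_min => /andP[/(h1 s t s0 st tb) k1 /(h2 s t s0 st tb) k2].
  rewrite /Z /W !clampE//; last exact: le_trans st.
  have u1 r := proj1 (elastic_U EP1 i) r; have u2 r := proj1 (elastic_U EP2 i) r.
  have v1 r := proj1 (elastic_V EP1 i) r; have v2 r := proj1 (elastic_V EP2 i) r.
  have a1 : L2 mu (fun x => U1 i t x - U1 i s x - (t - s) * V1 i s x).
    by apply: L2B; [exact: L2B|exact: L2Z].
  have a2 : L2 mu (fun x => U2 i t x - U2 i s x - (t - s) * V2 i s x).
    by apply: L2B; [exact: L2B|exact: L2Z].
  apply: le_trans (_ : _ <= nrm mu (fun x => \1_E x * ((U1 i t x - U1 i s x - (t - s) * V1 i s x) - (U2 i t x - U2 i s x - (t - s) * V2 i s x)))) _.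
    rewrite le_eqVlt; apply/orP; left; apply/eqP; congr (nrm _ _); apply/funext => x; ring.
  apply: le_trans (nrm_indic cE (L2B a1 a2)) _; apply: le_trans (nrmB a1 a2) _.
  by apply: le_trans (lerD k1 k2) _; rewrite -mulrDr -splitr.
- apply: increments_momentum => // [phi D [pD _ _] j|phi D i [pD pE DE]].
    by have [] := strongH1_L2 pD.
  have [p2 d2] := strongH1_L2 pD.
  have I1 := momentum_increments (elastic_H EP1) i (elastic_balance EP1) pD.
  have I2 := momentum_increments (elastic_H EP2) i (elastic_balance EP2) pD.
  apply: increments_eq (incrementsB I1 I2) => t t0.
    have v1 := proj1 (elastic_V EP1 i) t; have v2 := proj1 (elastic_V EP2 i) t.
    have q1 : L2 mu (fun x => rho1 x * V1 i t x) by exact: L2M mr1 rC1 v1.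
    have q2 : L2 mu (fun x => rho2 x * V2 i t x) by exact: L2M mr2 rC2 v2.
    rewrite -(@dot_indicB _ T3 R mu E _ _ _ pE q1 q2 p2).
    apply: ae_dot => //.
    - by apply: L2Z; exact: (proj1 (Wp i) t).
    - by apply: L2_indic => //; exact: L2B.
    - apply: ae_imp2 rE1 rE2 => x h1 h2; rewrite /W/= clampE// indicE.
      have [/set_mem xE|_] := boolP (x \in E); last by rewrite !mul0r mulr0.
      by rewrite h1// h2// !mul1r mulrBr.
    - exact: nearW.
  rewrite -opprD -sumrB; congr (- _); apply: eq_bigr => j _.
  have s1 := proj1 (stress_path lamb mu0 (elastic_H EP1) i j) t.
  have s2 := proj1 (stress_path lamb mu0 (elastic_H EP2) i j) t.
  rewrite -(@dot_indicB _ T3 R mu E _ _ _ (DE j) s1 s2 (d2 j)) /G clampE//.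
  congr (dot _ _ _); exact: (@stress_indic _ T3 R lamb mu0 E (fun i j => H1 i j t) (fun i j => H2 i j t) i j).
Qed.

(** The energy of the time integral of [Z] starts from 0 and has no source term, since the initial
    data agree on [E]. Its kinetic part at the final time is therefore at most 0, the elastic form
    being nonnegative. *)
Lemma exterior_unique i t : 0 < t -> {ae mu, forall x, E x -> U1 i t x = U2 i t x} /\
  forall j, {ae mu, forall x, E x -> H1 i j t x = H2 i j t x}.
Proof.
move=> t0.
have c0 : 0 <= `|rho0| by [].
have mc : measurable_fun setT (cst rho0 : T3 -> R) by exact: measurable_cst.
have rC : {ae mu, forall x, `|cst rho0 x| <= `|rho0|} by exact: nearW.
have Z2 k s : L2 mu (Z k s) by exact: (proj1 (Zp k) s).
have W2 k s : L2 mu (W k s) by exact: (proj1 (Wp k) s).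
have ae0 (f g : R3 R -> R) : {ae mu, forall x, E x -> f x = g x} -> {ae mu, forall x, \1_E x * (f x - g x) = 0}.
  apply: ae_imp => x h; rewrite indicE; have [/set_mem xE|_] := boolP (x \in E); last by rewrite mul0r.
  by rewrite h// subrr mulr0.
have dot0 (f g : R3 R -> R) : L2 mu f -> L2 mu g -> {ae mu, forall x, f x = 0} -> dot mu f g = 0.
  move=> f2 g2 f0; rewrite -(dot0l mu g); apply: ae_dot => //; [exact: L2_0|exact: nearW].
have k0 : kinetic mu (cst rho0) Z 0 = 0.
  rewrite /kinetic big1// => k _; apply: dot0; [exact: L2Z|exact: Z2|].
  by have := ae0 _ _ (U0 k); apply: ae_imp => x; rewrite /Z clampE// => ->; rewrite mulr0.
have kin_le : kinetic mu (cst rho0) Z t <= 0.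
  apply/ler_addgt0Pl => e e0; rewrite addr0.
  have [N _ /(_ N.+1 (leqnSn N))] := energy_identity mc rC c0 path3 t0 e0.
  rewrite /energy k0 subr0 mulrC divfK// big1 ?mulr0 ?subr0; last first.
    move=> k _; apply: dot0; [exact: L2Z|exact: riemann_L2|].
    by have := ae0 _ _ (V0 k); apply: ae_imp => x; rewrite /W clampE// => ->; rewrite mulr0.
  set tau := t / _; set D := fun i j => riemann tau (G i j) N.+1.
  have XD k : strongH1 (riemann tau (Z k) N.+1) (D k).
    by apply: strongH1_riemann => s; exact: Zstrong.
  have D2 k j : L2 mu (D k j) by have [_] := strongH1_L2 (XD k).
  have coer := elastic_form_coercive m0 l0 D2 (fun k j => strongH1_sym2 _ _ (XD j) (XD k)).
  have B0 : 0 <= elastic_form mu lamb mu0 D D.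
    apply: le_trans coer; apply: mulr_ge0; first by rewrite le_min !ltW.
    by apply: sumr_ge0 => k _; apply: sumr_ge0 => j _; exact: dot_ge0.
  have K0 r : 0 <= kinetic mu (cst rho0) Z r.
    apply: sumr_ge0 => k _; rewrite (@dotZl _ T3 R mu _ _ _ (Z2 k r) (Z2 k r)).
    by rewrite mulr_ge0 ?dot_ge0 ?ltW.
  have := K0 t; move: (kinetic _ _ _ t) B0 => k1; move: (elastic_form _ _ _ _ _) => k2.
  by rewrite ler_norml => ? ? /andP[_ h]; lra.
have Z0 : {ae mu, forall x, Z i t x = 0}.
  apply: nrm_eq0 => //; apply/eqP; rewrite -sqrf_eq0 nrm_sqr eq_le dot_ge0 andbT.
  rewrite -(ler_pM2l r0) mulr0 -(@dotZl _ T3 R mu _ _ _ (Z2 i t) (Z2 i t)).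
  apply: le_trans kin_le; rewrite /kinetic (bigD1 i)//= lerDl; apply: sumr_ge0 => k _.
  by rewrite (@dotZl _ T3 R mu _ _ _ (Z2 k t) (Z2 k t)) mulr_ge0 ?dot_ge0 ?ltW.
have back (f g : R3 R -> R) : {ae mu, forall x, \1_E x * (f x - g x) = 0} -> {ae mu, forall x, E x -> f x = g x}.
  by apply: ae_imp => x h xE; move: h; rewrite indicE mem_set// mul1r => /eqP; rewrite subr_eq0 => /eqP.
split; first by apply: back; move: Z0; rewrite /Z clampE// ltW.
move=> j; apply: back.
have G2 : L2 mu (G i j t) by exact: (proj1 (Gp i j) t).
(* [G] is the weak gradient of [Z], which vanishes almost everywhere: integrate by parts against
   test functions. *)
have : {ae mu, forall x, G i j t x = 0}.
  apply: test_orthogonal_ae0 => // phi tp.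
  have [u [ut uZ uG]] := Zstrong i t.
  have p2 := test_L2 tp; have dp2 := test_L2 (test_derive (e_ j) tp).
  have h1 := cvgL2_dot (uG j) p2.
  have h2 := cvgL2_dot uZ dp2.
  have z0 := dot0 _ _ (Z2 i t) dp2 Z0.
  rewrite z0 in h2; rewrite -oppr0; apply: (cvg_unique _ h1); first exact: norm_hausdorff.
  rewrite (_ : (fun n => _) = (fun n => - dot mu (u n) ('D_(e_ j) phi))); first exact: cvgN.
  by apply/funext => n; rewrite dot_derive//; exact: test_smooth tp.
by rewrite /G clampE// ltW.
Qed.
End unique.
End exterior.

(** * Affine growth and orthogonality to static fields *)

Lemma dot_riemann d (T : measurableType d) (R : realType) (m : {measure set T -> \bar R})
    (r : T -> R) (tau : R) (w : R -> T -> R) n : L2 m r -> (forall t, L2 m (w t)) ->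
  dot m r (riemann tau w n) = \sum_(k < n) tau * dot m r (w (k%:R * tau)).
Proof.
move=> r2 w2; elim: n => [|n IH] /=; first by rewrite big_ord0 dot0r.
rewrite dotDr ?dotZr//; [|exact: riemann_L2|exact: L2Z].
by rewrite big_ord_recr/= IH.
Qed.

Lemma dot_ae0 d (T : measurableType d) (R : realType) (m : {measure set T -> \bar R}) (f g : T -> R) :
  L2 m f -> L2 m g -> {ae m, forall x, f x * g x = 0} -> dot m f g = 0.
Proof.
move=> f2 g2 fg; rewrite -[RHS](dot0l m g); apply: ae_eq_Rintegral.
- exact: dot_integrable.
- exact: dot_integrable (L2_0 m) g2.
- by apply: ae_imp fg => x ->; rewrite mul0r.
Qed.

Lemma dot_weightC d (T : measurableType d) (R : realType) (m : {measure set T -> \bar R})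
  (rho f phi : T -> R) : dot m f (fun x => rho x * phi x) = dot m (fun x => rho x * f x) phi.
Proof. by congr Rintegral; apply/funext => x; ring. Qed.

Lemma dot_weightB d (T : measurableType d) (R : realType) (m : {measure set T -> \bar R})
    (rho1 rho2 f1 f2 phi : T -> R) :
  L2 m (fun x => rho1 x * f1 x) -> L2 m (fun x => rho2 x * f2 x) -> L2 m phi ->
  dot m f1 (fun x => rho1 x * phi x) - dot m f2 (fun x => rho2 x * phi x) =
  dot m (fun x => rho1 x * f1 x - rho2 x * f2 x) phi.
Proof. by move=> h1 h2 p2; rewrite dotBl// !dot_weightC. Qed.

(** The left Riemann sum of an affine function on [0, T]; the last term is the discretisation
    error. *)
Lemma sum_affine (R : realType) (a b T : R) (n : nat) : (0 < n)%N ->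
  \sum_(k < n) T / n%:R * (a + k%:R * (T / n%:R) * b) = T * a + T ^+ 2 * b / 2 - T ^+ 2 * b / 2 / n%:R.
Proof.
move=> n0; set tau := T / n%:R.
have -> : \sum_(k < n) tau * (a + k%:R * tau * b) = n%:R * tau * a + tau ^+ 2 * b * (n%:R * (n%:R - 1)) / 2.
  clearbody tau; clear n0; elim: n => [|n IH]; first by rewrite big_ord0; ring.
  by rewrite big_ord_recr/= IH -natr1; field.
have nz : n%:R != 0 :> R by rewrite pnatr_eq0 -lt0n.
by rewrite /tau; field.
Qed.

(** The value at 2 T minus twice the value at T isolates T^2 b, so b = 0; the remaining linear
    function is bounded only if a = 0. *)
Lemma bounded_affine_eq0 (R : realType) (a b K : R) :
  (forall T, 0 < T -> `|T * a + T ^+ 2 * b / 2| <= K) -> a = 0 /\ b = 0.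
Proof.
move=> h; have lin (c K' : R) : (forall T, 1 <= T -> T * `|c| <= K') -> c = 0.
  move=> hc; apply/eqP; rewrite -normr_le0 leNgt; apply/negP => c0.
  have k0 : 0 <= K' by apply: le_trans (hc 1 (lexx 1)); rewrite mul1r.
  have := hc (K' / `|c| + 1) _; rewrite lerDr divr_ge0// => /(_ isT).
  by rewrite mulrDl divfK ?gt_eqF// mul1r gerDl leNgt c0.
have b0 : b = 0.
  apply: (lin b (3 * K)) => T T1; have T0 : 0 < T by exact: lt_le_trans ltr01 T1.
  have h1 := h T T0; have h2 := h (2 * T) (mulr_gt0 (ltr0n _ 2) T0).
  apply: le_trans (_ : _ <= T ^+ 2 * `|b|) _.
    by rewrite ler_wpM2r// expr2 ler_pMl.
  rewrite -(ger0_norm (sqr_ge0 T)) -normrM.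
  have -> : T ^+ 2 * b = (2 * T * a + (2 * T) ^+ 2 * b / 2) - 2 * (T * a + T ^+ 2 * b / 2) by field.
  apply: le_trans (ler_normB _ _) _; rewrite normrM ger0_norm//; lra.
split=> //; apply: (lin a K) => T T1; have T0 : 0 < T by exact: lt_le_trans ltr01 T1.
by have := h T T0; rewrite b0 mulr0 mul0r addr0 normrM (gtr0_norm T0).
Qed.

Section static.
Context (R : realType).
Local Notation mR := (measurableTypeR R).
Local Notation T3 := (mR * mR * mR)%type.
Local Notation mu := (lebesgue3 R).
Local Notation test := (@test_function R (R3 R) setT).
Local Notation e_ := (basis3 R).

Lemma derive_near (f g : R3 R -> R) (N : R) (x v : R3 R) : (forall y, `|y| < N -> f y = g y) ->
  `|x| < N -> 'D_v f x = 'D_v g x.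
Proof.
move=> fg xN; apply: near_eq_derive.
near=> y; apply: fg; near: y.
have op : open [set y : R3 R | `|y| < N].
  by apply: (@open_comp _ _ (fun y : R3 R => `|y|) [set r | r < N]); [move=> *; exact: norm_continuous|exact: open_lt].
exact: open_nbhs_nbhs (conj op xN).
Unshelve. all: by end_near. Qed.

Variables (lamb mu0 : R).

Definition static (w : 'I_3 -> R3 R -> R) : Prop := (forall i, smooth (w i)) /\
  forall i x, \sum_j 'D_(e_ j) (stress lamb mu0 (fun i j => 'D_(e_ j) (w i)) i j) x = 0.

(* Integrating by parts twice moves both derivatives onto the static field,
   which is uncut where the displacement may be nonzero. *)
Lemma static_stress (N : R) (U : 'I_3 -> R3 R -> R) (H : 'I_3 -> 'I_3 -> R3 R -> R) w : static w ->
  (forall i, strongH1 (U i) (H i)) -> (forall i, {ae mu, forall x : T3, N <= `|x : R3 R| -> U i x = 0}) ->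
  elastic_form mu lamb mu0 H (fun i j => 'D_(e_ j) (fun x => cutoff N x * w i x)) = 0.
Proof.
move=> [sw eqw] UH U0.
pose Phi i x := cutoff N x * w i x.
have tPhi i : test (Phi i) by apply: testMr => //; exact: test_cutoff.
pose D i j := 'D_(e_ j) (Phi i).
have tD i j : test (D i j) by exact: test_derive.
have H2 i j : L2 mu (H i j) by have [_] := strongH1_L2 (UH i).
have U2 i : L2 mu (U i) by have [] := strongH1_L2 (UH i).
rewrite elastic_formC//; last by move=> i j; exact: test_L2 (tD i j).
pose th i j := stress lamb mu0 D i j.
have thE i j : th i j = fun x => mu0 * (D i j x - D j i x) + (i == j)%:R * ((lamb + 2 * mu0) * \sum_k D k k x) by [].
have tth i j : test (th i j).
  rewrite thE; apply: testD; first by apply: testZ; exact: testB.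
  by apply: testZ; apply: testZ; exact: test_sum.
rewrite /elastic_form -/Phi big1// => i _.
have part j : dot mu (th i j) (H i j) = - dot mu ('D_(e_ j) (th i j)) (U i).
  have [u [ut uU uH]] := UH i.
  have h1 := cvgL2_dot (uH j) (test_L2 (tth i j)).
  have h2 := cvgL2_dot uU (test_L2 (test_derive (e_ j) (tth i j))).
  rewrite (@dotC _ T3 R mu (th i j)) (@dotC _ T3 R mu ('D_(e_ j) _)).
  apply: (cvg_unique _ h1); first exact: norm_hausdorff.
  rewrite (_ : (fun n => _) = (fun n => - dot mu (u n) ('D_(e_ j) (th i j)))); first exact: cvgN.
  by apply/funext => n; rewrite dot_derive//; exact: test_smooth (tth i j).
rewrite (eq_bigr _ (fun j _ => part j)) sumrN.
have d2 j : L2 mu ('D_(e_ j) (th i j)) by exact: test_L2 (test_derive (e_ j) (tth i j)).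
rewrite -(@dot_suml _ T3 R mu _ _ _ _ d2 (U2 i)).
have s2 : L2 mu (fun x => \sum_j 'D_(e_ j) (th i j) x) by exact: L2_sum.
apply/eqP; rewrite oppr_eq0; apply/eqP; apply: dot_ae0 => //.
apply: ae_imp (U0 i) => x xN; have [xN'|xN'] := ltP `|x| N; last by rewrite xN// mulr0.
  rewrite (_ : \sum_j _ = 0) ?mul0r// -[RHS](eqw i x); apply: eq_bigr => j _.
  apply: (@derive_near _ _ N) => // y yN; rewrite thE /stress.
  have DE k l : D k l y = 'D_(e_ l) (w k) y.
    by apply: (@derive_near _ _ N) => // z zN; rewrite /Phi cutoff_in ?mul1r// ltW.
  by rewrite !DE; congr (_ + _ * (_ * _)); apply: eq_bigr => k _; rewrite DE.
Qed.

Section moments.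
Variables (rho1 rho2 : R3 R -> R) (C N : R).
Variables (U1 V1 U2 V2 : 'I_3 -> R -> R3 R -> R) (H1 H2 : 'I_3 -> 'I_3 -> R -> R3 R -> R).
Hypotheses (m0 : 0 < mu0) (l0 : 0 < lamb + 2 * mu0) (C0 : 0 <= C) (N0 : 0 <= N).
Hypotheses (mr1 : measurable_fun setT (rho1 : T3 -> R)) (mr2 : measurable_fun setT (rho2 : T3 -> R)).
Hypotheses (rC1 : {ae mu, forall x, 0 <= rho1 x <= C}) (rC2 : {ae mu, forall x, 0 <= rho2 x <= C}).
Hypotheses (EP1 : elastic_path mu lamb mu0 (@strongH1 R) rho1 U1 V1 H1)
  (EP2 : elastic_path mu lamb mu0 (@strongH1 R) rho2 U2 V2 H2).
Hypotheses (VN1 : forall i, {ae mu, forall x : T3, N < `|x : R3 R| -> V1 i 0 x = 0})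
  (VN2 : forall i, {ae mu, forall x : T3, N < `|x : R3 R| -> V2 i 0 x = 0}).
Hypothesis UN : forall i t, 0 <= t -> {ae mu, forall x : T3, N <= `|x : R3 R| -> U1 i t x = U2 i t x}.

Let rC1' : {ae mu, forall x, `|rho1 x| <= C}.
Proof. by apply: ae_imp rC1 => x /andP[? ?]; rewrite ger0_norm. Qed.
Let rC2' : {ae mu, forall x, `|rho2 x| <= C}.
Proof. by apply: ae_imp rC2 => x /andP[? ?]; rewrite ger0_norm. Qed.

(** For the cut-off field [Phi], [y] has derivative [p] and [p] has derivative 0, so y(t) = y(0) + t
    p(0). The Riemann sums of [y] are pairings with the Riemann sums of the two displacements, which
    stay bounded as the final time grows. *)
Lemma static_moments w : static w ->
  \sum_i dot mu (fun x => rho1 x * U1 i 0 x - rho2 x * U2 i 0 x) (fun x => cutoff N x * w i x) = 0 /\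
  \sum_i dot mu (fun x => rho1 x * V1 i 0 x - rho2 x * V2 i 0 x) (fun x => cutoff N x * w i x) = 0.
Proof.
move=> sw; pose Phi i x := cutoff N x * w i x.
have tPhi i : test (Phi i) by apply: testMr; [exact: (proj1 sw)|exact: test_cutoff].
have P2 i : L2 mu (Phi i) by exact: test_L2.
have R1 f : L2 mu f -> L2 mu (fun x => rho1 x * f x) by exact: L2M mr1 rC1'.
have R2 f : L2 mu f -> L2 mu (fun x => rho2 x * f x) by exact: L2M mr2 rC2'.
have u1 i t := proj1 (elastic_U EP1 i) t; have u2 i t := proj1 (elastic_U EP2 i) t.
have v1 i t := proj1 (elastic_V EP1 i) t; have v2 i t := proj1 (elastic_V EP2 i) t.
pose y t := \sum_i (dot mu (U1 i t) (fun x => rho1 x * Phi i x) - dot mu (U2 i t) (fun x => rho2 x * Phi i x)).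
pose p t := \sum_i (dot mu (V1 i t) (fun x => rho1 x * Phi i x) - dot mu (V2 i t) (fun x => rho2 x * Phi i x)).
have yE : y 0 = \sum_i dot mu (fun x => rho1 x * U1 i 0 x - rho2 x * U2 i 0 x) (Phi i).
  by apply: eq_bigr => i _; exact: dot_weightB (R1 _ (u1 i 0)) (R2 _ (u2 i 0)) (P2 i).
have pE : p 0 = \sum_i dot mu (fun x => rho1 x * V1 i 0 x - rho2 x * V2 i 0 x) (Phi i).
  by apply: eq_bigr => i _; exact: dot_weightB (R1 _ (v1 i 0)) (R2 _ (v2 i 0)) (P2 i).
have yp : increments y p.
  apply: increments_sum => i; apply: incrementsB.
    exact: velocity_increments (elastic_U EP1 i) (elastic_V EP1 i) (elastic_velocity EP1 i) (R1 _ (P2 i)).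
  exact: velocity_increments (elastic_U EP2 i) (elastic_V EP2 i) (elastic_velocity EP2 i) (R2 _ (P2 i)).
have p0 : increments p (fun=> 0).
  (* The derivative of [p] is minus the elastic form of the difference of the gradients against that
     of [Phi]. It vanishes by [static_stress], since the displacements agree wherever the cutoff may
     alter the field. *)
  have I1 i := momentum_increments (elastic_H EP1) i (elastic_balance EP1) (strongH1_test (tPhi i)).
  have I2 i := momentum_increments (elastic_H EP2) i (elastic_balance EP2) (strongH1_test (tPhi i)).
  apply: increments_eq (increments_sum (fun i => incrementsB (I1 i) (I2 i))) => t t0.
    by apply: eq_bigr => i _; rewrite !(@dot_weightC _ T3 R mu).
  have UH i : strongH1 (fun x => U1 i t x + -1 * U2 i t x) (fun j x => H1 i j t x + -1 * H2 i j t x).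
    exact: strongH1D (elastic_H1 EP1 i t) (strongH1Z (-1) (elastic_H1 EP2 i t)).
    have DU i : {ae mu, forall x : T3, N <= `|x : R3 R| -> U1 i t x + -1 * U2 i t x = 0}.
    by apply: ae_imp (UN i t0) => x h /h ->; rewrite mulN1r subrr.
  have h := static_stress sw UH DU.
  have h1 i j := proj1 (elastic_H EP1 i j) t; have h2 i j := proj1 (elastic_H EP2 i j) t.
  rewrite (@elastic_formDZ _ T3 R mu lamb mu0 (-1) (fun i j => H1 i j t) (fun i j => H2 i j t) _ h1 h2) in h; last first.
    by move=> i j; exact: test_L2 (test_derive _ (tPhi i)).
  rewrite mulN1r in h; transitivity (- (0 : R)); first by rewrite oppr0.
  rewrite -[X in - X = _]h opprB addrC /elastic_form -sumrN -big_split/=; apply: eq_bigr => i _.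
  by rewrite opprK.
have pt t : 0 <= t -> p t = p 0 by move=> t0; rewrite (increments_cst p0 t0) mulr0 addr0.
have yt t : 0 <= t -> y t = y 0 + t * p 0.
  move=> t0; apply: increments_cst => //.
  by apply: increments_eq yp => s s0//; rewrite pt.
have [Z1 Z10 B1] := riemann_bounded m0 l0 mr1 rC1 C0 N0 EP1 VN1.
have [Z2 Z20 B2] := riemann_bounded m0 l0 mr2 rC2 C0 N0 EP2 VN2.
have [N' N'0 PN] : exists2 N', 0 <= N' & forall i x, N' < `|x| -> Phi i x = 0.
  have h i : exists N', 0 < N' /\ forall x, N' < `|x| -> Phi i x = 0.
    by have [N' ? ?] := test_bounded_support (tPhi i); exists N'.
  have [f fP] := choice h; exists (\sum_i f i) => [|i x xN].
    by apply: sumr_ge0 => i _; rewrite ltW//; have [] := fP i.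
  have [_] := fP i; apply; apply: le_lt_trans xN; rewrite (bigD1 i)//= lerDl.
  by apply: sumr_ge0 => k _; rewrite ltW//; have [] := fP k.
(* The added 1 absorbs the discretisation error of the Riemann sum. *)
pose K := \sum_i ((1 + N' ^+ 2 *+ 3) * nrm mu (fun x => rho1 x * Phi i x) * Z1 +
   (1 + N' ^+ 2 *+ 3) * nrm mu (fun x => rho2 x * Phi i x) * Z2) + 1.
rewrite -yE -pE; apply: (@bounded_affine_eq0 _ _ _ K) => b b0.
have := B2 b b0; have := B1 b b0.
have sm : \forall n \near \oo, (0 < n)%N /\ `|b ^+ 2 * p 0 / 2| / n%:R <= 1.
  near=> n; have n0 : (0 < n)%N by near: n; exists 1%N.
  by split=> //; rewrite ler_pdivrMr ?ltr0n// mul1r; near: n; exact: nbhs_infty_ger.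
move=> [n1 _ h1] [n2 _ h2]; have [n3 _ h3] := sm.
pose n := (n1 + n2 + n3)%N.
have {}h1 := h1 n (leq_trans (leq_addr n2 n1) (leq_addr _ _)).
have {}h2 := h2 n (leq_trans (leq_addl n1 n2) (leq_addr _ _)).
have [n0 {}h3] := h3 n (leq_addl _ _).
clearbody n.
pose tau := b / n%:R; rewrite -/tau in h1 h2.
have tau0 : 0 <= tau by rewrite divr_ge0// ltW.
pose s := \sum_i (dot mu (fun x => rho1 x * Phi i x) (riemann tau (U1 i) n) - dot mu (fun x => rho2 x * Phi i x) (riemann tau (U2 i) n)).
have sK : `|s| <= K - 1.
  rewrite /K addrK; apply: le_trans (ler_norm_sum _ _ _) _; apply: ler_sum => i _.
  apply: le_trans (ler_normB _ _) _; apply: lerD.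
    by apply: h1 => //; [exact: R1|apply: nearW => x xN; rewrite PN// mulr0].
  by apply: h2 => //; [exact: R2|apply: nearW => x xN; rewrite PN// mulr0].
have sE : s = b * y 0 + b ^+ 2 * p 0 / 2 - b ^+ 2 * p 0 / 2 / n%:R.
  rewrite -sum_affine// /s -/tau.
  under eq_bigr do rewrite (@dot_riemann _ T3 R mu _ _ _ _ (R1 _ (P2 _)) (u1 _)) (@dot_riemann _ T3 R mu _ _ _ _ (R2 _ (P2 _)) (u2 _)) -sumrB.
  rewrite exchange_big/=; apply: eq_bigr => k _.
  have kt : 0 <= k%:R * tau by apply: mulr_ge0.
  rewrite -(yt _ kt) /y mulr_sumr; apply: eq_bigr => i _.
  by rewrite -mulrBr (@dotC _ T3 R mu (U1 _ _)) (@dotC _ T3 R mu (U2 _ _)).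
clearbody s K; move: sE sK h3; rewrite -[X in _ -> _ -> X / _ <= _ -> _]normrN.
move: (b ^+ 2 * p 0 / 2) (b * y 0) => q r -> sK; rewrite normrN => h3.
have {}h3 : `|q / n%:R| <= 1 by rewrite normrM (ger0_norm (_ : 0 <= n%:R^-1)) ?invr_ge0.
rewrite -(subrK (q / n%:R) (r + q)); apply: le_trans (ler_normD _ _) _.
by rewrite -lerBrDr; apply: le_trans sK _; rewrite lerB.
Unshelve. all: by end_near. Qed.

End moments.
End static.

(** * Moments depending on a parameter *)

Section moments.
Context d (T : measurableType d) (R : realType) (m : {measure set T -> \bar R}).
Local Notation intb f := (m.-integrable setT (EFin \o f)).
Implicit Types f g X : T -> R.

Lemma integrable_mul_bounded f (h : T -> R) K : intb f -> measurable_fun setT h ->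
  (forall x, f x != 0 -> `|h x| <= K) -> intb (fun x => f x * h x).
Proof.
move=> fi mh hK; have mf : measurable_fun setT f by apply/measurable_EFinP; exact: measurable_int fi.
apply: (le_integrable measurableT) (_ : intb (fun x => K * f x)).
- by apply/measurable_EFinP; exact: measurable_funM.
- move=> x _; rewrite /= lee_fin !normrM mulrC.
  have [->|fx] := eqVneq (f x) 0; first by rewrite normr0 !mulr0.
  rewrite ler_wpM2r//; apply: le_trans (hK x fx) (ler_norm _).
- rewrite (_ : _ \o _ = (fun x => K%:E * (EFin \o f) x)%E); first exact: integrableZl.
  by apply/funext => x /=; rewrite EFinM.
Qed.

(** Differentiation under the integral for a family with vanishing integrals: [L] is the one-sided
    derivative at 0 with an integrable quadratic error, so [h] times its integral is O(h^2). *)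
Lemma derive_integral0 (K : R -> T -> R) (L B : T -> R) (del : R) : 0 < del ->
  (forall h, 0 <= h < del -> intb (K h) /\ \int[m]_x K h x = 0) -> intb L -> intb B ->
  (forall h x, 0 <= h < del -> `|K h x - K 0 x - h * L x| <= h ^+ 2 * B x) ->
  \int[m]_x L x = 0.
Proof.
(* Parameters are rescaled by [c], since [small_quadratic] works on ]0, 1] while the family is
   controlled on [0, del[ only. *)
move=> del0 Ki Li Bi KB; set c := del / 2; have c0 : 0 < c by rewrite divr_gt0.
have cd : c < del by rewrite ltr_pdivrMr// ltr_pMr// ltr1n.
set b := \int[m]_x B x.
have bl h : 0 < h -> h < del -> h * `|\int[m]_x L x| <= h ^+ 2 * b.
  move=> h0 hd; have hr : 0 <= h < del by rewrite (ltW h0).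
  have z0 : 0 <= (0 : R) < del by rewrite lexx.
  have [Kh Kh0] := Ki h hr; have [K0 K00] := Ki 0 z0.
  have hL : intb (fun x => h * L x).
    rewrite (_ : _ \o _ = (fun x => h%:E * (EFin \o L) x)%E); first exact: integrableZl.
    by apply/funext => x /=; rewrite EFinM.
  have hB : intb (fun x => h ^+ 2 * B x).
    rewrite (_ : _ \o _ = (fun x => (h ^+ 2)%:E * (EFin \o B) x)%E); first exact: integrableZl.
    by apply/funext => x /=; rewrite EFinM.
  have KK : intb (fun x => K h x - K 0 x) by exact: (integrableB measurableT Kh K0).
  have KL : intb (fun x => K h x - K 0 x - h * L x) by exact: (integrableB measurableT KK hL).
  have E : \int[m]_x (K h x - K 0 x - h * L x) = - (h * \int[m]_x L x).
    by rewrite (RintegralB measurableT KK hL) (RintegralB measurableT Kh K0) Kh0 K00 subrr sub0r RintegralZl.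
  rewrite -[X in X * _](gtr0_norm h0) -normrM -normrN -E -(RintegralZl _ measurableT Bi).
  apply: le_trans (le_normr_Rintegral measurableT KL) _; apply: le_Rintegral => //.
    by have := integrable_norm KL; apply: eq_integrable.
  by move=> x _; exact: KB.
apply: (@small_quadratic _ _ (c * `|b| + 1)); first by rewrite ltr_wpDl// mulr_ge0// ltW.
move=> h h0 h1; rewrite -(ler_pM2l c0) mulrA.
apply: le_trans (bl (c * h) (mulr_gt0 c0 h0) _) _.
  by apply: le_lt_trans cd; rewrite ger_pMr.
have bb := ler_norm b; move: (`|b|) bb => b' bb.
have sc (x y : R) : 0 <= x -> y <= b' -> (c * h) ^+ 2 * y <= c * ((c * b' + 1) * h ^+ 2).
  move=> _ yb; rewrite exprMn.
  have h2 : 0 <= c * h ^+ 2 by rewrite mulr_ge0 ?sqr_ge0// ltW.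
  have -> : c * ((c * b' + 1) * h ^+ 2) = c ^+ 2 * h ^+ 2 * b' + c * h ^+ 2 by ring.
  apply: le_trans (_ : _ <= c ^+ 2 * h ^+ 2 * b') _; last by rewrite lerDl.
  by rewrite ler_wpM2l// mulr_ge0 ?sqr_ge0.
exact: (sc 0 b).
Qed.

(** From 1 + k <= exp(k) and exp(k) (1 - k) <= 1, the latter being the former at -k. *)
Lemma expR_taylor (k : R) : `|k| <= 2^-1 -> `|expR k - 1 - k| <= 2 * k ^+ 2.
Proof.
rewrite ler_norml => /andP[k1 k2].
have h1 := expR_ge1Dx k; have h2 := expR_ge1Dx (- k).
have ke : expR k * expR (- k) = 1 by rewrite -expRD subrr expR0.
have e0 := expR_gt0 k.
have : expR k * (1 - k) <= 1 by rewrite -[leRHS]ke ler_wpM2l// ltW.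
move: (expR k) e0 h1 => e e0 h1 h3.
rewrite ger0_norm; last by rewrite -addrA -opprD subr_ge0.
nra.
Qed.

Lemma measurable_pow X k : measurable_fun setT X -> measurable_fun setT (fun x => X x ^+ k).
Proof. by move=> mX; exact: measurable_funX. Qed.

Lemma measurable_expRM (a : R) X : measurable_fun setT X -> measurable_fun setT (fun x => expR (a * X x)).
Proof.
by move=> mX; apply: measurableT_comp => //; apply: measurable_funM => //.
Qed.

(** Each derivation in [a] brings down one more factor [X]; boundedness of [X] on the support of [g]
    gives integrability and the Taylor error. *)
Lemma exp_moment g X (N p q : R) k : intb g -> measurable_fun setT X ->
  (forall x, g x != 0 -> `|X x| <= N) ->
  (forall a, p < a < q -> \int[m]_x (g x * expR (a * X x)) = 0) ->
  forall a, p < a < q -> \int[m]_x (g x * X x ^+ k * expR (a * X x)) = 0.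
Proof.
move=> gi mX gN g0.
have gk n : intb (fun x => g x * X x ^+ n).
  apply: (@integrable_mul_bounded _ _ (N ^+ n)) => //; first exact: measurable_pow.
  by move=> x /gN xN; rewrite normrX lerXn2r ?nnegrE//; exact: le_trans xN.
have ge n a : intb (fun x => g x * X x ^+ n * expR (a * X x)).
  apply: (@integrable_mul_bounded _ _ (expR (`|a| * N))) => //; first exact: measurable_expRM.
  move=> x; rewrite mulf_eq0 negb_or => /andP[/gN xN _].
  rewrite gtr0_norm ?expR_gt0// ler_expR; apply: le_trans (ler_norm _) _.
  by rewrite normrM ler_wpM2l.
elim: k => [|k IH] a /andP[pa aq].
  by under eq_Rintegral do rewrite expr0 mulr1; apply: g0; rewrite pa.
have N0 : 0 < `|N| + 1 by rewrite ltr_wpDl.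
pose del := Num.min (q - a) (2^-1 / (`|N| + 1)).
apply: (@derive_integral0 (fun h x => g x * X x ^+ k * expR ((a + h) * X x)) _
  (fun x => 2 * (`|g x * X x ^+ k.+2 * expR (a * X x)|)) del).
- by rewrite lt_min subr_gt0 aq divr_gt0// invr_gt0.
- move=> h /andP[h0]; rewrite lt_min => /andP[h1 _]; split; first exact: ge.
  by apply: IH; rewrite (lt_le_trans pa) ?lerDl//= -ltrBrDl.
- exact: ge.
- have := integrableZl measurableT 2 (integrable_norm (ge k.+2 a)).
  by apply: eq_integrable.
- move=> h x /andP[h0]; rewrite lt_min addr0 => /andP[_ h2].
  have [g0'|gx] := eqVneq (g x) 0; first by rewrite g0' !mul0r !mulr0 normr0 !subr0 normr0 !mulr0.
  have hX : `|h * X x| <= 2^-1.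
    rewrite normrM ger0_norm//; apply: le_trans (_ : _ <= h * (`|N| + 1)) _.
      by rewrite ler_wpM2l//; apply: le_trans (gN x gx) (le_trans (ler_norm N) _); rewrite lerDl.
    by rewrite -ler_pdivlMr// ltW.
  have := expR_taylor hX.
  have -> : expR ((a + h) * X x) = expR (a * X x) * expR (h * X x) by rewrite mulrDl expRD.
  move: (expR (h * X x)) => e et.
  have -> : g x * X x ^+ k * (expR (a * X x) * e) - g x * X x ^+ k * expR (a * X x) -
     h * (g x * X x ^+ k.+1 * expR (a * X x)) = (g x * X x ^+ k * expR (a * X x)) * (e - 1 - h * X x).
    by rewrite exprSr; ring.
  rewrite normrM; apply: le_trans (ler_wpM2l (normr_ge0 _) et) _.
  have -> : g x * X x ^+ k.+2 * expR (a * X x) = (g x * X x ^+ k * expR (a * X x)) * X x ^+ 2 by rewrite !exprSr expr0; ring.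
  rewrite [in leRHS]normrM (ger0_norm (sqr_ge0 (X x))) exprMn le_eqVlt; apply/orP; left; apply/eqP; ring.
Qed.

End moments.

(** * Trigonometric and exponential functions *)

Section trigonometric.
Context (R : realType).

Lemma smooth1_coind (P : (R -> R) -> Prop) :
  (forall f, P f -> exists2 f', forall v : R, P (fun t => v * f' t) & forall t : R, is_derive t (1 : R) f (f' t)) ->
  forall f, P f -> smooth f.
Proof.
move=> PP; apply: (@smooth_coind R R^o) => f /PP[f' Pf' df].
have dif x : differentiable f x by apply/derivable1_diffP; have [] := df x.
split=> // v; rewrite (_ : 'D_v f = fun t => v * f' t)//; apply/funext => x.
have [_ <-] := df x.
by rewrite !deriveE// -[X in 'd _ x X](mulr1 v) -[LHS]/('d f x (v *: 1)) linearZ.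
Qed.

(** Sine and cosine are kept together because derivation is the rotation (p, q) |-> (q, -p) of the
    coefficients. *)
Definition tri (p q t : R) : R := p * cos t + q * sin t.

Lemma is_derive_tri p q (t : R) : is_derive t (1 : R) (tri p q) (tri q (- p) t).
Proof.
rewrite /tri; have -> : (fun t => p * cos t + q * sin t) = (p *: (@cos R) + q *: (@sin R)).
  by apply/funext => s; rewrite /= !fctE.
have h := is_deriveD (is_deriveZ p (is_derive_cos t)) (is_deriveZ q (is_derive_sin t)).
by apply: (is_derive_eq h); rewrite /GRing.scale/= mulrN mulNr addrC.
Qed.

Lemma smooth_tri p q : smooth (tri p q).
Proof.
apply: (@smooth1_coind (fun f => exists p q, f = tri p q)); last by exists p, q.
move=> f [a [b ->]]; exists (tri b (- a)); last by move=> t; exact: is_derive_tri.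
by move=> v; exists (v * b), (v * - a); apply/funext => t; rewrite /tri; ring.
Qed.

Lemma tri_le p q t : `|tri p q t| <= `|p| + `|q|.
Proof.
apply: le_trans (ler_normD _ _) _; rewrite !normrM; apply: lerD; rewrite ler_piMr//.
  by rewrite ler_norml cos_geN1 cos_le1.
by rewrite ler_norml sin_geN1 sin_le1.
Qed.

Lemma tri_taylor p q (s k : R) : `|tri p q (s + k) - tri p q s - k * tri q (- p) s| <= k ^+ 2 * (`|p| + `|q|).
Proof.
have sp := smooth_tri p q.
have E1 u : 'D_k (tri p q) u = k * tri q (- p) u.
  by rewrite derive_smooth1//; have [_ ->] := is_derive_tri p q u.
have tb y : `|'D_k ('D_k (tri p q)) y| <= k ^+ 2 * (`|p| + `|q|).
  rewrite (_ : 'D_k (tri p q) = fun u => k * tri q (- p) u); last exact/funext.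
  rewrite derive_smoothZ; last exact: smooth_tri.
  rewrite derive_smooth1; last exact: smooth_tri.
  have [_ ->] := is_derive_tri q (- p) y; rewrite mulrA -expr2 normrM ger0_norm ?sqr_ge0//.
  by rewrite ler_wpM2l ?sqr_ge0//; apply: le_trans (tri_le _ _ _) _; rewrite !normrN.
rewrite -E1; exact: smooth_taylor2 sp tb.
Qed.

Lemma is_derive_expRM (a t : R) : is_derive t (1 : R) (fun t => expR (a * t)) (a * expR (a * t)).
Proof.
have -> : (fun t => expR (a * t)) = (@expR R) \o (a *: (@id R)) by [].
by apply: is_derive_eq; rewrite /GRing.scale/= mulr1 mulrC.
Qed.

Lemma smooth_expRM (a c : R) : smooth (fun t => c * expR (a * t)).
Proof.
apply: (@smooth1_coind (fun f => exists c, f = fun t => c * expR (a * t))); last by exists c.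
move=> f [b ->]; exists (fun t => b * (a * expR (a * t))) => [v|t].
  by exists (v * (b * a)); apply/funext => t; ring.
have -> : (fun t => b * expR (a * t)) = b *: (fun t : R => expR (a * t)) by [].
have := is_derive_expRM a t => ?; apply: is_derive_eq; rewrite /GRing.scale//.
Qed.

End trigonometric.

(** * Moment problems *)

Section polynomial_sieve.
Context (R : realType).

Lemma bernoulli_le (t : R) m : 0 <= t <= 1 -> 1 - m%:R * t <= (1 - t) ^+ m.
Proof.
move=> /andP[t0 t1]; elim: m => [|m IH]; first by rewrite mul0r subr0 expr0.
rewrite exprS -natr1; have h := ler_wpM2l (_ : 0 <= 1 - t) IH.
apply: le_trans (h _); last by rewrite subr_ge0.
have : 0 <= m%:R * (t * t) by rewrite !mulr_ge0.
move: (m%:R) => n; nra.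
Qed.

(** With y = sqrt(x), the factor n y^n is at most (1 - y)^-1, because n y^n is at most the geometric
    sum; the other factor y^n tends to 0. *)
Lemma cvg_natr_expr (x : R) : 0 <= x < 1 -> n%:R * x ^+ n @[n --> \oo] --> 0.
Proof.
move=> /andP[x0 x1]; set y := Num.sqrt x.
have y0 : 0 <= y by exact: sqrtr_ge0.
have y1 : y < 1 by rewrite -(sqrtr1 R) ltr_sqrt.
have xy n : x ^+ n = y ^+ n * y ^+ n by rewrite -exprMn -expr2 sqr_sqrtr.
have ny n : n%:R * y ^+ n <= (1 - y)^-1.
  rewrite -[leRHS]mul1r ler_pdivlMr ?subr_gt0//.
  apply: le_trans (_ : _ <= (\sum_(k < n) y ^+ k) * (1 - y)) _.
    rewrite ler_wpM2r ?subr_ge0 ?(ltW y1)//.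
    rewrite -[n in n%:R](card_ord n) -sumr_const mulr_suml; apply: ler_sum => i _.
    by rewrite mul1r ler_wiXn2l ?(ltW y1) ?(ltnW (ltn_ord i)).
  by rewrite mulrC -opprB mulNr -subrX1 opprB gerBl exprn_ge0.
apply: (@squeeze_cvgr _ _ _ _ (fun=> 0) (fun n => (1 - y)^-1 * y ^+ n)); last 2 first.
- exact: cvg_cst.
- rewrite -[X in _ --> X](mulr0 (1 - y)^-1); apply: cvgM; first exact: cvg_cst.
  by apply: cvg_expr; rewrite ger0_norm.
- apply: nearW => n; rewrite mulr_ge0 ?exprn_ge0//= xy mulrA.
  by rewrite ler_wpM2r// exprn_ge0.
Qed.

(** Polynomials in [u] converging on [0, 1] to the indicator of u < 1/2, as in the elementary proof
    of the Stone-Weierstrass theorem. With exponent m, they lie between 1 - m u^n, by Bernoulli's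
    inequality, and exp(- m u^n). *)
Definition sharp (n : nat) (u : R) : R := (1 - u ^+ n) ^+ (n * 2 ^ n).

Lemma sharp01 n u : 0 <= u <= 1 -> 0 <= sharp n u <= 1.
Proof.
move=> /andP[u0 u1]; have p0 : 0 <= u ^+ n by exact: exprn_ge0.
have p1 : u ^+ n <= 1 by exact: exprn_ile1.
by rewrite exprn_ge0 ?subr_ge0//= exprn_ile1 ?subr_ge0// gerBl.
Qed.

(* The extra factor [n] in the exponent makes the limit [0] at [u = 1/2]. *)
Lemma sharp_cvg u : 0 <= u <= 1 -> sharp n u @[n --> \oo] --> ((u < 2^-1)%R%:R : R).
Proof.
move=> u01; have /andP[u0 u1] := u01.
have p0 n : 0 <= u ^+ n by exact: exprn_ge0.
have p1 n : u ^+ n <= 1 by exact: exprn_ile1.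
have pw n : (n * 2 ^ n)%N%:R * u ^+ n = n%:R * (2 * u) ^+ n :> R.
  by rewrite natrM natrX exprMn mulrA.
have [uh|uh] := ltP u 2^-1.
  have u2 : 0 <= 2 * u < 1 by rewrite mulr_ge0//= -ltr_pdivlMl// mulr1.
  apply: (@squeeze_cvgr _ _ _ _ (fun n => 1 - n%:R * (2 * u) ^+ n) (fun=> 1)); last 2 first.
  - rewrite -[X in _ --> X]subr0; apply: cvgB; [exact: cvg_cst|exact: cvg_natr_expr].
  - exact: cvg_cst.
  - apply: nearW => n; have /andP[_ ->] := sharp01 n u01; rewrite andbT -pw.
    by apply: bernoulli_le; rewrite p0 p1.
apply: (@squeeze_cvgr _ _ _ _ (fun=> 0) (@harmonic R)); [|exact: cvg_cst|exact: cvg_harmonic].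
apply: nearW => n; have /andP[-> _] := sharp01 n u01; rewrite /harmonic/=.
apply: le_trans (_ : _ <= expR (- (n%:R * (2 * u) ^+ n))) _.
  rewrite -pw mulrC -mulNr expRM_natr lerXn2r ?nnegrE ?subr_ge0 ?expR_ge0//.
  exact: expR_ge1Dx.
rewrite expRN lef_pV2 ?posrE ?expR_gt0//; apply: le_trans (expR_ge1Dx _).
rewrite -natr1 addrC lerD2l ler_peMr// exprn_ege1// -ler_pdivrMl// mulr1//.
Qed.

End polynomial_sieve.

Section moment_problem.
Context d (T : measurableType d) (R : realType) (m : {measure set T -> \bar R}).
Local Notation intb f := (m.-integrable setT (EFin \o f)).

Lemma integrable_sum_Rintegral0 n (F : nat -> T -> R) (c : nat -> R) :
  (forall i, intb (F i) /\ \int[m]_x F i x = 0) ->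
  intb (fun x => \sum_(i < n) c i * F i x) /\ \int[m]_x (\sum_(i < n) c i * F i x) = 0.
Proof.
move=> F0; elim: n => [|n [IHi IH]].
  rewrite (_ : (fun x => _) = cst 0); last by apply/funext => x; rewrite big_ord0.
  by split; [exact: integrable0|rewrite /Rintegral integral0].
have cF : intb (fun x => c n * F n x).
  by have := integrableZl measurableT (c n) (proj1 (F0 n)); apply: eq_integrable.
have E : (fun x => \sum_(i < n.+1) c i * F i x) = (fun x => \sum_(i < n) c i * F i x + c n * F n x).
  by apply/funext => x; rewrite big_ord_recr.
rewrite E; split; first exact: (integrableD measurableT IHi cF).
by rewrite (RintegralD measurableT IHi cF) IH add0r (RintegralZl _ measurableT (proj1 (F0 n))) (proj2 (F0 n)) mulr0.
Qed.

(** As for exponentials: derivation in the frequency brings down a factor [X] and rotates (p, q),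
    which is harmless since all coefficients are allowed. *)
Lemma trig_moment (g X : T -> R) (N u v : R) k : intb g -> measurable_fun setT X ->
  (forall x, g x != 0 -> `|X x| <= N) ->
  (forall r p q, u < r < v -> \int[m]_x (g x * tri p q (r * X x)) = 0) ->
  forall r p q, u < r < v -> \int[m]_x (g x * X x ^+ k * tri p q (r * X x)) = 0.
Proof.
move=> gi mX gN g0.
have gk n : intb (fun x => g x * X x ^+ n).
  apply: (@integrable_mul_bounded _ _ _ _ _ _ (N ^+ n)) => //; first exact: measurable_funX.
  by move=> x /gN xN; rewrite normrX lerXn2r ?nnegrE//; exact: le_trans xN.
have ge n r p q : intb (fun x => g x * X x ^+ n * tri p q (r * X x)).
  apply: (@integrable_mul_bounded _ _ _ _ _ _ (`|p| + `|q|)) => //; last by move=> x _; exact: tri_le.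
  have mr : measurable_fun setT (fun x => r * X x) by apply: measurable_funM.
  by apply: measurable_funD; apply: measurable_funM => //; apply: measurableT_comp => //;
    apply: continuous_measurable_fun; [exact: continuous_cos|exact: continuous_sin].
elim: k => [|k IH] r p q /andP[ur rv].
  by under eq_Rintegral do rewrite expr0 mulr1; apply: g0; rewrite ur.
pose p' := - q; pose q' := p.
have -> : tri p q = tri q' (- p') by rewrite /p' /q' opprK.
apply: (@derive_integral0 _ _ _ _ (fun h x => g x * X x ^+ k * tri p' q' ((r + h) * X x)) _
  (fun x => (`|p'| + `|q'|) * `|g x * X x ^+ k.+2|) (v - r)).
- by rewrite subr_gt0.
- move=> h /andP[h0 h1]; split; first exact: ge.
  by apply: IH; rewrite (lt_le_trans ur) ?lerDl//= -ltrBrDl.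
- exact: ge.
- have := integrableZl measurableT (`|p'| + `|q'|) (integrable_norm (gk k.+2)).
  by apply: eq_integrable.
- move=> h x _; rewrite addr0 mulrDl.
  have := tri_taylor p' q' (r * X x) (h * X x).
  move: (tri p' q' _) (tri p' q' _) (tri q' (- p') _) (_ + `|q'|) => a b c e et.
  have -> : g x * X x ^+ k * b - g x * X x ^+ k * a - h * (g x * X x ^+ k.+1 * c) =
     g x * X x ^+ k * (b - a - h * X x * c) by rewrite exprSr; ring.
  rewrite normrM; apply: le_trans (ler_wpM2l (normr_ge0 _) et) _.
  have -> : g x * X x ^+ k.+2 = (g x * X x ^+ k) * X x ^+ 2 by rewrite !exprSr expr0; ring.
  rewrite [in leRHS]normrM (ger0_norm (sqr_ge0 (X x))) exprMn le_eqVlt; apply/orP; left; apply/eqP; ring.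
Qed.

(** Vanishing moments kill every polynomial in [X]; the sieve polynomials, composed with an affine
    map, converge boundedly on the support of [g] to the indicator of X < al. *)
Lemma moment_ray (g X : T -> R) (N : R) : intb g -> measurable_fun setT X ->
  (forall x, g x != 0 -> `|X x| <= N) -> (forall k, \int[m]_x (g x * X x ^+ k) = 0) ->
  forall al, \int[m]_x (g x * (X x < al)%R%:R) = 0.
Proof.
move=> gi mX gN g0 al.
have gk n : intb (fun x => g x * X x ^+ n).
  apply: (@integrable_mul_bounded _ _ _ _ _ _ (N ^+ n)) => //; first exact: measurable_funX.
  by move=> x /gN xN; rewrite normrX lerXn2r ?nnegrE//; exact: le_trans xN.
have mg : measurable_fun setT g by apply/measurable_EFinP; exact: measurable_int gi.
(* Then |X - al| <= B on the support, so u = 1/2 + (X - al) / (2 B) stays in [0, 1] and is below 1/2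
   exactly when X < al. *)
pose B := `|N| + `|al| + 1; have B0 : 0 < B by rewrite ltr_wpDl// addr_ge0.
pose a := 2^-1 - al / (2 * B); pose b := (2 * B)^-1.
have uE x : a + b * X x = 2^-1 + (X x - al) / (2 * B) by rewrite /a /b; ring.
have u01 x : g x != 0 -> 0 <= a + b * X x <= 1.
  move=> /gN xN; rewrite uE.
  have : `|(X x - al) / (2 * B)| <= 2^-1.
    rewrite normrM normfV (gtr0_norm (_ : 0 < 2 * B)) ?mulr_gt0// ler_pdivrMr ?mulr_gt0// mulrA mulVf ?mul1r//.
    apply: le_trans (ler_normB _ _) _; have := ler_norm N; rewrite /B; lra.
  by rewrite ler_norml; lra.
have ult x : (a + b * X x < 2^-1) = (X x < al).
  by rewrite uE gtrDl pmulr_llt0 ?invr_gt0 ?mulr_gt0// subr_lt0.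
have poly0 p : intb (fun x => g x * p.[X x]) /\ \int[m]_x (g x * p.[X x]) = 0.
  have -> : (fun x => g x * p.[X x]) = fun x => \sum_(i < size p) p`_i * (g x * X x ^+ i).
    by apply/funext => x; rewrite horner_coef mulr_sumr; apply: eq_bigr => i _; ring.
  by apply: (@integrable_sum_Rintegral0 _ (fun i x => g x * X x ^+ i)) => i; split.
pose S n : {poly R} := (1 - (a%:P + b *: 'X) ^+ n) ^+ (n * 2 ^ n).
have SE n x : (S n).[X x] = sharp n (a + b * X x) by rewrite /S /sharp !hornerE.
have I0 : (fun n => \int[m]_x (g x * (S n).[X x])) = cst 0.
  by apply/funext => n; have [] := poly0 (S n).
apply/esym; apply: (cvg_unique _ (@cvg_cst _ (0 : R) _ \oo _)); first exact: norm_hausdorff.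
rewrite -[X in X @ _]I0; apply: (@Rintegral_dominated _ _ _ m _ _ (fun x => `|g x|)) => [n|x||n x].
- by apply/measurable_EFinP; exact: measurable_int (proj1 (poly0 (S n))).
- have [->|gx] := eqVneq (g x) 0.
    by under eq_cvg do rewrite mul0r; rewrite mul0r; exact: cvg_cst.
  apply: cvgM; first exact: cvg_cst.
  by under eq_cvg do rewrite SE; rewrite -ult; exact: sharp_cvg (u01 x gx).
- by have := integrable_norm gi; apply: eq_integrable.
- have [->|gx] := eqVneq (g x) 0; first by rewrite mul0r normr0.
  rewrite normrM ler_piMr// SE; have /andP[s0 s1] := sharp01 n (u01 x gx).
  by rewrite ger0_norm.
Qed.

End moment_problem.

Section moment_uniqueness.
Context (R : realType).
Local Notation mR := (measurableTypeR R).
Local Notation T2 := (mR * mR)%type.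
Local Notation lam := (@lebesgue_measure R).
Local Notation mu2 := (lebesgue2 R).

Lemma ray_threshold (A : set mR) (N : R) : rays A ->
  exists al : R, forall t, `|t| <= N -> \1_A t = (t < al)%R%:R :> R.
Proof.
move=> [->|[a ->]].
  exists (N + 1) => t tN; rewrite indicT (_ : t < _); first by [].
  by apply: le_lt_trans (ler_norm t) _; apply: le_lt_trans tN _; rewrite ltrDl.
by exists a => t _; rewrite indicE mem_setE in_itv.
Qed.

Lemma moment_ae0_1 (g : R -> R) (N : R) : lam.-integrable setT (EFin \o g) ->
  (forall t, g t != 0 -> `|t| <= N) -> (forall k, \int[lam]_t (g t * t ^+ k) = 0) ->
  {ae lam, forall t, g t = 0}.
Proof.
move=> gi gN g0; apply: (@determining_ae0 R _ mR (@rays R) lam) => //; first exact: determining_rays.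
move=> A rA; have [al alP] := ray_threshold N rA.
have h := @moment_ray _ mR R lam g id N gi (@measurable_id _ _ _) gN g0 al.
rewrite [LHS]Rintegral_mkcond -[RHS]h; apply: eq_Rintegral => t _; rewrite patchE.
have [->|gt] := eqVneq (g t) 0; first by rewrite mul0r if_same.
by rewrite -(alP t (gN t gt)) indicE; case: (t \in A); rewrite ?mulr1 ?mulr0.
Qed.

(** [moment_ray] is used in one variable with the powers of the other as part of the weight, and
    again in the second variable with the ray indicator as part of the weight. *)
Lemma moment_ae0_2 (g : R2 R -> R) (N : R) : mu2.-integrable setT (EFin \o g) ->
  (forall x, g x != 0 -> `|x.1| <= N /\ `|x.2| <= N) ->
  (forall k l, \int[mu2]_x (g x * x.1 ^+ k * x.2 ^+ l) = 0) ->
  {ae mu2, forall x, g x = 0}.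
Proof.
move=> gi gN g0.
have m1 : measurable_fun setT (fun x : T2 => x.1 : R) by exact: measurable_fst.
have m2 : measurable_fun setT (fun x : T2 => x.2 : R) by exact: measurable_snd.
apply: (@determining_ae0 R _ T2 [set A `*` B | A in @rays R & B in @rays R] mu2) => //.
  by apply: determining_prod; [left|left|exact: determining_rays..].
move=> _ [A rA [B rB <-]].
have [al alP] := ray_threshold N rA; have [be beP] := ray_threshold N rB.
have gl l : mu2.-integrable setT (EFin \o (fun x => g x * x.2 ^+ l)).
  apply: (@integrable_mul_bounded _ _ _ _ _ _ (N ^+ l)) => //; first exact: measurable_funX.
  by move=> x /gN[_ xN]; rewrite normrX lerXn2r ?nnegrE//; exact: le_trans xN.
have r1 l : \int[mu2]_x (g x * x.2 ^+ l * (x.1 < al)%R%:R) = 0.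
  apply: (@moment_ray _ T2 R mu2 (fun x => g x * x.2 ^+ l) (fun x => x.1) N) => //.
    by move=> x; rewrite mulf_eq0 negb_or => /andP[/gN[]].
  by move=> k; rewrite -(g0 k l); apply: eq_Rintegral => x _; ring.
have mal : measurable_fun setT (fun x : T2 => (x.1 < al)%R%:R : R).
  rewrite (_ : (fun x : T2 => _) = fun x : T2 => \1_(`]-oo, al[%classic : set mR) x.1).
    by apply: measurableT_comp m1; exact: measurable_indic.
  by apply/funext => x; rewrite indicE mem_setE in_itv.
have gal : mu2.-integrable setT (EFin \o (fun x => g x * (x.1 < al)%R%:R)).
  apply: (@integrable_mul_bounded _ _ _ _ _ _ 1) => // x _.
  by case: (_ < _); rewrite ?normr1 ?normr0.
have r2 := @moment_ray _ T2 R mu2 (fun x => g x * (x.1 < al)%R%:R) (fun x => x.2) N gal m2 _ _ be.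
rewrite [LHS]Rintegral_mkcond -[RHS]r2.
- apply: eq_Rintegral => x _; rewrite patchE.
  have [->|gx] := eqVneq (g x) 0; first by rewrite !mul0r if_same.
  have [x1N x2N] := gN x gx.
  rewrite -(alP _ x1N) -(beP _ x2N) -mulrA -(indic_setX R A B x) indicE.
  by case: (x \in _); rewrite ?mulr1 ?mulr0.
- by move=> x; rewrite mulf_eq0 negb_or => /andP[/gN[]].
- by move=> k; rewrite -(r1 k); apply: eq_Rintegral => x _; ring.
Qed.

(** Differentiating in a and b shows that F times a fixed positive exponential has vanishing
    polynomial moments. *)
Lemma exp_moment_ae0 (F : R2 R -> R) (N p q p' q' : R) : mu2.-integrable setT (EFin \o F) ->
  (forall x, F x != 0 -> `|x.1| <= N /\ `|x.2| <= N) -> p < q -> p' < q' ->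
  (forall a b, p < a < q -> p' < b < q' -> \int[mu2]_x (F x * (expR (a * x.1) * expR (b * x.2))) = 0) ->
  {ae mu2, forall x, F x = 0}.
Proof.
move=> Fi FN pq pq' F0.
have m1 : measurable_fun setT (fun x : T2 => x.1 : R) by exact: measurable_fst.
have m2 : measurable_fun setT (fun x : T2 => x.2 : R) by exact: measurable_snd.
have FN1 x : F x != 0 -> `|x.1| <= N by case/FN.
have FN2 x : F x != 0 -> `|x.2| <= N by case/FN.
have bexp (X : T2 -> R) a x : `|X x| <= N -> `|expR (a * X x)| <= expR (`|a| * N).
  move=> xN; rewrite gtr0_norm ?expR_gt0// ler_expR; apply: le_trans (ler_norm _) _.
  by rewrite normrM ler_wpM2l.
have i2 b : mu2.-integrable setT (EFin \o (fun x => F x * expR (b * x.2))).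
  apply: (@integrable_mul_bounded _ _ _ _ _ _ (expR (`|b| * N))) => //; first exact: measurable_expRM.
  by move=> x /FN2; exact: bexp (fun x => x.2) b x.
have ik a k : mu2.-integrable setT (EFin \o (fun x => F x * x.1 ^+ k * expR (a * x.1))).
  apply: (@integrable_mul_bounded _ _ _ _ _ _ (expR (`|a| * N))); last 2 first.
  - exact: measurable_expRM.
  - by move=> x; rewrite mulf_eq0 negb_or => /andP[/FN1 h _]; exact: bexp (fun x => x.1) a x h.
  apply: (@integrable_mul_bounded _ _ _ _ _ _ (N ^+ k)) => //; first exact: measurable_funX.
  by move=> x /FN1 xN; rewrite normrX lerXn2r ?nnegrE//; exact: le_trans xN.
have s1 k a b : p < a < q -> p' < b < q' ->
    \int[mu2]_x (F x * expR (b * x.2) * x.1 ^+ k * expR (a * x.1)) = 0.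
  move=> ar br; move: a ar; apply: (@exp_moment _ T2 R mu2 _ (fun x => x.1) N p q) => //.
    by move=> x; rewrite mulf_eq0 negb_or => /andP[/FN1].
  by move=> a ar; rewrite -(F0 a b ar br); apply: eq_Rintegral => x _; ring.
have s2 k l a b : p < a < q -> p' < b < q' ->
    \int[mu2]_x (F x * x.1 ^+ k * expR (a * x.1) * x.2 ^+ l * expR (b * x.2)) = 0.
  move=> ar br; move: b br; apply: (@exp_moment _ T2 R mu2 _ (fun x => x.2) N p' q') => //.
    by move=> x; rewrite !mulf_eq0 !negb_or => /andP[/andP[/FN2]].
  by move=> b br; rewrite -(s1 k a b ar br); apply: eq_Rintegral => x _; ring.
pose a := (p + q) / 2; pose b := (p' + q') / 2.
have ar : p < a < q by rewrite !midf_lt.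
have br : p' < b < q' by rewrite !midf_lt.
have : {ae mu2, forall x, F x * (expR (a * x.1) * expR (b * x.2)) = 0}.
  apply: (@moment_ae0_2 _ N) => [|x|k l].
  - have : mu2.-integrable setT (EFin \o (fun x => F x * expR (b * x.2) * expR (a * x.1))).
      apply: (@integrable_mul_bounded _ _ _ _ _ _ (expR (`|a| * N))) => //; first exact: measurable_expRM.
      by move=> x; rewrite mulf_eq0 negb_or => /andP[/FN1 h _]; exact: bexp (fun x => x.1) a x h.
    by apply: eq_integrable => // x _ /=; congr EFin; ring.
  - by rewrite mulf_eq0 negb_or => /andP[/FN].
  - by rewrite -(s2 k l a b ar br); apply: eq_Rintegral => x _; ring.
apply: ae_imp => x /eqP; rewrite mulf_eq0 => /predU1P[//|]; rewrite gt_eqF// mulr_gt0 ?expR_gt0//.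
Qed.

Lemma continuous_ae0 (f : R -> R) : continuous f -> {ae lam, forall t, f t = 0} -> forall t, f t = 0.
Proof.
move=> cf [B [mB B0 sB]] t; apply/eqP/negP => /negP ft.
have [e /= e0 he] : \forall s \near t, f s != 0.
  have op : open [set y : R | y != 0] by exact: open_neq.
  exact: (cf t _ (open_nbhs_nbhs (conj op ft))).
have sub : `]t - e, t + e[%classic `<=` B.
  move=> s /=; rewrite in_itv/= => /andP[s1 s2]; apply: sB => /= fs.
  have := he s; rewrite /= /ball_/= ltr_distlC => /(_ _); rewrite s1 s2 => /(_ isT).
  by rewrite fs eqxx.
have mI : measurable (`]t - e, t + e[%classic : set mR) by exact: measurable_itv.
have h := @subset_measure0 _ mR R lam _ _ mI mB sub B0.
have L : @lebesgue_measure R `](t - e)%R, (t + e)%R[%classic = ((t + e) - (t - e))%:E.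
  by rewrite lebesgue_measure_itv/= lte_fin ifT// ltrD2l gtrN.
by have := etrans (esym L) h => -[]; lra.
Qed.

(** Otherwise, differentiating in the frequency, all polynomial moments of psi cos(r t) and psi
    sin(r t) vanish; both functions are then 0, and cos^2 + sin^2 = 1 gives psi = 0. *)
Lemma trig_integral_neq0 (psi : R -> R) (N u v : R) : continuous psi ->
  (forall t, psi t != 0 -> `|t| <= N) -> (exists t, psi t != 0) ->
  lam.-integrable setT (EFin \o psi) -> u < v ->
  exists r p q, u < r < v /\ \int[lam]_t (psi t * tri p q (r * t)) != 0.
Proof.
move=> cpsi psiN [t0 pt0] ipsi uv; apply: contrapT => no.
have all0 r p q : u < r < v -> \int[lam]_t (psi t * tri p q (r * t)) = 0.
  by move=> ur; apply/eqP/negP => /negP h; apply: no; exists r, p, q.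
pose r := (u + v) / 2; have ur : u < r < v by rewrite !midf_lt.
have mtri p q : measurable_fun setT (fun t : mR => tri p q (r * t) : R).
  have mr : measurable_fun setT (fun t : mR => r * t : R) by apply: measurable_funM.
  by apply: measurable_funD; apply: measurable_funM => //; apply: measurableT_comp => //;
    apply: continuous_measurable_fun; [exact: continuous_cos|exact: continuous_sin].
have ae p q : {ae lam, forall t, psi t * tri p q (r * t) = 0}.
  apply: (@moment_ae0_1 _ N) => [|t|k].
  - apply: (@integrable_mul_bounded _ _ _ _ _ _ (`|p| + `|q|)) => // t _; exact: tri_le.
  - by rewrite mulf_eq0 negb_or => /andP[/psiN].
  - rewrite -(@trig_moment _ mR R lam psi id N u v k ipsi (@measurable_id _ _ _) psiN all0 r p q ur).
    by apply: eq_Rintegral => t _; ring.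
have psi0 : {ae lam, forall t, psi t = 0}.
  apply: ae_imp2 (ae 1 0) (ae 0 1) => t; rewrite /tri mul1r !mul0r addr0 add0r mul1r => h1 h2.
  have := cos2Dsin2 (r * t) => /(congr1 (fun y => psi t * y)).
  by rewrite mulr1 mulrDr !expr2 !mulrA h1 h2 !mul0r addr0.
by rewrite (continuous_ae0 cpsi psi0) eqxx in pt0.
Qed.

(** The integral is Lipschitz in r, with constant (|p| + |q|) N times the integral of |psi|. *)
Lemma trig_integral_nbhs (psi : R -> R) (N p q r0 : R) : 0 <= N ->
  (forall t, psi t != 0 -> `|t| <= N) -> lam.-integrable setT (EFin \o psi) ->
  \int[lam]_t (psi t * tri p q (r0 * t)) != 0 ->
  exists2 del, 0 < del & forall r, `|r - r0| < del -> \int[lam]_t (psi t * tri p q (r * t)) != 0.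
Proof.
move=> N0 psiN ipsi I0.
have mtri r : measurable_fun setT (fun t : mR => tri p q (r * t) : R).
  have mr : measurable_fun setT (fun t : mR => r * t : R) by apply: measurable_funM.
  by apply: measurable_funD; apply: measurable_funM => //; apply: measurableT_comp => //;
    apply: continuous_measurable_fun; [exact: continuous_cos|exact: continuous_sin].
have itri r : lam.-integrable setT (EFin \o (fun t => psi t * tri p q (r * t))).
  apply: (@integrable_mul_bounded _ _ _ _ _ _ (`|p| + `|q|)) => // t _; exact: tri_le.
have lip s k : `|tri p q (s + k) - tri p q s| <= (`|p| + `|q|) * `|k|.
  apply: derive_smooth_le; first exact: smooth_tri.
  move=> y; rewrite derive_smooth1; last exact: smooth_tri.
  have [_ ->] := is_derive_tri p q y; rewrite normrM mulrC ler_wpM2r//.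
  by apply: le_trans (tri_le _ _ _) _; rewrite normrN addrC.
set J := \int[lam]_t `|psi t|.
have J0 : 0 <= J by apply: Rintegral_ge0.
pose L := (`|p| + `|q|) * N * J.
have L0 : 0 <= L by rewrite !mulr_ge0// addr_ge0.
exists (`|\int[lam]_t (psi t * tri p q (r0 * t))| / (L + 1)); first by rewrite divr_gt0 ?normr_gt0// ltr_wpDl.
move=> r; rewrite ltr_pdivlMr ?ltr_wpDl// => h; apply/negP => /eqP Ir.
have D : lam.-integrable setT (EFin \o (fun t => psi t * tri p q (r * t) - psi t * tri p q (r0 * t))).
  exact: (integrableB measurableT (itri r) (itri r0)).
have : `|\int[lam]_t (psi t * tri p q (r0 * t))| <= `|r - r0| * L.
  rewrite -[X in `|X| <= _]opprK normrN -[X in `|- X|]subr0 opprB -Ir -(RintegralB measurableT (itri r) (itri r0)).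
  apply: le_trans (le_normr_Rintegral measurableT D) _.
  rewrite /L [leRHS](_ : _ = (`|r - r0| * ((`|p| + `|q|) * N)) * J); last by ring.
  rewrite /J -RintegralZl//; last by have := integrable_norm ipsi; apply: eq_integrable.
  apply: le_Rintegral => //.
  - by have := integrable_norm D; apply: eq_integrable.
  - have := integrableZl measurableT (`|r - r0| * ((`|p| + `|q|) * N)) (integrable_norm ipsi).
    by apply: eq_integrable.
  move=> t _; have [->|pt] := eqVneq (psi t) 0; first by rewrite !mul0r subrr normr0 mulr0.
  rewrite -mulrBr normrM mulrC ler_wpM2r//.
  have -> : r * t = r0 * t + (r - r0) * t by ring.
  apply: le_trans (lip _ _) _; rewrite normrM [leRHS]mulrCA ler_wpM2l ?addr_ge0// ler_wpM2l//.
  exact: psiN.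
move=> h2; have := lt_le_trans h h2; rewrite ltNge ler_wpM2l// lerDl//.
Qed.

End moment_uniqueness.

Lemma Rintegral_prod d1 d2 (T1 : measurableType d1) (T2 : measurableType d2) (R : realType)
    (m1 : {sigma_finite_measure set T1 -> \bar R}) (m2 : {sigma_finite_measure set T2 -> \bar R})
    (f : T1 -> R) (g : T2 -> R) :
  m1.-integrable setT (EFin \o f) -> m2.-integrable setT (EFin \o g) ->
  (m1 \x m2)%E.-integrable setT (EFin \o (fun x => f x.1 * g x.2)) /\
  \int[(m1 \x m2)%E]_x (f x.1 * g x.2) = \int[m1]_x f x * \int[m2]_y g y.
Proof.
move=> fi gi.
have mf : measurable_fun setT f by apply/measurable_EFinP; exact: measurable_int fi.
have mg : measurable_fun setT g by apply/measurable_EFinP; exact: measurable_int gi.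
have mfg : measurable_fun setT (fun x : T1 * T2 => f x.1 * g x.2).
  by apply: measurable_funM; [exact: measurableT_comp mf measurable_fst|exact: measurableT_comp mg measurable_snd].
have ng := integrable_norm gi.
have fgi : (m1 \x m2)%E.-integrable setT (EFin \o (fun x : T1 * T2 => f x.1 * g x.2)).
  apply/integrable12ltyP; first exact/measurable_EFinP.
  under eq_integral => x _.
    under eq_integral do rewrite /= normrM EFinM.
    rewrite (integralZl measurableT ng) /= (integrable_Rintegral ng) muleC.
    over.
  rewrite (integralZl measurableT (integrable_norm fi)) /= (integrable_Rintegral (integrable_norm fi)).
  by rewrite -EFinM ltry.
split=> //; rewrite {1}/Rintegral -(integral12_prod_meas1 fgi) /fubini_F/=.
under eq_integral => x _.
  under eq_integral do rewrite EFinM.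
  rewrite (integralZl measurableT gi) (integrable_Rintegral gi) muleC.
  over.
by rewrite (integralZl measurableT fi) (integrable_Rintegral fi) -EFinM/= mulrC.
Qed.

(** A Lindelof argument: a point off the support lies in a basic set on which [f] vanishes almost
    everywhere, and there are countably many basic sets. The map [i] and the system [ae] relate the
    measurable space to the topological one, which are different structures on the same points in
    the applications. *)
Lemma ess_support_ae0 d (T : measurableType d) (R : realType) (m : {measure set T -> \bar R})
    (X : topologicalType) (V : zmodType) (ae : set_system X) (B : nat -> set X) (f : X -> V)
    (i : T -> X) :
  (forall x U, nbhs x U -> exists2 n, B n x & B n `<=` U) ->
  (forall A, ae A -> {ae m, forall x, A (i x)}) -> (forall A A' : set X, A `<=` A' -> ae A -> ae A') ->
  {ae m, forall x, ~ ess_support ae f (i x) -> f (i x) = 0}.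
Proof.
move=> hB aem mono.
have : {ae m, forall x, forall n, ae [set y | B n y -> f y = 0] -> B n (i x) -> f (i x) = 0}.
  apply: ae_foralln => n; have [h|h] := pselect (ae [set y | B n y -> f y = 0]).
    by have := aem _ h; apply: ae_imp => x fx _.
  exact: nearW.
apply: ae_imp => x h /existsNP[U /not_implyP[xU /contrapT U0]].
have [n Bx BU] := hB _ _ xU; apply: (h n) => //.
by apply: mono U0 => y /= k /BU.
Qed.

(** * Static fields *)

Section fields.
Context (R : realType).
Local Notation e_ := (basis3 R).
Variables (a b r : R).

Definition exp_tri p q (x : R3 R) : R := expR (a * x.1.1) * expR (b * x.1.2) * tri p q (r * x.2).

Lemma smooth_expR_scale (c : R) : smooth (fun t : R => expR (c * t)).
Proof.
by rewrite (_ : (fun t => _) = fun t => 1 * expR (c * t)); [exact: smooth_expRM|apply/funext => t; rewrite mul1r].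
Qed.

Lemma smooth_tri_scale p q : smooth (fun t : R => tri p q (r * t)).
Proof.
rewrite (_ : (fun t => _) = fun t => tri p q (r * (t - 0))).
  exact: (smooth_comp (smooth_tri p q) (is_diff_affine 0 r)).
by apply/funext => t; rewrite subr0.
Qed.

Lemma smooth_exp_tri p q : smooth (exp_tri p q).
Proof. exact: (smooth_coord (smooth_expR_scale a) (smooth_expR_scale b) (smooth_tri_scale p q)). Qed.

(** Derivation along e_j acts on the coefficients (p, q) of [exp_tri]: a horizontal direction
    multiplies by a or b, the vertical one rotates them and scales by r. *)
Definition gradx (j : 'I_3) : R := (j == 0)%:R * a + (j == 1)%:R * b.
Definition gradz (j : 'I_3) : R := (j == 2)%:R * r.

Lemma derive_exp_tri p q j x : 'D_(e_ j) (exp_tri p q) x =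
  exp_tri (gradx j * p + gradz j * q) (gradx j * q - gradz j * p) x.
Proof.
have s1 := smooth_comp (smooth_expR_scale a) (@is_diff_coord1 R).
have s2 := smooth_comp (smooth_expR_scale b) (@is_diff_coord2 R).
have s3 := smooth_comp (smooth_tri_scale p q) (@is_diff_coord3 R).
have d1 : 'D_(e_ j) (fun x : R3 R => expR (a * x.1.1)) x = (j == 0)%:R * (a * expR (a * x.1.1)).
  rewrite (derive_smooth_comp x _ (smooth_expR_scale a) (@is_diff_coord1 R)) derive_smooth1; last exact: smooth_expR_scale.
  by have [_ ->] := is_derive_expRM a x.1.1.
have d2 : 'D_(e_ j) (fun x : R3 R => expR (b * x.1.2)) x = (j == 1)%:R * (b * expR (b * x.1.2)).
  rewrite (derive_smooth_comp x _ (smooth_expR_scale b) (@is_diff_coord2 R)) derive_smooth1; last exact: smooth_expR_scale.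
  by have [_ ->] := is_derive_expRM b x.1.2.
have d3 : 'D_(e_ j) (fun x : R3 R => tri p q (r * x.2)) x = (j == 2)%:R * (r * tri q (- p) (r * x.2)).
  rewrite (derive_smooth_comp x _ (smooth_tri_scale p q) (@is_diff_coord3 R)).
  rewrite (_ : (fun t => tri p q (r * t)) = fun t => tri p q (r * (t - 0))); last by apply/funext => t; rewrite subr0.
  rewrite (derive_smooth_comp x.2 _ (smooth_tri p q) (is_diff_affine 0 r)) !subr0.
  rewrite derive_smooth1; last exact: smooth_tri.
  by have [_ ->] := is_derive_tri p q (r * x.2); rewrite mulrCA mulrA.
rewrite /exp_tri (derive_smoothM _ _ (smoothM s1 s2) s3) (derive_smoothM _ _ s1 s2) d1 d2 d3.
by rewrite /gradx /gradz /tri; ring.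
Qed.

Lemma exp_tri_sum (n : nat) (p q : 'I_n -> R) x :
  \sum_i exp_tri (p i) (q i) x = exp_tri (\sum_i p i) (\sum_i q i) x.
Proof. by rewrite /exp_tri /tri -mulr_sumr big_split/= -!mulr_suml. Qed.

(** The condition r^2 = a^2 + b^2 makes each component harmonic, and the two linear conditions are
    the coefficients of the divergence; a harmonic divergence-free field is annihilated by the
    elastic operator whatever the constants. *)
Lemma static_exp_tri lamb mu0 (P Q : 'I_3 -> R) : r ^+ 2 = a ^+ 2 + b ^+ 2 ->
  a * P 0 + b * P 1 + r * Q 2 = 0 -> a * Q 0 + b * Q 1 - r * P 2 = 0 ->
  static lamb mu0 (fun i => exp_tri (P i) (Q i)).
Proof.
move=> rE c1 c2; split=> [i|i x]; first exact: smooth_exp_tri.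
pose dp j (p q : R) := gradx j * p + gradz j * q.
pose dq j (p q : R) := gradx j * q - gradz j * p.
have G0 : gradx 0 = a by rewrite /gradx/= mul1r mul0r addr0.
have G1 : gradx 1 = b by rewrite /gradx/= mul1r mul0r add0r.
have G2 : gradx 2 = 0 by rewrite /gradx/= !mul0r addr0.
have Z0 : gradz 0 = 0 by rewrite /gradz/= mul0r.
have Z1 : gradz 1 = 0 by rewrite /gradz/= mul0r.
have Z2 : gradz 2 = r by rewrite /gradz/= mul1r.
have s3 (F : 'I_3 -> R) : \sum_j F j = F 0 + F 1 + F 2.
  rewrite !big_ord_recl big_ord0 addr0 addrA; congr (F _ + F _ + F _); exact: val_inj.
have SE j : stress lamb mu0 (fun i j => 'D_(e_ j) (exp_tri (P i) (Q i))) i j =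
    exp_tri (mu0 * (dp j (P i) (Q i) - dp i (P j) (Q j))) (mu0 * (dq j (P i) (Q i) - dq i (P j) (Q j))).
  apply/funext => y; rewrite /stress/= !derive_exp_tri.
  under eq_bigr do rewrite derive_exp_tri.
  rewrite exp_tri_sum !s3 G0 G1 G2 Z0 Z1 Z2 !mul0r !addr0 !subr0 add0r sub0r c1 c2.
  by rewrite {3}/exp_tri /tri !mul0r addr0 !mulr0 addr0 /exp_tri /tri /dp /dq; ring.
under eq_bigr do rewrite SE derive_exp_tri.
rewrite exp_tri_sum !s3 G0 G1 G2 Z0 Z1 Z2 /dp /dq G0 G1 G2 Z0 Z1 Z2.
rewrite (_ : _ + _ = 0 :> R); last first.
  transitivity (mu0 * ((a ^+ 2 + b ^+ 2 - r ^+ 2) * P i - gradx i * (a * P 0 + b * P 1 + r * Q 2) - gradz i * (a * Q 0 + b * Q 1 - r * P 2))); first by ring.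
  by rewrite rE c1 c2 subrr; ring.
rewrite [X in exp_tri _ X](_ : _ = 0 :> R); last first.
  transitivity (mu0 * ((a ^+ 2 + b ^+ 2 - r ^+ 2) * Q i - gradx i * (a * Q 0 + b * Q 1 - r * P 2) + gradz i * (a * P 0 + b * P 1 + r * Q 2))); first by ring.
  by rewrite rE c1 c2 subrr; ring.
by rewrite /exp_tri /tri !mul0r addr0 mulr0.
Qed.

End fields.

Lemma ae_forall_ord d (T : measurableType d) (R : realType) (m : {measure set T -> \bar R}) n
    (Q : 'I_n -> T -> Prop) : (forall i, {ae m, forall x, Q i x}) -> {ae m, forall x, forall i, Q i x}.
Proof.
move=> h; have : {ae m, forall x, forall k : nat, forall i : 'I_n, k = i -> Q i x}.
  apply: ae_foralln => k; have [ki|ki] := pselect (exists i : 'I_n, k = i).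
    by case: ki => i ->; have := h i; apply: ae_imp => x qx j /ord_inj <-.
  by apply: nearW => x i kE; case: ki; exists i.
by apply: ae_imp => x k i; exact: (k i).
Qed.

Lemma ae_fst d1 d2 (T1 : measurableType d1) (T2 : measurableType d2) (R : realType)
    (m1 : {sigma_finite_measure set T1 -> \bar R}) (m2 : {sigma_finite_measure set T2 -> \bar R})
    (P : T1 -> Prop) : {ae m1, forall x, P x} -> {ae (m1 \x m2)%E, forall x, P x.1}.
Proof.
move=> [A [mA A0 sA]]; exists (A `*` setT); split.
- exact: measurableX.
- have E := @product_measure1E _ _ T1 T2 R m1 m2 A setT mA measurableT.
  by apply: etrans E _; rewrite [X in (X * _)%E](_ : _ = 0%E) ?mul0e.
- by move=> x /= Px; split=> //; apply: sA.
Qed.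

(** For each component there is a divergence-free choice of P and Q for which P_i c + Q_i s vanishes
    in the two other components, and equals r (c^2 + s^2), or a (c^2 + s^2) for the vertical one, in
    the component itself. *)
Lemma field_selection (R : realType) (a b r c s : R) (m : 'I_3 -> R) : a != 0 -> r != 0 ->
  (c != 0) || (s != 0) ->
  (forall P Q : 'I_3 -> R, a * P 0 + b * P 1 + r * Q 2 = 0 -> a * Q 0 + b * Q 1 - r * P 2 = 0 ->
     \sum_i m i * (P i * c + Q i * s) = 0) ->
  forall i, m i = 0.
Proof.
move=> a0 r0 cs h.
have cs0 : c ^+ 2 + s ^+ 2 != 0.
  by rewrite paddr_eq0 ?sqr_ge0// !sqrf_eq0 negb_and.
have s3 (F : 'I_3 -> R) : \sum_j F j = F 0 + F 1 + F 2.
  rewrite !big_ord_recl big_ord0 addr0 addrA; congr (F _ + F _ + F _); exact: val_inj.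
pose v (x y z : R) (i : 'I_3) : R := [:: x; y; z]`_i.
have z2 : m 2 = 0.
  have := h (v (- r * s) 0 (a * c)) (v (r * c) 0 (a * s)); rewrite s3 /v/= => k.
  have : m 2 * (a * (c ^+ 2 + s ^+ 2)) = 0 by rewrite -[RHS]k; ring.
  by move=> /eqP; rewrite !mulf_eq0 (negbTE a0) (negbTE cs0) !orbF => /eqP.
have z0 : m 0 = 0.
  have := h (v (r * c) 0 (a * s)) (v (r * s) 0 (- a * c)); rewrite s3 /v/= => k.
  have : m 0 * (r * (c ^+ 2 + s ^+ 2)) = 0 by rewrite -[RHS]k; ring.
  by move=> /eqP; rewrite !mulf_eq0 (negbTE r0) (negbTE cs0) !orbF => /eqP.
have z1 : m 1 = 0.
  have := h (v 0 (r * c) (b * s)) (v 0 (r * s) (- b * c)); rewrite s3 /v/= => k.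
  have : m 1 * (r * (c ^+ 2 + s ^+ 2)) = 0 by rewrite -[RHS]k; ring.
  by move=> /eqP; rewrite !mulf_eq0 (negbTE r0) (negbTE cs0) !orbF => /eqP.
case=> -[|[|[|//]]] hi.
- by rewrite (_ : Ordinal hi = 0) ?z0//; exact: val_inj.
- by rewrite (_ : Ordinal hi = 1) ?z1//; exact: val_inj.
- by rewrite (_ : Ordinal hi = 2) ?z2//; exact: val_inj.
Qed.

(** * Separation of the vertical profile *)

Section separated.
Context (R : realType).
Local Notation mR := (measurableTypeR R).
Local Notation T2 := (mR * mR)%type.
Local Notation T3 := (mR * mR * mR)%type.
Local Notation lam := (@lebesgue_measure R).
Local Notation mu2 := (lebesgue2 R).
Local Notation mu := (lebesgue3 R).

Lemma sqrt_close (a b r0 d : R) : 0 <= d -> d <= r0 -> `|a - r0| <= d -> `|b| <= d ->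
  `|Num.sqrt (a ^+ 2 + b ^+ 2) - r0| <= 2 * d.
Proof.
move=> d0 dr; rewrite !ler_norml => /andP[a1 a2] /andP[b1 b2].
have a0 : 0 <= a by lra.
have h0 : 0 <= a ^+ 2 + b ^+ 2 by rewrite addr_ge0 ?sqr_ge0.
have s0 := sqrtr_ge0 (a ^+ 2 + b ^+ 2); have sE := sqr_sqrtr h0.
move: (Num.sqrt _) s0 sE => s s0 sE; clear h0; apply/andP; split.
  have : a <= s by rewrite -(@ler_pXn2r _ 2)// ?nnegrE// sE lerDl sqr_ge0.
  by lra.
have : s <= a + d.
  rewrite -(@ler_pXn2r _ 2)// ?nnegrE ?addr_ge0// sE sqrrD -addrA lerD2l.
  have b2d : b ^+ 2 <= d ^+ 2 by nra.
  by apply: le_trans b2d _; rewrite lerDr mulrn_wge0// mulr_ge0.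
by lra.
Qed.

Lemma bounded_L2_integrable2 (F : R2 R -> R) (N : R) : L2 mu2 F ->
  (forall x, F x != 0 -> `|x.1| <= N /\ `|x.2| <= N) -> mu2.-integrable setT (EFin \o F).
Proof.
move=> F2 FN; pose I := (`[- N, N]%classic : set mR).
have mI : measurable I by exact: measurable_itv.
have mII : measurable (I `*` I) by exact: measurableX.
have fin : (mu2 (I `*` I) < +oo)%E.
  have -> : mu2 (I `*` I) = (lam I * lam I)%E by exact: (@product_measure1E _ _ _ _ _ lam lam).
  have [n0|n0] := leP 0 N.
    have -> : lam I = (N - - N)%:E.
      have -> : lam I = @lebesgue_measure R `[(- N)%R, N]%classic by [].
      rewrite lebesgue_measure_itv/= lte_fin; case: ifPn => // h.
      have -> : N = 0 by apply/eqP; rewrite eq_le n0 andbT; move: h; rewrite -leNgt; lra.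
      by rewrite oppr0 subrr.
    by rewrite -EFinM ltry.
  have -> : I = set0.
    by apply/seteqP; split=> // t; rewrite /I/= in_itv/= => /andP[t1 t2]; have := lt_le_trans n0 (le_trans _ t2); lra.
  by rewrite measure0 mul0e ltry.
have I2 : L2 mu2 (\1_(I `*` I) : T2 -> R).
  apply: L2P; first exact: measurable_indic.
  rewrite (_ : (fun x => _) = \1_(I `*` I)); last first.
    by apply/funext => x; rewrite indicE; case: (_ \in _); rewrite ?expr1n ?expr0n.
  apply/integrableP; split; first by apply/measurable_EFinP; exact: measurable_indic.
  under eq_integral do rewrite /= ger0_norm//.
  by rewrite integral_indic// setIT.
have := dot_integrable F2 I2; apply: eq_integrable => // x _ /=; congr EFin.
have [->|/FN[x1 x2]] := eqVneq (F x) 0; first by rewrite mul0r.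
rewrite indicE mem_set ?mulr1//; split; rewrite /I/= in_itv/=.
  by rewrite -ler_norml.
by rewrite -ler_norml.
Qed.

(** By Fubini's theorem the pairing with an exponential field is a sum of planar moments m_i(a, b)
    times trigonometric integrals of psi. Near a frequency r0 where one of these is nonzero,
    [field_selection] isolates each m_i(a, b), which therefore vanishes for (a, b) close to (r0,
    0). *)
Lemma separated_eq0 lamb mu0 (psi : R -> R) (tm tp N : R) (F : 'I_3 -> R2 R -> R) (h : 'I_3 -> R3 R -> R) :
  test_function `]tm, tp[%classic psi -> (exists t, psi t != 0) ->
  0 <= N -> `|tm| <= N -> `|tp| <= N ->
  (forall i, L2 mu2 (F i)) -> (forall i, {ae mu2, forall x : T2, N < `|x : R2 R| -> F i x = 0}) ->
  (forall i, L2 mu (h i)) -> (forall i, {ae mu, forall x, h i x = psi x.2 * F i x.1}) ->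
  (forall w, static lamb mu0 w -> \sum_i dot mu (h i) (fun x => cutoff N x * w i x) = 0) ->
  forall i, {ae mu2, forall x, F i x = 0}.
Proof.
move=> tpsi psi0 N0 tmN tpN F2 FN h2 hE sw.
have spsi := test_smooth tpsi; have cpsi : continuous psi by exact: smooth_continuous.
have psiN t : psi t != 0 -> `|t| <= N.
  move=> pt; have [_ _ /(_ t)] := tpsi; have ct := @subset_closure _ [set x | psi x != 0] t pt.
  move=> /(_ ct); rewrite /= in_itv/= => /andP[t1 t2].
  by move: tmN tpN; rewrite !ler_norml; lra.
have ipsi : lam.-integrable setT (EFin \o psi).
  have mI : measurable (`[- N, N]%classic : set mR) by exact: measurable_itv.
  have := proj1 (@integrable_mkcond _ mR R lam _ (EFin \o psi) mI) (@continuous_itv_integrable R psi (- N) N cpsi).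
  apply: eq_integrable => // t _; rewrite /= patchE; case: ifPn => // /negP nt.
  have [->//|/psiN tN] := eqVneq (psi t) 0.
  by case: nt; rewrite mem_setE/= in_itv/= -ler_norml.
(* [F] vanishes far away only almost everywhere; the truncation has bounded support at every point,
   as the moment lemmas ask. *)
pose J (x : T2) : bool := (`|x.1| <= N) && (`|x.2| <= N).
pose F' i (x : R2 R) : R := (J x)%:R * F i x.
have mJ : measurable_fun setT (fun x : T2 => (J x)%:R : R).
  pose I := (`[- N, N]%classic : set mR).
  rewrite (_ : (fun x => _) = \1_(I `*` I)); last first.
    apply/funext => x; rewrite indic_setX !indicE /J /I !mem_setE/= !in_itv/= -!ler_norml -natrM mulnb//.
  by apply: measurable_indic; apply: measurableX; exact: measurable_itv.
have F'2 i : L2 mu2 (F' i).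
  apply: (@L2M _ _ _ _ 1) => //; apply: nearW => x; by case: (J x); rewrite ?normr1 ?normr0.
have F'N i x : F' i x != 0 -> `|x.1| <= N /\ `|x.2| <= N.
  by rewrite mulf_eq0 negb_or pnatr_eq0 eqb0 negbK => /andP[/andP[]].
have F'i i := bounded_L2_integrable2 (F'2 i) (F'N i).
have F'E i : {ae mu2, forall x, F i x = F' i x}.
  apply: ae_imp (FN i) => x xN; rewrite /F'; case: (boolP (J x)) => [|nJ]; first by rewrite mul1r.
  rewrite mul0r; apply: xN; rewrite ltNge; apply: contra nJ => xN.
  by rewrite /J (le_trans _ xN) ?(le_trans _ xN)// /Num.norm/= le_max lexx ?orbT.
have F'3 i : {ae mu, forall x, F i x.1 = F' i x.1}.
  exact: (@ae_fst _ _ T2 mR R (@leb2 R) lam (fun x => F i x = F' i x) (F'E i)).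
pose m i a b := \int[mu2]_x (F' i x * (expR (a * x.1) * expR (b * x.2))).
pose I r p q := \int[lam]_t (psi t * tri p q (r * t)).
have mtri r p q : measurable_fun setT (fun t : mR => tri p q (r * t) : R).
  have mr : measurable_fun setT (fun t : mR => r * t : R) by apply: measurable_funM.
  by apply: measurable_funD; apply: measurable_funM => //; apply: measurableT_comp => //;
    apply: continuous_measurable_fun; [exact: continuous_cos|exact: continuous_sin].
have itri r p q : lam.-integrable setT (EFin \o (fun t => psi t * tri p q (r * t))).
  apply: (@integrable_mul_bounded _ _ _ _ _ _ (`|p| + `|q|)) => // t _; exact: tri_le.
have IE r p q : I r p q = p * I r 1 0 + q * I r 0 1.
  rewrite /I -!RintegralZl//; try exact: itri.
  have iz c p' q' : lam.-integrable setT (EFin \o (fun t => c * (psi t * tri p' q' (r * t)))).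
    by have := integrableZl measurableT c (itri r p' q'); apply: eq_integrable.
  rewrite -RintegralD//; [|exact: iz..].
  by apply: eq_Rintegral => t _; rewrite /tri; ring.
have mexp i a b : mu2.-integrable setT (EFin \o (fun x => F' i x * (expR (a * x.1) * expR (b * x.2)))).
  apply: (@integrable_mul_bounded _ _ _ _ _ _ (expR (`|a| * N) * expR (`|b| * N))) => //.
    apply: measurable_funM; apply: (@measurable_expRM _ T2); [exact: measurable_fst|exact: measurable_snd].
  move=> x /F'N[x1 x2].
  have e c t : `|t| <= N -> `|expR (c * t)| <= expR (`|c| * N).
    move=> tN; rewrite gtr0_norm ?expR_gt0// ler_expR; apply: le_trans (ler_norm _) _.
    by rewrite normrM ler_wpM2l.
  by rewrite normrM ler_pM// e.
have key a b r P Q : r ^+ 2 = a ^+ 2 + b ^+ 2 -> a * P 0 + b * P 1 + r * Q 2 = 0 ->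
    a * Q 0 + b * Q 1 - r * P 2 = 0 -> \sum_i m i a b * I r (P i) (Q i) = 0.
  move=> rE c1 c2; have st := static_exp_tri lamb mu0 rE c1 c2.
  rewrite -[RHS](sw _ st); apply: eq_bigr => i _.
  have [pi pE] := @Rintegral_prod _ _ T2 mR R (@leb2 R) lam _ _ (mexp i a b) (itri r (P i) (Q i)).
  rewrite /m /I -[LHS]pE.
  have tw : L2 mu (fun x => cutoff N x * exp_tri a b r (P i) (Q i) x).
    by apply: test_L2; apply: testMr; [exact: smooth_exp_tri|exact: test_cutoff].
  apply: (@ae_eq_Rintegral _ T3 R mu) => //; first exact: dot_integrable (h2 i) tw.
  apply: ae_imp2 (hE i) (F'3 i) => x -> ->.
  have [->|pn] := eqVneq (psi x.2) 0; first by rewrite !mul0r mulr0.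
  have [->|fn] := eqVneq (F' i x.1) 0; first by rewrite !(mulr0, mul0r).
  have [x1 x2] := F'N i x.1 fn.
  rewrite cutoff_in; first by rewrite /exp_tri; ring.
  by rewrite /Num.norm/= ge_max psiN// andbT /Num.norm/= ge_max x1.
(* The interval ]1, 2[ is a convenient range of positive frequencies. *)
have [r0 [p0 [q0 [/andP[r1 r2] I0]]]] := trig_integral_neq0 cpsi psiN psi0 ipsi (ltr1n R 2 : 1 < 2).
have [del del0 Ir] := trig_integral_nbhs N0 psiN ipsi I0.
have r00 : 0 < r0 by exact: lt_trans r1.
(* If a is within [d] of r0 and |b| <= d, then a > 0 and the frequency r = sqrt(a^2 + b^2) is within
   2 d < del of r0. *)
pose d := Num.min (r0 / 2) (del / 4).
have d0 : 0 < d by rewrite lt_min !divr_gt0.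
have dr : d <= r0 / 2 by rewrite ge_min lexx.
have dd : d <= del / 4 by rewrite ge_min lexx orbT.
have m0 a b i : r0 - d < a < r0 + d -> - d < b < d -> m i a b = 0.
  move=> /andP[a1 a2] /andP[b1 b2].
  set r := Num.sqrt (a ^+ 2 + b ^+ 2).
  have rE : r ^+ 2 = a ^+ 2 + b ^+ 2 by rewrite sqr_sqrtr// addr_ge0 ?sqr_ge0.
  have rr : `|r - r0| <= 2 * d.
    by apply: sqrt_close; rewrite ?ler_norml; lra.
  have rdel : `|r - r0| < del by apply: le_lt_trans rr _; lra.
  have a0 : 0 < a by lra.
  have rn : r != 0 by rewrite -sqrf_eq0 rE paddr_eq0 ?sqr_ge0// sqrf_eq0 gt_eqF.
  move: i; apply: (@field_selection R a b r (I r 1 0) (I r 0 1)) => //; first by rewrite gt_eqF.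
    rewrite -negb_and; apply/negP => /andP[/eqP z1 /eqP z2].
    by have := Ir r rdel; rewrite -/(I r p0 q0) IE z1 z2 !mulr0 addr0 eqxx.
  by move=> P Q c1 c2; rewrite -[RHS](key a b r P Q rE c1 c2); apply: eq_bigr => i _; rewrite [in RHS]IE.
move=> i; apply: ae_imp2 (F'E i) (_ : {ae mu2, forall x, F' i x = 0}) => [x -> //|].
apply: (@exp_moment_ae0 R _ N (r0 - d) (r0 + d) (- d) d) => //; first exact: F'N; try lra.
by move=> a b ar br; exact: m0.
Qed.

End separated.

(** * Essential supports *)

Section support.
Context (R : realType).
Local Notation mR := (measurableTypeR R).
Local Notation T2 := (mR * mR)%type.
Local Notation T3 := (mR * mR * mR)%type.
Local Notation mu2 := (lebesgue2 R).
Local Notation mu := (lebesgue3 R).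

Definition rboxes (n : nat) : set (R3 R) := if unpickle n is Some k then rbox k else set0.

Lemma rboxes_nbhs (x : R3 R) U : nbhs x U -> exists2 n, rboxes n x & rboxes n `<=` U.
Proof. by move=> /rbox_nbhs[k kx kU]; exists (pickle k); rewrite /rboxes pickleK. Qed.

Lemma support3_ae0 (V : zmodType) (Q : set (R3 R)) (f : R3 R -> V) :
  ess_compactly_in (almost_everywhere mu) Q f -> {ae mu, forall x : T3, ~ Q x -> f x = 0}.
Proof.
move=> [_ sQ].
have := @ess_support_ae0 _ T3 R mu (R3 R) V (almost_everywhere mu) rboxes f id rboxes_nbhs
  (fun A h => h) (fun A A' s h => @ae_imp _ T3 R mu A A' s h).
by apply: ae_imp => x h Qx; apply: h => /sQ.
Qed.

(** Slices of the spatial cubes at height 0 serve as a countable base of the plane. *)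
Lemma support2_ae0 (V : zmodType) (D : set (R2 R)) (f : R2 R -> V) :
  ess_compactly_in (almost_everywhere mu2) D f -> {ae mu2, forall x : T2, ~ D x -> f x = 0}.
Proof.
move=> [_ sD].
pose B n : set (R2 R) := [set y | rboxes n (y, 0)].
have B_nbhs (x : R2 R) U : nbhs x U -> exists2 n, B n x & B n `<=` U.
  move=> xU; have : nbhs ((x, 0) : R3 R) (U `*` setT).
    by exists (U, setT) => //=; split=> //; exact: filterT.
  by move=> /rboxes_nbhs[n nx nU]; exists n => // y /nU[].
have := @ess_support_ae0 _ T2 R mu2 (R2 R) V (almost_everywhere mu2) B f id B_nbhs
  (fun A h => h) (fun A A' s h => @ae_imp _ T2 R mu2 A A' s h).
by apply: ae_imp => x h Dx; apply: h => /sD.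
Qed.

Lemma bounded_norm_lt (V : normedModType R) (A : set V) : bounded_set A ->
  exists2 N : R, 0 <= N & forall x, A x -> `|x| < N.
Proof.
move=> [M [_ MA]]; exists (`|M| + 2) => [|x Ax]; first by rewrite addr_ge0.
apply: le_lt_trans (MA (`|M| + 1) _ x Ax) _; last by rewrite ltrD2l ltr1n.
by apply: le_lt_trans (ler_norm M) _; rewrite ltrDl.
Qed.

End support.

Theorem theorem2p3 (R : realType)
  (lam mu : R) (mu_gt0 : 0 < mu) (lam2mu_gt0 : 0 < lam + 2 * mu)
  (Omega : set (R * R * R)) (Omega_lip : bounded_lipschitz_domain Omega)
  (D : set (R * R)) (D_bounded : bounded_set D) (D_open : open D)
  (tm tp : R) (tm_lt_tp : tm < tp)
  (QOmega : closure (D `*` `]tm, tp[) `<=` Omega)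
  (rhom rho0 rhop : R)
  (rhom_gt0 : 0 < rhom) (rhom_lt_rho0 : rhom < rho0) (rho0_lt_rhop : rho0 < rhop)
  (psif psig : R -> R)
  (psif_test : test_function `]tm, tp[ psif) (psif_neq0 : exists s, psif s != 0)
  (psig_test : test_function `]tm, tp[ psig) (psig_neq0 : exists s, psig s != 0)
  (rho1 rho2 : R * R * R -> R) (f1 g1 f2 g2 : R * R * R -> 'rV[R]_3)
  (adm1 : admissible (D `*` `]tm, tp[) rhom rho0 rhop rho1 f1 g1)
  (adm2 : admissible (D `*` `]tm, tp[) rhom rho0 rhop rho2 f2 g2)
  (F1 G1 F2 G2 : R * R -> 'rV[R]_3)
  (F1_L2c : vL2c2 D F1) (G1_L2c : vL2c2 D G1)
  (F2_L2c : vL2c2 D F2) (G2_L2c : vL2c2 D G2)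
  (f1E : {ae lebesgue3 R, forall x, rho1 x *: f1 x = psif x.2 *: F1 x.1})
  (g1E : {ae lebesgue3 R, forall x, rho1 x *: g1 x = psig x.2 *: G1 x.1})
  (f2E : {ae lebesgue3 R, forall x, rho2 x *: f2 x = psif x.2 *: F2 x.1})
  (g2E : {ae lebesgue3 R, forall x, rho2 x *: g2 x = psig x.2 *: G2 x.1})
  (M1 M2 : R -> R * R * R -> 'rV[R]_3)
  (M1_data : passive_data lam mu Omega rho1 f1 g1 M1)
  (M2_data : passive_data lam mu Omega rho2 f2 g2 M2)
  (M12 : forall t, 0 < t ->
    M1 t = M2 t %[ae surface_measure R in closure Omega `\` Omega]) :
  {ae lebesgue3 R, forall x, rho1 x *: f1 x = rho2 x *: f2 x} /\
  {ae lebesgue3 R, forall x, rho1 x *: g1 x = rho2 x *: g2 x}.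
Proof.
pose T3 := (measurableTypeR R * measurableTypeR R * measurableTypeR R)%type.
pose T2 := (measurableTypeR R * measurableTypeR R)%type.
have [oO _ bO lO] := Omega_lip.
have Hfin := hausdorff2_frontier_finite oO bO lO.
set Q := D `*` `]tm, tp[%classic in adm1 adm2 QOmega.
have QO x : Q x -> Omega x by move=> Qx; apply: QOmega; exact: subset_closure.
have rp0 : 0 <= rhop by lra.
have r00 : 0 < rho0 by lra.
have mrho rho f g : admissible Q rhom rho0 rhop rho f g -> measurable_fun setT (rho : T3 -> R).
  by move=> /admissible_Loo; rewrite inE => /andP[+ _]; rewrite inE.
have rhoC rho f g : admissible Q rhom rho0 rhop rho f g -> {ae lebesgue3 R, forall x, 0 <= rho x <= rhop}.
  move=> h; have := admissible_bounds h; apply: ae_imp => x /andP[h1 ->]; rewrite andbT.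
  exact: le_trans (ltW rhom_gt0) h1.
have rhoA rho f g : admissible Q rhom rho0 rhop rho f g -> {ae lebesgue3 R, forall x, `|rho x| <= rhop}.
  by move=> /rhoC; apply: ae_imp => x /andP[? ?]; rewrite ger0_norm.
have rhoE rho f g : admissible Q rhom rho0 rhop rho f g ->
    {ae lebesgue3 R, forall x, (~` Omega) x -> rho x = rho0}.
  by move=> h; have := admissible_background h; apply: ae_imp => x k nO; apply: k => /QO.
have fQ rho f g : admissible Q rhom rho0 rhop rho f g -> {ae lebesgue3 R, forall x : T3, ~ Q x -> f x = 0}.
  by move=> h; apply: support3_ae0; have [] := admissible_f h.
have gQ rho f g : admissible Q rhom rho0 rhop rho f g -> {ae lebesgue3 R, forall x : T3, ~ Q x -> g x = 0}.
  by move=> h; apply: support3_ae0; have [] := admissible_g h.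
have [U1 [V1 [H1 [EP1 U10 V10 tr1]]]] := passive_elastic (mrho _ _ _ adm1) (rhoA _ _ _ adm1) M1_data.
have [U2 [V2 [H2 [EP2 U20 V20 tr2]]]] := passive_elastic (mrho _ _ _ adm2) (rhoA _ _ _ adm2) M2_data.
have zero (f : R3 R -> 'rV[R]_3) (w : 'I_3 -> R3 R -> R) : {ae lebesgue3 R, forall x : T3, ~ Q x -> f x = 0} ->
    (forall i, {ae lebesgue3 R, forall x, w i x = f x 0 i}) ->
    forall i, {ae lebesgue3 R, forall x : T3, (~` Omega) x -> w i x = 0}.
  move=> f0 wf i; apply: ae_imp2 f0 (wf i) => x h -> nO; rewrite h ?mxE//.
  by move=> /QO.
have U1z := zero _ _ (fQ _ _ _ adm1) U10; have U2z := zero _ _ (fQ _ _ _ adm2) U20.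
have V1z := zero _ _ (gQ _ _ _ adm1) V10; have V2z := zero _ _ (gQ _ _ _ adm2) V20.
(* At time 0 both displacements vanish outside [Omega] because the initial data are supported in
   [Q]; at later times the agreement is exterior uniqueness. *)
have Ut i t : 0 <= t -> {ae lebesgue3 R, forall x : T3, (~` Omega) x -> U1 i t x = U2 i t x}.
  rewrite le_eqVlt => /predU1P[<-|t0].
    by apply: ae_imp2 (U1z i) (U2z i) => x h1 h2 nO; rewrite h1 ?h2.
  have cE : closed (~` Omega) by exact: open_closedC.
  have tr s : 0 < s -> forall i phi j, test_function setT phi ->
    dot (lebesgue3 R) (fun x => \1_(~` Omega) x * (U1 i s x - U2 i s x)) ('D_(basis3 R j) phi) =
    - dot (lebesgue3 R) (fun x => \1_(~` Omega) x * (H1 i j s x - H2 i j s x)) phi.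
    move=> s0 k phi j tphi.
    have [mM1 [u1 [tu1 cu1 du1 su1]]] := tr1 s s0 k.
    have [mM2 [u2 [tu2 cu2 du2 su2]]] := tr2 s s0 k.
    apply: (trace_identity oO bO Hfin tu1 tu2 cu1 cu2 du1 du2 mM1 mM2 su1 su2) => //.
    by have := M12 s s0; apply: ae_imp => x h /h ->.
  have [] := exterior_unique mu_gt0 lam2mu_gt0 r00 cE (mrho _ _ _ adm1) (mrho _ _ _ adm2)
    (rhoA _ _ _ adm1) (rhoA _ _ _ adm2) EP1 EP2 (rhoE _ _ _ adm1) (rhoE _ _ _ adm2) _ _ tr i t0 => //.
  - by move=> k; apply: ae_imp2 (U1z k) (U2z k) => x h1 h2 nO; rewrite h1 ?h2.
  - by move=> k; apply: ae_imp2 (V1z k) (V2z k) => x h1 h2 nO; rewrite h1 ?h2.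
have [N1 N10 ON] := bounded_norm_lt bO.
have [N2 N20 DN] := bounded_norm_lt D_bounded.
(* One radius serves two purposes: the displacements agree beyond it, since it bounds [Omega], and
   it bounds [D] and the interval, so that the cutoff is 1 on the sources. *)
pose N := N1 + N2 + `|tm| + `|tp|.
have N0 : 0 <= N by rewrite !addr_ge0.
have OutN (x : R3 R) : N <= `|x| -> (~` Omega) x.
  move=> xN /ON; apply/negP; rewrite -leNgt; apply: le_trans xN.
  by rewrite /N -!addrA lerDl !addr_ge0.
have VN (V : 'I_3 -> R -> R3 R -> R) : (forall i, {ae lebesgue3 R, forall x : T3, (~` Omega) x -> V i 0 x = 0}) ->
    forall i, {ae lebesgue3 R, forall x : T3, N < `|x : R3 R| -> V i 0 x = 0}.
  by move=> h i; apply: ae_imp (h i) => x k /ltW /OutN.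
have UN i t : 0 <= t -> {ae lebesgue3 R, forall x : T3, N <= `|x : R3 R| -> U1 i t x = U2 i t x}.
  by move=> t0; apply: ae_imp (Ut i t t0) => x k /OutN.
have SM := static_moments mu_gt0 lam2mu_gt0 rp0 N0 (mrho _ _ _ adm1) (mrho _ _ _ adm2)
  (rhoC _ _ _ adm1) (rhoC _ _ _ adm2) EP1 EP2 (VN _ V1z) (VN _ V2z) UN.
(* The two conclusions are the same statement, for the initial displacements with [psif] and for the
   initial velocities with [psig]; each uses one half of [SM]. *)
have concl (psi : R -> R) (F G : R2 R -> 'rV[R]_3) (f g : R3 R -> 'rV[R]_3) (w v : 'I_3 -> R3 R -> R) :
  test_function `]tm, tp[%classic psi -> (exists s, psi s != 0) -> vL2c2 D F -> vL2c2 D G ->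
  {ae lebesgue3 R, forall x, rho1 x *: f x = psi x.2 *: F x.1} ->
  {ae lebesgue3 R, forall x, rho2 x *: g x = psi x.2 *: G x.1} ->
  (forall i, {ae lebesgue3 R, forall x, w i x = f x 0 i}) ->
  (forall i, {ae lebesgue3 R, forall x, v i x = g x 0 i}) ->
  (forall i, L2 (lebesgue3 R) (w i)) -> (forall i, L2 (lebesgue3 R) (v i)) ->
  (forall e, static lam mu e -> \sum_i dot (lebesgue3 R) (fun x => rho1 x * w i x - rho2 x * v i x)
     (fun x => cutoff N x * e i x) = 0) ->
  {ae lebesgue3 R, forall x, rho1 x *: f x = rho2 x *: g x}.
  move=> tpsi psi0 [F2' Fs] [G2' Gs] fE gE wf vg w2 v2 sE.
  have FG0 := @separated_eq0 R lam mu psi tm tp N (fun i x => F x 0 i - G x 0 i)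
    (fun i x => rho1 x * w i x - rho2 x * v i x) tpsi psi0 N0 _ _ _ _ _ _ sE.
  have {}FG0 i : {ae lebesgue2 R, forall x, F x 0 i - G x 0 i = 0}.
    apply: FG0.
    - by rewrite /N -addrA addrCA lerDl !addr_ge0.
    - by rewrite /N lerDr !addr_ge0.
    - by move=> k; apply: L2B; [exact: F2'|exact: G2'].
    - move=> k; apply: ae_imp2 (support2_ae0 Fs) (support2_ae0 Gs) => x h1 h2 xN.
      have nD : ~ D x.
        move=> /DN; apply/negP; rewrite -leNgt; apply: le_trans (ltW xN).
        by rewrite /N addrAC -!addrA addrCA lerDl !addr_ge0.
      by rewrite h1// h2// subrr.
    - by move=> k; apply: L2B; [exact: L2M (mrho _ _ _ adm1) (rhoA _ _ _ adm1) (w2 k)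
        |exact: L2M (mrho _ _ _ adm2) (rhoA _ _ _ adm2) (v2 k)].
    - move=> k; have h1 : {ae lebesgue3 R, forall x, rho1 x * w k x = psi x.2 * F x.1 0 k}.
        by apply: ae_imp2 fE (wf k) => x /matrixP/(_ 0 k); rewrite !mxE => <- ->.
      have h2 : {ae lebesgue3 R, forall x, rho2 x * v k x = psi x.2 * G x.1 0 k}.
        by apply: ae_imp2 gE (vg k) => x /matrixP/(_ 0 k); rewrite !mxE => <- ->.
      by apply: ae_imp2 h1 h2 => x -> ->; rewrite mulrBr.
  have FG : {ae lebesgue3 R, forall x, F x.1 = G x.1}.
    apply: (@ae_fst _ _ T2 (measurableTypeR R) R (@leb2 R) (@lebesgue_measure R) (fun x => F x = G x)).
    have := ae_forall_ord FG0; apply: ae_imp => x h; apply/rowP => i; apply/eqP.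
    by rewrite -subr_eq0; apply/eqP; exact: h.
  have h : {ae lebesgue3 R, forall x, rho1 x *: f x = psi x.2 *: G x.1}.
    by apply: ae_imp2 fE FG => x -> ->.
  by apply: ae_imp2 h gE => x -> ->.
split.
  by apply: (concl psif F1 F2 f1 f2 (fun i => U1 i 0) (fun i => U2 i 0)) => // [i|i|e /SM[]//];
    [exact: (proj1 (elastic_U EP1 i) 0)|exact: (proj1 (elastic_U EP2 i) 0)].
by apply: (concl psig G1 G2 g1 g2 (fun i => V1 i 0) (fun i => V2 i 0)) => // [i|i|e /SM[]//];
  [exact: (proj1 (elastic_V EP1 i) 0)|exact: (proj1 (elastic_V EP2 i) 0)].
Qed.
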